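(* Let $\mathbb{k}$ be an infinite field, $R=\mathbb{k}[x_1,\dots,x_d]$ a polynomial ring, $\mathfrak m=(x_1,\dots,x_d)$, and $I$ a nonzero monomial ideal. If $I$ satisfies $G_d$ and $I_{\mathfrak m}$ is weakly $(d-2)$-residually $S_2$, then $$\operatorname{core}(I)=\operatorname{mono}(K)$$ for $K=J+(f^d)$ a general reduction of $I$. Here, if $I$ is generated by forms of the same degree $\delta$, then $f:=0$ and $f_1,\dots,f_u$ is a fixed generating sequence of $I$ consisting of forms of degree $\delta$; otherwise $f$ is a fixed nonzero element of $I$ and $f_1,\dots,f_u$ is any fixed generating sequence of $I$; and $J$ is an ideal generated by $d$ general elements of $I$ with respect to $f_1,\dots,f_u$.
   Context: A subideal $J\subseteq I$ is a reduction of $I$ if $I^{m+1}=JI^m$ for $m\gg0$. $\operatorname{core}(I)$ is the intersection of all reductions of $I$. For an ideal $K\subseteq R$, $\operatorname{mono}(K)$ is the largest monomial ideal contained in $K$. $G_s$: $I$ satisfies $G_s$ if $\mu(I_{\mathfrak p})\leqslant \operatorname{ht}(\mathfrak p)$ for every $\mathfrak p\in V(I)$ with $\operatorname{ht}(\mathfrak p)\leqslant s-1$, where $\mu$ is the minimal number of generators. Residual intersections (in a Cohen-Macaulay ring $S$, for an ideal $I$ of $S$): an ideal $K$ is an $s$-residual intersection of $I$ if $K=\mathfrak a:I$ for some ideal $\mathfrak a\subsetneq I$ generated by $s$ elements with $\operatorname{ht}(K)\geqslant s$; it is geometric if in addition $\operatorname{ht}(I+K)>s$ (the unit ideal has infinite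 height). $I$ is weakly $s$-residually $S_2$ if $S/K$ satisfies Serre's condition $S_2$ for every $0\leqslant i\leqslant s$ and every geometric $i$-residual intersection $K$ of $I$. General elements: for $\lambda=(\lambda_{ij})\in\mathbb{A}^{du}_{\mathbb{k}}$ ($1\leqslant i\leqslant d$, $1\leqslant j\leqslant u$) let $J_\lambda$ be the ideal of $R$ generated by $\sum_{j=1}^u\lambda_{ij}f_j$, $1\leqslant i\leqslant d$. A statement holds for an ideal $J$ generated by $d$ general elements of $I$ if there is a Zariski dense open subset $U\subseteq\mathbb{A}^{du}_{\mathbb{k}}$ such that it holds for $J=J_\lambda$ for all $\lambda\in U$. *)

(* Defs.v *)
From HB Require Import structures.
From mathcomp Require Import all_boot all_order all_algebra.
From mathcomp Require Import generic_quotient ring.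
From mathcomp Require Import boolp classical_sets functions cardinality.
From mathcomp Require Import mpoly.

Set Implicit Arguments.
Unset Strict Implicit.
Unset Printing Implicit Defensive.

Import GRing.Theory Num.Theory.
Local Open Scope classical_set_scope.
Local Open Scope ring_scope.
Local Open Scope quotient_scope.

(* lets an ideal I be applied: I x means that x is an element of I *)
Identity Coercion set_to_fun : set >-> Funclass.

Section Ideals.
Variable A : comPzRingType.

Definition is_ideal (I : set A) : Prop :=
  [/\ I 0, forall x y, I x -> I y -> I (x + y) & forall a x, I x -> I (a * x)].

Record ideal := Ideal { ideal_set :> set A; idealP : is_ideal ideal_set }.

Record prime_ideal := PrimeIdeal {
  prime_ideal_val :> ideal;
  prime_proper : ~ prime_ideal_val 1;
  prime_mul : forall x y, prime_ideal_val (x * y) ->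
                prime_ideal_val x \/ prime_ideal_val y }.

Implicit Types I J K a : ideal.

Lemma ideal0 I : I 0. Proof. by have [] := idealP I. Qed.
Lemma idealD I x y : I x -> I y -> I (x + y).
Proof. by have [_ + _] := idealP I; apply. Qed.
Lemma idealMl I b x : I x -> I (b * x).
Proof. by have [_ _] := idealP I; apply. Qed.
Lemma idealMr I b x : I x -> I (x * b).
Proof. by rewrite mulrC; apply: idealMl. Qed.
Lemma idealN I x : I x -> I (- x).
Proof. by rewrite -mulN1r; apply: idealMl. Qed.
Lemma idealB I x y : I x -> I y -> I (x - y).
Proof. by move=> Ix Iy; apply: idealD => //; apply: idealN. Qed.

Lemma eq_ideal I J : I = J :> set A -> I = J.
Proof.
case: I J => [I iI] [J iJ] /= eIJ; case: J / eIJ iJ => iJ.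
by congr Ideal; apply: Prop_irrelevance.
Qed.

Lemma is_ideal_gen (S : set A) :
  is_ideal [set x | forall I, S `<=` I -> I x].
Proof.
split=> /= [I _|x y Sx Sy I SI|b x Sx I SI]; first exact: ideal0.
  by apply: idealD; [apply: Sx|apply: Sy].
by apply: idealMl; apply: Sx.
Qed.
Definition gen (S : set A) : ideal := Ideal (is_ideal_gen S).

Lemma sub_gen (S : set A) : S `<=` gen S.
Proof. by move=> x Sx I; apply. Qed.
Lemma gen_sub (S : set A) I : S `<=` I -> gen S `<=` I.
Proof. by move=> SI x; apply. Qed.

Definition add_ideal I J : ideal := gen (I `|` J).

Definition mul_ideal I J : ideal := gen [set x * y | x in I & y in J].

Fixpoint exp_ideal I (n : nat) : ideal :=
  if n is m.+1 then mul_ideal I (exp_ideal I m) else gen setT.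

Lemma is_ideal_colon a I : is_ideal [set x | forall y, I y -> a (x * y)].
Proof.
split=> [y _|x z ax az y Iy|b x ax y Iy] /=.
- by rewrite mul0r; apply: ideal0.
- by rewrite mulrDl; apply: idealD; [apply: ax|apply: az].
- by rewrite -mulrA; apply: idealMl; apply: ax.
Qed.
Definition colon_ideal a I : ideal := Ideal (is_ideal_colon a I).

Definition generated_by I (n : nat) : Prop :=
  exists c : 'I_n -> A, I = gen (range c).

(* mu(I) = n *)
Definition min_num_gens I (n : nat) : Prop :=
  generated_by I n /\ forall m, generated_by I m -> (n <= m)%N.

Definition is_reduction J I : Prop :=
  J `<=` I /\
  exists N : nat, forall m, (N <= m)%N ->
    exp_ideal I m.+1 = mul_ideal J (exp_ideal I m).

Lemma is_ideal_core I :
  is_ideal [set x | forall J, is_reduction J I -> J x].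
Proof.
split=> /= [J _|x y cx cy J rJ|b x cx J rJ]; first exact: ideal0.
  by apply: idealD; [apply: cx|apply: cy].
by apply: idealMl; apply: cx.
Qed.
Definition core I : ideal := Ideal (is_ideal_core I).

(* c 0 < c 1 < ... < c n; the values of c beyond n are irrelevant *)
Definition prime_chain (c : nat -> prime_ideal) (n : nat) : Prop :=
  forall i, (i < n)%N -> c i `<` c i.+1.

(* dim A >= n *)
Definition dim_ge (n : nat) : Prop :=
  exists c : nat -> prime_ideal, prime_chain c n.

(* ht P >= n *)
Definition prime_ht_ge (P : prime_ideal) (n : nat) : Prop :=
  exists2 c : nat -> prime_ideal, prime_chain c n & c n = P.

(* ht P = n *)
Definition prime_ht (P : prime_ideal) (n : nat) : Prop :=
  prime_ht_ge P n /\ ~ prime_ht_ge P n.+1.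

(* ht I >= n; it holds for all n when I is the unit ideal *)
Definition ht_ge I (n : nat) : Prop :=
  forall P : prime_ideal, I `<=` P -> prime_ht_ge P n.

Definition regular_seq (s : seq A) : Prop :=
  (forall i, (i < size s)%N -> forall x,
     gen [set` take i s] (s`_i * x) -> gen [set` take i s] x) /\
  ~ gen [set` s] 1.

(* the I-depth of A is >= n; when A is local with maximal ideal I, this is
   depth A >= n *)
Definition depth_ge I (n : nat) : Prop :=
  exists s : seq A, [/\ size s = n, [set` s] `<=` I & regular_seq s].

End Ideals.

Arguments dim_ge : clear implicits.

Section Quotient.
Variables (A : comPzRingType) (K : ideal A).

Definition quot_rel (x y : A) : bool := `[< K (x - y) >].

Lemma quot_rel_refl : reflexive quot_rel.
Proof. by move=> x; apply/asboolP; rewrite subrr; apply: ideal0. Qed.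
Lemma quot_rel_sym : ssrbool.symmetric quot_rel.
Proof.
suff H x y : quot_rel x y -> quot_rel y x by move=> x y; apply/idP/idP; apply: H.
by move=> /asboolP Kxy; apply/asboolP; rewrite -opprB; apply: idealN.
Qed.
Lemma quot_rel_trans : transitive quot_rel.
Proof.
move=> y x z /asboolP Kxy /asboolP Kyz; apply/asboolP.
by rewrite -(subrKA y); apply: idealD.
Qed.
Canonical quot_equiv :=
  EquivRel quot_rel quot_rel_refl quot_rel_sym quot_rel_trans.

(* the ring A/K; it is the zero ring when K is the unit ideal *)
Definition quot : Type := {eq_quot quot_rel}.
HB.instance Definition _ := Choice.on quot.
HB.instance Definition _ : EqQuotient _ quot_rel quot := EqQuotient.on quot.

Definition to_quot (x : A) : quot := \pi_quot x.

Lemma to_quotP x y : to_quot x = to_quot y <-> K (x - y).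
Proof.
by split=> [/eqquotP /asboolP //|Kxy]; apply/eqquotP; apply/asboolP.
Qed.

Definition quot_add (x y : quot) : quot := to_quot (repr x + repr y).
Definition quot_opp (x : quot) : quot := to_quot (- repr x).
Definition quot_mul (x y : quot) : quot := to_quot (repr x * repr y).

Lemma repr_to_quot x : K (repr (to_quot x) - x).
Proof. by apply/to_quotP; rewrite /to_quot reprK. Qed.

Lemma to_quotD x y : to_quot (x + y) = quot_add (to_quot x) (to_quot y).
Proof.
apply/to_quotP; rewrite -opprB; apply: idealN.
by rewrite opprD addrACA; apply: idealD; apply: repr_to_quot.
Qed.
Lemma to_quotN x : to_quot (- x) = quot_opp (to_quot x).
Proof.
apply/to_quotP; rewrite opprK addrC; exact: repr_to_quot.
Qed.
Lemma to_quotM x y : to_quot (x * y) = quot_mul (to_quot x) (to_quot y).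
Proof.
apply/to_quotP; rewrite -opprB; apply: idealN.
have -> : repr (to_quot x) * repr (to_quot y) - x * y =
  (repr (to_quot x) - x) * repr (to_quot y) + x * (repr (to_quot y) - y) by ring.
by apply: idealD; [apply: idealMr|apply: idealMl]; apply: repr_to_quot.
Qed.

Lemma quotW (Q : quot -> Prop) : (forall x, Q (to_quot x)) -> forall x, Q x.
Proof. by move=> H x; rewrite -[x]reprK; apply: H. Qed.

Lemma quot_addA : associative quot_add.
Proof.
by elim/quotW=> x; elim/quotW=> y; elim/quotW=> z; rewrite -!to_quotD addrA.
Qed.
Lemma quot_addC : commutative quot_add.
Proof. by elim/quotW=> x; elim/quotW=> y; rewrite -!to_quotD addrC. Qed.
Lemma quot_add0 : left_id (to_quot 0) quot_add.
Proof. by elim/quotW=> x; rewrite -!to_quotD add0r. Qed.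
Lemma quot_addN : left_inverse (to_quot 0) quot_opp quot_add.
Proof. by elim/quotW=> x; rewrite -to_quotN -!to_quotD addNr. Qed.
HB.instance Definition _ :=
  GRing.isZmodule.Build quot quot_addA quot_addC quot_add0 quot_addN.

Lemma quot_mulA : associative quot_mul.
Proof.
by elim/quotW=> x; elim/quotW=> y; elim/quotW=> z; rewrite -!to_quotM mulrA.
Qed.
Lemma quot_mulC : commutative quot_mul.
Proof. by elim/quotW=> x; elim/quotW=> y; rewrite -!to_quotM mulrC. Qed.
Lemma quot_mul1 : left_id (to_quot 1) quot_mul.
Proof. by elim/quotW=> x; rewrite -!to_quotM mul1r. Qed.
Lemma quot_mulD : left_distributive quot_mul quot_add.
Proof.
elim/quotW=> x; elim/quotW=> y; elim/quotW=> z.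
by rewrite -to_quotD -!to_quotM -to_quotD mulrDl.
Qed.
HB.instance Definition _ :=
  GRing.Zmodule_isComPzRing.Build quot quot_mulA quot_mulC quot_mul1 quot_mulD.

Lemma to_quot_zmod_morphism : zmod_morphism to_quot.
Proof. by move=> x y; rewrite to_quotD to_quotN. Qed.
HB.instance Definition _ :=
  GRing.isZmodMorphism.Build A quot to_quot to_quot_zmod_morphism.
Lemma to_quot_monoid_morphism : monoid_morphism to_quot.
Proof. by split=> // x y; rewrite to_quotM. Qed.
HB.instance Definition _ :=
  GRing.isMonoidMorphism.Build A quot to_quot to_quot_monoid_morphism.

End Quotient.

Section Localization.
Variables (A : comPzRingType) (P : prime_ideal A).

Record fracs := Fracs { fnum : A; fden : A; fdenP : ~ P fden }.
HB.instance Definition _ := gen_eqMixin fracs.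
HB.instance Definition _ := gen_choiceMixin fracs.

Definition loc_rel (x y : fracs) : bool :=
  `[< exists2 w, ~ P w & w * (fnum x * fden y - fnum y * fden x) = 0 >].

Lemma prime_mulN x y : ~ P x -> ~ P y -> ~ P (x * y).
Proof. by move=> Px Py /prime_mul []. Qed.

Lemma loc_rel_refl : reflexive loc_rel.
Proof.
move=> x; apply/asboolP; exists 1; first exact: prime_proper.
by rewrite subrr mulr0.
Qed.
Lemma loc_rel_sym : ssrbool.symmetric loc_rel.
Proof.
suff H x y : loc_rel x y -> loc_rel y x by move=> x y; apply/idP/idP; apply: H.
move=> /asboolP[w Pw e]; apply/asboolP; exists w => //.
by rewrite -opprB mulrN e oppr0.
Qed.
Lemma loc_rel_trans : transitive loc_rel.
Proof.
move=> [b t Pt] [a s Ps] [c r Pr] /asboolP[v Pv /= e] /asboolP[w Pw /= e'].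
apply/asboolP; exists (v * w * t); first by do 2?apply: prime_mulN.
rewrite /=.
have -> : v * w * t * (a * r - c * s) =
  w * r * (v * (a * t - b * s)) + v * s * (w * (b * r - c * t)) by ring.
by rewrite e e' !mulr0 addr0.
Qed.
Canonical loc_equiv := EquivRel loc_rel loc_rel_refl loc_rel_sym loc_rel_trans.

(* the local ring A_P *)
Definition loc : Type := {eq_quot loc_rel}.
HB.instance Definition _ := Choice.on loc.
HB.instance Definition _ : EqQuotient _ loc_rel loc := EqQuotient.on loc.

(* mkfrac a Ps is the fraction a / s *)
Definition mkfrac (a s : A) (Ps : ~ P s) : loc := \pi_loc (Fracs a Ps).

Lemma mkfracP a s (Ps : ~ P s) b t (Pt : ~ P t) :
  mkfrac a Ps = mkfrac b Pt <-> exists2 w, ~ P w & w * (a * t - b * s) = 0.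
Proof.
by split=> [/eqquotP /asboolP //|H]; apply/eqquotP; apply/asboolP.
Qed.

Lemma locW (Q : loc -> Prop) :
  (forall a s (Ps : ~ P s), Q (mkfrac a Ps)) -> forall x, Q x.
Proof. by move=> H x; rewrite -[x]reprK; case: (repr x) => a s Ps; apply: H. Qed.

Lemma eq_mkfrac a s (Ps : ~ P s) b t (Pt : ~ P t) :
  a * t = b * s -> mkfrac a Ps = mkfrac b Pt.
Proof.
move=> e; apply/mkfracP; exists 1; first exact: prime_proper.
by rewrite e subrr mulr0.
Qed.

Definition loc_add (x y : loc) : loc :=
  mkfrac (fnum (repr x) * fden (repr y) + fnum (repr y) * fden (repr x))
         (prime_mulN (@fdenP (repr x)) (@fdenP (repr y))).
Definition loc_opp (x : loc) : loc :=
  mkfrac (- fnum (repr x)) (@fdenP (repr x)).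
Definition loc_mul (x y : loc) : loc :=
  mkfrac (fnum (repr x) * fnum (repr y))
         (prime_mulN (@fdenP (repr x)) (@fdenP (repr y))).

Lemma repr_mkfrac a s (Ps : ~ P s) : exists2 w, ~ P w &
  w * (fnum (repr (mkfrac a Ps)) * s - a * fden (repr (mkfrac a Ps))) = 0.
Proof.
have /eqquotP/asboolP := reprK (mkfrac a Ps).
by [].
Qed.

Lemma mkfracD a s (Ps : ~ P s) b t (Pt : ~ P t) :
  loc_add (mkfrac a Ps) (mkfrac b Pt) =
  mkfrac (a * t + b * s) (prime_mulN Ps Pt).
Proof.
have [v Pv e] := repr_mkfrac a Ps; have [w Pw e'] := repr_mkfrac b Pt.
rewrite /loc_add; apply/mkfracP; exists (v * w); first exact: prime_mulN.
move: (repr (mkfrac a Ps)) (repr (mkfrac b Pt)) e e' => [a' s' /= _] [b' t' /= _] e e'.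
have -> : v * w * ((a' * t' + b' * s') * (s * t) - (a * t + b * s) * (s' * t')) =
  w * t * t' * (v * (a' * s - a * s')) + v * s * s' * (w * (b' * t - b * t')).
  by ring.
by rewrite e e' !mulr0 addr0.
Qed.
Lemma mkfracN a s (Ps : ~ P s) : loc_opp (mkfrac a Ps) = mkfrac (- a) Ps.
Proof.
have [v Pv e] := repr_mkfrac a Ps.
rewrite /loc_opp; apply/mkfracP; exists v => //.
by rewrite !mulNr -opprD mulrN e oppr0.
Qed.
Lemma mkfracM a s (Ps : ~ P s) b t (Pt : ~ P t) :
  loc_mul (mkfrac a Ps) (mkfrac b Pt) = mkfrac (a * b) (prime_mulN Ps Pt).
Proof.
have [v Pv e] := repr_mkfrac a Ps; have [w Pw e'] := repr_mkfrac b Pt.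
rewrite /loc_mul; apply/mkfracP; exists (v * w); first exact: prime_mulN.
move: (repr (mkfrac a Ps)) (repr (mkfrac b Pt)) e e' => [a' s' /= _] [b' t' /= _] e e'.
have -> : v * w * (a' * b' * (s * t) - a * b * (s' * t')) =
  w * b' * t * (v * (a' * s - a * s')) + v * a * s' * (w * (b' * t - b * t')).
  by ring.
by rewrite e e' !mulr0 addr0.
Qed.

Definition to_loc (a : A) : loc := mkfrac a (@prime_proper A P).

Lemma loc_addA : associative loc_add.
Proof.
elim/locW=> a s Ps; elim/locW=> b t Pt; elim/locW=> c r Pr.
by rewrite !mkfracD; apply: eq_mkfrac; ring.
Qed.
Lemma loc_addC : commutative loc_add.
Proof.
elim/locW=> a s Ps; elim/locW=> b t Pt.
by rewrite !mkfracD; apply: eq_mkfrac; ring.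
Qed.
Lemma loc_add0 : left_id (to_loc 0) loc_add.
Proof. by elim/locW=> a s Ps; rewrite mkfracD; apply: eq_mkfrac; ring. Qed.
Lemma loc_addN : left_inverse (to_loc 0) loc_opp loc_add.
Proof.
by elim/locW=> a s Ps; rewrite mkfracN mkfracD; apply: eq_mkfrac; ring.
Qed.
HB.instance Definition _ :=
  GRing.isZmodule.Build loc loc_addA loc_addC loc_add0 loc_addN.

Lemma loc_mulA : associative loc_mul.
Proof.
elim/locW=> a s Ps; elim/locW=> b t Pt; elim/locW=> c r Pr.
by rewrite !mkfracM; apply: eq_mkfrac; ring.
Qed.
Lemma loc_mulC : commutative loc_mul.
Proof.
elim/locW=> a s Ps; elim/locW=> b t Pt.
by rewrite !mkfracM; apply: eq_mkfrac; ring.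
Qed.
Lemma loc_mul1 : left_id (to_loc 1) loc_mul.
Proof. by elim/locW=> a s Ps; rewrite mkfracM; apply: eq_mkfrac; ring. Qed.
Lemma loc_mulD : left_distributive loc_mul loc_add.
Proof.
elim/locW=> a s Ps; elim/locW=> b t Pt; elim/locW=> c r Pr.
by rewrite !(mkfracM, mkfracD); apply: eq_mkfrac; ring.
Qed.
HB.instance Definition _ :=
  GRing.Zmodule_isComPzRing.Build loc loc_mulA loc_mulC loc_mul1 loc_mulD.

Lemma to_loc_zmod_morphism : zmod_morphism to_loc.
Proof.
by move=> x y; rewrite -[RHS]/(loc_add _ (loc_opp _)) mkfracN mkfracD;
  apply: eq_mkfrac; ring.
Qed.
HB.instance Definition _ :=
  GRing.isZmodMorphism.Build A loc to_loc to_loc_zmod_morphism.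
Lemma to_loc_monoid_morphism : monoid_morphism to_loc.
Proof.
by split=> // x y; rewrite -[RHS]/(loc_mul _ _) mkfracM; apply: eq_mkfrac; ring.
Qed.
HB.instance Definition _ :=
  GRing.isMonoidMorphism.Build A loc to_loc to_loc_monoid_morphism.

(* I_P; in particular loc_ideal P is the maximal ideal of A_P *)
Definition loc_ideal (I : ideal A) : ideal loc := gen (to_loc @` I).

End Localization.

Section Conditions.
Variable A : comPzRingType.
Implicit Types I K a : ideal A.

(* "ht P <= s - 1" is stated as ht P < s *)
Definition satisfies_G (s : nat) I : Prop :=
  forall P : prime_ideal A, I `<=` P ->
  forall h, prime_ht P h -> (h < s)%N ->
  exists2 n, min_num_gens (loc_ideal P I) n & (n <= h)%N.

(* Serre's condition S_r, i.e. depth A_P >= min(r, dim A_P) for all P *)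
Definition serre_S (r : nat) : Prop :=
  forall P : prime_ideal A, forall n, (n <= r)%N ->
  dim_ge (loc P) n -> depth_ge (loc_ideal P P) n.

Definition residual_intersection (s : nat) I K : Prop :=
  exists a, [/\ a `<` I, generated_by a s, K = colon_ideal a I & ht_ge K s].

Definition geometric_residual_intersection (s : nat) I K : Prop :=
  residual_intersection s I K /\ ht_ge (add_ideal I K) s.+1.

End Conditions.

Arguments serre_S : clear implicits.

(* s is an integer, so that the condition is empty when s < 0 *)
Definition weakly_residually_S2 (A : comPzRingType) (s : int) (I : ideal A) :
    Prop :=
  forall i : nat, i%:Z <= s ->
  forall K : ideal A, geometric_residual_intersection i I K ->
  serre_S (quot K) 2.

Section Polynomials.
Variables (k : fieldType) (d : nat).
Implicit Types I K L : ideal {mpoly k[d]}.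

Definition is_monomial_ideal I : Prop :=
  exists M : set 'X_{1..d}, I = gen [set 'X_[k, m] | m in M].

(* the sum of all monomial ideals contained in K; by the three lemmas below
   it is the largest of them *)
Definition mono K : ideal {mpoly k[d]} :=
  gen [set p | exists L, [/\ is_monomial_ideal L, L `<=` K & L p]].

Lemma mono_sub K : mono K `<=` K.
Proof. by apply: gen_sub => p [L [_ LK Lp]]; apply: LK. Qed.

Lemma mono_max K L : is_monomial_ideal L -> L `<=` K -> L `<=` mono K.
Proof. by move=> mL LK p Lp; apply: sub_gen; exists L. Qed.

Lemma mono_monomial K : is_monomial_ideal (mono K).
Proof.
exists [set m | K 'X_[m]]; apply: eq_ideal; apply/seteqP; split.
  apply: gen_sub => p [L [[M ->] MK]]; apply: gen_sub => q [m Mm <-].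
  by apply: sub_gen; exists m => //; apply: MK; apply: sub_gen; exists m.
apply: mono_max; first by exists [set m | K 'X_[m]].
by apply: gen_sub => p [m Km <-].
Qed.

Definition generated_in_degree I (delta : nat) : Prop :=
  exists2 S : set {mpoly k[d]}, (forall p, S p -> p \is delta.-homog) &
    I = gen S.

Definition vars_ideal : ideal {mpoly k[d]} :=
  gen (range (fun i : 'I_d => 'X_i)).

Lemma vars_idealP p : vars_ideal p <-> p@_0%MM = 0.
Proof.
split=> [|p0].
  have iK : is_ideal [set p : {mpoly k[d]} | p@_0%MM = 0].
    split=> /= [|x y ex ey|a x ex]; first by rewrite mcoeff0.
      by rewrite mcoeffD ex ey addr0.
    by rewrite rmorphM /= ex mulr0.
  apply: (gen_sub (I := Ideal iK)) => q [i _ <-] /=.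
  by rewrite mcoeffX mnm1_eq0.
rewrite [p]mpolyE; elim/big_ind: _ => [|x y|m _].
- exact: ideal0.
- exact: idealD.
- have [->|mn0] := eqVneq m 0%MM; first by rewrite p0 scale0r; apply: ideal0.
  have [i mi] : exists i, m i != 0%N.
    apply/existsP; apply: contraNT mn0 => /existsPn m0.
    by apply/eqP/mnmP => i; rewrite mnm0E; apply/eqP; have := m0 i; rewrite negbK.
  rewrite -mul_mpolyC; apply: idealMl.
  rewrite -(submK (m := U_(i)%MM) (m' := m)); last first.
    by apply/mnm_lepP => j; rewrite mnm1E; case: eqVneq => // <-; rewrite lt0n.
  by rewrite mpolyXD; apply: idealMl; apply: sub_gen; exists i.
Qed.

Lemma vars_ideal_proper : ~ vars_ideal 1.
Proof. by move/vars_idealP; rewrite mcoeff1 eqxx => /eqP; rewrite oner_eq0. Qed.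

Lemma vars_ideal_mul x y : vars_ideal (x * y) -> vars_ideal x \/ vars_ideal y.
Proof.
by rewrite !vars_idealP rmorphM /= => /eqP; rewrite mulf_eq0 => /orP[] /eqP;
  [left|right].
Qed.

(* the maximal ideal (x_1, ..., x_d), as a prime ideal *)
Definition max_ideal : prime_ideal {mpoly k[d]} :=
  PrimeIdeal vars_ideal_proper vars_ideal_mul.

End Polynomials.

Section GeneralElements.
Variables (k : fieldType) (d u : nat).

(* Zariski topology on the k-points of affine space A^(du), whose points are
   the d x u matrices and whose coordinate functions are their entries *)
Definition zariski_open (U : set 'M[k]_(d, u)) : Prop :=
  exists S : set {mpoly k[d * u]},
    U = [set lam | exists2 p, S p & p.@[mxvec lam 0] != 0].

Definition zariski_dense (U : set 'M[k]_(d, u)) : Prop :=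
  forall V, zariski_open V -> V !=set0 -> U `&` V !=set0.

Definition general_ideal (f : 'I_u -> {mpoly k[d]}) (lam : 'M[k]_(d, u)) :
    ideal {mpoly k[d]} :=
  gen (range (fun i : 'I_d => \sum_(j < u) lam i j *: f j)).

End GeneralElements.

(* Main.v *)
(* The torus acts on the reductions of I, so core(I) is a monomial ideal, and it
   lies in mono(K) because K is a reduction. For the converse let x be a monomial
   of K = J + (f^d) with J general. Now f^d is in I^d, which lies in J_m
   by a Briancon-Skoda theorem, so x is in J_m. (In characteristic p this uses the
   Frobenius; membership in J_m modulo m^t I for generic J is a linear algebra
   condition over the prime ring, which transfers it to characteristic 0.) For a
   fixed monomial this condition holds or fails generically, and finitely many
   monomials have to be tested, so x is in J_m for generic J.
   The G_d and S_2 hypotheses enter through general elements a_1, ..., a_(d-1) of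
   a local reduction: modulo their residual intersection the ring has dimension
   one and a one-dimensional computation shows that x remains in J_m when a
   generator of J moves along a line from generic position to a special one. So x
   is in L_m for every reduction L of I.
   Finally L_P = I_P for each reduction L and each prime P that misses a variable:
   by G_d the fiber ring of the monomial ideal I at P is a polynomial ring. Hence
   L contains m^t I for some t, and x is in L. *)

Require Import Defs.
From HB Require Import structures.
From mathcomp Require Import all_boot all_order all_algebra.
From mathcomp Require Import perm ring zify.
From mathcomp Require Import boolp classical_sets cardinality.
From mathcomp Require Import ssrcomplements mpoly.

Set Implicit Arguments.
Unset Strict Implicit.
Unset Printing Implicit Defensive.

Import Defs.
Import GRing.Theory.
Local Open Scope classical_set_scope.
Local Open Scope ring_scope.

Arguments ideal_set : simpl never.
Arguments gen : simpl never.
Arguments add_ideal : simpl never.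
Arguments mul_ideal : simpl never.
Arguments colon_ideal : simpl never.
Arguments core : simpl never.
Arguments mono : simpl never.
Arguments loc_ideal : simpl never.

(** The obstacle is to compare an arbitrary reduction L with the ideals J_lambda. Both are put in
    one family: d general elements of L are combinations of the generators of I with a matrix of
    coefficients in R, where J_lambda has a matrix over k. A matrix over R is brought to generic
    position by changing the constant terms of one column after another. Such a move must keep a
    residual intersection fixed whose defining elements are themselves general. Taking general
    elements on a moment curve reconciles the two: a deformation whose direction is given by the
    coefficients of the polynomial vanishing at d - 1 nodes does not affect the elements at these
    nodes. It also makes general mean all but finitely many parameters, so that k need only be
    infinite. Membership in J_m becomes finite linear algebra once a single power m^t, with m^t I in
    J_m, serves all generic J; this uniform bound comes from comparing ranks with one special J. The
    element f^d serves away from m, where J alone may fail to be a reduction: the generators of I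
    have powers in J + (f). *)

Section IdealBasics.
Variable T : comPzRingType.
Implicit Types I J K b : ideal T.

(** * Sums, products and powers of ideals *)

Lemma ideal_sum I (n : nat) (F : 'I_n -> T) :
  (forall i, I (F i)) -> I (\sum_i F i).
Proof.
move=> IF; elim/big_ind: _ => // [|x y]; [exact: ideal0|exact: idealD].
Qed.

Lemma gen_rangeP n (c : 'I_n -> T) x :
  gen (range c) x <-> exists a : 'I_n -> T, x = \sum_i a i * c i.
Proof.
split=> [|[a ->]]; last first.
  by apply: ideal_sum => i; apply: idealMl; apply: sub_gen; exists i.
have iK : is_ideal [set x | exists a : 'I_n -> T, x = \sum_i a i * c i].
  split=> /= [|y z [a ->] [a' ->]|r y [a ->]].
  - by exists (fun _ => 0); rewrite big1 // => i _; rewrite mul0r.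
  - exists (fun i => a i + a' i); rewrite -big_split /=.
    by apply: eq_bigr => i _; rewrite mulrDl.
  - exists (fun i => r * a i); rewrite mulr_sumr.
    by apply: eq_bigr => i _; rewrite mulrA.
apply: (gen_sub (I := Ideal iK)) => _ [i _ <-] /=.
exists (fun j => (j == i)%:R); rewrite (bigD1 i) //= eqxx mul1r.
by rewrite big1 ?addr0 // => j /negbTE ->; rewrite mul0r.
Qed.

Lemma gen1P (y x : T) : gen [set y] x <-> exists r, x = r * y.
Proof.
split=> [|[r ->]]; last by apply: idealMl; apply: sub_gen.
have iK : is_ideal [set x | exists r, x = r * y].
  split=> /= [|_ _ [a ->] [a' ->]|r _ [a ->]].
  - by exists 0; rewrite mul0r.
  - by exists (a + a'); rewrite mulrDl.
  - by exists (r * a); rewrite mulrA.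
by apply: (gen_sub (I := Ideal iK)) => _ -> /=; exists 1; rewrite mul1r.
Qed.

Lemma add_idealP I J x :
  add_ideal I J x <-> exists i j, [/\ I i, J j & x = i + j].
Proof.
split=> [|[i [j [Ii Jj ->]]]]; last first.
  by apply: idealD; apply: sub_gen; [left|right].
have iK : is_ideal [set x | exists i j, [/\ I i, J j & x = i + j]].
  split=> /= [|_ _ [i [j [Ii Jj ->]]] [i' [j' [Ii' Jj' ->]]]|r _ [i [j [Ii Jj ->]]]].
  - by exists 0, 0; split; rewrite ?addr0 //; apply: ideal0.
  - by exists (i + i'), (j + j'); rewrite addrACA; split=> //; apply: idealD.
  - by exists (r * i), (r * j); rewrite mulrDr; split=> //; apply: idealMl.
apply: (gen_sub (I := Ideal iK)) => z [Iz|Jz] /=.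
  by exists z, 0; split; rewrite ?addr0 //; apply: ideal0.
by exists 0, z; split; rewrite ?add0r //; apply: ideal0.
Qed.

Lemma add_idealL I J : I `<=` add_ideal I J.
Proof. by move=> x Ix; apply: sub_gen; left. Qed.

Lemma add_idealR I J : J `<=` add_ideal I J.
Proof. by move=> x Jx; apply: sub_gen; right. Qed.

Lemma add_ideal_sub I J K : I `<=` K -> J `<=` K -> add_ideal I J `<=` K.
Proof. by move=> IK JK; apply: gen_sub => x [/IK|/JK]. Qed.

Lemma add_idealC I J : add_ideal I J = add_ideal J I.
Proof.
by apply: eq_ideal; apply/seteqP; split; apply: add_ideal_sub;
  (exact: add_idealL || exact: add_idealR).
Qed.

Lemma add_idealA I J K :
  add_ideal I (add_ideal J K) = add_ideal (add_ideal I J) K.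
Proof.
apply: eq_ideal; apply/seteqP; split; apply: add_ideal_sub => x.
- by move=> Ix; do 2?apply: add_idealL.
- move: x; apply: add_ideal_sub => x Hx; last exact: add_idealR.
  by apply: add_idealL; apply: add_idealR.
- move: x; apply: add_ideal_sub => x Hx; first exact: add_idealL.
  by apply: add_idealR; apply: add_idealL.
- by move=> Kx; do 2?apply: add_idealR.
Qed.

Definition addg b (y : T) : ideal T := add_ideal b (gen [set y]).
Arguments addg : simpl never.

Lemma addgP b y x : addg b y x <-> exists r, b (x - r * y).
Proof.
split=> [/add_idealP[i [j [bi /gen1P[r ->] ->]]]|[r Hr]].
  by exists r; rewrite addrK.
rewrite -(subrK (r * y) x); apply/add_idealP; exists (x - r * y), (r * y).
by split=> //; apply/gen1P; exists r.
Qed.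

Lemma addgC b y z : addg (addg b y) z = addg (addg b z) y.
Proof. by rewrite /addg -!add_idealA (add_idealC (gen [set y])). Qed.

Lemma sub_addg b y : b `<=` addg b y. Proof. exact: add_idealL. Qed.

Lemma mem_addg b y : addg b y y.
Proof. by apply: add_idealR; apply: sub_gen. Qed.

Lemma addg_sub b y K : b `<=` K -> K y -> addg b y `<=` K.
Proof. by move=> bK Ky; apply: add_ideal_sub => //; apply: gen_sub => _ ->. Qed.

Lemma addg_mono b b' y : b `<=` b' -> addg b y `<=` addg b' y.
Proof.
move=> bb'; apply: addg_sub; last exact: mem_addg.
by apply: subset_trans bb' _; apply: sub_addg.
Qed.

Lemma mul_ideal_mem I J x y : I x -> J y -> mul_ideal I J (x * y).
Proof. by move=> Ix Jy; apply: sub_gen; exists x => //; exists y. Qed.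

Lemma mul_ideal_sub I J K :
  (forall x y, I x -> J y -> K (x * y)) -> mul_ideal I J `<=` K.
Proof. by move=> H; apply: gen_sub => _ [x Ix [y Jy <-]]; apply: H. Qed.

Lemma mul_ideal_mono I I' J J' :
  I `<=` I' -> J `<=` J' -> mul_ideal I J `<=` mul_ideal I' J'.
Proof.
by move=> II JJ; apply: mul_ideal_sub => x y Ix Jy; apply: mul_ideal_mem; auto.
Qed.

Lemma mul_idealC I J : mul_ideal I J = mul_ideal J I.
Proof.
by apply: eq_ideal; apply/seteqP; split; apply: mul_ideal_sub => x y Hx Hy;
  rewrite mulrC; apply: mul_ideal_mem.
Qed.

Lemma mul_ideal_subl I J : mul_ideal I J `<=` I.
Proof. by apply: mul_ideal_sub => x y Ix _; apply: idealMr. Qed.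

Lemma mul_ideal_subr I J : mul_ideal I J `<=` J.
Proof. by apply: mul_ideal_sub => x y _; apply: idealMl. Qed.

Lemma mul_idealA I J K :
  mul_ideal I (mul_ideal J K) = mul_ideal (mul_ideal I J) K.
Proof.
apply: eq_ideal; apply/seteqP; split.
  apply: mul_ideal_sub => x y Ix; move: y.
  have iL : is_ideal [set y | mul_ideal (mul_ideal I J) K (x * y)].
    split=> /= [|y z Hy Hz|r y Hy]; first by rewrite mulr0; apply: ideal0.
      by rewrite mulrDr; apply: idealD.
    by rewrite mulrCA; apply: idealMl.
  apply: (@mul_ideal_sub J K (Ideal iL)) => y z Jy Kz.
  change (mul_ideal (mul_ideal I J) K (x * (y * z))).
  by rewrite mulrA; do 2?apply: mul_ideal_mem.
move=> w; have iL : is_ideal [set y | forall z, K z -> mul_ideal I (mul_ideal J K) (y * z)].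
  split=> /= [z _|y y' Hy Hy' z Kz|r y Hy z Kz]; first by rewrite mul0r; apply: ideal0.
    by rewrite mulrDl; apply: idealD; auto.
  by rewrite -mulrA; apply: idealMl; apply: Hy.
apply: mul_ideal_sub => y z Hy Kz {w}; move: y Hy z Kz.
apply: (@mul_ideal_sub I J (Ideal iL)) => x y Ix Jy z Kz.
by rewrite -mulrA; do 2?apply: mul_ideal_mem.
Qed.

Lemma gen_setT x : gen [set: T] x.
Proof. exact: sub_gen. Qed.

Lemma mul_ideal1 I : mul_ideal I (gen setT) = I.
Proof.
apply: eq_ideal; apply/seteqP; split; first exact: mul_ideal_subl.
by move=> x Ix; rewrite -(mulr1 x); apply: mul_ideal_mem => //; apply: gen_setT.
Qed.

Lemma exp_idealD I m n :
  exp_ideal I (m + n) = mul_ideal (exp_ideal I m) (exp_ideal I n).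
Proof.
elim: m => [|m IHm]; first by rewrite mul_idealC mul_ideal1.
by rewrite addSn /= IHm mul_idealA.
Qed.

Lemma exp_ideal_le I m n : (m <= n)%N -> exp_ideal I n `<=` exp_ideal I m.
Proof. by move=> /subnKC <-; rewrite exp_idealD; apply: mul_ideal_subl. Qed.

Lemma exp_ideal_pow I n x : I x -> exp_ideal I n (x ^+ n).
Proof.
move=> Ix; elim: n => [|n IHn]; first exact: gen_setT.
by rewrite exprS; apply: mul_ideal_mem.
Qed.

Lemma exp_idealM I m n : exp_ideal (exp_ideal I m) n = exp_ideal I (m * n).
Proof. by elim: n => [|n IHn]; rewrite ?muln0 // mulnS exp_idealD -IHn. Qed.

Lemma exp_ideal1 I : exp_ideal I 1 = I.
Proof. exact: mul_ideal1. Qed.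

End IdealBasics.

(** * Localization at a prime, expressed by saturation *)

Section Saturation.
Variable T : comPzRingType.
Implicit Types (I J K b X : ideal T) (P Q : prime_ideal T).

Lemma is_ideal_sat P b : is_ideal [set x | exists2 s, ~ P s & b (s * x)].
Proof.
split=> /= [|x y [s Ps bx] [t Pt bY]|r x [s Ps bx]].
- by exists 1; [exact: prime_proper|rewrite mulr0; apply: ideal0].
- exists (s * t); first exact: prime_mulN.
  rewrite mulrDr; apply: idealD.
    by rewrite -mulrA mulrCA; apply: idealMl.
  by rewrite -mulrA; apply: idealMl.
- by exists s => //; rewrite mulrCA; apply: idealMl.
Qed.

(* the contraction to the ring of the localization of b at P *)
Definition sat P b : ideal T := Ideal (is_ideal_sat P b).
Arguments sat : simpl never.

Lemma sub_sat P b : b `<=` sat P b.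
Proof. by move=> x bx; exists 1; [exact: prime_proper|rewrite mul1r]. Qed.

Lemma sat_mono P b b' : b `<=` b' -> sat P b `<=` sat P b'.
Proof. by move=> bb' x [s Ps bsx]; exists s => //; apply: bb'. Qed.

Lemma sat_unit P b s x : ~ P s -> sat P b (s * x) -> sat P b x.
Proof.
move=> Ps [t Pt H]; exists (t * s); first exact: prime_mulN.
by rewrite -mulrA.
Qed.

Lemma sat_sat P b : sat P (sat P b) `<=` sat P b.
Proof. by move=> x [s Ps]; apply: sat_unit. Qed.

Lemma sat_sub P b b' : b `<=` sat P b' -> sat P b `<=` sat P b'.
Proof. by move=> H; apply: subset_trans (@sat_sat P b'); apply: sat_mono. Qed.

Lemma sat_prime P b : b `<=` P -> sat P b `<=` P.
Proof. by move=> bP x [s Ps /bP /prime_mul []]. Qed.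

Lemma sat_le P Q b : Q `<=` P -> sat P b `<=` sat Q b.
Proof. by move=> QP x [s Ps H]; exists s => // /QP. Qed.

Lemma sat_mul P I J I' J' : I `<=` sat P I' -> J `<=` sat P J' ->
  mul_ideal I J `<=` sat P (mul_ideal I' J').
Proof.
move=> HI HJ; apply: mul_ideal_sub => x y /HI[s Ps Hx] /HJ[t Pt Hy].
exists (s * t); first exact: prime_mulN.
by rewrite mulrACA; apply: mul_ideal_mem.
Qed.

Lemma prime_pow P x n : P (x ^+ n) -> P x.
Proof.
elim: n => [/prime_proper//|n IHn]; first by rewrite exprS => /prime_mul [|/IHn].
Qed.

Lemma prime_sum P (n : nat) (F : 'I_n -> T) :
  ~ P (\prod_i F i) <-> (forall i, ~ P (F i)).
Proof.
split=> [H i PF|]; first by apply: H; rewrite (bigD1 i) //=; apply: idealMr.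
move=> H; elim/big_ind: _ => //; [exact: prime_proper|exact: prime_mulN].
Qed.

Lemma sat_gen P b n (c : 'I_n -> T) : (forall i, sat P b (c i)) ->
  exists2 s, ~ P s & forall x, gen (range c) x -> b (s * x).
Proof.
move=> H.
have {H} /choice[s Hs] : forall i, exists s, ~ P s /\ b (s * c i).
  by move=> i; have [s Ps bs] := H i; exists s.
exists (\prod_i s i); first by apply/prime_sum => i; have [] := Hs i.
move=> x /gen_rangeP[a ->]; rewrite mulr_sumr; apply: ideal_sum => i.
rewrite (bigD1 i) //=; set p := \prod_(j | _) _.
have -> : s i * p * (a i * c i) = (p * a i) * (s i * c i) by ring.
by apply: idealMl; have [] := Hs i.
Qed.

End Saturation.

(** * Noetherian rings: annihilators, minimal primes, Nakayama *)

Definition noeth (T : comPzRingType) : Prop :=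
  forall I : ideal T, exists n, generated_by I n.

Section Noetherian.
Variable T : comPzRingType.
Hypothesis noethT : noeth T.
Implicit Types (I J K b X : ideal T) (P Q : prime_ideal T).

Lemma is_ideal_union (F : nat -> ideal T) :
  (forall n, F n `<=` F n.+1) -> is_ideal [set x | exists n, F n x].
Proof.
move=> FS; have Fle m n : (m <= n)%N -> F m `<=` F n.
  move=> /subnKC <-; elim: (n - m)%N => [|j IHj]; first by rewrite addn0.
  by rewrite addnS; apply: subset_trans IHj _.
split=> /= [|x y [m Fx] [n Fy]|a x [n Fx]]; first by exists 0%N; apply: ideal0.
  exists (maxn m n); apply: idealD; [apply: Fle Fx|apply: Fle Fy].
    exact: leq_maxl.
  exact: leq_maxr.
by exists n; apply: idealMl.
Qed.

Lemma noeth_chain (F : nat -> ideal T) : (forall n, F n `<=` F n.+1) ->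
  exists n, forall m, F m `<=` F n.
Proof.
move=> FS; have Fle m n : (m <= n)%N -> F m `<=` F n.
  move=> /subnKC <-; elim: (n - m)%N => [|j IHj]; first by rewrite addn0.
  by rewrite addnS; apply: subset_trans IHj _.
have [r [c Uc]] := noethT (Ideal (is_ideal_union FS)).
have /choice[h Hh] : forall i : 'I_r, exists n, F n (c i).
  move=> i; have : gen (range c) (c i) by apply: sub_gen; exists i.
  by rewrite -Uc.
exists (\max_i h i)%N => m x Fx.
have : Ideal (is_ideal_union FS) x by exists m.
rewrite Uc; apply: gen_sub => _ [i _ <-].
by apply: Fle (Hh i); apply: leq_bigmax.
Qed.

Lemma noeth_max (C : ideal T -> Prop) : (exists I, C I) ->
  exists2 I, C I & forall J, C J -> I `<=` J -> J `<=` I.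
Proof.
move=> [I0 CI0]; apply: contrapT => H.
have next (I : {I | C I}) : exists J : {I | C I},
    sval I `<=` sval J /\ ~ sval J `<=` sval I.
  case: I => I CI /=; apply: contrapT => HI; apply: H; exists I => // J CJ IJ.
  by apply: contrapT => JI; apply: HI; exists (exist _ J CJ).
have [f Hf] := choice next.
pose F n := sval (iter n f (exist _ I0 CI0)).
have [n Hn] : exists n, forall m, F m `<=` F n.
  by apply: noeth_chain => n; have [] := Hf (iter n f (exist _ I0 CI0)).
by have [_] := Hf (iter n f (exist _ I0 CI0)); apply; apply: (Hn n.+1).
Qed.

Lemma is_ideal_ann b w : is_ideal [set r | b (r * w)].
Proof.
split=> /= [|x y Hx Hy|a x Hx]; first by rewrite mul0r; apply: ideal0.
  by rewrite mulrDl; apply: idealD.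
by rewrite -mulrA; apply: idealMl.
Qed.
Definition ann b w : ideal T := Ideal (is_ideal_ann b w).

Lemma annE b w r : ann b w r = b (r * w). Proof. by []. Qed.

(** A maximal annihilator modulo b is prime. Only multiples outside b must stay in [D], so that the
    search can be confined to the multiples of one element z, or to the elements killed by all that
    kills z. *)
Lemma max_ann b (D : T -> Prop) z : D z -> ~ b z ->
  (forall w r, D w -> ~ b (r * w) -> D (r * w)) ->
  exists Q w, [/\ D w, ~ b w, (forall r, prime_ideal_val Q r <-> b (r * w)) &
    forall w', D w' -> ~ b w' -> (forall r, b (r * w) -> b (r * w')) ->
      forall r, b (r * w') -> b (r * w)].
Proof.
move=> Dz bz DM.
have [|_ [w [Dw bw ->]] max] := @noeth_max
  (fun J => exists w, [/\ D w, ~ b w & J = ann b w]).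
  by exists (ann b z), z.
have max' w' : D w' -> ~ b w' -> (forall r, b (r * w) -> b (r * w')) ->
      forall r, b (r * w') -> b (r * w).
  by move=> Dw' bw' ww' r; apply: (max (ann b w')) => //; exists w'.
have pr1 : ~ ann b w 1 by rewrite annE mul1r.
have prM x y : ann b w (x * y) -> ann b w x \/ ann b w y.
  rewrite !annE => bxy; case: (pselect (b (y * w))) => by_; [by right|left].
  apply: (max' (y * w)) => //; first exact: DM.
    by move=> r br; rewrite mulrCA; apply: idealMl.
  by rewrite mulrA.
by exists (PrimeIdeal pr1 prM), w; split.
Qed.

Lemma max_ann_all b z : ~ b z ->
  exists Q w, [/\ ~ b w, (forall r, prime_ideal_val Q r <-> b (r * w)) &
   (forall r, b (r * z) -> Q r)].
Proof.
move=> bz.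
have [||Q [w [[a ->] bw QE _]]] :=
  @max_ann b (fun w => exists a, w = a * z) z _ bz.
- by exists 1; rewrite mul1r.
- by move=> _ r [a ->] _; exists (r * a); rewrite mulrA.
exists Q, (a * z); split=> // r br; apply/QE; rewrite mulrCA; exact: idealMl.
Qed.

Lemma max_ann_mul b z : ~ b z ->
  exists Q a, ~ b (a * z) /\ (forall r, prime_ideal_val Q r <-> b (r * (a * z))).
Proof.
move=> bz.
have [||Q [w [[a ->] bw QE _]]] :=
  @max_ann b (fun w => exists a, w = a * z) z _ bz.
- by exists 1; rewrite mul1r.
- by move=> _ r [a ->] _; exists (r * a); rewrite mulrA.
by exists Q, a.
Qed.

(** The generators have to be found inside [S]; hence an ideal maximal among those generated by
    finitely many elements of [S] is taken, rather than arbitrary generators of [gen S]. *)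
Lemma gen_finite (S : set T) : exists n (c : 'I_n -> T),
  (forall i, S (c i)) /\ gen S = gen (range c).
Proof.
pose C (J : ideal T) := exists n (c : 'I_n -> T),
  (forall i, S (c i)) /\ J = gen (range c).
have [|J [n [c [Sc ->]]] max] := @noeth_max C.
  exists (gen (range (fun i : 'I_0 => 0))), 0%N, (fun=> 0); split=> //.
  by case.
exists n, c; split=> //; apply: eq_ideal; apply/seteqP; split; last first.
  by apply: gen_sub => _ [i _ <-]; apply: sub_gen.
apply: gen_sub => x Sx.
pose c' (i : 'I_n.+1) := if unlift ord_max i is Some j then c j else x.
have c'x : gen (range c') x.
  by apply: sub_gen; exists ord_max => //; rewrite /c' unlift_none.
apply: (max (gen (range c'))) => //.
  by exists n.+1, c'; split=> // i; rewrite /c'; case: unlift.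
apply: gen_sub => _ [i _ <-]; apply: sub_gen; exists (lift ord_max i) => //.
by rewrite /c' liftK.
Qed.

Lemma prime_family_sub n (F : 'I_n -> ideal T) P :
  (forall x, (forall i, F i x) -> P x) -> exists i, F i `<=` P.
Proof.
move=> H; apply: contrapT => nH.
have /choice[x Hx] : forall i, exists x, F i x /\ ~ P x.
  move=> i; apply: contrapT => Hi; apply: nH; exists i => x Fx.
  by apply: contrapT => Px; apply: Hi; exists x.
suff : P (\prod_i x i) by move/(proj2 (prime_sum P x)); apply=> i; have [] := Hx i.
by apply: H => i; rewrite (bigD1 i) //=; apply: idealMr; have [] := Hx i.
Qed.

(* the maximal annihilators of elements of A/b are finitely many: if z_1, ...,
   z_n generate the ideal of all the elements having such an annihilator, then
   each of them contains the intersection of the annihilators of the z_i *)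
Lemma zero_divisors b : exists n (Q : 'I_n -> prime_ideal T) (w : 'I_n -> T),
  [/\ forall i, ~ b (w i), forall i r, Q i r <-> b (r * w i) &
    forall r z, b (r * z) -> ~ b z -> exists i, Q i r].
Proof.
pose M (w : T) := ~ b w /\ forall w', ~ b w' ->
  (forall r, b (r * w) -> b (r * w')) -> forall r, b (r * w') -> b (r * w).
have [n [w [Mw gM]]] := gen_finite M.
have primeM z : M z -> exists Q : prime_ideal T, forall r, Q r <-> b (r * z).
  move=> [bz maxz].
  have pr1 : ~ ann b z 1 by rewrite annE mul1r.
  have prM x y : ann b z (x * y) -> ann b z x \/ ann b z y.
    rewrite !annE => bxy; case: (pselect (b (y * z))) => by_; [by right|left].
    apply: (maxz (y * z)) => //; last by rewrite mulrA.
    by move=> r br; rewrite mulrCA; apply: idealMl.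
  by exists (PrimeIdeal pr1 prM).
have /choice[Q HQ] := fun i => primeM (w i) (Mw i).
exists n, Q, w; split=> // [i|r z brz bz]; first by have [] := Mw i.
have [||Q' [v [Dv bv Q'E maxv]]] :=
  @max_ann b (fun w => forall r, b (r * z) -> b (r * w)) z _ bz.
- by [].
- by move=> u s H _ r' /H; rewrite mulrCA; apply: idealMl.
have Mv : M v.
  by split=> // u bu vu; apply: maxv => // r' /Dv /vu.
have [i Hi] : exists i, ann b (w i) `<=` Q'.
  apply: prime_family_sub => x Hx; apply/Q'E.
  have : gen (range w) v by rewrite -gM; apply: sub_gen.
  move=> /gen_rangeP[a ->]; rewrite mulr_sumr; apply: ideal_sum => i.
  by rewrite mulrCA; apply: idealMl; apply: Hx.
exists i; apply/HQ; have [_ mi] := Mw i; apply: (mi v) => //.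
  by move=> s Hs; apply/Q'E; apply: Hi.
exact: Dv.
Qed.

(** Noetherian induction: an ideal c maximal among the counterexamples is not prime, and if x y is
    in c with x and y outside, each prime over c lies over c + (x) or c + (y). *)
Lemma primes_over b : exists n (Q : 'I_n -> prime_ideal T),
  (forall i, b `<=` Q i) /\
  forall P : prime_ideal T, b `<=` P -> exists i, Q i `<=` P.
Proof.
apply: contrapT => Hb.
pose C b := ~ exists n (Q : 'I_n -> prime_ideal T), (forall i, b `<=` Q i) /\
  forall P : prime_ideal T, b `<=` P -> exists i, Q i `<=` P.
have [|c Cc max] := @noeth_max C; first by exists b.
have c1 : ~ c 1.
  move=> c1; apply: Cc.
  have F : 'I_0 -> prime_ideal T by case.
  by exists 0%N, F; split=> [[]//|P cP]; case: (prime_proper (cP _ c1)).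
have [x [y [cxy cx cy]]] : exists x y, [/\ c (x * y), ~ c x & ~ c y].
  apply: contrapT => H.
  have prM x y : c (x * y) -> c x \/ c y.
    move=> cxy; case: (pselect (c x)) => cx; [by left|right].
    by apply: contrapT => cy; apply: H; exists x, y.
  apply: Cc; exists 1%N, (fun=> PrimeIdeal c1 prM); split=> [_ x //|P cP].
  by exists ord0.
have nC z : ~ c z -> ~ C (addg c z).
  move=> cz CC; apply: cz; apply: (max _ CC); [exact: sub_addg|exact: mem_addg].
have /contrapT[m [Q [cQ HQ]]] := nC _ cx.
have /contrapT[n [Q' [cQ' HQ']]] := nC _ cy.
apply: Cc; exists (m + n)%N, (fun i => match fintype.split i with inl j => Q j | inr j => Q' j end).
split=> [i|P cP].
  by case: (fintype.split i) => j; [apply: subset_trans (cQ j)|apply: subset_trans (cQ' j)];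
    apply: sub_addg.
have [Px|Py] := prime_mul (cP _ cxy).
  have [j Hj] := HQ P (addg_sub cP Px); exists (fintype.unsplit (inl j)).
  by rewrite fintype.unsplitK.
have [j Hj] := HQ' P (addg_sub cP Py); exists (fintype.unsplit (inr j)).
by rewrite fintype.unsplitK.
Qed.

(* applied to an ideal H maximal among the P-saturated ideals that contain b
   but not X *)
Lemma nakayama P b X : X `<=` sat P (add_ideal b (mul_ideal P X)) -> X `<=` sat P b.
Proof.
move=> HX; apply: contrapT => nX.
have [|H [bH HP HnX] max] := @noeth_max
  (fun H => [/\ b `<=` H, sat P H `<=` H & ~ X `<=` H]).
  by exists (sat P b); split=> //; [exact: sub_sat|exact: sat_sat].
have [x [Xx Hx]] : exists x, X x /\ ~ H x.
  apply: contrapT => nx; apply: HnX => x Xx; apply: contrapT => Hx.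
  by apply: nx; exists x.
have XH : X `<=` sat P (addg H x).
  apply: contrapT => nXH; apply: Hx; apply: (max (sat P (addg H x))).
  - split=> //; last exact: sat_sat.
    apply: subset_trans bH _; apply: subset_trans (@sub_addg _ H x) _.
    exact: sub_sat.
  - by apply: subset_trans (@sub_addg _ H x) _; apply: sub_sat.
  - by apply: sub_sat; apply: mem_addg.
have sub : add_ideal b (mul_ideal P X) `<=`
    sat P (add_ideal H (mul_ideal P (gen [set x]))).
  apply: add_ideal_sub.
    apply: subset_trans bH _; apply: subset_trans (@sub_sat _ P _).
    exact: add_idealL.
  apply: mul_ideal_sub => p y Pp /XH[s Ps /addgP[r Hr]]; exists s => //.
  rewrite mulrCA -(subrK (r * x) (s * y)) mulrDr; apply: idealD.
    by apply: add_idealL; apply: idealMl.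
  apply: add_idealR; rewrite mulrCA; apply: idealMl.
  by apply: mul_ideal_mem => //; apply: sub_gen.
have /(sat_sub sub)[s Ps] := HX _ Xx.
move=> /add_idealP[h [j [Hh Hj E]]].
have [p Pp jE] : exists2 p, P p & j = p * x.
  have iK : is_ideal [set j | exists2 p, P p & j = p * x].
    split=> /= [|_ _ [p Pp ->] [q Pq ->]|a _ [p Pp ->]].
    - by exists 0; rewrite ?mul0r //; apply: ideal0.
    - by exists (p + q); rewrite ?mulrDl //; apply: idealD.
    - by exists (a * p); rewrite ?mulrA //; apply: idealMl.
  apply: (@mul_ideal_sub _ _ _ (Ideal iK)) Hj => p _ Pp /gen1P[a ->].
  by exists (p * a); rewrite ?mulrA //; apply: idealMr.
apply: Hx; apply: HP; exists (s - p).
  by move=> Psp; apply: Ps; rewrite -(subrK p s); apply: idealD.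
by rewrite mulrBl E jE addrK.
Qed.

Lemma sat_denom P b X : X `<=` sat P b ->
  exists2 s, ~ P s & forall x, X x -> b (s * x).
Proof.
have [n [c ->]] := noethT X => H; apply: sat_gen => i; apply: H.
by apply: sub_gen; exists i.
Qed.

End Noetherian.

(** * Cofinite sets of parameters *)

Section Cofinite.
Variable k : fieldType.
Implicit Types A B : k -> Prop.

(** Plays the role of a dense open subset of the affine line: over an infinite field finitely many
    such conditions have a common solution. *)
Definition cof A : Prop := exists s : seq k, forall t, t \notin s -> A t.

Lemma cofT A : (forall t, A t) -> cof A.
Proof. by move=> AT; exists [::]. Qed.

Lemma cofI A B : cof A -> cof B -> cof (fun t => A t /\ B t).
Proof.
move=> [s As] [r Br]; exists (s ++ r) => t.
by rewrite mem_cat negb_or => /andP[/As ? /Br].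
Qed.

Lemma cof_sub A B : (forall t, A t -> B t) -> cof A -> cof B.
Proof. by move=> AB [s As]; exists s => t /As /AB. Qed.

Lemma cof_imp (C : Prop) B : (C -> cof B) -> cof (fun t => C -> B t).
Proof.
by case: (pselect C) => [c /(_ c)|nc _]; [apply: cof_sub|apply: cofT].
Qed.

Lemma cof_ord n (A : 'I_n -> k -> Prop) :
  (forall i, cof (A i)) -> cof (fun t => forall i, A i t).
Proof.
move=> /choice[s As]; exists (flatten (codom s)) => t ts i; apply: As.
apply: contra ts => ts; apply/flattenP; exists (s i) => //; exact: codom_f.
Qed.

Lemma not_cof n A : ~ cof A ->
  exists s : seq k, [/\ uniq s, size s = n & forall t, t \in s -> ~ A t].
Proof.
move=> nA; elim: n => [|n [s [us <- sA]]]; first by exists [::].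
have [t [ts At]] : exists t, t \notin s /\ ~ A t.
  apply: contrapT => H; apply: nA; exists s => t ts; apply: contrapT => At.
  by apply: H; exists t.
exists (t :: s); split=> //=; first by rewrite ts us.
by move=> r; rewrite inE => /orP[/eqP ->|/sA].
Qed.

Lemma cof_neq a : cof (fun t => t <> a).
Proof. by exists [:: a] => t; rewrite inE => /eqP. Qed.

Lemma cof_root (p : {poly k}) : p != 0 -> cof (fun t => p.[t] != 0).
Proof.
move=> p0; apply: contrapT => /(not_cof (size p))[s [us ss sp]].
have := max_poly_roots p0 _ us; rewrite ss ltnn => H; apply: notF; apply: H.
by apply/allP => t /sp /negP; rewrite negbK.
Qed.

Hypothesis infk : infinite_set [set: k].

Lemma infinite_fresh (s : seq k) : exists t, t \notin s.
Proof.
apply: contrapT => H; apply: infk.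
apply: (sub_finite_set _ (finite_seq s)) => t _ /=.
by apply: contrapT => /negP ts; apply: H; exists t.
Qed.

Lemma cof_list A n : cof A ->
  exists s : seq k, [/\ uniq s, size s = n & forall t, t \in s -> A t].
Proof.
move=> [r Ar]; suff [s [us ss sr]] : exists s : seq k,
    [/\ uniq s, size s = n & forall t, t \in s -> t \notin r].
  by exists s; split=> // t /sr /Ar.
elim: n => [|n [s [us <- sr]]]; first by exists [::].
have [t] := infinite_fresh (s ++ r); rewrite mem_cat negb_or => /andP[ts tr].
exists (t :: s); split=> //=; first by rewrite ts us.
by move=> t'; rewrite inE => /orP[/eqP ->|/sr].
Qed.

Lemma cof_ex A : cof A -> exists t, A t.
Proof. by move=> [s As]; have [t /As] := infinite_fresh s; exists t. Qed.

End Cofinite.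

(** * General elements on a moment curve *)

Section Moment.
Variables (k : fieldType) (T : comPzRingType) (iota : {rmorphism k -> T}).
Implicit Types W b : ideal T.

Lemma unitmx_mem n (A : 'M[k]_n) (c : 'I_n -> T) W : A \in unitmx ->
  (forall i, W (\sum_j iota (A i j) * c j)) -> forall j, W (c j).
Proof.
move=> uA WA j.
have -> : c j = \sum_i iota (invmx A j i) * \sum_l iota (A i l) * c l.
  under eq_bigr => i _ do rewrite mulr_sumr.
  rewrite exchange_big /= (bigD1 j) //= [X in _ + X]big1 ?addr0 => [|l lj].
    under eq_bigr => i _ do rewrite mulrA -rmorphM.
    rewrite -mulr_suml -rmorph_sum /=.
    have -> : \sum_i invmx A j i * A i j = 1.
      by have /matrixP/(_ j j) := mulVmx uA; rewrite !mxE eqxx.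
    by rewrite rmorph1 mul1r.
  under eq_bigr => i _ do rewrite mulrA -rmorphM.
  rewrite -mulr_suml -rmorph_sum /=.
  have -> : \sum_i invmx A j i * A i l = 0.
    by have /matrixP/(_ j l) := mulVmx uA; rewrite !mxE eq_sym (negbTE lj).
  by rewrite rmorph0 mul0r.
by apply: ideal_sum => i; apply: idealMl.
Qed.

(** The point of parameter t on the moment curve with coordinates [c j]. Its values at n distinct
    parameters have the same span over k as the [c j] (Vandermonde), so an ideal that misses some
    [c j] contains fewer than n of them. *)
Definition mom n (c : 'I_n -> T) (t : k) : T :=
  \sum_(j < n) iota (t ^+ j) * c j.

Lemma mom_mem n (c : 'I_n -> T) t W : (forall j, W (c j)) -> W (mom c t).
Proof. by move=> Wc; apply: ideal_sum => i; apply: idealMl. Qed.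

Definition moment_mx n (s : 'I_n -> k) : 'M[k]_n := \matrix_(i, j) s i ^+ j.

Lemma moment_unit n (s : 'I_n -> k) : injective s -> moment_mx s \in unitmx.
Proof.
move=> injs; rewrite -unitmx_tr.
have -> : (moment_mx s)^T = Vandermonde n (\row_i s i).
  by apply/matrixP => i j; rewrite !mxE.
rewrite unitmxE det_Vandermonde unitfE.
apply/prodf_neq0 => i _; apply/prodf_neq0 => j ij; rewrite !mxE subr_eq0.
by apply: contraTN ij => /eqP /injs ->; rewrite ltnn.
Qed.

Lemma mom_all n (c : 'I_n -> T) (s : 'I_n -> k) W : injective s ->
  (forall i, W (mom c (s i))) -> forall j, W (c j).
Proof.
move=> injs H; apply: (unitmx_mem (moment_unit injs)) => i.
by under eq_bigr => j _ do rewrite mxE; apply: H.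
Qed.

Lemma mom_avoid n (c : 'I_n -> T) W : ~ (forall j, W (c j)) ->
  cof (fun t => ~ W (mom c t)).
Proof.
move=> nW; apply: contrapT => /(not_cof n)[s [us ss sW]]; apply: nW.
apply: (@mom_all _ _ (fun i => nth 0 s i)) => [i j /eqP|i].
  by rewrite nth_uniq ?ss // => /eqP /val_inj.
by apply: contrapT => H; apply: (sW (nth 0 s i)) => //; rewrite mem_nth // ss.
Qed.

Lemma mom_avoid_gen n (c : 'I_n -> T) W : ~ gen (range c) `<=` W ->
  cof (fun t => ~ W (mom c t)).
Proof.
move=> H; apply: mom_avoid => Wc; apply: H; apply: gen_sub => _ [i _ <-].
exact: Wc.
Qed.

End Moment.

(** * Depth: exchange of regular sequences *)

Section DepthExchange.
Variables (k : fieldType) (T : comPzRingType) (iota : {rmorphism k -> T}).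
Hypothesis infk : infinite_set [set: k].
Hypothesis noethT : noeth T.
Implicit Types (I J K b W : ideal T) (P Q : prime_ideal T).

(* y is a nonzerodivisor on the localization of T/b at P *)
Definition preg P b (y : T) : Prop := forall r, sat P b (y * r) -> sat P b r.

Fixpoint regseq P b (ys : seq T) : Prop :=
  if ys is y :: ys' then [/\ P y, preg P b y & regseq P (addg b y) ys'] else True.

Definition adds b (ys : seq T) : ideal T := foldl (@addg T) b ys.

(** P is an associated prime of T/b, that is, (T/b)_P has depth 0. *)
Definition passoc P b : Prop :=
  exists z, ~ sat P b z /\ forall p, P p -> sat P b (p * z).

Lemma adds_rcons b ys y : adds b (rcons ys y) = addg (adds b ys) y.
Proof. by rewrite /adds -cats1 foldl_cat. Qed.

Lemma sub_adds b ys : b `<=` adds b ys.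
Proof.
elim: ys b => [|y ys IH] b //=; apply: subset_trans (IH _); exact: sub_addg.
Qed.

Lemma adds_addg b c ys : adds (addg b c) ys = addg (adds b ys) c.
Proof. by elim: ys b => [|y ys IH] b //=; rewrite addgC IH. Qed.

Lemma regseq_rcons P b ys y : regseq P b (rcons ys y) <->
  [/\ regseq P b ys, P y & preg P (adds b ys) y].
Proof.
elim: ys b => [|z ys IH] b /=; first by split=> [[]|[]].
by split=> [[Pz zb /IH[]]|[[Pz zb ys_] Py yb]]; split=> //; apply/IH.
Qed.

Lemma ann_sub P b w : ~ sat P b w -> forall r, sat P b (r * w) -> P r.
Proof. by move=> bw r H; apply: contrapT => Pr; apply: bw; apply: sat_unit H. Qed.

Lemma cof_preg P b n (c : 'I_n -> T) :
  (forall Q w, ~ sat P b w -> (forall r, prime_ideal_val Q r <-> sat P b (r * w)) ->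
     ~ forall j, Q (c j)) ->
  cof (fun t => preg P b (mom iota c t)).
Proof.
move=> H; have [m [Q [w [bw Qw Hz]]]] := zero_divisors noethT (sat P b).
apply: (@cof_sub _ (fun t => forall i, ~ Q i (mom iota c t))); last first.
  by apply: cof_ord => i; apply: mom_avoid; apply: H (bw i) (Qw i).
move=> t Qt r Hr; apply: contrapT => br.
by have [i] := Hz _ _ Hr br; apply: Qt.
Qed.

Lemma cof_preg_passoc P b n (c : 'I_n -> T) : P = gen (range c) :> set T ->
  ~ passoc P b -> cof (fun t => preg P b (mom iota c t)).
Proof.
move=> Pc nP; apply: cof_preg => Q w bw QE Qc; apply: nP.
exists w; split=> // p; rewrite Pc => gp; apply/QE; move: p gp.
by apply: gen_sub => _ [i _ <-].
Qed.

Lemma passoc_preg P b y : P y -> preg P b y -> ~ passoc P b.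
Proof. by move=> Py yb [z [bz Hz]]; apply: bz; apply: yb; apply: Hz. Qed.

Lemma sat_addgP P b y x : sat P (addg b y) x <->
  exists s r, ~ P s /\ b (s * x - r * y).
Proof.
split=> [[s Ps /addgP[r H]]|[s [r [Ps H]]]]; first by exists s, r.
by exists s => //; apply/addgP; exists r.
Qed.

(** As c is already regular modulo b, permuting the regular pair y, c only requires cancelling,
    without Nakayama. *)
Lemma preg_swap P b y c :
  preg P b y -> preg P b c -> preg P (addg b y) c -> preg P (addg b c) y.
Proof.
move=> yb cb cby r /sat_addgP[s [t [Ps H]]].
have : sat P (addg b y) (c * t).
  apply: sub_sat; apply/addgP; exists (s * r).
  rewrite -opprB; apply: idealN.
  by have -> : s * r * y - c * t = s * (y * r) - t * c by ring.
move=> /cby /sat_addgP[s' [t' [Ps' H']]].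
suff /yb : sat P b (y * (s' * s * r - t' * c)).
  move=> [s'' Ps'' H'']; apply/sat_addgP; exists (s'' * (s' * s)), (s'' * t').
  split; first by do 2?apply: prime_mulN.
  by have -> : s'' * (s' * s) * r - s'' * t' * c = s'' * (s' * s * r - t' * c) by ring.
apply: sub_sat.
have -> : y * (s' * s * r - t' * c) =
  s' * (s * (y * r) - t * c) + c * (s' * t - t' * y) by ring.
by apply: idealD; apply: idealMl.
Qed.

Fixpoint pregs P b (c : T) (ys : seq T) : Prop :=
  preg P b c /\ if ys is y :: ys' then pregs P (addg b y) c ys' else True.

Lemma regseq_addg P b c ys : pregs P b c ys -> regseq P b ys ->
  regseq P (addg b c) ys.
Proof.
elim: ys b => [|y ys IH] b //= [cb H] [Py yb Hys]; split=> //.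
  by apply: preg_swap => //; case: ys H {IH Hys} => [|? ?] [].
by rewrite addgC; apply: IH.
Qed.

Lemma cof_pregs P b n (c : 'I_n -> T) ys y : P = gen (range c) :> set T ->
  regseq P b (rcons ys y) -> cof (fun t => pregs P b (mom iota c t) ys).
Proof.
move=> Pc; elim: ys b => [|z ys IH] b /= [Pz zb H]; apply: cofI.
- by apply: (cof_preg_passoc Pc); apply: passoc_preg zb.
- exact: cofT.
- by apply: (cof_preg_passoc Pc); apply: passoc_preg zb.
- exact: IH.
Qed.

(** The relation c z = w y modulo b sends a socle element z modulo y to a socle element w modulo c;
    both socles compute the same Ext group. *)
Lemma passoc_exchange P b y c : preg P b y -> preg P b c -> P c ->
  passoc P (addg b y) -> passoc P (addg b c).
Proof.
move=> yb cb Pc [z [bz Pz]].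
have /sat_addgP[s [w [Ps Hw]]] := Pz _ Pc.
exists w; split.
  move=> /sat_addgP[s2 [v [Ps2 Hv]]]; apply: bz.
  suff /cb[s3 Ps3 H3] : sat P b (c * (s2 * s * z - v * y)).
    apply/sat_addgP; exists (s3 * (s2 * s)), (s3 * v).
    split; first by do 2?apply: prime_mulN.
    by have -> : s3 * (s2 * s) * z - s3 * v * y = s3 * (s2 * s * z - v * y) by ring.
  apply: sub_sat.
  have -> : c * (s2 * s * z - v * y) =
    s2 * (s * (c * z) - w * y) + y * (s2 * w - v * c) by ring.
  by apply: idealD; apply: idealMl.
move=> p /Pz /sat_addgP[s2 [v [Ps2 Hv]]].
suff /yb[s3 Ps3 H3] : sat P b (y * (s2 * p * w - s * c * v)).
  apply/sat_addgP; exists (s3 * s2), (s3 * s * v); split; first exact: prime_mulN.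
  by have -> : s3 * s2 * (p * w) - s3 * s * v * c = s3 * (s2 * p * w - s * c * v) by ring.
apply: sub_sat.
have -> : y * (s2 * p * w - s * c * v) =
  s * c * (s2 * (p * z) - v * y) - s2 * p * (s * (c * z) - w * y) by ring.
by apply: idealB; apply: idealMl.
Qed.

(** Rees's invariance of the length: a general e in P is regular modulo all proper initial segments
    of both sequences, hence may replace the last element of each and be moved to the front, where
    induction divides by it. The socle at the end of [ys] survives by [passoc_exchange]. *)
Lemma depth_exchange P b ys xs : regseq P b ys -> passoc P (adds b ys) ->
  regseq P b xs -> (size xs <= size ys)%N.
Proof.
have [n [c Pc]] := noethT P.
suff H m : forall b ys xs, size ys = m -> size xs = m.+1 -> regseq P b ys ->
    passoc P (adds b ys) -> regseq P b xs -> False.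
  move=> Hys pys Hxs; rewrite leqNgt; apply/negP => yx.
  apply: (H (size ys) b ys (take (size ys).+1 xs)) => //.
    by rewrite size_takel.
  have := cat_take_drop (size ys).+1 xs; move: (take _ _) (drop _ _) => x1 x2 E.
  move: Hxs; rewrite -E; elim: x1 (b) {E} => [|x x1 IH] b' //= [? ? /IH]; by split.
elim: m => [|m IH] {}b {}ys {}xs.
  move=> /size0nil -> /=; case: xs => [|x xs] //= _ _ pb [Px xb _].
  by apply: (passoc_preg Px xb pb).
case/lastP: ys => [|ys y]; rewrite ?size_rcons // => -[sy].
case/lastP: xs => [|xs x]; rewrite ?size_rcons // => -[sx] Hys pys Hxs.
have := cofI (cof_pregs (f_equal _ Pc) Hys) (cof_pregs (f_equal _ Pc) Hxs).
move=> /(cof_ex infk)[t []]; set e := mom iota c t => ey ex.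
have Pe : P e.
  by rewrite Pc; apply: mom_mem => j; apply: sub_gen; exists j.
have [rys Py yys] := iffLR (regseq_rcons _ _ _ _) Hys.
have [rxs _ _] := iffLR (regseq_rcons _ _ _ _) Hxs.
apply: (IH (addg b e) ys xs) => //; try exact: regseq_addg.
rewrite adds_addg; move: pys; rewrite adds_rcons; apply: passoc_exchange => //.
elim: ys b ey {IH sy Hys rys Py yys Hxs ex rxs} => [|z ys IH] b //= [] // _.
exact: IH.
Qed.

End DepthExchange.

(** * Depth at adjacent primes *)

Section AdjacentPrimes.
Variables (k : fieldType) (T : comPzRingType) (iota : {rmorphism k -> T}).
Hypothesis infk : infinite_set [set: k].
Hypothesis noethT : noeth T.
Implicit Types (I J K b W : ideal T) (P Q : prime_ideal T).

Lemma regseq_le P0 P b ys : P0 `<=` P -> (forall y, y \in ys -> P0 y) ->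
  regseq P b ys -> regseq P0 b ys.
Proof.
move=> P0P; elim: ys b => [|y ys IH] b //= ysP [Py yb Hys]; split.
- by apply: ysP; rewrite inE eqxx.
- move=> r [s P0s H]; apply: (sat_unit P0s).
  have : sat P b (y * (s * r)) by apply: sub_sat; rewrite mulrCA.
  by move=> /yb; apply: sat_le.
- by apply: IH => // z zs; apply: ysP; rewrite inE zs orbT.
Qed.

(* depth grows by at most one between adjacent primes: a maximal regular
   sequence of A_P inside P0 has P0 or P as an associated prime, and in the
   first case one more element of P makes P associated *)
Lemma adjacent_depth P0 P b ys0 xs : P0 `<=` P ->
  (forall Q, P0 `<=` Q -> Q `<=` P -> Q `<=` P0 \/ P `<=` Q) ->
  regseq P0 b ys0 -> passoc P0 (adds b ys0) ->
  regseq P b xs -> (size xs <= (size ys0).+1)%N.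
Proof.
move=> P0P adj Hys0 pys0 Hxs.
have bound ys : (forall y, y \in ys -> P0 y) -> regseq P b ys ->
    (size ys <= size ys0)%N.
  by move=> ysP /(regseq_le P0P ysP); apply: (depth_exchange iota infk noethT).
have [ys [ysP Hys nc]] : exists ys, [/\ forall y, y \in ys -> P0 y,
    regseq P b ys & forall c, P0 c -> ~ preg P (adds b ys) c].
  suff H j : forall ys, (size ys0 < j + size ys)%N ->
      (forall y, y \in ys -> P0 y) -> regseq P b ys ->
      exists ys, [/\ forall y, y \in ys -> P0 y,
        regseq P b ys & forall c, P0 c -> ~ preg P (adds b ys) c].
    by apply: (H (size ys0).+1 [::]); rewrite ?addn0.
  elim: j => [|j IH] ys sys ysP Hys.
    by have := bound _ ysP Hys; rewrite leqNgt sys.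
  case: (pselect (exists2 c, P0 c & preg P (adds b ys) c)) => [[c P0c cb]|nc].
    apply: (IH (rcons ys c)); rewrite ?size_rcons ?addnS -?addSn //.
      by move=> y; rewrite mem_rcons inE => /orP[/eqP -> //|]; apply: ysP.
    by apply/regseq_rcons; split=> //; apply: P0P.
  exists ys; split=> // c P0c cb; apply: nc; by exists c.
have sys := bound _ ysP Hys.
set B := adds b ys in nc.
have assocP : passoc P B -> (size xs <= (size ys0).+1)%N.
  move=> pB; apply: leqW; apply: leq_trans sys.
  exact: (depth_exchange iota infk noethT Hys pB Hxs).
have [n0 [c0 P0c]] := noethT P0.
have [Q [w [Bw QE P0Q]]] : exists Q w, [/\ ~ sat P B w,
    (forall r, prime_ideal_val Q r <-> sat P B (r * w)) & P0 `<=` Q].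
  apply: contrapT => nQ.
  have : cof (fun t => preg P B (mom iota c0 t)).
    apply: cof_preg => // Q w Bw QE Qc; apply: nQ; exists Q, w; split=> //.
    by rewrite P0c; apply: gen_sub => _ [i _ <-].
  move=> /(cof_ex infk)[t]; apply: nc; rewrite P0c; apply: mom_mem => i.
  by apply: sub_gen; exists i.
have QP : Q `<=` P by move=> r /QE; apply: ann_sub.
case: (adj Q P0Q QP) => [QP0|PQ]; last first.
  by apply: assocP; exists w; split=> // p /PQ /QE.
case: (pselect (passoc P B)) => [//|npB].
have [n1 [c1 Pc]] := noethT P.
have [t] := cof_ex infk (cof_preg_passoc iota noethT (f_equal _ Pc) npB).
set c := mom iota c1 t => cB.
have Pc' : P c by rewrite Pc; apply: mom_mem => j; apply: sub_gen; exists j.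
have iW : is_ideal [set z | forall p, P0 p -> sat P B (p * z)].
  split=> [p _|z z' Hz Hz' p P0p|a z Hz p P0p] /=.
  - by rewrite mulr0; apply: ideal0.
  - by rewrite mulrDr; apply: idealD; [apply: Hz|apply: Hz'].
  - by rewrite mulrCA; apply: idealMl; apply: Hz.
(* If all elements killed by P0 modulo B were in B + (c), they would lie in B plus P times
   themselves, as c is regular modulo B, and hence in B by Nakayama. *)
have [z [Wz Bz]] : exists z, Ideal iW z /\ ~ sat P (addg B c) z.
  apply: contrapT => nz.
  suff : Ideal iW `<=` sat P B by move=> H; apply: Bw; apply: H => p /P0Q /QE.
  apply: (nakayama noethT) => z Wz.
  have : sat P (addg B c) z by apply: contrapT => Bz; apply: nz; exists z.
  move=> /sat_addgP[s [r [Ps Hr]]]; exists s => //.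
  rewrite -(subrK (r * c) (s * z)); apply: idealD; first exact: add_idealL.
  apply: add_idealR; rewrite mulrC; apply: mul_ideal_mem => // p P0p.
  apply: cB; have -> : c * (p * r) = s * (p * z) - p * (s * z - r * c) by ring.
  apply: idealB; first by apply: idealMl; apply: Wz.
  by apply: idealMl; apply: sub_sat.
have [Q' [a [Baz Q'E]]] := max_ann_mul noethT Bz.
have P0Q' : P0 `<=` Q'.
  move=> p P0p; apply/Q'E; rewrite mulrCA; apply: idealMl.
  by apply: sat_mono (Wz _ P0p); apply: sub_addg.
have Q'P : Q' `<=` P by move=> r /Q'E; apply: ann_sub.
have Q'c : Q' c by apply/Q'E; apply: sub_sat; apply: idealMr; apply: mem_addg.
(* Q' contains c, which is regular modulo B and so not in P0. Hence Q' is P, which becomes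
   associated after one more regular element. *)
case: (adj Q' P0Q' Q'P) => [/(_ _ Q'c) /P0Q /QE /cB //|PQ'].
have : (size xs <= size (rcons ys c))%N; last by rewrite size_rcons => /leq_trans; apply.
apply: (depth_exchange iota infk noethT (P := P) (b := b)) => //.
  by apply/regseq_rcons; split.
by rewrite adds_rcons; exists (a * z); split=> // p /PQ' /Q'E.
Qed.

End AdjacentPrimes.

(** * Heights of primes *)

Section Heights.
Variable T : comPzRingType.
Implicit Types (P Q : prime_ideal T).

Lemma prime_ht_ge0 P : prime_ht_ge P 0.
Proof. by exists (fun=> P). Qed.

Lemma prime_ht_geS P Q n : Q `<` P -> prime_ht_ge Q n -> prime_ht_ge P n.+1.
Proof.
move=> QP [c Hc cn]; exists (fun i => if (i <= n)%N then c i else P); last first.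
  by rewrite ltnn.
move=> i; rewrite ltnS leq_eqVlt => /orP[/eqP ->|lin].
  by rewrite eqxx ltnn cn.
by rewrite lin orbT; apply: Hc.
Qed.

Lemma prime_ht_ge_le P m n : (m <= n)%N -> prime_ht_ge P n -> prime_ht_ge P m.
Proof.
move=> mn [c Hc cn]; exists (fun i => c (i + (n - m))%N); last by rewrite subnKC.
by move=> i im; rewrite addSn; apply: Hc; lia.
Qed.

Lemma prime_htP P n : ~ prime_ht_ge P n.+1 -> exists2 h, (h <= n)%N & prime_ht P h.
Proof.
elim: n => [|n IH] H; first by exists 0%N => //; split=> //; apply: prime_ht_ge0.
case: (pselect (prime_ht_ge P n.+1)) => [Hn|/IH[h hn ?]]; first by exists n.+1.
by exists h => //; apply: leqW.
Qed.

Lemma prime_ht_lt P h n : prime_ht P h -> (h < n)%N -> ~ prime_ht_ge P n.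
Proof. by move=> [_ H] hn /(prime_ht_ge_le hn). Qed.

Lemma eq_prime P Q : P `<=` Q -> Q `<=` P -> P = Q.
Proof.
move=> PQ QP; have : P = Q :> ideal T by apply: eq_ideal; apply/seteqP.
case: P Q {PQ QP} => [P P1 PM] [Q Q1 QM] /= E; case: Q / E Q1 QM => Q1 QM.
by congr PrimeIdeal; apply: Prop_irrelevance.
Qed.

Lemma prime_ht_ge_sub P Q n : Q `<=` P -> prime_ht_ge Q n -> prime_ht_ge P n.
Proof.
move=> QP HQ; case: (pselect (P `<=` Q)) => PQ; first by rewrite -(eq_prime QP PQ).
by apply: (@prime_ht_ge_le _ n n.+1) => //; apply: prime_ht_geS HQ.
Qed.

End Heights.

(** * Local numbers of generators *)

Section LocalGenerators.
Variable T : comPzRingType.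
Variable I : ideal T.
Implicit Types (b : ideal T) (P Q : prime_ideal T).

(* (I / b)_P is generated by m elements *)
Definition gens P b (m : nat) : Prop := exists w : 'I_m -> T,
  (forall i, I (w i)) /\ exists2 s, ~ P s &
    forall x, I x -> add_ideal b (gen (range w)) (s * x).

Lemma gens_mono P b m n : (m <= n)%N -> gens P b m -> gens P b n.
Proof.
move=> mn [w [Iw [s Ps H]]].
exists (fun i => if insub (val i) is Some j then w j else 0); split.
  by move=> i; case: insubP => // _; apply: ideal0.
exists s => // x /H; apply: add_ideal_sub; first exact: add_idealL.
apply: gen_sub => _ [i _ <-]; apply: add_idealR; apply: sub_gen.
by exists (widen_ord mn i) => //=; rewrite valK.
Qed.

Lemma gens_le P b b' m : b `<=` b' -> gens P b m -> gens P b' m.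
Proof.
move=> bb' [w [Iw [s Ps H]]]; exists w; split=> //; exists s => // x /H.
by apply: add_ideal_sub; [apply: subset_trans bb' _; apply: add_idealL|
  apply: add_idealR].
Qed.

Lemma gens0 P b : gens P b 0 -> exists2 s, ~ P s & forall x, I x -> b (s * x).
Proof.
move=> [w [_ [s Ps H]]]; exists s => // x /H.
by apply: add_ideal_sub => //; apply: gen_sub => _ [[]//].
Qed.

Lemma gens0_intro P b s : ~ P s -> (forall x, I x -> b (s * x)) -> gens P b 0.
Proof.
move=> Ps H; exists (fun=> 0); split=> [[]//|]; exists s => // x /H.
exact: add_idealL.
Qed.

(** The element a is a minimal generator at P, so one of its coefficients is a unit there and the
    corresponding [w j] can be eliminated. *)
Lemma gens_exchange P b a m : I a -> ~ sat P (add_ideal b (mul_ideal P I)) a ->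
  gens P b m.+1 -> gens P (addg b a) m.
Proof.
move=> Ia na [w [Iw [s Ps H]]].
have /add_idealP[c [_ [bc /gen_rangeP[r ->] E]]] := H _ Ia.
have [j Prj] : exists j, ~ P (r j).
  apply: contrapT => nr; apply: na; exists s => //; rewrite E.
  apply/add_idealP; exists c, (\sum_i r i * w i); split=> //.
  apply: ideal_sum => i; apply: mul_ideal_mem => //.
  by apply: contrapT => Pri; apply: nr; exists i.
exists (w \o lift j); split=> [i|]; first exact: Iw.
set K := add_ideal _ _; exists (r j * s); first exact: prime_mulN.
have Ki i : K (r j * w i).
  case: (unliftP j i) => [l ->|->].
    by apply: idealMl; apply: add_idealR; apply: sub_gen; exists l.
  have -> : r j * w j = s * a - c - \sum_(i | i != j) r i * w i.
    by rewrite E (bigD1 j) //=; ring.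
  apply: idealB; first apply: idealB.
  - by apply: add_idealL; apply: idealMl; apply: mem_addg.
  - by apply: add_idealL; apply: sub_addg.
  - elim/big_ind: _ => [|x y|i']; [exact: ideal0|exact: idealD|].
    case: (unliftP j i') => [l ->|-> /eqP//] _.
    by apply: idealMl; apply: add_idealR; apply: sub_gen; exists l.
move=> x /H /add_idealP[c' [_ [bc' /gen_rangeP[q ->] E']]].
rewrite -mulrA E' mulrDr; apply: idealD.
  by apply: idealMl; apply: add_idealL; apply: sub_addg.
by rewrite mulr_sumr; apply: ideal_sum => i; rewrite mulrCA; apply: idealMl.
Qed.

(* the primes of this ideal are those at which I / b needs more than m
   generators *)
Definition nongens b m : ideal T := gen [set y | exists w : 'I_m -> T,
  (forall i, I (w i)) /\ forall x, I x -> add_ideal b (gen (range w)) (y * x)].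

Lemma gensP P b m : gens P b m <-> ~ nongens b m `<=` P.
Proof.
split=> [[w [Iw [s Ps H]]] HP|HP].
  by apply: Ps; apply: HP; apply: sub_gen; exists w.
apply: contrapT => nP; apply: HP; apply: gen_sub => y [w [Iw H]].
by apply: contrapT => Py; apply: nP; exists w; split=> //; exists y.
Qed.

End LocalGenerators.

(** * Towers of residual intersections *)

Section ResidualTower.
Variables (k : fieldType) (T : comPzRingType) (iota : {rmorphism k -> T}).
Hypothesis infk : infinite_set [set: k].
Hypothesis noethT : noeth T.
Hypothesis domT : forall x y : T, x * y = 0 -> x = 0 \/ y = 0.
Implicit Types (b K W : ideal T) (P Q q : prime_ideal T).

Definition zideal : ideal T := gen set0.

Lemma zidealP x : zideal x <-> x = 0.
Proof.
split=> [|->]; last exact: ideal0.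
have iz : is_ideal [set x : T | x = 0].
  by split=> //= [? ? -> ->|? ? ->]; rewrite ?addr0 ?mulr0.
exact: (gen_sub (I := Ideal iz)).
Qed.

Lemma adds_sub b ys K : b `<=` K -> (forall y, y \in ys -> K y) -> adds b ys `<=` K.
Proof.
elim: ys b => [|y ys IH] b //= bK ysK; apply: IH.
  by apply: addg_sub => //; apply: ysK; rewrite inE eqxx.
by move=> z zs; apply: ysK; rewrite inE zs orbT.
Qed.

Lemma mem_adds b ys y : y \in ys -> adds b ys y.
Proof.
elim: ys b => [|z ys IH] b //=; rewrite inE => /orP[/eqP ->|]; last exact: IH.
by apply: sub_adds; apply: mem_addg.
Qed.

Lemma adds_generated ys : generated_by (adds zideal ys) (size ys).
Proof.
exists (fun i => nth 0 ys i); apply: eq_ideal; apply/seteqP; split.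
  apply: adds_sub; first by apply: gen_sub.
  move=> y /(nthP 0)[i si <-]; apply: sub_gen; by exists (Ordinal si).
by apply: gen_sub => _ [i _ <-]; apply: mem_adds; apply: mem_nth.
Qed.

Variables (I : ideal T) (d : nat).
Hypothesis I_neq0 : exists2 x, I x & x <> 0.
Hypothesis CM : forall P n, prime_ht_ge P n ->
  exists2 xs, size xs = n & regseq P zideal xs.
Hypothesis Gd : forall P h, I `<=` P -> prime_ht P h -> (h < d)%N ->
  gens I P zideal h.
(* how the S_2 condition is used: an associated prime P of a + K has depth 1 in
   A/K, hence dimension at most 1 *)
Hypothesis S2 : forall i K P a z, (i + 2 <= d)%N ->
  geometric_residual_intersection i I K ->
  (forall r, K (a * r) -> K r) -> K `<=` P -> ~ addg K a z ->
  (forall r, P r <-> addg K a (r * z)) ->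
  forall P0 P1 : prime_ideal T, K `<=` P0 -> P0 `<` P1 -> P1 `<` P -> False.

Variables (n r : nat) (c : 'I_r -> T).
Let J := gen (range c).
Hypothesis n_le_d : (n <= d)%N.
Hypothesis JI : J `<=` I.
Hypothesis IJ : ~ I `<=` J.
Hypothesis Jlow : forall q, I `<=` q -> ~ prime_ht_ge q n ->
  exists2 s, ~ q s & forall x, I x -> J (s * x).
Hypothesis Jrad : forall q, J `<=` q -> I `<=` q.

Definition resid (as_ : seq T) : ideal T := colon_ideal (adds zideal as_) I.

(** The invariants of general elements [as_] of J with residual intersection K = ([as_]) : I. At
    primes of height below n each element saves one generator of I; I meets K in ([as_]); J lies in
    no associated prime of K; the height of K is at least the number of elements, and these form a
    regular sequence off V(I). *)
Definition tower (as_ : seq T) : Prop :=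
  [/\ forall y, y \in as_ -> J y,
      forall q h, I `<=` q -> prime_ht q h -> (h < n)%N ->
        gens I q (adds zideal as_) (h - size as_),
      forall x, I x -> resid as_ x -> adds zideal as_ x,
      forall Q w, ~ resid as_ w ->
        (forall x, prime_ideal_val Q x <-> resid as_ (x * w)) -> ~ J `<=` Q &
      ht_ge (resid as_) (size as_) /\
      forall q, adds zideal as_ `<=` q -> ~ I `<=` q -> regseq q zideal as_].

Lemma adds_resid as_ : adds zideal as_ `<=` resid as_.
Proof. by move=> x Hx y _; apply: idealMr. Qed.

Lemma resid_sat as_ q : ~ I `<=` q ->
  sat q (resid as_) `<=` sat q (adds zideal as_).
Proof.
move=> Iq x [s qs H].
have [y [Iy qy]] : exists y, I y /\ ~ q y.
  apply: contrapT => ny; apply: Iq => y Iy; apply: contrapT => qy.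
  by apply: ny; exists y.
exists (y * s); first exact: prime_mulN.
by rewrite -mulrA mulrC; apply: H.
Qed.

Lemma tower0 : tower [::].
Proof.
have [x0 Ix0 x0N0] := I_neq0.
have K0 x : resid [::] x -> x = 0.
  by move=> /(_ _ Ix0) /zidealP /domT[].
split=> //.
- by move=> q h Iq qh hn; rewrite subn0; apply: Gd => //; apply: leq_trans n_le_d.
- by move=> x _ /K0 ->; apply: ideal0.
- move=> Q w nw QE /Jrad IQ; have /QE/K0/domT[//|w0] := IQ _ Ix0.
  by apply: nw; rewrite w0; apply: ideal0.
- by split=> // P _; apply: prime_ht_ge0.
Qed.

(** In height at most h the truncated difference is 0: there I is generated by [as_] and a. *)
Lemma low_resid as_ a P h : (forall q h, I `<=` q -> prime_ht q h -> (h < n)%N ->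
    gens I q (adds zideal (rcons as_ a)) (h - size (rcons as_ a))) ->
  I `<=` P -> (size as_).+1 = h -> (h < n)%N -> ~ prime_ht_ge P h.+1 ->
  exists2 s, ~ P s & forall x, I x -> adds zideal (rcons as_ a) (s * x).
Proof.
move=> H IP hE hn nP.
have [h' h'h Ph'] := prime_htP nP.
apply: gens0; have := H P h' IP Ph' (leq_ltn_trans h'h hn).
by rewrite size_rcons hE (eqP h'h).
Qed.

Lemma tower_geometric as_ : tower as_ -> (size as_ < n)%N ->
  geometric_residual_intersection (size as_) I (resid as_).
Proof.
move=> [asJ Hg _ _ [Hht _]] ltn; split.
  exists (adds zideal as_); split=> //; last exact: adds_generated.
  have aJ : adds zideal as_ `<=` J by apply: adds_sub => //; apply: gen_sub.
  by split; [apply: subset_trans aJ JI|move=> H; apply: IJ; apply: subset_trans aJ].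
move=> P IKP; apply: contrapT => nP; have [h hn Ph] := prime_htP nP.
have IP : I `<=` P by apply: subset_trans IKP; apply: add_idealL.
have := Hg P h IP Ph (leq_ltn_trans hn ltn).
rewrite (eqP hn) => /gens0[s Ps Hs]; apply: Ps; apply: IKP.
by apply: add_idealR => x Ix; apply: Hs.
Qed.

Lemma assoc_below K P a : (forall x, K (a * x) -> K x) -> K `<=` P ->
  exists Q w, [/\ ~ sat P K w, (forall x, prime_ideal_val Q x <-> sat P K (x * w)),
    Q `<=` P, K `<=` Q & ~ Q a].
Proof.
move=> aK KP.
have K1 : ~ sat P K 1 by move/(sat_prime KP); apply: prime_proper.
have [Q [w [Kw QE _]]] := max_ann_all noethT K1.
exists Q, w; split=> //.
- by move=> x /QE; apply: ann_sub.
- by move=> x Kx; apply/QE; apply: idealMr; apply: sub_sat.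
- move=> /QE[s Ps Hs]; apply: Kw; exists s => //; apply: aK.
  by rewrite mulrCA.
Qed.

(** Let Q be an associated prime of K inside P not containing a. By S_2 no prime lies strictly
    between Q and P, so the depth at P exceeds the one at Q, which is the number of [as_], by at
    most one. As the ring is Cohen-Macaulay this bounds the height of P, and in this height I is
    generated by [as_] and a, contrary to the choice of z. *)
Lemma tower_assoc as_ a : tower as_ -> ((size as_).+1 < n)%N -> J a ->
  (forall x, resid as_ (a * x) -> resid as_ x) ->
  (forall q h, I `<=` q -> prime_ht q h -> (h < n)%N ->
    gens I q (adds zideal (rcons as_ a)) (h - size (rcons as_ a))) ->
  forall P z, I z -> ~ addg (resid as_) a z ->
    (forall x, prime_ideal_val P x <-> addg (resid as_) a (x * z)) -> ~ I `<=` P.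
Proof.
move=> Htw ltn Ja aK Hg P z Iz naz PE IP.
have [asJ _ _ _ [_ Hreg]] := Htw.
have KP : resid as_ `<=` P.
  by move=> x Kx; apply/PE; apply: idealMr; apply: sub_addg.
have Pa : P a by apply/PE; apply: idealMr; apply: mem_addg.
have [Q [w [Kw QE QP KQ Qa]]] := assoc_below aK KP.
have nQI : ~ I `<=` Q by move=> IQ; apply: Qa; apply: IQ; apply: JI.
have noP1 : forall P1 : prime_ideal T, Q `<` P1 -> P1 `<` P -> False.
  move=> P1 QP1 P1P; apply: (S2 _ (tower_geometric Htw (ltnW ltn)) aK KP naz PE KQ QP1 P1P).
  by lia.
have nht : ~ prime_ht_ge P (size as_).+2.
  move=> /CM[xs sxs Hxs].
  suff : (size xs <= (size as_).+1)%N by rewrite sxs ltnn.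
  apply: (adjacent_depth iota infk noethT (P0 := Q) (P := P) (b := zideal)) => //.
  - move=> P1 QP1 P1P; case: (pselect (P1 `<=` Q)) => [|nP1Q]; [by left|right].
    by apply: contrapT => nPP1; apply: (noP1 P1).
  - by apply: Hreg => //; apply: subset_trans KQ; apply: adds_resid.
  - exists w; split.
      move=> [s Qs Hs]; apply: Qs; apply/QE; apply: sub_sat.
      exact: adds_resid.
    by move=> x /QE /(sat_le QP); apply: resid_sat.
have [s Ps Hs] := low_resid Hg IP erefl ltn nht.
apply: Ps; apply/PE; move: (Hs _ Iz); rewrite adds_rcons.
by apply: addg_mono; apply: adds_resid.
Qed.

(** Let K' be the new residual intersection. If I met K' in more than ([as_], a), or if J lay in an
    associated prime of K', there would be an element of I outside K + (a) whose annihilator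
    contains I, which [tower_assoc] excludes. *)
Lemma tower_step as_ a : tower as_ -> ((size as_).+1 < n)%N -> J a ->
  (forall x, resid as_ (a * x) -> resid as_ x) ->
  (forall q h, I `<=` q -> prime_ht q h -> (h < n)%N ->
    gens I q (adds zideal (rcons as_ a)) (h - size (rcons as_ a))) ->
  tower (rcons as_ a).
Proof.
move=> Htw ltn Ja aK Hg.
have HX := tower_assoc Htw ltn Ja aK Hg.
have [asJ _ IK _ [Hht Hreg]] := Htw.
have Ia : I a by apply: JI.
have IKa x : I x -> addg (resid as_) a x -> adds zideal (rcons as_ a) x.
  move=> Ix /addgP[y Ky]; rewrite adds_rcons; apply/addgP; exists y.
  by apply: IK => //; apply: idealB => //; apply: idealMl.
have sub_a : adds zideal (rcons as_ a) `<=` addg (resid as_) a.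
  by rewrite adds_rcons; apply: addg_mono; apply: adds_resid.
split=> //.
- by move=> y; rewrite mem_rcons inE => /orP[/eqP ->|/asJ].
- move=> x Ix Kx; apply: IKa => //; apply: contrapT => nx.
  have [P [y [nyx PE]]] := max_ann_mul noethT nx.
  apply: (HX P (y * x)) => //; first exact: idealMl.
  move=> z Iz; apply/PE; apply: sub_a; rewrite mulrC -mulrA.
  by apply: idealMl; apply: Kx.
- move=> Q w nw QE /Jrad IQ.
  have [v [Iv nwv]] : exists v, I v /\ ~ adds zideal (rcons as_ a) (w * v).
    apply: contrapT => nv; apply: nw => v Iv; apply: contrapT => nwv.
    by apply: nv; exists v.
  have nwv' : ~ addg (resid as_) a (w * v).
    by move=> H; apply: nwv; apply: IKa => //; apply: idealMl.
  have [P [y [ny PE]]] := max_ann_mul noethT nwv'.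
  apply: (HX P (y * (w * v))) => //; first by do 2?apply: idealMl.
  move=> u /IQ /QE Hu; apply/PE; rewrite mulrCA; apply: idealMl; apply: sub_a.
  by rewrite mulrA; apply: Hu.
split.
- rewrite size_rcons => P KP; case: (pselect (I `<=` P)) => IP.
    apply: contrapT => nP.
    have nP' : ~ prime_ht_ge P (size as_).+2.
      by move/(prime_ht_ge_le (leqnSn _)).
    have [s Ps Hs] := low_resid Hg IP erefl ltn nP'.
    by apply: Ps; apply: KP => x Ix; apply: Hs.
  have KP' : resid as_ `<=` P.
    apply: subset_trans KP => x Kx y Iy; rewrite adds_rcons; apply: sub_addg.
    exact: Kx.
  have [Q [w [Kw QE QP KQ Qa]]] := assoc_below aK KP'.
  apply: (@prime_ht_geS _ P Q); last exact: Hht.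
  split=> // PQ; apply: Qa; apply: PQ; apply: KP; apply: adds_resid.
  by rewrite adds_rcons; apply: mem_addg.
- move=> q aq nIq; apply/regseq_rcons; split.
  + apply: Hreg => //; apply: subset_trans aq; rewrite adds_rcons; exact: sub_addg.
  + by apply: aq; rewrite adds_rcons; apply: mem_addg.
  + move=> x [s qs Hs]; apply: resid_sat => //; exists s => //; apply: aK.
    by rewrite mulrCA; apply: adds_resid.
Qed.

Lemma J_low q : I `<=` q -> ~ prime_ht_ge q n -> I `<=` sat q J.
Proof. by move=> Iq /(Jlow Iq)[s qs Hs] x /Hs; exists s. Qed.

(** Infinitely many primes q are controlled by finitely many conditions on t: only the minimal
    primes of I + [nongens I b m], for m < n, are considered, and any q is compared with such a
    prime P below it. *)
Lemma cof_gens as_ : tower as_ -> cof (fun t =>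
  forall q h, I `<=` q -> prime_ht q h -> (h < n)%N ->
    gens I q (adds zideal (rcons as_ (mom iota c t))) (h - (size as_).+1)).
Proof.
move=> [asJ Hg _ _ _]; set b := adds zideal as_ in Hg.
pose good t := forall (m : 'I_n) q, I `<=` q -> nongens I b m `<=` q ->
  exists P, [/\ P `<=` q, I `<=` P, nongens I b m `<=` P &
   ~ J `<=` sat P (add_ideal b (mul_ideal P I)) ->
   ~ sat P (add_ideal b (mul_ideal P I)) (mom iota c t)].
have : cof good.
  apply: cof_ord => m.
  have [l [Q [QF HQ]]] := primes_over noethT (add_ideal I (nongens I b m)).
  apply: (@cof_sub _ (fun t => forall i, ~ J `<=` sat (Q i) (add_ideal b (mul_ideal (Q i) I)) ->
   ~ sat (Q i) (add_ideal b (mul_ideal (Q i) I)) (mom iota c t))) => [t Ht q Iq Fq|].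
    have [i Hi] := HQ q (add_ideal_sub Iq Fq); exists (Q i); split=> //; last exact: Ht.
      by apply: subset_trans (QF i); apply: add_idealL.
    by apply: subset_trans (QF i); apply: add_idealR.
  by apply: cof_ord => i; apply: cof_imp; apply: mom_avoid_gen.
apply: cof_sub => t Ht q h Iq qh hn; set a := mom iota c t in Ht *.
rewrite adds_rcons -/b.
have Ia : I a by apply: JI; apply: mom_mem => i; apply: sub_gen; exists i.
have [m Hm minm] : exists2 m, gens I q b m & forall m', (m' < m)%N -> ~ gens I q b m'.
  have ex : exists m, `[< gens I q b m >].
    by exists (h - size as_)%N; apply/asboolP; apply: Hg.
  exists (ex_minn ex); case: ex_minnP => m /asboolP // _ mm m' m'm /asboolP H.
  by move: (mm _ H); rewrite leqNgt m'm.
have mh : (m <= h - size as_)%N.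
  by rewrite leqNgt; apply/negP => /minm; apply; apply: Hg.
case: m Hm minm mh => [|m] Hm minm mh.
  by apply: gens_mono (leq0n _) _; apply: gens_le Hm; apply: sub_addg.
have mn : (m < n)%N by lia.
have Fq : nongens I b m `<=` q.
  by apply: contrapT => /gensP; apply: minm.
have [P [Pq IP FP Pa]] := Ht (Ordinal mn) q Iq Fq.
have nPm : ~ gens I P b m by move=> /gensP; apply.
have nPn : ~ prime_ht_ge P n.
  by move=> /(prime_ht_ge_sub Pq); apply: prime_ht_lt qh hn.
(* In height below n the ideals J and I agree, so J inside b + P I would force I into b at P by
   Nakayama. *)
have {}Pa : ~ sat P (add_ideal b (mul_ideal P I)) a.
  apply: Pa => HJ; apply: nPm; apply: (gens_mono (leq0n m)).
  have : I `<=` sat P b.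
    apply: (nakayama noethT); apply: subset_trans (J_low IP nPn) _.
    exact: sat_sub.
  by move=> /(sat_denom noethT)[s Ps Hs]; apply: gens0_intro Ps Hs.
case: (pselect (q `<=` P)) => [qP|nqP].
  have E := eq_prime Pq qP; rewrite E in Pa.
  apply: (@gens_mono _ _ _ _ m); first by lia.
  exact: gens_exchange.
have Plt : P `<` q by split.
have nPh : ~ prime_ht_ge P h by move=> /(prime_ht_geS Plt); case: qh.
(* Here q is larger than P and its height is now written h + 1. Since P needs more than m generators
   and has height at most h, m + 1 <= h - [size as_]: there is room for one generator more. *)
case: h qh hn mh nPh => [|h] qh hn mh nPh; first by case: nPh; apply: prime_ht_ge0.
have [h' h'h Ph'] := prime_htP nPh.
have := Hg P h' IP Ph' (leq_ltn_trans h'h (ltnW hn)).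
have [le1|lt1 _] := leqP (h' - size as_) m; first by move=> /(gens_mono le1).
apply: (@gens_mono _ _ _ _ m.+1); first by lia.
by apply: gens_le Hm; apply: sub_addg.
Qed.

Lemma cof_nzd as_ : tower as_ ->
  cof (fun t => forall x, resid as_ (mom iota c t * x) -> resid as_ x).
Proof.
move=> [_ _ _ HQ _].
have [l [Q [w [Kw QE Hz]]]] := zero_divisors noethT (resid as_).
apply: (@cof_sub _ (fun t => forall i, ~ Q i (mom iota c t))) => [t Ht x Hx|].
  apply: contrapT => nx; have [i] := Hz _ _ Hx nx; exact: Ht.
apply: cof_ord => i; apply: mom_avoid_gen; exact: HQ (Kw i) (QE i).
Qed.

Lemma tower_exists (C : seq k -> k -> Prop) i : (forall ts, cof (C ts)) ->
  (i < n)%N -> exists ts, [/\ size ts = i,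
    forall j, (j < i)%N -> C (take j ts) (nth 0 ts j) &
    tower (map (mom iota c) ts)].
Proof.
move=> HC; elim: i => [|i IH] lin.
  by exists [::]; split=> //; apply: tower0.
have [ts [sts Cts Htw]] := IH (ltnW lin).
have := cofI (HC ts) (cofI (cof_gens Htw) (cof_nzd Htw)).
move=> /(cof_ex infk)[t [Ct [Ht1 Ht2]]]; exists (rcons ts t); split.
- by rewrite size_rcons sts.
- move=> j; rewrite ltnS leq_eqVlt => /orP[/eqP ->|ji].
    by rewrite -cats1 takel_cat ?sts // take_oversize ?sts // nth_cat sts ltnn subnn.
  by rewrite -cats1 takel_cat ?sts ?nth_cat ?sts ?ji; [apply: Cts|apply: ltnW].
- rewrite map_rcons; apply: tower_step => //.
  + by rewrite size_map sts.
  + by apply: mom_mem => j; apply: sub_gen; exists j.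
  + by move=> q h; rewrite size_rcons; apply: Ht1.
Qed.

(** Take the n - 1 elements of a tower outside p I whenever possible. Either one more element of J
    completes them to generators of I at p, or they generate J modulo p I. In the second case
    Nakayama puts a power of I in the residual intersection K at p, although a general element of J
    is a nonzerodivisor modulo K and K is not the unit ideal at p. *)
Lemma reduction_eq_at (p : prime_ideal T) N : (0 < n)%N -> I `<=` p -> gens I p zideal n ->
  exp_ideal I N.+1 `<=` sat p (mul_ideal J (exp_ideal I N)) -> I `<=` sat p J.
Proof.
move=> n0 Ip Hn Hred; apply: contrapT => nIJ.
pose bs ts := adds zideal (map (mom iota c) ts).
pose W ts := sat p (add_ideal (bs ts) (mul_ideal p I)).
have [||ts [sts Cts Htw]] := @tower_exists
  (fun ts t => ~ J `<=` W ts -> ~ W ts (mom iota c t)) n.-1 _ _.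
- by move=> ts; apply: cof_imp; apply: mom_avoid_gen.
- by rewrite ltn_predL.
have bsS j : (j < n.-1)%N ->
    bs (take j.+1 ts) = addg (bs (take j ts)) (mom iota c (nth 0 ts j)).
  by move=> jn; rewrite /bs (take_nth 0) ?sts // map_rcons adds_rcons.
have momI t : I (mom iota c t).
  by apply: JI; apply: mom_mem => i; apply: sub_gen; exists i.
have step j : (j <= n.-1)%N ->
    J `<=` W (take j ts) \/ gens I p (bs (take j ts)) (n - j).
  elim: j => [|j IH] jn; first by right; rewrite take0 subn0.
  have WS : W (take j ts) `<=` W (take j.+1 ts).
    apply: sat_mono; rewrite bsS //; apply: add_ideal_sub; last exact: add_idealR.
    by apply: subset_trans (@add_idealL _ _ _); apply: sub_addg.
  case: (pselect (J `<=` W (take j ts))) => [JW|nJW].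
    by left; apply: subset_trans WS.
  case: (IH (ltnW jn)) => // Hg; right; rewrite bsS //.
  apply: gens_exchange; [exact: momI|exact: Cts|].
  by rewrite -subSn //; lia.
have JW : J `<=` W ts.
  case: (step _ (leqnn _)); rewrite take_oversize ?sts //.
  rewrite (_ : n - n.-1 = 1)%N; last by lia.
  move=> Hg; apply: contrapT => nJW; apply: nIJ.
  have [i Hi] : exists i, ~ W ts (c i).
    apply: contrapT => nc; apply: nJW; apply: gen_sub => _ [i _ <-].
    by apply: contrapT => Hi; apply: nc; exists i.
  have Jc : J (c i) by apply: sub_gen; exists i.
  have /gens0[s ps Hs] := gens_exchange (JI Jc) Hi Hg.
  move=> x /Hs Hx; exists s => //; move: Hx; apply: addg_sub => //.
  apply: adds_sub; first exact: gen_sub.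
  by case: Htw.
have [asJ _ _ _ _] := Htw.
have [t Ht] := cof_ex infk (cof_nzd Htw).
set as_ := map _ _ in Htw asJ Ht; set a := mom iota c t in Ht.
have Kp : resid as_ `<=` p.
  move=> s Ks; apply: contrapT => ps; apply: nIJ => x Ix; exists s => //.
  by move: (Ks _ Ix); apply: adds_sub => //; apply: gen_sub.
have IK : exp_ideal I N.+1 `<=` sat p (resid as_).
  apply: (nakayama noethT); apply: subset_trans Hred _; apply: sat_sub.
  apply: subset_trans (@sat_mul _ p _ _ _ (exp_ideal I N) JW (@sub_sat _ p _)) _.
  apply: sat_mono; apply: mul_ideal_sub => x y /add_idealP[u [v [Hu Hv ->]]] Hy.
  rewrite mulrDl; apply: idealD.
    by apply: add_idealL; apply: idealMr; apply: adds_resid.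
  apply: add_idealR; rewrite /= mul_idealA; exact: mul_ideal_mem.
have [s ps Hs] : sat p (resid as_) (a ^+ N.+1).
  by apply: IK; apply: exp_ideal_pow; apply: momI.
apply: ps; apply: Kp; elim: N.+1 Hs => [|j IHj]; first by rewrite expr0 mulr1.
by rewrite exprS mulrCA => /Ht.
Qed.

(** The parameters are made distinct so that the n elements generate J, by Vandermonde, as soon as J
    is given by n generators. *)
Lemma tower_last m (C : seq k -> k -> Prop) : (forall ts, cof (C ts)) -> n = m.+1 ->
  exists ts, [/\ size ts = m.+1, uniq ts,
    forall j, (j < m)%N -> C (take j ts) (nth 0 ts j),
    tower (map (mom iota c) (take m ts)) &
    forall x, resid (map (mom iota c) (take m ts)) (mom iota c (nth 0 ts m) * x) ->
      resid (map (mom iota c) (take m ts)) x].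
Proof.
move=> HC nm.
have fresh (ts : seq k) : cof (fun t => t \notin ts) by exists ts.
have [||ts [sts Cts Htw]] := @tower_exists (fun ts t => C ts t /\ t \notin ts) m _ _.
- by move=> ts; apply: cofI.
- by rewrite nm.
have [t [Ht tts]] := cof_ex infk (cofI (cof_nzd Htw) (fresh ts)).
have tk j : (j <= m)%N -> take j (rcons ts t) = take j ts.
  by move=> jm; rewrite -cats1 takel_cat ?sts.
have uts : uniq ts.
  suff H j : (j <= m)%N -> uniq (take j ts).
    by rewrite -[ts](@take_oversize _ m) ?sts //; apply: H.
  elim: j => [|j IH] jm; first by rewrite take0.
  rewrite (take_nth 0) ?sts // rcons_uniq IH ?(ltnW jm) // andbT.
  by have [] := Cts _ jm.
exists (rcons ts t); rewrite size_rcons sts tk // take_oversize ?sts //; split=> //.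
- by rewrite rcons_uniq tts.
- by move=> j jm; rewrite tk ?(ltnW jm) // nth_rcons sts jm; have [] := Cts j jm.
- by move=> x; rewrite nth_rcons sts ltnn eqxx; apply: Ht.
Qed.

End ResidualTower.

(** * Exchange of generators in dimension one *)

Section OneDimensionalExchange.
Variables (k : fieldType) (T : comPzRingType) (iota : {rmorphism k -> T}).
Hypothesis infk : infinite_set [set: k].
Hypothesis noethT : noeth T.
Variables (K : ideal T) (a e : T).
Hypothesis a_nzd : forall x, K (a * x) -> K x.
Let E := addg (gen [set a]) e.

Let Ea : E a. Proof. by apply: sub_addg; apply: sub_gen. Qed.
Let Ee : E e. Proof. exact: mem_addg. Qed.

Lemma E_ind (W : ideal T) (y : T) : W (a * y) -> W (e * y) ->
  forall v, E v -> W (v * y).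
Proof.
move=> Wa We v /addgP[r /gen1P[s Hs]].
rewrite -(subrK (r * e) v) Hs mulrDl -!mulrA.
by apply: idealD; apply: idealMl.
Qed.

Lemma exp_E_split n : exp_ideal E n.+1 `<=`
  addg (mul_ideal (gen [set a]) (exp_ideal E n)) (e ^+ n.+1).
Proof.
elim: n => [|n IH]; apply: mul_ideal_sub => x y Ex Hy.
  move: x Ex; apply: E_ind.
    by apply: sub_addg; apply: mul_ideal_mem Hy; apply: sub_gen.
  by rewrite expr1; apply: idealMr; apply: mem_addg.
move: x Ex; apply: E_ind.
  by apply: sub_addg; apply: mul_ideal_mem Hy; apply: sub_gen.
have /addgP[r] := IH _ Hy; set y' := y - _ => Hy'.
have -> : e * y = e * y' + r * e ^+ n.+2 by rewrite /y' (exprS _ n.+1); ring.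
apply: idealD; last by apply: idealMl; apply: mem_addg.
apply: sub_addg; rewrite mulrC.
have {}Hy' : mul_ideal (mul_ideal (gen [set a]) (exp_ideal E n)) E (y' * e).
  exact: mul_ideal_mem.
by rewrite -mul_idealA (mul_idealC _ E) in Hy'.
Qed.

(* if e is integral over a modulo K and x is a multiple of a + t e modulo K for
   enough values of t, then x is a multiple of a: modulo K, the multiples by x of
   the forms of degree n - 1 in a and e are divisible by the product of n of the
   elements a + t e, which is itself a multiple of a by such a form *)
Lemma exchange_forms x (ss : seq k) : uniq ss -> (0 < size ss)%N ->
  (forall t, t \in ss -> addg K (a + iota t * e) x) ->
  forall y, exp_ideal E (size ss).-1 y ->
    addg K (\prod_(t <- ss) (a + iota t * e)) (y * x).
Proof.
move: {2}(size ss) (erefl (size ss)) => m; elim: m ss => [|m IH] ss.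
  by move=> ->.
case: m IH => [|m] IH.
  case: ss => [|t [|//]] // _ _ _ H y _; rewrite big_seq1.
  by apply: idealMl; apply: H; rewrite inE.
case: ss => [|t1 [|t2 ss]] //= [sss] /andP[t1ss /andP[t2ss uss]] _ H.
(* Leaving out t2, respectively t1, and multiplying by the missing factor puts a y x + t2 e y x and
   a y x + t1 e y x in K + (PP); as t1 and t2 differ, both terms follow. *)
have HA : forall y, exp_ideal E m y ->
    addg K (\prod_(t <- t1 :: ss) (a + iota t * e)) (y * x).
  have := IH (t1 :: ss); rewrite /= sss; apply=> //.
    by rewrite uss andbT; apply: contra t1ss; rewrite inE orbC => ->.
  by move=> t; rewrite inE => /orP[/eqP ->|ts]; apply: H; rewrite !inE ?eqxx ?ts ?orbT.
have HB : forall y, exp_ideal E m y ->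
    addg K (\prod_(t <- t2 :: ss) (a + iota t * e)) (y * x).
  have := IH (t2 :: ss); rewrite /= sss; apply=> //; first by rewrite uss t2ss.
  by move=> t ts; apply: H; rewrite inE ts orbT.
rewrite sss; set PP := \prod_(t <- _) _.
have mulin (t : k) y (p : T) : addg K p (y * x) ->
    addg K ((a + iota t * e) * p) (a * y * x + iota t * (e * y * x)).
  move=> /addgP[r Hr]; apply/addgP; exists r.
  have -> : a * y * x + iota t * (e * y * x) - r * ((a + iota t * e) * p) =
    (a + iota t * e) * (y * x - r * p) by ring.
  exact: idealMl.
have Hsplit y : exp_ideal E m y -> addg K PP (a * y * x) /\ addg K PP (e * y * x).
  move=> Hy; have := mulin t2 _ _ (HA _ Hy); have := mulin t1 _ _ (HB _ Hy).
  rewrite !big_cons mulrCA.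
  have -> : (a + iota t2 * e) * ((a + iota t1 * e) * \prod_(j <- ss) (a + iota j * e)) = PP.
    by rewrite /PP !big_cons mulrCA.
  move=> H1 H2.
  have He : addg K PP (e * y * x).
    have t12 : t1 - t2 != 0.
      by rewrite subr_eq0; apply: contraNneq t1ss => ->; rewrite inE eqxx.
    rewrite -[e * y * x]mul1r -(rmorph1 iota) -(mulVf t12) rmorphM -mulrA.
    apply: idealMl; rewrite rmorphB.
    have -> : (iota t1 - iota t2) * (e * y * x) =
      (a * y * x + iota t1 * (e * y * x)) - (a * y * x + iota t2 * (e * y * x)) by ring.
    exact: idealB.
  split=> //; rewrite -[a * y * x](addrK (iota t1 * (e * y * x))).
  by apply: idealB => //; apply: idealMl.
apply: (@mul_ideal_sub _ _ _ (ann (addg K PP) x)) => u y Eu Hy.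
by apply: E_ind Eu; rewrite annE; have [] := Hsplit y Hy.
Qed.

Lemma cof_nzd_pair : cof (fun t => forall x, K ((a + iota t * e) * x) -> K x).
Proof.
have [l [Q [w [Kw QE Hz]]]] := zero_divisors noethT K.
apply: (@cof_sub _ (fun t => forall i, ~ Q i (a + iota t * e))) => [t Ht x Hx|].
  by apply: contrapT => nx; have [i] := Hz _ _ Hx nx; apply: Ht.
apply: cof_ord => i; pose ae (j : 'I_2) := if j == ord0 then a else e.
have : cof (fun t => ~ Q i (mom iota ae t)).
  by apply: mom_avoid => /(_ ord0) /QE /a_nzd; apply: Kw.
apply: cof_sub => t; rewrite /mom !big_ord_recl big_ord0 /= /ae /= addr0.
by rewrite expr0 rmorph1 mul1r expr1.
Qed.

Lemma one_dim_exchange x n :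
  exp_ideal E n.+1 `<=` add_ideal K (mul_ideal (gen [set a]) (exp_ideal E n)) ->
  cof (fun t => addg K (a + iota t * e) x) -> addg K a x.
Proof.
move=> Eint Hx.
have [ss [uss sss Hss]] := cof_list infk n.+1 (cofI Hx cof_nzd_pair).
have Hform := @exchange_forms x ss uss.
rewrite sss in Hform.
set PP := \prod_(t <- ss) (a + iota t * e) in Hform.
have EPP : exp_ideal E n.+1 PP.
  rewrite -sss /PP; elim: {uss sss Hss Hform PP} ss => [|t ss IH].
    by rewrite big_nil; apply: gen_setT.
  rewrite big_cons; apply: mul_ideal_mem => //.
  by apply: idealD => //; apply: idealMl.
have PPnzd z : K (PP * z) -> K z.
  rewrite /PP; elim: {uss sss Hform PP EPP} ss Hss => [|t ss IH] Hss.
    by rewrite big_nil mul1r.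
  rewrite big_cons -mulrA; have [_ Ht] := Hss t (mem_head _ _).
  by move=> /Ht; apply: IH => t' t'ss; apply: Hss; rewrite inE t'ss orbT.
have gen1M v : mul_ideal (gen [set a]) (exp_ideal E n) v ->
    exists2 G, exp_ideal E n G & v = a * G.
  have iW : is_ideal [set v | exists2 G, exp_ideal E n G & v = a * G].
    split=> /= [|_ _ [G EG ->] [G' EG' ->]|r _ [G EG ->]].
    - by exists 0; rewrite ?mulr0 //; apply: ideal0.
    - by exists (G + G'); rewrite ?mulrDr //; apply: idealD.
    - by exists (r * G); rewrite 1?mulrCA //; apply: idealMl.
  apply: (@mul_ideal_sub _ _ _ (Ideal iW)) => _ G /gen1P[r ->] EG.
  by exists (r * G); [apply: idealMl|ring].
(* As a form of degree n + 1, PP is a G modulo K with G a form of degree n. Along with PP, G is a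
   nonzerodivisor, so it can be cancelled. *)
have /add_idealP[y [_ [Ky /gen1M[G EG ->] PPE]]] := Eint _ EPP.
have Gnzd z : K (G * z) -> K z.
  move=> KG; apply: PPnzd; rewrite PPE mulrDl -mulrA.
  by apply: idealD; [apply: idealMr|apply: idealMl].
have /addgP[r Hr] : addg K PP (G * x).
  by apply: Hform => // t /Hss[].
apply/addgP; exists r; apply: Gnzd.
have -> : G * (x - r * a) = (G * x - r * PP) + r * (PP - a * G) by ring.
apply: idealD => //; apply: idealMl; rewrite PPE addrK //.
Qed.

(* e is integral over a modulo K as soon as e X is in K + a X for an ideal X
   containing a power of a: by noetherianity, some u_n is a combination modulo K
   of the previous ones, where a^i u_i = e^i u_0 *)
Lemma integral_form (X : ideal T) N : X (a ^+ N) -> ~ K 1 ->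
  (forall v, X v -> exists2 v', X v' & K (e * v - a * v')) ->
  exists n, exp_ideal E n.+1 `<=` add_ideal K (mul_ideal (gen [set a]) (exp_ideal E n)).
Proof.
move=> XaN K1 Hstep.
have /choice[f Hf] : forall v, exists v', X v -> X v' /\ K (e * v - a * v').
  move=> v; case: (pselect (X v)) => [/Hstep[v' Xv' Hv']|nX]; last by exists 0.
  by exists v'.
pose u i := iter i f (a ^+ N).
have Xu i : X (u i) by elim: i => [//|i /Hf[]].
have uE i : K (a ^+ i * u i - e ^+ i * a ^+ N).
  elim: i => [|i IH]; first by rewrite !expr0 !mul1r subrr; apply: ideal0.
  have [_ Hi] := Hf _ (Xu i).
  have -> : a ^+ i.+1 * u i.+1 - e ^+ i.+1 * a ^+ N =
    e * (a ^+ i * u i - e ^+ i * a ^+ N) - a ^+ i * (e * u i - a * f (u i)).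
    by rewrite /u iterS -/(u i) !exprS; ring.
  by apply: idealB; apply: idealMl.
have [n Hn] : exists n, forall m, adds K (mkseq u m) `<=` adds K (mkseq u n).
  apply: (noeth_chain noethT) => n; rewrite /mkseq -[n.+1]addn1 iotaD map_cat cats1.
  by rewrite adds_rcons; apply: sub_addg.
have aNnzd m z : K (a ^+ m * z) -> K z.
  elim: m => [|m IH]; first by rewrite expr0 mul1r.
  by rewrite exprS -mulrA => /a_nzd.
have [m [mn Hm]] : exists m, n = m.+1 /\ adds K (mkseq u n) (u n).
  have Hu : adds K (mkseq u n) (u n).
    apply: (Hn n.+1); rewrite /mkseq -[n.+1]addn1 iotaD map_cat cats1 adds_rcons.
    exact: mem_addg.
  case: n Hn Hu => [|n] Hn Hu; last by exists n.
  by case: K1; apply: (aNnzd N); rewrite mulr1.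
exists m; set A := mul_ideal _ _.
(* Here u_i stands for a^N (e/a)^i. Multiplied by a^n, the relation expressing u_n by its
   predecessors puts a^N e^n in a^N A + K, and a^N is cancelled at the end. *)
have iW : is_ideal [set v | exists2 w, A w & K (a ^+ n * v - a ^+ N * w)].
  split=> /= [|v v' [w Aw Kw] [w' Aw' Kw']|r v [w Aw Kw]].
  - by exists 0; [apply: ideal0|rewrite !mulr0 subrr; apply: ideal0].
  - exists (w + w'); first exact: idealD.
    have -> : a ^+ n * (v + v') - a ^+ N * (w + w') =
      (a ^+ n * v - a ^+ N * w) + (a ^+ n * v' - a ^+ N * w') by ring.
    exact: idealD.
  - exists (r * w); first exact: idealMl.
    have -> : a ^+ n * (r * v) - a ^+ N * (r * w) = r * (a ^+ n * v - a ^+ N * w) by ring.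
    exact: idealMl.
have [w Aw Kw] : exists2 w, A w & K (a ^+ n * u n - a ^+ N * w).
  apply: (@adds_sub _ K (mkseq u n) (Ideal iW)) Hm => [v Kv|v].
    by exists 0; [apply: ideal0|rewrite mulr0 subr0; apply: idealMl].
  move=> /mapP[i]; rewrite mem_iota add0n => lin ->.
  exists (a ^+ (n - i) * e ^+ i).
    have lim : (i <= m)%N by rewrite -ltnS -mn.
    rewrite mn subSn // exprS -mulrA; apply: mul_ideal_mem; first exact: sub_gen.
    rewrite -(subnK lim) exp_idealD addnK; apply: mul_ideal_mem; exact: exp_ideal_pow.
  have -> : a ^+ n * u i - a ^+ N * (a ^+ (n - i) * e ^+ i) =
      a ^+ (n - i) * (a ^+ i * u i - e ^+ i * a ^+ N).
    by rewrite -{1}(subnK (ltnW lin)) exprD; ring.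
  exact: idealMl.
apply: subset_trans (@exp_E_split m) _; apply: addg_sub; first exact: add_idealR.
rewrite -(subrK w (e ^+ m.+1)); apply: idealD; last exact: add_idealR.
apply: add_idealL; apply: (aNnzd N).
have -> : a ^+ N * (e ^+ m.+1 - w) = (a ^+ n * u n - a ^+ N * w) -
   (a ^+ n * u n - e ^+ n * a ^+ N) by rewrite mn; ring.
exact: idealB.
Qed.

End OneDimensionalExchange.

(** * Exchange on top of a tower *)

Section TowerExchange.
Variables (k : fieldType) (T : comPzRingType) (iota : {rmorphism k -> T}).
Hypothesis infk : infinite_set [set: k].
Hypothesis noethT : noeth T.

(** By Vandermonde J is generated by [as_] and a, so e I^N lies in J I^N, hence in a I^N modulo K,
    which makes e integral over a. The exchange in dimension one puts x in K + (a), and x returns to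
    J because I meets K in ([as_]). *)
Lemma tower_exchange (I : ideal T) n m (c : 'I_m.+1 -> T) (ts : seq k) N e x :
  let as_ := map (mom iota c) (take m ts) in let a := mom iota c (nth 0 ts m) in
  gen (range c) `<=` I -> ~ I `<=` gen (range c) ->
  tower I n c as_ -> size ts = m.+1 -> uniq ts ->
  (forall x, resid I as_ (a * x) -> resid I as_ x) ->
  exp_ideal I N.+1 `<=` mul_ideal (gen (range c)) (exp_ideal I N) ->
  I e -> I x ->
  cof (fun t => addg (adds (zideal T) as_) (a + iota t * e) x) ->
  gen (range c) x.
Proof.
move=> as_ a JI IJ Htw sts uts aK Hred Ie Ix Hx.
have [asJ _ IK _ _] := Htw.
set b := adds _ as_ in Hx IK; set K := resid I as_ in aK IK.
have bJ : b `<=` gen (range c) by apply: adds_sub => //; apply: gen_sub.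
have Ja : gen (range c) a by apply: mom_mem => j; apply: sub_gen; exists j.
have Jba : gen (range c) `<=` addg b a.
  have Wm (i : 'I_m.+1) : addg b a (mom iota c (nth 0 ts i)).
    have := ltn_ord i; rewrite ltnS leq_eqVlt => /orP[/eqP ->|im].
      exact: mem_addg.
    apply: sub_addg; apply: mem_adds; apply: map_f; rewrite -(nth_take 0 im).
    by apply: mem_nth; rewrite size_takel // sts.
  apply: gen_sub => _ [j _ <-]; move: j; apply: (mom_all _ Wm) => i j /eqP.
  by rewrite nth_uniq ?sts // => /eqP /val_inj.
have bK : b `<=` K by apply: adds_resid.
have K1 : ~ K 1.
  move=> K1; apply: IJ => y Iy; apply: bJ; rewrite -[y]mul1r; exact: K1.
have [||v Xv|n' Hn'] := @integral_form T noethT K a e aK (exp_ideal I N) N.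
- by apply: exp_ideal_pow; apply: JI.
- by [].
- pose W := [set w | exists2 v', exp_ideal I N v' & K (w - a * v')].
  have iW : is_ideal W.
    split=> /= [|w w' [v1 Hv1 Kv1] [v2 Hv2 Kv2]|r w [v1 Hv1 Kv1]].
    - by exists 0; [apply: ideal0|rewrite mulr0 subr0; apply: ideal0].
    - exists (v1 + v2); first exact: idealD.
      by rewrite mulrDr opprD addrACA; apply: idealD.
    - exists (r * v1); first exact: idealMl.
      by rewrite mulrCA -mulrBr; apply: idealMl.
  suff : Ideal iW (e * v) by [].
  have : exp_ideal I N.+1 (e * v) by apply: mul_ideal_mem.
  move=> /Hred; apply: mul_ideal_sub => y z /Jba /addgP[r Hr] Xz.
  exists (r * z); first exact: idealMl.
  have -> : y * z - a * (r * z) = (y - r * a) * z by ring.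
  by apply: idealMr; apply: bK.
have /addgP[r Kr] : addg K a x.
  apply: (one_dim_exchange infk noethT aK Hn').
  by apply: cof_sub Hx => t; apply: addg_mono.
rewrite -(subrK (r * a) x); apply: idealD; last exact: idealMl.
by apply: bJ; apply: IK => //; apply: idealB => //; apply: idealMl; apply: JI.
Qed.

End TowerExchange.

(** * Ideals and primes of a localization *)

Section Contraction.
Variables (A B : comPzRingType) (f : {rmorphism A -> B}).

Lemma is_ideal_contr (J : ideal B) : is_ideal [set a | J (f a)].
Proof.
split=> /= [|x y|a x]; first by rewrite rmorph0; apply: ideal0.
  by rewrite rmorphD; apply: idealD.
by rewrite rmorphM; apply: idealMl.
Qed.
Definition contr (J : ideal B) : ideal A := Ideal (is_ideal_contr J).

Lemma contr_prime1 (Q : prime_ideal B) : ~ contr Q 1.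
Proof. by move=> H; apply: (@prime_proper _ Q); rewrite -(rmorph1 f). Qed.

Lemma contr_primeM (Q : prime_ideal B) x y :
  contr Q (x * y) -> contr Q x \/ contr Q y.
Proof. by move=> H; apply: prime_mul; rewrite -rmorphM. Qed.

Definition pcontr (Q : prime_ideal B) : prime_ideal A :=
  PrimeIdeal (contr_prime1 (Q := Q)) (contr_primeM (Q := Q)).

End Contraction.

Section LocalizationIdeals.
Variables (A : comPzRingType) (P : prime_ideal A).
Implicit Types (I J : ideal A) (Q : prime_ideal A).
Local Notation L := (loc P).

Lemma mulL a s (Ps : ~ P s) b t (Pt : ~ P t) :
  mkfrac a Ps * mkfrac b Pt = mkfrac (a * b) (prime_mulN Ps Pt).
Proof. exact: mkfracM. Qed.

Lemma mkfracE a s (Ps : ~ P s) :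
  mkfrac a Ps = mkfrac 1 Ps * to_loc P a.
Proof. by rewrite mulL; apply: eq_mkfrac; ring. Qed.

Lemma to_locE a s (Ps : ~ P s) : to_loc P a = to_loc P s * mkfrac a Ps.
Proof. by rewrite mulL; apply: eq_mkfrac; ring. Qed.

Lemma mkfrac_eq0 a s (Ps : ~ P s) :
  mkfrac a Ps = 0 <-> exists2 w, ~ P w & w * a = 0.
Proof.
rewrite -[0]/(mkfrac 0 (@prime_proper _ P)); split=> [/mkfracP[w Pw]|[w Pw H]].
  by rewrite mul0r subr0 mulr1; exists w.
by apply/mkfracP; exists w => //; rewrite mul0r subr0 mulr1.
Qed.

Lemma ideal_mkfrac (J : ideal L) a s (Ps : ~ P s) :
  J (mkfrac a Ps) <-> J (to_loc P a).
Proof.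
by split=> H; [rewrite (to_locE a Ps)|rewrite mkfracE]; apply: idealMl.
Qed.

Lemma loc_idealP I y :
  loc_ideal P I y <-> exists a s (Ps : ~ P s), I a /\ y = mkfrac a Ps.
Proof.
split=> [|[a [s [Ps [Ia ->]]]]]; last first.
  by apply/ideal_mkfrac; apply: sub_gen; exists a.
have iW : is_ideal [set y | exists a s (Ps : ~ P s), I a /\ y = mkfrac a Ps].
  split=> /=.
  - by exists 0, 1, (@prime_proper _ P); split=> //; apply: ideal0.
  - move=> _ _ [a [s [Ps [Ia ->]]]] [b [t [Pt [Ib ->]]]].
    exists (a * t + b * s), (s * t), (prime_mulN Ps Pt); split; last exact: mkfracD.
    by apply: idealD; apply: idealMr.
  - elim/locW=> b t Pt _ [a [s [Ps [Ia ->]]]].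
    exists (b * a), (t * s), (prime_mulN Pt Ps); split; last exact: mkfracM.
    exact: idealMl.
apply: (gen_sub (I := Ideal iW)) => _ [a Ia <-].
by exists a, 1, (@prime_proper _ P).
Qed.

Lemma loc_ideal_to_loc I a : loc_ideal P I (to_loc P a) <-> sat P I a.
Proof.
split=> [/loc_idealP[b [s [Ps [Ib /mkfracP[w Pw H]]]]]|[s Ps Is]].
  exists (w * s); first exact: prime_mulN.
  have -> : w * s * a = w * b by apply: subr0_eq; rewrite -H; ring.
  exact: idealMl.
apply/loc_idealP; exists (s * a), s, Ps; split=> //.
by apply: eq_mkfrac; ring.
Qed.

Lemma loc_ideal_mkfrac I a s (Ps : ~ P s) : loc_ideal P I (mkfrac a Ps) <-> sat P I a.
Proof. by rewrite ideal_mkfrac loc_ideal_to_loc. Qed.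

Lemma noeth_loc : noeth A -> noeth L.
Proof.
move=> nA J; have [n [c Ec]] := nA (contr (to_loc P) J).
exists n, (fun i => to_loc P (c i)); apply: eq_ideal; apply/seteqP; split.
  elim/locW=> a s Ps /ideal_mkfrac Ja; rewrite mkfracE; apply: idealMl.
  have : contr (to_loc P) J a by [].
  rewrite Ec => /gen_rangeP[r ->]; rewrite rmorph_sum; apply: ideal_sum => i.
  by rewrite rmorphM; apply: idealMl; apply: sub_gen; exists i.
apply: gen_sub => _ [i _ <-].
have : contr (to_loc P) J (c i) by rewrite Ec; apply: sub_gen; exists i.
by [].
Qed.

Lemma loc_ideal_gen n (c : 'I_n -> A) :
  loc_ideal P (gen (range c)) = gen (range (fun i => to_loc P (c i))).
Proof.
apply: eq_ideal; apply/seteqP; split; last first.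
  apply: gen_sub => _ [i _ <-]; apply: sub_gen; exists (c i) => //.
  by apply: sub_gen; exists i.
apply: gen_sub => _ [a /gen_rangeP[r ->] <-]; rewrite rmorph_sum.
apply: ideal_sum => i; rewrite rmorphM; apply: idealMl.
by apply: sub_gen; exists i.
Qed.

Lemma loc_ideal_mono I J : I `<=` sat P J -> loc_ideal P I `<=` loc_ideal P J.
Proof. by move=> IJ; apply: gen_sub => _ [a /IJ Ja <-]; apply/loc_ideal_to_loc. Qed.

Lemma loc_ideal_mul I J :
  loc_ideal P (mul_ideal I J) = mul_ideal (loc_ideal P I) (loc_ideal P J).
Proof.
apply: eq_ideal; apply/seteqP; split; last first.
  apply: mul_ideal_sub => _ _ /loc_idealP[a [s [Ps [Ia ->]]]]
    /loc_idealP[b [t [Pt [Jb ->]]]].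
  rewrite mulL; apply/loc_idealP; do 3?eexists; split; last by [].
  exact: mul_ideal_mem.
apply: gen_sub => _ [y Hy <-]; move: y Hy.
set W := mul_ideal (loc_ideal P I) _.
apply: (@mul_ideal_sub _ _ _ (contr (to_loc P) W)) => a b Ia Jb; rewrite {}/W.
change (mul_ideal (loc_ideal P I) (loc_ideal P J) (to_loc P (a * b))).
by rewrite rmorphM; apply: mul_ideal_mem; apply: sub_gen; [exists a|exists b].
Qed.

Lemma loc_ideal_exp I n : loc_ideal P (exp_ideal I n) = exp_ideal (loc_ideal P I) n.
Proof.
elim: n => [|n IH] /=; last by rewrite loc_ideal_mul IH.
apply: eq_ideal; apply/seteqP; split=> y _; first exact: gen_setT.
elim/locW: y => a s Ps; apply/loc_idealP; exists a, s, Ps; split=> //.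
exact: gen_setT.
Qed.

Lemma pcontr_sub (Q : prime_ideal L) : pcontr (to_loc P) Q `<=` P.
Proof.
move=> a Qa; apply: contrapT => Pa; apply: (@prime_proper _ Q).
have -> : 1 = mkfrac 1 Pa * to_loc P a.
  by rewrite -mkfracE -[1]/(to_loc P 1); apply: eq_mkfrac; ring.
exact: idealMl.
Qed.

Lemma pcontr_lt (Q1 Q2 : prime_ideal L) : Q1 `<` Q2 ->
  pcontr (to_loc P) Q1 `<` pcontr (to_loc P) Q2.
Proof.
move=> [Q12 nQ]; split=> [a /Q12 //|H]; apply: nQ; elim/locW=> a s Ps.
by move=> /ideal_mkfrac Qa; apply/ideal_mkfrac; apply: H.
Qed.

Lemma loc_prime1 Q : Q `<=` P -> ~ loc_ideal P Q 1.
Proof.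
move=> QP; rewrite -[1]/(to_loc P 1) => /loc_ideal_to_loc[s Ps].
by rewrite mulr1 => /QP.
Qed.

Lemma sat_primeE Q a : Q `<=` P -> sat P Q a -> Q a.
Proof. by move=> QP [s Ps /prime_mul[/QP|]]. Qed.

Lemma loc_primeM Q (QP : Q `<=` P) x y :
  loc_ideal P Q (x * y) -> loc_ideal P Q x \/ loc_ideal P Q y.
Proof.
elim/locW: x => a s Ps; elim/locW: y => b t Pt; rewrite mulL !loc_ideal_mkfrac.
by move=> /(sat_primeE QP) /prime_mul[H|H]; [left|right]; apply: sub_sat.
Qed.

Definition ploc Q (QP : Q `<=` P) : prime_ideal L :=
  PrimeIdeal (loc_prime1 QP) (loc_primeM QP).

Lemma plocE Q (QP : Q `<=` P) a s (Ps : ~ P s) : ploc QP (mkfrac a Ps) <-> Q a.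
Proof.
split=> [/loc_ideal_mkfrac /(sat_primeE QP) //|Qa].
by apply/loc_ideal_mkfrac; apply: sub_sat.
Qed.

Lemma ploc_le Q1 Q2 (QP1 : Q1 `<=` P) (QP2 : Q2 `<=` P) :
  Q1 `<=` Q2 -> ploc QP1 `<=` ploc QP2.
Proof. by move=> H; elim/locW=> a s Ps /plocE /H Qa; apply/plocE. Qed.

Lemma ploc_lt Q1 Q2 (QP1 : Q1 `<=` P) (QP2 : Q2 `<=` P) :
  Q1 `<` Q2 -> ploc QP1 `<` ploc QP2.
Proof.
move=> [Q12 nQ]; split; first exact: ploc_le.
move=> H; apply: nQ => a Qa; apply/(plocE QP1 a (@prime_proper _ P)); apply: H.
exact/plocE.
Qed.

Lemma ploc_contr (Q : prime_ideal L) : ploc (pcontr_sub (Q := Q)) = Q.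
Proof.
apply: eq_prime; elim/locW=> a s Ps.
  by move=> /plocE Qa; apply/ideal_mkfrac.
by move=> /ideal_mkfrac Qa; apply/plocE.
Qed.

Lemma pcontr_ht (Q : prime_ideal L) n :
  prime_ht_ge Q n -> prime_ht_ge (pcontr (to_loc P) Q) n.
Proof.
move=> [c Hc <-]; exists (fun i => pcontr (to_loc P) (c i)) => // i lin.
by apply: pcontr_lt; apply: Hc.
Qed.

Lemma chain_le (B : comPzRingType) (c : nat -> prime_ideal B) n i :
  prime_chain c n -> (i <= n)%N -> c i `<=` c n.
Proof.
move=> Hc; elim: n Hc => [|n IH] Hc; first by rewrite leqn0 => /eqP ->.
rewrite leq_eqVlt => /orP[/eqP -> //|lin].
apply: subset_trans (proj1 (Hc n (ltnSn n))).
by apply: IH => // j jn; apply: Hc; apply: leqW.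
Qed.

Lemma ploc_ht Q (QP : Q `<=` P) n : prime_ht_ge Q n -> prime_ht_ge (ploc QP) n.
Proof.
move=> [c Hc cn]; have cP i : c (minn i n) `<=` P.
  by apply: subset_trans (chain_le Hc (geq_minr i n)) _; rewrite cn.
exists (fun i => ploc (cP i)) => [i lin|].
  by apply: ploc_lt; rewrite (minn_idPl lin) (minn_idPl (ltnW lin)); apply: Hc.
by apply: eq_prime; apply: ploc_le; rewrite minnn cn.
Qed.

Lemma loc_dim n : prime_ht_ge P n -> dim_ge L n.
Proof. by move=> /(ploc_ht (@subset_refl _ P))[c Hc _]; exists c. Qed.

End LocalizationIdeals.

(** * Primes of a quotient ring *)

Section QuotientPrimes.
Variables (A : comPzRingType) (K : ideal A).
Implicit Types P Q : prime_ideal A.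

Lemma to_quot_eq0 x : to_quot K x = 0 <-> K x.
Proof. by rewrite -[0]/(to_quot K 0) to_quotP subr0. Qed.

Lemma is_ideal_quot (J : ideal A) : is_ideal [set y : quot K | exists2 x, J x & y = to_quot K x].
Proof.
split=> /=.
- by exists 0 => //; apply: ideal0.
- by move=> _ _ [x Jx ->] [y Jy ->]; exists (x + y); [apply: idealD|rewrite rmorphD].
- by elim/quotW=> a _ [x Jx ->]; exists (a * x); [apply: idealMl|rewrite rmorphM].
Qed.
Definition iquot J : ideal (quot K) := Ideal (is_ideal_quot J).

Lemma iquotE (J : ideal A) x : K `<=` J -> iquot J (to_quot K x) <-> J x.
Proof.
move=> KJ; split=> [[y Jy /to_quotP/KJ Hxy]|Jx]; last by exists x.
by rewrite -(subrK y x); apply: idealD.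
Qed.

Lemma pquot1 P : K `<=` P -> ~ iquot P 1.
Proof. by move=> KP; rewrite -(rmorph1 (to_quot K)) => /(iquotE _ KP) /prime_proper. Qed.

Lemma pquotM P : K `<=` P -> forall x y, iquot P (x * y) -> iquot P x \/ iquot P y.
Proof.
move=> KP; elim/quotW=> x; elim/quotW=> y; rewrite -rmorphM.
by rewrite !(iquotE _ KP); apply: prime_mul.
Qed.

Definition pquot P (KP : K `<=` P) : prime_ideal (quot K) :=
  PrimeIdeal (pquot1 KP) (pquotM KP).

Lemma pquotE P (KP : K `<=` P) x : pquot KP (to_quot K x) <-> P x.
Proof. exact: iquotE. Qed.

Lemma pquot_lt P Q (KP : K `<=` P) (KQ : K `<=` Q) : P `<` Q -> pquot KP `<` pquot KQ.
Proof.
move=> [PQ nQP]; split.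
  by elim/quotW=> x /pquotE /PQ Qx; apply/pquotE.
by move=> H; apply: nQP => x Qx; apply/(pquotE KP); apply: H; apply/pquotE.
Qed.

End QuotientPrimes.

(** * Serre's condition and associated primes *)

Section SerreDepth.
Variable A : comPzRingType.

(** From s1 z = w a and s2 z = v a follows s2 w = s1 v, whence s1 divides w. In other words,
    dividing a ring of depth 2 by a nonzerodivisor leaves depth at least 1. *)
Lemma depth2_exchange (B : comPzRingType) (a z s1 s2 : B) : (forall x, a * x = 0 -> x = 0) ->
  regular_seq [:: s1; s2] -> gen [set a] (s1 * z) -> gen [set a] (s2 * z) ->
  gen [set a] z.
Proof.
move=> anz [reg _] /gen1P[w Hw] /gen1P[v Hv].
have s1nz x : s1 * x = 0 -> x = 0.
  move=> H; have gen0 : gen [set` [::]] x.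
    by apply: (reg 0%N) => //=; rewrite H; apply: ideal0.
  by apply/zidealP; move: gen0; apply: gen_sub.
have E1 : [set` [:: s1]] = [set s1].
  by apply/seteqP; split=> y /=; rewrite inE => /eqP.
have : gen [set s1] w.
  rewrite -E1; apply: (reg 1%N) => //=; rewrite E1; apply/gen1P; exists v.
  apply: subr0_eq; apply: anz.
  have -> : a * (s2 * w - v * s1) = s2 * (w * a) - s1 * (v * a) by ring.
  by rewrite -Hw -Hv; ring.
move=> /gen1P[w' Hw']; apply/gen1P; exists w'.
apply: subr0_eq; apply: s1nz; rewrite mulrBr Hw Hw'; ring.
Qed.

(** A chain of three primes gives (A/K)_P dimension at least 2 and hence a regular pair in P. The
    pair multiplies z into (a), so z would lie in (a) at P. *)
Lemma serre_S2_assoc (K : ideal A) (P : prime_ideal A) a z :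
  serre_S (quot K) 2 -> (forall r, K (a * r) -> K r) -> K `<=` P ->
  ~ addg K a z -> (forall r, P r <-> addg K a (r * z)) ->
  forall P0 P1 : prime_ideal A, K `<=` P0 -> P0 `<` P1 -> P1 `<` P -> False.
Proof.
move=> S2 anz KP naz PE P0 P1 KP0 P01 P1P.
have KP1 : K `<=` P1 by apply: subset_trans KP0 (proj1 P01).
have ht2 : prime_ht_ge (pquot KP) 2.
  apply: (prime_ht_geS (pquot_lt KP1 KP P1P)).
  by apply: (prime_ht_geS (pquot_lt KP0 KP1 P01)); apply: prime_ht_ge0.
have [s [ss sP sreg]] := S2 (pquot KP) 2%N (leqnn 2) (loc_dim ht2).
case: s ss sP sreg => [|s1 [|s2 [|//]]] // _ sP sreg.
pose rho x := to_loc (pquot KP) (to_quot K x).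
have rhoM x y : rho (x * y) = rho x * rho y by rewrite /rho !rmorphM.
have anz' y : rho a * y = 0 -> y = 0.
  elim/locW: y; elim/quotW=> b; elim/quotW=> t Pt; rewrite mulL => /mkfrac_eq0[w].
  elim/quotW: w => w Pw.
  have <- : to_quot K (w * (a * b)) = to_quot K w * (to_quot K a * to_quot K b).
    by rewrite !rmorphM.
  move=> /to_quot_eq0; rewrite mulrCA => /anz Kwb; apply/mkfrac_eq0; exists (to_quot K w) => //.
  by rewrite -rmorphM; apply/to_quot_eq0.
have maxz y : loc_ideal (pquot KP) (pquot KP) y -> gen [set rho a] (y * rho z).
  move=> /loc_idealP[p [s [Ps [Pp ->]]]]; elim/quotW: p Pp => p /pquotE.
  move=> /PE /addgP[r Kr]; apply/gen1P; exists (mkfrac (to_quot K r) Ps).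
  rewrite /rho !mulL; apply: eq_mkfrac.
  have -> : to_quot K p * to_quot K z = to_quot K r * to_quot K a.
    by rewrite -!rmorphM; apply/to_quotP.
  by [].
have : gen [set rho a] (rho z).
  by apply: (depth2_exchange anz' sreg); apply: maxz; apply: sP; rewrite /= !inE eqxx ?orbT.
move=> /gen1P[y]; elim/locW: y; elim/quotW=> b; elim/quotW=> t Pt.
rewrite mulL => /mkfracP[w]; elim/quotW: w => w Pw.
have <- : to_quot K (w * (z * (t * 1) - b * a * 1)) = to_quot K w *
    (to_quot K z * (to_quot K t * 1) - to_quot K b * to_quot K a * 1).
  by rewrite !(rmorphM, rmorphB, rmorph1).
move=> /to_quot_eq0 H.
have Pwt : ~ P (w * t) by move=> /prime_mul[]; rewrite -(pquotE KP).
apply: Pwt; apply/PE; apply/addgP; exists (w * b).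
by have -> : w * t * z - w * b * a = w * (z * (t * 1) - b * a * 1) by ring.
Qed.

End SerreDepth.

(** * Hilbert's basis theorem *)

Section HilbertBasis.

Lemma noeth_surj (A B : comPzRingType) (f : {rmorphism A -> B}) :
  (forall y, exists x, f x = y) -> noeth A -> noeth B.
Proof.
move=> surj nA J; have [n [c Ec]] := nA (contr f J).
exists n, (fun i => f (c i)); apply: eq_ideal; apply/seteqP; split.
  move=> y Jy; have [x fx] := surj y.
  have : contr f J x by rewrite -fx in Jy.
  rewrite Ec => /gen_rangeP[r xE]; rewrite -fx xE rmorph_sum.
  apply: ideal_sum => i; rewrite rmorphM; apply: idealMl.
  by apply: sub_gen; exists i.
apply: gen_sub => _ [i _ <-].
have : contr f J (c i) by rewrite Ec; apply: sub_gen; exists i.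
by [].
Qed.

Lemma noeth_field (k : fieldType) : noeth k.
Proof.
move=> J; case: (pselect (exists2 x, J x & x != 0)) => [[x Jx x0]|nJ].
  exists 1%N, (fun=> 1); apply: eq_ideal; apply/seteqP; split=> y _.
    by rewrite -[y]mulr1; apply: idealMl; apply: sub_gen; exists ord0.
  by rewrite -[y](mulfVK x0); apply: idealMl.
exists 0%N, (fun=> 0); apply: eq_ideal; apply/seteqP; split; last first.
  by apply: gen_sub => y [[]].
move=> y Jy; have -> : y = 0; last exact: ideal0.
by apply/eqP; apply: contrapT => /negP y0; apply: nJ; exists y.
Qed.

Lemma generated_by_finType (T : comPzRingType) (F : finType) (c : F -> T) :
  generated_by (gen (range c)) #|F|.
Proof.
exists (fun i => c (enum_val i)); congr gen; apply/seteqP; split=> _ [x _ <-].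
  by exists (enum_rank x); rewrite ?enum_rankK.
by exists (enum_val x).
Qed.

Variable A : comNzRingType.
Hypothesis nA : noeth A.

Lemma is_ideal_coef (J : ideal {poly A}) n :
  is_ideal [set a | exists p, [/\ J p, (size p <= n.+1)%N & p`_n = a]].
Proof.
split=> /=.
- by exists 0; rewrite size_poly0 coef0; split=> //; apply: ideal0.
- move=> _ _ [p [Jp sp <-]] [q [Jq sq <-]]; exists (p + q); rewrite coefD.
  split=> //; first exact: idealD.
  by apply: leq_trans (size_polyD _ _) _; rewrite geq_max sp.
- move=> a _ [p [Jp sp <-]]; exists (a%:P * p); rewrite coefCM.
  split=> //; first exact: idealMl.
  by rewrite mul_polyC; apply: leq_trans (size_scale_leq _ _) _.
Qed.
Definition coef_ideal J n : ideal A := Ideal (@is_ideal_coef J n).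

Lemma noeth_poly : noeth {poly A}.
Proof.
move=> J; have CS n : coef_ideal J n `<=` coef_ideal J n.+1.
  move=> _ [p [Jp sp <-]]; exists (p * 'X); split.
  - exact: idealMr.
  - by apply: leq_trans (size_polyMleq _ _) _; rewrite size_polyX addn2.
  - by rewrite coefMX.
have [N HN] := noeth_chain nA CS.
have /choice[r Hr] : forall n, exists r, exists q : 'I_r -> {poly A},
  (forall i, J (q i) /\ (size (q i) <= n.+1)%N) /\
  forall a, coef_ideal J n a -> exists b : 'I_r -> A, a = \sum_i b i * (q i)`_n.
  move=> n; have [r [c Ec]] := nA (coef_ideal J n); exists r.
  have /choice[q Hq] : forall i, exists p, [/\ J p, (size p <= n.+1)%N & p`_n = c i].
    move=> i; have : coef_ideal J n (c i) by rewrite Ec; apply: sub_gen; exists i.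
    by [].
  exists q; split=> [i|a]; first by have [] := Hq i.
  rewrite Ec => /gen_rangeP[b ->]; exists b; apply: eq_bigr => i _.
  by have [_ _ ->] := Hq i.
pose q n : 'I_(r n) -> {poly A} := sval (cid (Hr n)).
have Hq n : (forall i, J (q n i) /\ (size (q n i) <= n.+1)%N) /\
  forall a, coef_ideal J n a -> exists b : 'I_(r n) -> A, a = \sum_i b i * (q n i)`_n.
  exact: (svalP (cid (Hr n))).
pose F := {n : 'I_N.+1 & 'I_(r n)}.
pose c (x : F) := q (tag x) (tagged x).
suff -> : J = gen (range c) by eexists; apply: generated_by_finType.
apply: eq_ideal; apply/seteqP; split; last first.
  by apply: gen_sub => _ [[n i] _ <-]; have [/(_ i)[]] := Hq n.
suff H m (p : {poly A}) : (size p <= m)%N -> J p -> gen (range c) p by move=> p; apply: (H (size p)).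
elim: m p => [|m IH] p sp Jp.
  by move: sp; rewrite leqn0 size_poly_eq0 => /eqP ->; apply: ideal0.
(* Beyond degree N the ideals of leading coefficients no longer grow, so elements of degree N times
   a power of X suffice. *)
pose n := minn m N; have nN : (n < N.+1)%N by rewrite ltnS geq_minr.
have [qJ Hn] := Hq n.
have Cp : coef_ideal J n p`_m.
  rewrite /n; case: (leqP m N) => [_|/ltnW Nm]; first by exists p.
  by apply: (HN m); exists p.
have [b Hb] := Hn _ Cp.
pose s := \sum_i b i *: ('X^(m - n) * q n i).
have nm : (n <= m)%N by apply: geq_minl.
have gs : gen (range c) s.
  apply: ideal_sum => i; rewrite -mul_polyC; do 2!apply: idealMl.
  by apply: sub_gen; exists (@Tagged 'I_N.+1 (Ordinal nN) (fun n => 'I_(r n)) i).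
rewrite -(subrK s p); apply: idealD => //; apply: IH; last first.
  apply: idealB => //; apply: ideal_sum => i; rewrite -mul_polyC.
  by do 2!apply: idealMl; have [] := qJ i.
apply/leq_sizeP => j; rewrite leq_eqVlt => /orP[/eqP <-|mj]; rewrite coefB.
  rewrite /s coef_sum Hb; apply/eqP; rewrite subr_eq0; apply/eqP; apply: eq_bigr => i _.
  by rewrite coefZ coefXnM ltnNge leq_subr /= subKn.
rewrite (nth_default _ (leq_trans sp mj)) sub0r /s coef_sum big1 ?oppr0 // => i _.
rewrite coefZ coefXnM; case: ifP => [_|/negbT]; first by rewrite mulr0.
rewrite -leqNgt => mnj; rewrite nth_default ?mulr0 //.
have [_ sq] := qJ i; apply: leq_trans sq _; lia.
Qed.

End HilbertBasis.

Section MpolyNoetherian.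
Variable k : fieldType.

Lemma mpoly_ring_ind (A : comNzRingType) n (Pr : {mpoly A[n]} -> Prop) :
  (forall c, Pr c%:MP) -> (forall i, Pr 'X_i) ->
  (forall p q, Pr p -> Pr q -> Pr (p + q)) ->
  (forall p q, Pr p -> Pr q -> Pr (p * q)) -> forall p, Pr p.
Proof.
move=> PC PX PD PM p; rewrite [p]mpolyE.
elim/big_ind: _ => [|//|m _]; first by rewrite -mpolyC0; apply: PC.
rewrite -mul_mpolyC; apply: (PM) => //; rewrite mpolyXE_id.
elim/big_ind: _ => [|//|i _]; first by rewrite -mpolyC1; apply: PC.
elim: (m i) => [|e IH]; first by rewrite expr0 -mpolyC1; apply: PC.
by rewrite exprS; apply: PM.
Qed.

Lemma noeth_mpoly n : noeth {mpoly k[n]}.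
Proof.
elim: n => [|n IH].
  apply: (@noeth_surj k _ (@mpolyC 0 k)) (@noeth_field k) => p.
  by exists p@_0%MM; symmetry; apply: nvar0_mpolyC.
pose f : {rmorphism {poly {mpoly k[n]}} -> {mpoly k[n.+1]}} :=
  horner_eval 'X_ord_max \o map_poly (@mwiden n k).
apply: (@noeth_surj _ _ f) (noeth_poly IH) => p.
elim/mpoly_ring_ind: p => [c|i|p q [x <-] [y <-]|p q [x <-] [y <-]].
- by exists c%:MP%:P; rewrite /f /= map_polyC /= /horner_eval hornerC mwidenC.
- case: (unliftP ord_max i) => [j ->|->].
    exists ('X_j)%:P; rewrite /f /= map_polyC /= /horner_eval hornerC mwidenX mnmwiden1.
    by congr 'X_[U_(_)]; apply/val_inj; rewrite /= /bump leqNgt ltn_ord.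
  by exists 'X; rewrite /f /= map_polyX /horner_eval hornerX.
- by exists (x + y); rewrite rmorphD.
- by exists (x * y); rewrite rmorphM.
Qed.

End MpolyNoetherian.

(** * Linear and algebraic dependence; heights in polynomial rings *)

Section LinearDependence.
Variable k : fieldType.

Lemma lin_dep (A B : finType) (f : A -> B -> k) : (#|B| < #|A|)%N ->
  exists2 c : A -> k, (exists a, c a != 0) & forall b, \sum_a c a * f a b = 0.
Proof.
move=> BA; pose M : 'M[k]_(#|A|, #|B|) := \matrix_(i, j) f (enum_val i) (enum_val j).
have kM : kermx M != 0.
  rewrite -mxrank_eq0 mxrank_ker subn_eq0 -ltnNge.
  exact: leq_ltn_trans (rank_leq_col M) BA.
have [i [j Hij]] : exists i j, kermx M i j != 0.
  apply: contrapT => H; move/negP: kM; apply; apply/eqP/matrixP => i j; rewrite [RHS]mxE.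
  by apply/eqP; apply: contrapT => /negP Hij; apply: H; exists i, j.
exists (fun a => kermx M i (enum_rank a)); first by exists (enum_val j); rewrite enum_valK.
move=> b; have /matrixP/(_ i (enum_rank b)) := mulmx_ker M.
rewrite mxE [RHS]mxE => H; rewrite -[RHS]H (reindex (@enum_val A predT)) /=; last first.
  by exists enum_rank => x _; rewrite ?enum_valK ?enum_rankK.
by apply: eq_bigr => a _; rewrite enum_valK [M _ _]mxE enum_rankK.
Qed.

End LinearDependence.

Lemma leq_expn2 a b e : (a <= b)%N -> (a ^ e <= b ^ e)%N.
Proof. by move=> ab; elim: e => [|e IH] //; rewrite !expnS leq_mul. Qed.

Section AlgebraicDependence.
Variables (k : fieldType) (d : nat).
Local Notation R := {mpoly k[d]}.

Fixpoint allseqs (N m : nat) : seq (seq nat) :=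
  if m is m'.+1 then [seq j :: s | j <- iota 0 N.+1, s <- allseqs N m']
  else [:: [::]].

Lemma allseqs_consE N m : allseqs N m.+1 =
  [seq j :: s | j <- iota 0 N.+1, s <- allseqs N m].
Proof. by []. Qed.

Lemma size_allseqs N m : size (allseqs N m) = (N.+1 ^ m)%N.
Proof.
by elim: m => [|m IH] //; rewrite allseqs_consE size_allpairs size_iota IH expnS.
Qed.

Lemma allseqs_uniq N m : uniq (allseqs N m).
Proof.
elim: m => [|m IH] //; rewrite allseqs_consE.
by apply: allpairs_uniq => //; [exact: iota_uniq|move=> [a s] [b t] _ _ [-> ->]].
Qed.

Lemma allseqsS N m j s :
  (j :: s \in allseqs N m.+1) = (j <= N)%N && (s \in allseqs N m).
Proof.
rewrite allseqs_consE.
apply/allpairsP/andP => [[[a t] [Ha Ht [-> ->]]]|[jN sm]].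
  by rewrite mem_iota add0n in Ha.
by exists (j, s); rewrite mem_iota add0n ltnS.
Qed.

(** The polynomial with coefficients c and exponents up to N, evaluated at [ys]. Nesting the sums
    gives access to the expansion in powers of the first element, from which lowest and highest
    terms are taken later. *)
Fixpoint psum (N : nat) (ys : seq R) (c : seq nat -> k) : R :=
  if ys is y :: ys' then
    \sum_(j < N.+1) y ^+ j * psum N ys' (fun s => c (nat_of_ord j :: s))
  else (c [::])%:MP.

Fixpoint pmon (ys : seq R) (s : seq nat) : R :=
  match ys, s with
  | y :: ys', j :: s' => y ^+ j * pmon ys' s'
  | _, _ => 1
  end.

Lemma psumE N ys c : psum N ys c = \sum_(s <- allseqs N (size ys)) c s *: pmon ys s.
Proof.
elim: ys c => [|y ys IH] c; first by rewrite big_seq1 /= alg_mpolyC.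
rewrite [psum _ _ _]/= [size _]/= allseqs_consE big_allpairs_dep.
rewrite -val_enum_ord big_map big_enum /=.
apply: eq_bigr => j _; rewrite IH mulr_sumr; apply: eq_bigr => s _.
by rewrite scalerAr.
Qed.

Lemma psum_eq0 N ys c : (forall s, s \in allseqs N (size ys) -> c s = 0) ->
  psum N ys c = 0.
Proof.
by move=> H; rewrite psumE big_seq big1 // => s /H ->; rewrite scale0r.
Qed.

Lemma msizeM_deg (p q : R) a b : (msize p <= a.+1)%N -> (msize q <= b.+1)%N ->
  (msize (p * q) <= (a + b).+1)%N.
Proof.
have [->|p0] := eqVneq p 0; first by rewrite mul0r msize0.
have [->|q0] := eqVneq q 0; first by rewrite mulr0 msize0.
by move=> pa qb; rewrite msizeM //; move: (msize p) (msize q) pa qb => x y; lia.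
Qed.

Lemma msizeX_deg (y : R) D j :
  (msize y <= D.+1)%N -> (msize (y ^+ j) <= (j * D).+1)%N.
Proof.
move=> yD; elim: j => [|j IH]; first by rewrite expr0 msize1.
by rewrite exprS mulSn; apply: msizeM_deg.
Qed.

Lemma pmon_size D N ys s : (forall y, y \in ys -> (msize y <= D.+1)%N) ->
  s \in allseqs N (size ys) -> (msize (pmon ys s) <= (size ys * (N * D)).+1)%N.
Proof.
elim: ys s => [|y ys IH] s; first by rewrite msize1.
case: s => [|j s] H; first by move=> /allpairsP[[? ?] []].
rewrite allseqsS => /andP[jN sm]; rewrite [size _]/= mulSn.
have yD := msizeX_deg j (H _ (mem_head _ _)).
apply: msizeM_deg; first by apply: leq_trans yD _; rewrite ltnS leq_mul.
by apply: IH => // z zs; apply: H; rewrite inE zs orbT.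
Qed.

Lemma alg_dep (ys : seq R) : (d < size ys)%N ->
  exists N c s, [/\ s \in allseqs N (size ys), c s != 0 & psum N ys c = 0].
Proof.
move=> dys; set m := size ys in dys.
have [D HD] : exists D, forall y, y \in ys -> (msize y <= D.+1)%N.
  exists (\max_(y <- ys) msize y)%N => y yys; apply: leqW.
  exact: leq_bigmax_seq.
(* With this N, M^d <= (m (D + 1) (N + 1))^d = N (N + 1)^d < (N + 1)^(d + 1), so the (N + 1)^m
   products outnumber the exponents with entries below M. *)
pose N := ((m * D.+1) ^ d)%N; pose M := (m * (N * D)).+1.
pose L := allseqs N m.
have [|c0 [a0 Ha0] Hc0] := @lin_dep k 'I_(size L) {ffun 'I_d -> 'I_M}
  (fun i b => (pmon ys (nth [::] L i))@_[multinom (b l : nat) | l < d]).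
  rewrite card_ffun !card_ord size_allseqs.
  apply: (@leq_ltn_trans ((m * D.+1 * N.+1) ^ d)%N).
    by apply: leq_expn2; rewrite /M; nia.
  rewrite expnMn -/N (leq_trans _ (leq_pexp2l _ dys)) // expnS.
  by rewrite ltn_mul2r expn_gt0 /=.
pose c s := if insub (index s L) is Some i then c0 i else 0.
have cn i : c (nth [::] L (nat_of_ord i)) = c0 i.
  by rewrite /c index_uniq ?allseqs_uniq // valK.
exists N, c, (nth [::] L a0); split; first by apply: mem_nth.
  by rewrite cn.
rewrite psumE -/m -/L (big_nth [::]) big_mkord; apply/mpolyP => e; rewrite mcoeff0.
have coefE : (\sum_(i < size L) c (nth [::] L i) *: pmon ys (nth [::] L i))@_e =
    \sum_i c0 i * (pmon ys (nth [::] L i))@_e.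
  by rewrite raddf_sum /=; apply: eq_bigr => i _; rewrite mcoeffZ cn.
rewrite coefE; case: (boolP [forall l, e l < M]%N) => [/forallP eM|/forallPn[l Hl]].
  have := Hc0 [ffun l => Ordinal (eM l)].
  have -> // : [multinom ([ffun l => Ordinal (eM l)] l : nat) | l < d] = e.
  by apply/mnmP => l; rewrite mnmE ffunE.
rewrite big1 // => i _; have := pmon_size HD (mem_nth [::] (ltn_ord i)).
rewrite -/M => sM; rewrite [_@_e]memN_msupp_eq0 ?mulr0 //.
apply: msize_mdeg_ge; apply: leq_trans sM _.
rewrite -leqNgt in Hl; apply: leq_trans Hl _.
by rewrite mdegE (bigD1 l) //= leq_addr.
Qed.

(* the elements X_j, j in E, are algebraically independent modulo P *)
Definition indep (P : prime_ideal R) (E : seq 'I_d) : Prop :=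
  forall N c s, s \in allseqs N (size E) -> c s != 0 ->
    ~ P (psum N [seq 'X_j | j <- E] c).

(* The lowest terms, successively in y_1, ..., y_n, of a relation between the
   y_i and the X_j: since y_i is in P_i but not in P_(i-1), its coefficient is in
   P_n. *)
Lemma chain_relation (zs : seq R) N n ch (ys : seq R) c s : size ys = n ->
  prime_chain ch n ->
  (forall i, (i < n)%N -> (ch i.+1 : prime_ideal R) (nth 0 ys i) /\ ~ ch i (nth 0 ys i)) ->
  s \in allseqs N (size (ys ++ zs)) -> c s != 0 ->
  ch 0%N (psum N (ys ++ zs) c) ->
  exists c' s', [/\ s' \in allseqs N (size zs), c' s' != 0 & ch n (psum N zs c')].
Proof.
elim: n ch ys c s => [|n IH] ch ys c s sys Hch Hy ss cs Hp.
  by move/size0nil: sys ss Hp => -> ss Hp; exists c, s.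
case: ys sys Hy ss Hp => [//|y ys] [sys] Hy ss Hp.
case: s ss cs => [|j0 s0]; first by move=> /allpairsP[[? ?] []].
rewrite cat_cons [size _]/= allseqsS => /andP[j0N s0m] cs.
pose nz j := `[< exists2 s, s \in allseqs N (size (ys ++ zs)) & c (j :: s) != 0 >].
have exj : exists j, nz j && (j <= N)%N.
  by exists j0; rewrite j0N andbT; apply/asboolP; exists s0.
case: (ex_minnP exj) => j /andP[/asboolP[s1 s1m cs1] jN] minj.
pose G i := psum N (ys ++ zs) (fun s => c (i :: s)).
have [Py nPy] := Hy 0%N (ltn0Sn _).
have G0 i : (i < j)%N -> G i = 0.
  move=> ij; apply: psum_eq0 => t tm; apply/eqP; apply: contrapT => /negP ct.
  have := minj i; rewrite (leq_trans (ltnW ij) jN) andbT leqNgt ij => H.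
  by apply: notF; apply: H; apply/asboolP; exists t.
have Gj : ch 1%N (G j).
  have E : psum N (y :: ys ++ zs) c =
      y ^+ j * (G j + y * \sum_(i < N.+1 | (j < i)%N) y ^+ (i - j.+1) * G i).
    rewrite /= (bigID (fun i : 'I_N.+1 => (j < i)%N)) /=.
    rewrite [X in _ + X](bigD1 (Ordinal (jN : (j < N.+1)%N))) /= ?ltnn //.
    rewrite [X in _ + (_ + X)]big1 ?addr0; last first.
      move=> i /andP[]; rewrite -leqNgt leq_eqVlt => /orP[/eqP E /eqP[]|ij _].
        exact/val_inj.
      by rewrite -/(G i) G0 ?mulr0.
    rewrite addrC mulrDr mulrA -exprSr; congr (_ + _); rewrite mulr_sumr.
    by apply: eq_bigr => i ji; rewrite mulrA -exprD subnKC.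
  move: Hp; rewrite cat_cons E => /prime_mul[/prime_pow/nPy//|Hp].
  have {}Hp := proj1 (Hch 0%N (ltn0Sn _)) _ Hp.
  move: Hp; set r := y * _ => Hp; rewrite -(addrK r (G j)).
  by apply: idealB => //; apply: idealMr.
apply: (IH (fun i => ch i.+1) ys (fun s => c (j :: s)) s1 sys) => //.
- by move=> i lin; apply: Hch.
- by move=> i lin; apply: (Hy i.+1).
Qed.

(** Elements separating the successive primes of a chain of length n, together with more than d - n
    variables, are algebraically dependent; [chain_relation] turns the dependence into one of the
    variables modulo P. *)
Lemma ht_indep P E n : prime_ht_ge P n -> indep P E -> (n + size E <= d)%N.
Proof.
move=> [ch Hch <-] HE; rewrite leqNgt; apply/negP => lt.
have /choice[y Hy] : forall i, exists y : R, (i < n)%N -> ch i.+1 y /\ ~ ch i y.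
  move=> i; case: (ltnP i n) => [/Hch[_ nsub]|]; last by exists 0.
  apply: contrapT => ny; apply: nsub => y Py; apply: contrapT => nPy.
  by apply: ny; exists y.
have [|N [c [s [ss cs H0]]]] := @alg_dep (mkseq y n ++ [seq 'X_j | j <- E]).
  by rewrite size_cat size_mkseq size_map.
have [||c' [s' [ss' cs']]] := chain_relation (size_mkseq y n) Hch _ ss cs.
- by move=> i lin; rewrite nth_mkseq //; apply: Hy.
- by rewrite H0; apply: ideal0.
by apply: HE cs'; rewrite size_map in ss'.
Qed.

Lemma indep_max P : exists2 E, indep P E & forall j, ~ indep P (j :: E).
Proof.
have ex0 : exists n, `[< exists2 E, indep P E & size E = n >].
  exists 0%N; apply/asboolP; exists [::] => // N c s; rewrite inE => /eqP -> c0 /=.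
  move=> Pc; apply: (@prime_proper _ P).
  rewrite -mpolyC1 -(mulVf c0) rmorphM; exact: idealMl.
have bnd n : `[< exists2 E, indep P E & size E = n >] -> (n <= d)%N.
  move=> /asboolP[E HE <-]; apply: (@ht_indep P E 0) HE; exact: prime_ht_ge0.
case: (ex_maxnP ex0 bnd) => n /asboolP[E HE sE] maxn; exists E => // j Hj.
have := maxn n.+1; rewrite ltnn => H; apply: notF; apply: H.
by apply/asboolP; exists (j :: E) => //=; rewrite sE.
Qed.

End AlgebraicDependence.

(** * Cohen-Macaulayness of polynomial rings *)

Section PolynomialCohenMacaulay.
Variables (k : fieldType) (d : nat).
Local Notation R := {mpoly k[d]}.

(** An element of R as a polynomial in X_j. Its coefficients remain in R, so that ideals of R can be
    tested on them without passing to a ring with one variable less. *)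
Definition upoly (j : 'I_d) : R -> {poly R} :=
  mmap (polyC \o @mpolyC d k) (fun l => if l == j then 'X else ('X_l)%:P).

Lemma upolyD j : {morph upoly j : p q / p + q}.
Proof. exact: rmorphD. Qed.
Lemma upolyM j : {morph upoly j : p q / p * q}.
Proof. exact: rmorphM. Qed.
Lemma upolyC j c : upoly j c%:MP = c%:MP%:P.
Proof. by rewrite /upoly mmapC. Qed.
Lemma upolyX j l : upoly j 'X_l = if l == j then 'X else ('X_l)%:P.
Proof. by rewrite /upoly mmapX mmap1U. Qed.
Lemma upoly_sum j (I : Type) (s : seq I) (F : I -> R) :
  upoly j (\sum_(i <- s) F i) = \sum_(i <- s) upoly j (F i).
Proof. exact: rmorph_sum. Qed.
Lemma upoly_exp j p n : upoly j (p ^+ n) = upoly j p ^+ n.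
Proof. exact: rmorphXn. Qed.

Lemma upolyK j r : (upoly j r).['X_j] = r.
Proof.
elim/mpoly_ring_ind: r => [c|i|p q IHp IHq|p q IHp IHq].
- by rewrite upolyC hornerC.
- by rewrite upolyX; case: eqP => [->|_]; rewrite ?hornerX ?hornerC.
- by rewrite upolyD hornerD; congr (_ + _).
- by rewrite upolyM hornerM; congr (_ * _).
Qed.

Definition free_of (j : 'I_d) (g : R) : Prop := upoly j g = g%:P.

Lemma free_psum N E c j : j \notin E -> free_of j (psum N [seq 'X_l | l <- E] c).
Proof.
elim: E c => [|l E IH] c; first by rewrite /free_of upolyC.
rewrite inE negb_or => /andP[jl jE]; rewrite /free_of /= upoly_sum rmorph_sum.
apply: eq_bigr => i _; rewrite upolyM upoly_exp upolyX eq_sym (negbTE jl).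
by rewrite IH // rmorphM rmorphXn.
Qed.

(** The top coefficient of g rho is g_D rho_e, so after multiplication by the leading coefficient
    g_D of g the top term of rho may be dropped. *)
Lemma poly_lead_regular (b : ideal R) (g rho : {poly R}) D :
  (size g <= D.+1)%N -> (forall i, b (g * rho)`_i) ->
  exists n, forall i, b (g`_D ^+ n * rho`_i).
Proof.
move=> sg; elim: {rho}(size rho) {-2}rho (leqnn (size rho)) => [|e IH] rho srho Hb.
  move: srho; rewrite leqn0 size_poly_eq0 => /eqP ->; exists 0%N => i.
  by rewrite coef0 mulr0; apply: ideal0.
pose rho' := \poly_(i < e) rho`_i.
have rhoE : rho = rho' + (rho`_e)%:P * 'X^e.
  apply/polyP => i; rewrite coefD coef_poly coefCM coefXn.
  case: ltngtP => [|ei|->]; rewrite ?mulr0 ?mulr1 ?addr0 ?add0r //.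
  by rewrite nth_default // (leq_trans srho).
have top : b (g`_D * rho`_e).
  have := Hb (D + e)%N; rewrite coefM (bigD1 (Ordinal (leq_addr e D : (D < (D + e).+1)%N))) //=.
  rewrite addKn big1 ?addr0 // => i iD.
  have [Di|iD'] := ltnP D i.
    by rewrite (nth_default _ (leq_trans sg Di)) mul0r.
  have {iD iD'} iD : (i < D)%N.
    by rewrite ltn_neqAle iD' andbT; apply: contra iD => /eqP iD; apply/eqP/val_inj.
  by rewrite [rho`__]nth_default ?mulr0 // (leq_trans srho) //; lia.
have [|i|n Hn] := IH ((g`_D)%:P * rho').
- rewrite mul_polyC; apply: leq_trans (size_scale_leq _ _) _; exact: size_poly.
- have -> : g * ((g`_D)%:P * rho') =
      (g`_D)%:P * (g * rho) - (g`_D * rho`_e)%:P * (g * 'X^e).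
    by rewrite [in g * rho]rhoE rmorphM; ring.
  rewrite coefB !coefCM; apply: idealB; first by apply: idealMl.
  by apply: idealMr.
exists n.+1 => i; rewrite rhoE coefD mulrDr; apply: idealD.
  by have := Hn i; rewrite coefCM mulrA -exprSr.
rewrite coefCM exprSr -mulrA; apply: idealMl; rewrite mulrA; apply: idealMr; exact: top.
Qed.

Lemma free_coef (b : ideal R) j (gs : seq R) : b = adds (zideal _) gs ->
  (forall g, g \in gs -> free_of j g) -> forall u, b u -> forall i, b (upoly j u)`_i.
Proof.
move=> bE Hfree.
have iW : is_ideal [set u | forall i, b (upoly j u)`_i].
  split=> /= [i|u v Hu Hv i|a u Hu i].
  - by rewrite -mpolyC0 upolyC mpolyC0 coef0; apply: ideal0.
  - by rewrite upolyD coefD; exact: (idealD (Hu i) (Hv i)).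
  - by rewrite upolyM coefM; apply: ideal_sum => l; exact: (idealMl _ (Hu _)).
move=> u; rewrite {1}bE; apply: (@adds_sub _ (zideal _) gs (Ideal iW)).
  by apply: gen_sub.
move=> g ggs i; rewrite (Hfree _ ggs) coefC; case: eqP => _; last exact: ideal0.
by rewrite bE; apply: mem_adds.
Qed.

(** The ideal is extended from the polynomials without X_j, and the leading coefficient of g in X_j
    is a unit at P. *)
Lemma preg_free (P : prime_ideal R) j (gs : seq R) g D :
  (forall h, h \in gs -> free_of j h) ->
  (size (upoly j g) <= D.+1)%N -> ~ P (upoly j g)`_D ->
  preg P (adds (zideal _) gs) g.
Proof.
move=> Hfree sg PD r [s Ps Hs]; set b := adds _ _ in Hs *.
have [n Hn] : exists n, forall i, b ((upoly j g)`_D ^+ n * (upoly j (s * r))`_i).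
  apply: poly_lead_regular => // i; rewrite -upolyM.
  by apply: (free_coef (erefl b) Hfree); rewrite mulrCA.
apply: (sat_unit Ps); exists ((upoly j g)`_D ^+ n); first by move/prime_pow.
rewrite -(upolyK j (s * r)) horner_coef mulr_sumr; apply: ideal_sum => i.
by rewrite mulrA; apply: idealMr.
Qed.

Lemma indep_witness (P : prime_ideal R) E j : indep P E -> ~ indep P (j :: E) ->
  j \notin E -> exists g D, [/\ P g, forall l, l \notin j :: E -> free_of l g,
   (size (upoly j g) <= D.+1)%N & ~ P (upoly j g)`_D].
Proof.
move=> HE nHE jE.
have [N [c [s [ss cs Pp]]]] : exists N c s, [/\ s \in allseqs N (size (j :: E)),
    c s != 0 & P (psum N [seq 'X_l | l <- j :: E] c)].
  apply: contrapT => H; apply: nHE => N c s ss cs Pp; apply: H.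
  by exists N, c, s.
case: s ss cs => [|j0 s0]; first by move=> /allpairsP[[? ?] []].
rewrite [size _]/= allseqsS => /andP[j0N s0m] cs.
pose nz i := `[< exists2 s, s \in allseqs N (size E) & c (i :: s) != 0 >].
have exj : exists i, nz i && (i <= N)%N.
  by exists j0; rewrite j0N andbT; apply/asboolP; exists s0.
have [|D /andP[/asboolP[s1 s1m cs1] DN] maxD] := ex_maxnP exj (m := N).
  by move=> i /andP[].
pose G i := psum N [seq 'X_l | l <- E] (fun s => c (i :: s)).
pose g := psum N [seq 'X_l | l <- j :: E] c.
have ug : upoly j g = \sum_(i < N.+1) (G i)%:P * 'X^i.
  rewrite /g /= upoly_sum; apply: eq_bigr => i _.
  by rewrite upolyM upoly_exp upolyX eqxx (free_psum _ _ jE) mulrC.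
have ugi i : (i <= N)%N -> (upoly j g)`_i = G i.
  move=> iN; rewrite ug coef_sum (bigD1 (Ordinal (iN : (i < N.+1)%N))) //=.
  rewrite coefCM coefXn eqxx mulr1 big1 ?addr0 // => l li.
  rewrite coefCM coefXn; case: eqP => [E'|]; rewrite ?mulr0 //.
  by case/eqP: li; apply: val_inj.
exists g, D; split=> //.
- by move=> l; apply: free_psum.
- apply/leq_sizeP => i Di; have [Ni|iN] := ltnP N i.
    rewrite ug coef_sum big1 // => l _; rewrite coefCM coefXn.
    by case: eqP => [E'|]; rewrite ?mulr0 //; move: (ltn_ord l); rewrite ltnS leqNgt -E' Ni.
  rewrite ugi //; apply: psum_eq0 => t tm; rewrite size_map in tm.
  apply/eqP; apply: contrapT => /negP ct.
  have := maxD i; rewrite iN andbT leqNgt Di => H; apply: notF; apply: H.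
  by apply/asboolP; exists t.
- by rewrite ugi //; apply: HE cs1.
Qed.

Lemma regseq_take (T : comPzRingType) (P : prime_ideal T) b xs n :
  regseq P b xs -> regseq P b (take n xs).
Proof.
elim: n xs b => [|n IH] [|x xs] b //= [Px xb Hxs]; split=> //; exact: IH.
Qed.

(* the localizations of R are Cohen-Macaulay: if E is a maximal set of variables
   algebraically independent modulo P, then ht P <= d - |E| and each other
   variable X_j satisfies modulo P an equation in X_E, X_j; these equations form a
   regular sequence at P *)
Lemma mpoly_CM (P : prime_ideal R) n : prime_ht_ge P n ->
  exists2 xs, size xs = n & regseq P (zideal _) xs.
Proof.
move=> Hn; have [E HE maxE] := indep_max P.
have /choice[g Hg] : forall j, exists g, j \notin E ->
  [/\ P g, forall l, l \notin j :: E -> free_of l g & exists D,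
      (size (upoly j g) <= D.+1)%N /\ ~ P (upoly j g)`_D].
  move=> j; case: (boolP (j \in E)) => jE; first by exists 0.
  have [g [D [Pg gfree sg PD]]] := indep_witness HE (maxE j) jE.
  by exists g => _; split=> //; exists D.
pose js := [seq j <- enum 'I_d | j \notin E].
have reg (s : seq 'I_d) : uniq s -> (forall j, j \in s -> j \notin E) ->
    regseq P (zideal _) (map g s).
  elim/last_ind: s => [|s j IH] //; rewrite rcons_uniq => /andP[js_ us] Hs.
  have jE : j \notin E by apply: Hs; rewrite mem_rcons inE eqxx.
  have [Pg _ [D [sg PD]]] := Hg _ jE.
  rewrite map_rcons; apply/regseq_rcons; split=> //.
    by apply: IH => // l ls; apply: Hs; rewrite mem_rcons inE ls orbT.
  apply: preg_free sg PD => _ /mapP[l ls ->].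
  have lE : l \notin E by apply: Hs; rewrite mem_rcons inE ls orbT.
  have [_ gfree _] := Hg _ lE; apply: gfree; rewrite inE negb_or jE andbT.
  by apply: contraNneq js_ => ->.
exists (take n (map g js)); last first.
  by apply: regseq_take; apply: reg;
    [exact: filter_uniq (enum_uniq _)|move=> j; rewrite mem_filter => /andP[]].
rewrite size_takel // size_map size_filter.
have := ht_indep Hn HE.
have le1 : (count (fun j => j \in E) (enum 'I_d) <= size E)%N.
  by rewrite -size_filter; apply: uniq_leq_size;
    [exact: filter_uniq (enum_uniq _)|move=> j; rewrite mem_filter => /andP[]].
have := count_predC (fun j => j \in E) (enum 'I_d); rewrite size_enum_ord.
move: le1; set x := count _ _; set y := count _ _ => le1 E1.
lia.
Qed.

End PolynomialCohenMacaulay.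

(** * Deformation of the generators of a local reduction *)

Section Swap.
Variables (k : fieldType) (T : comPzRingType) (iota : {rmorphism k -> T}).
Hypothesis infk : infinite_set [set: k].
Hypothesis noethT : noeth T.
Hypothesis domT : forall x y : T, x * y = 0 -> x = 0 \/ y = 0.
Variables (I : ideal T) (m : nat).
Hypothesis I_neq0 : exists2 x, I x & x <> 0.
Hypothesis CM : forall (P : prime_ideal T) n, prime_ht_ge P n ->
  exists2 xs, size xs = n & regseq P (zideal T) xs.
Hypothesis Gd : forall (P : prime_ideal T) h, I `<=` P -> prime_ht P h ->
  (h < m.+1)%N -> gens I P (zideal T) h.
Hypothesis S2 : forall i (K : ideal T) (P : prime_ideal T) a z, (i + 2 <= m.+1)%N ->
  geometric_residual_intersection i I K ->
  (forall r, K (a * r) -> K r) -> K `<=` P -> ~ addg K a z ->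
  (forall r, P r <-> addg K a (r * z)) ->
  forall P0 P1 : prime_ideal T, K `<=` P0 -> P0 `<` P1 -> P1 `<` P -> False.

Definition node_poly (ts : seq k) : {poly k} := \prod_(s <- ts) ('X - s%:P).

Lemma size_node_poly ts : size (node_poly ts) = (size ts).+1.
Proof. exact: size_prod_XsubC. Qed.

Lemma mom_shift (c : 'I_m.+1 -> T) (t : k) e ts s : size ts = m ->
  mom iota (fun i => c i + iota (t * (node_poly ts)`_i) * e) s =
  mom iota c s + iota t * (iota (node_poly ts).[s] * e).
Proof.
move=> sts; rewrite /mom horner_coef size_node_poly sts rmorph_sum mulr_suml mulr_sumr.
rewrite -big_split; apply: eq_bigr => i _ /=.
by rewrite mulrDr !rmorphM /=; congr (_ + _); ring.
Qed.

(* the direction of the deformation of c has to be orthogonal to all the a_i but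
   the last, which are combinations of the c_i along the moment curve: it is
   given by the coefficients of the polynomial that vanishes at the nodes *)
Lemma swap (c : 'I_m.+1 -> T) (C : seq k -> k -> Prop) N e x :
  gen (range c) `<=` I ->
  (forall q : prime_ideal T, I `<=` q -> ~ prime_ht_ge q m.+1 ->
    exists2 s, ~ q s & forall x, I x -> gen (range c) (s * x)) ->
  (forall q : prime_ideal T, gen (range c) `<=` q -> I `<=` q) ->
  exp_ideal I N.+1 `<=` mul_ideal (gen (range c)) (exp_ideal I N) ->
  (forall ts, cof (C ts)) -> I e -> I x ->
  exists ts, [/\ size ts = m, forall j, (j < m)%N -> C (take j ts) (nth 0 ts j) &
    cof (fun t => gen (range (fun i : 'I_m.+1 =>
      c i + iota (t * (node_poly ts)`_i) * e)) x) -> gen (range c) x].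
Proof.
move=> JI Jlow Jrad Hred HC Ie Ix.
have [IJ|IJ] := pselect (I `<=` gen (range c)).
  have /(_ m)[ts [sts Hts]] : forall n, exists ts, size ts = n /\
      forall j, (j < n)%N -> C (take j ts) (nth 0 ts j).
    elim=> [|n [ts [sts Hts]]]; first by exists [::].
    have [t Ht] := cof_ex infk (HC ts); exists (rcons ts t).
    rewrite size_rcons sts; split=> // j; rewrite ltnS leq_eqVlt => /orP[/eqP ->|jn].
      by rewrite -sts -cats1 take_size_cat // nth_cat ltnn subnn.
    rewrite -cats1 takel_cat ?sts 1?ltnW // nth_cat sts jn; exact: Hts.
  by exists ts; split=> // _; apply: IJ.
have [ts [sts uts Cts Htw Hnzd]] := tower_last iota infk noethT domT I_neq0 CM Gd S2
  (leqnn _) JI IJ Jlow Jrad HC (erefl m.+1).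
have stk : size (take m ts) = m by rewrite size_takel // sts.
exists (take m ts); split=> // [j jm|Hx].
  by rewrite take_takel 1?ltnW // nth_take //; apply: Cts.
set Z := node_poly _ in Hx.
have Zlast : Z.[nth 0 ts m] != 0.
  rewrite -/(root _ _) root_prod_XsubC; apply/negP => H.
  move: uts; rewrite -(cat_take_drop m ts) cat_uniq => /and3P[_ /hasPn H' _].
  have /H' : nth 0 ts m \in drop m ts.
    by rewrite -[m in nth _ _ m]addn0 -nth_drop mem_nth // size_drop sts subSnn.
  by rewrite /= H.
apply: (@tower_exchange k T iota infk noethT I m.+1 m c ts N
  (iota Z.[nth 0 ts m] * e) x) => //; first exact: idealMl.
apply: cof_sub Hx => t.
set ct := fun i => _; set W := addg _ _ => Hx.
suff ctW : gen (range ct) `<=` W by apply: ctW.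
have Wm (i : 'I_m.+1) : W (mom iota ct (nth 0 ts i)).
  rewrite mom_shift //; have := ltn_ord i; rewrite ltnS leq_eqVlt => /orP[/eqP ->|im].
    exact: mem_addg.
  have zi : nth 0 ts i \in take m ts.
    by rewrite -(nth_take 0 im) mem_nth // stk.
  have -> : (node_poly (take m ts)).[nth 0 ts i] = 0.
    by apply/eqP; rewrite -/(root _ _) root_prod_XsubC.
  by rewrite rmorph0 mul0r mulr0 addr0; apply: sub_addg; apply: mem_adds; apply: map_f.
apply: gen_sub => _ [j _ <-]; move: j; apply: (mom_all _ Wm) => i j /eqP.
by rewrite nth_uniq ?sts // => /eqP /val_inj.
Qed.

End Swap.

(** * Transfer of the hypotheses to the localization at m *)

Section LocalizationTransfer.
Variables (A : comPzRingType) (P : prime_ideal A).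

Lemma sat_ploc (Q : prime_ideal A) (QP : Q `<=` P) (b : ideal A) r :
  sat (ploc QP) (loc_ideal P b) (to_loc P r) <-> sat Q b r.
Proof.
split=> [[y Qy]|[s Qs bs]]; last first.
  exists (to_loc P s); first by move/plocE.
  by rewrite -rmorphM; apply: sub_gen; exists (s * r).
elim/locW: y Qy => a s Ps Qy.
have -> : mkfrac a Ps * to_loc P r = mkfrac (a * r) Ps.
  by rewrite mulL; apply: eq_mkfrac; ring.
move/loc_ideal_mkfrac => [w Pw H]; exists (w * a); last by rewrite -mulrA.
by apply: prime_mulN => [/QP //|Qa]; apply: Qy; apply/plocE.
Qed.

Lemma loc_addg (b : ideal A) y : loc_ideal P (addg b y) = addg (loc_ideal P b) (to_loc P y).
Proof.
apply: eq_ideal; apply/seteqP; split.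
  apply: gen_sub => _ [a /addgP[r Hr] <-]; apply/addgP; exists (to_loc P r).
  by rewrite -rmorphM -rmorphB; apply: sub_gen; exists (a - r * y).
apply: addg_sub; last by apply: sub_gen; exists y => //; apply: mem_addg.
by apply: loc_ideal_mono => a ba; apply: sub_sat; apply: sub_addg.
Qed.

Lemma loc_zideal : loc_ideal P (zideal A) = zideal _.
Proof.
apply: eq_ideal; apply/seteqP; split; last by apply: gen_sub.
by apply: gen_sub => _ [a /zidealP -> <-]; apply/zidealP; rewrite rmorph0.
Qed.

Lemma regseq_ploc (Q : prime_ideal A) (QP : Q `<=` P) b xs :
  regseq Q b xs -> regseq (ploc QP) (loc_ideal P b) (map (to_loc P) xs).
Proof.
elim: xs b => [|x xs IH] b //= [Qx xb Hxs]; rewrite -loc_addg; split; last exact: IH.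
  by apply/plocE.
elim/locW=> a s Ps; have -> : to_loc P x * mkfrac a Ps = mkfrac (x * a) Ps.
  by rewrite mulL; apply: eq_mkfrac; ring.
by move/ideal_mkfrac/sat_ploc/xb => H; apply/ideal_mkfrac/sat_ploc.
Qed.

End LocalizationTransfer.
Section LocalFacts.
Variables (k : fieldType) (d : nat).
Local Notation R := {mpoly k[d]}.
Local Notation m := (max_ideal k d).
Local Notation T := (loc m).
Variable I : ideal R.
Hypothesis I_neq0 : exists2 p, I p & p != 0.
Hypothesis HG : satisfies_G d I.
Hypothesis HS : weakly_residually_S2 (d%:Z - 2) (loc_ideal m I).

Definition loc_const : {rmorphism k -> T} := (to_loc m \o @mpolyC d k)%FUN.

Lemma loc_constE c : loc_const c = to_loc m c%:MP. Proof. by []. Qed.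

Lemma loc_domain (x y : T) : x * y = 0 -> x = 0 \/ y = 0.
Proof.
elim/locW: x => a s Ps; elim/locW: y => b t Pt; rewrite mulL => /mkfrac_eq0[w Pw] /eqP.
rewrite !mulf_eq0 => /or3P[/eqP w0|/eqP ->|/eqP ->].
- by case: Pw; rewrite w0; apply: ideal0.
- by left; apply/mkfrac_eq0; exists 1; [apply: prime_proper|rewrite mulr0].
- by right; apply/mkfrac_eq0; exists 1; [apply: prime_proper|rewrite mulr0].
Qed.

Lemma loc_noeth : noeth T. Proof. exact: noeth_loc (@noeth_mpoly k d). Qed.

Lemma loc_neq0 : exists2 x, loc_ideal m I x & x <> 0.
Proof.
have [p Ip pn0] := I_neq0; exists (to_loc m p); first by apply: sub_gen; exists p.
by move=> /mkfrac_eq0[w Pw /eqP]; rewrite mulf_eq0 (negbTE pn0) orbF => /eqP w0;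
  apply: Pw; rewrite w0; apply: ideal0.
Qed.

Lemma loc_CM (Q : prime_ideal T) n : prime_ht_ge Q n ->
  exists2 xs, size xs = n & regseq Q (zideal T) xs.
Proof.
move=> /pcontr_ht/mpoly_CM[xs sxs Hxs]; exists (map (to_loc m) xs); first by rewrite size_map.
by rewrite -(ploc_contr Q) -loc_zideal; apply: regseq_ploc.
Qed.

Lemma G_gens (q : prime_ideal R) h : I `<=` q -> prime_ht q h -> (h < d)%N ->
  gens I q (zideal R) h.
Proof.
move=> Iq qh hd; have [n [[c Ec] _] nh] := HG Iq qh hd.
apply: gens_mono nh _.
have H i : exists a, I a /\ exists s (Ps : ~ q s), c i = mkfrac a Ps.
  have : loc_ideal q I (c i) by rewrite Ec; apply: sub_gen; exists i.
  by move=> /loc_idealP[a [s [Ps [Ia E]]]]; exists a; split=> //; exists s, Ps.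
have [w Hw] := choice H; exists w; split=> [i|]; first by have [] := Hw i.
have Ew : loc_ideal q I `<=` loc_ideal q (gen (range w)).
  rewrite Ec; apply: gen_sub => _ [i _ <-]; have [_ [s [Ps ->]]] := Hw i.
  by apply/loc_ideal_mkfrac/sub_sat; apply: sub_gen; exists i.
have [s qs Hs] : exists2 s, ~ q s & forall x, I x -> gen (range w) (s * x).
  apply: (sat_denom (@noeth_mpoly k d)) => x Ix; apply/loc_ideal_to_loc; apply: Ew.
  by apply: sub_gen; exists x.
by exists s => // x /Hs; apply: add_idealR.
Qed.

Lemma gens_ploc (q : prime_ideal R) (qm : q `<=` m) h : gens I q (zideal R) h ->
  gens (loc_ideal m I) (ploc qm) (zideal T) h.
Proof.
move=> [w [Iw [s qs Hs]]]; exists (fun i => to_loc m (w i)); split.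
  by move=> i; apply: sub_gen; exists (w i).
exists (to_loc m s); first by move/plocE.
move=> y /loc_idealP[a [t [Pt [/Hs Ia ->]]]].
have -> : to_loc m s * mkfrac a Pt = mkfrac (s * a) Pt.
  by rewrite mulL; apply: eq_mkfrac; ring.
apply/ideal_mkfrac; rewrite -loc_ideal_gen; move: Ia => /add_idealP[i [j [/zidealP -> Hj ->]]].
by rewrite add0r; apply: add_idealR; apply: sub_gen; exists j.
Qed.

Lemma loc_sub (J : ideal R) (Q : prime_ideal T) :
  loc_ideal m J `<=` Q <-> J `<=` pcontr (to_loc m) Q.
Proof.
split=> H a Ja; first by apply: H; apply: sub_gen; exists a.
by move: a Ja; apply: gen_sub => _ [a Ja <-]; apply: H.
Qed.

Lemma loc_ht (Q : prime_ideal T) n :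
  prime_ht_ge (pcontr (to_loc m) Q) n -> prime_ht_ge Q n.
Proof. by rewrite -{2}(ploc_contr Q); apply: ploc_ht. Qed.

Lemma loc_G (Q : prime_ideal T) h : loc_ideal m I `<=` Q -> prime_ht Q h ->
  (h < d)%N -> gens (loc_ideal m I) Q (zideal T) h.
Proof.
move=> /loc_sub IQ [Qh Qh'] hd; rewrite -(ploc_contr Q); apply: gens_ploc.
by apply: G_gens => //; split; [apply: pcontr_ht|move=> /loc_ht].
Qed.

Lemma loc_S2 i (K : ideal T) (P : prime_ideal T) a z : (i + 2 <= d)%N ->
  geometric_residual_intersection i (loc_ideal m I) K ->
  (forall r, K (a * r) -> K r) -> K `<=` P -> ~ addg K a z ->
  (forall r, P r <-> addg K a (r * z)) ->
  forall P0 P1 : prime_ideal T, K `<=` P0 -> P0 `<` P1 -> P1 `<` P -> False.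
Proof.
move=> id2 geoK; apply: serre_S2_assoc; apply: HS geoK; lia.
Qed.

Hypothesis infk : infinite_set [set: k].

Lemma loc_gen_sub n (c : 'I_n -> R) (J : ideal R) :
  loc_ideal m J `<=` gen (range (fun i => to_loc m (c i))) -> J `<=` sat m (gen (range c)).
Proof.
rewrite -loc_ideal_gen => H x Jx; apply/loc_ideal_to_loc; apply: H.
by apply: sub_gen; exists x.
Qed.

Lemma low_loc r (c : 'I_r -> R) n :
  (forall q : prime_ideal R, q `<=` m -> I `<=` q -> ~ prime_ht_ge q n ->
    I `<=` sat q (gen (range c))) ->
  forall Q : prime_ideal T, loc_ideal m I `<=` Q -> ~ prime_ht_ge Q n ->
  exists2 s, ~ Q s & forall x, loc_ideal m I x ->
    gen (range (fun i => to_loc m (c i))) (s * x).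
Proof.
move=> H Q /loc_sub IQ nQ; have [|s qs Hs] := sat_denom (@noeth_mpoly k d)
    (H (pcontr (to_loc m) Q) (@pcontr_sub _ _ Q) IQ _).
  by move=> /loc_ht.
exists (to_loc m s) => // y /loc_idealP[a [t [Pt [/Hs Ia ->]]]].
have -> : to_loc m s * mkfrac a Pt = mkfrac (s * a) Pt.
  by rewrite mulL; apply: eq_mkfrac; ring.
by apply/ideal_mkfrac; rewrite -loc_ideal_gen; apply: sub_gen; exists (s * a).
Qed.

Lemma red_at (p : prime_ideal R) n r (c : 'I_r -> R) N : p `<=` m -> (0 < n <= d)%N ->
  gen (range c) `<=` I -> I `<=` p -> gens I p (zideal R) n ->
  (forall q : prime_ideal R, q `<=` m -> I `<=` q -> ~ prime_ht_ge q n ->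
    I `<=` sat q (gen (range c))) ->
  (forall q : prime_ideal R, gen (range c) `<=` q -> I `<=` q) ->
  exp_ideal I N.+1 `<=` sat p (mul_ideal (gen (range c)) (exp_ideal I N)) ->
  I `<=` sat p (gen (range c)).
Proof.
move=> pm /andP[n0 nd] JI Ip Hn Hlow Hrad Hred.
have [IJ|IJ] := pselect (loc_ideal m I `<=` gen (range (fun i => to_loc m (c i)))).
  by apply: subset_trans (loc_gen_sub IJ) _; apply: sat_le.
move=> x Ix; rewrite -(sat_ploc pm).
have := @reduction_eq_at _ _ loc_const infk loc_noeth loc_domain _ d loc_neq0 loc_CM
  loc_G loc_S2 n r (fun i => to_loc m (c i)) nd _ IJ (low_loc Hlow) _ (ploc pm) N n0.
rewrite -!loc_ideal_gen -!loc_ideal_exp -loc_ideal_mul => H; apply: H.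
- by apply: loc_ideal_mono; apply: subset_trans JI _; apply: sub_sat.
- by move=> Q /loc_sub JQ; apply/loc_sub; apply: Hrad.
- by apply: (@loc_ideal_mono _ m I p); apply: subset_trans Ip _; apply: sub_sat.
- exact: gens_ploc.
- elim/locW=> a s Ps /ideal_mkfrac/loc_ideal_to_loc[t mt /Hred H]; apply/ideal_mkfrac.
  apply/sat_ploc; apply: sat_unit H; by move=> /pm.
- by apply: sub_gen; exists x.
Qed.

End LocalFacts.

Lemma swap_at (k : fieldType) (m : nat) (I : ideal {mpoly k[m.+1]})
    (c : 'I_m.+1 -> {mpoly k[m.+1]}) (C : seq k -> k -> Prop) N e x :
  infinite_set [set: k] -> (exists2 p, I p & p != 0) -> satisfies_G m.+1 I ->
  weakly_residually_S2 (m.+1%:Z - 2) (loc_ideal (max_ideal k m.+1) I) ->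
  gen (range c) `<=` I ->
  (forall q : prime_ideal _, q `<=` max_ideal k m.+1 -> I `<=` q ->
    ~ prime_ht_ge q m.+1 -> I `<=` sat q (gen (range c))) ->
  exp_ideal I N.+1 `<=`
    sat (max_ideal k m.+1) (mul_ideal (gen (range c)) (exp_ideal I N)) ->
  (forall ts, cof (C ts)) -> I e -> I x ->
  exists ts, [/\ size ts = m, forall j, (j < m)%N -> C (take j ts) (nth 0 ts j) &
    cof (fun t => sat (max_ideal k m.+1) (gen (range (fun i : 'I_m.+1 =>
      c i + (t * (node_poly ts)`_i) *: e))) x) ->
    sat (max_ideal k m.+1) (gen (range c)) x].
Proof.
move=> infk I0 HG HS JI Hlow Hred HC Ie Ix.
set M := max_ideal k m.+1 in Hlow Hred *.
have := @swap _ _ (@loc_const k m.+1) infk (@loc_noeth _ _) (@loc_domain _ _)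
  (loc_ideal M I) m (loc_neq0 I0) (@loc_CM _ _)
  (loc_G HG) (loc_S2 HS) (fun i => to_loc M (c i)) C N (to_loc M e) (to_loc M x).
rewrite -!loc_ideal_gen -!loc_ideal_exp -loc_ideal_mul => H.
have [| | | | |||ts [sts Cts Hts]] := H.
- by apply: loc_ideal_mono; apply: subset_trans JI _; apply: sub_sat.
- by have := low_loc Hlow; rewrite -loc_ideal_gen.
- move=> Q /loc_sub JQ; apply/loc_sub => y Iy.
  have [s ms Hs] := Hred _ (exp_ideal_pow N.+1 Iy).
  apply: (@prime_pow _ _ _ N.+1).
  have /prime_mul[/(@pcontr_sub _ _ Q)//|//] : pcontr (to_loc M) Q (s * y ^+ N.+1).
  exact: JQ (mul_ideal_subl Hs).
- exact: loc_ideal_mono.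
- exact: HC.
- by apply: sub_gen; exists e.
- by apply: sub_gen; exists x.
exists ts; split=> // Hx; apply/loc_ideal_to_loc; apply: Hts.
apply: cof_sub Hx => t /loc_ideal_to_loc; rewrite loc_ideal_gen.
set F := fun i : 'I_m.+1 => _; set F' := fun i : 'I_m.+1 => _.
suff -> : F = F' by [].
apply/funext => i; rewrite /F /F' loc_constE -mul_mpolyC.
by rewrite rmorphD rmorphM.
Qed.

(** * Monomial ideals and monomial primes *)

Section MonomialTools.
Variables (k : fieldType) (d : nat).
Local Notation R := {mpoly k[d]}.
Implicit Types (I J : ideal R) (a b g m : 'X_{1..d}) (S : {set 'I_d}).

Definition mon_lin (V : lmodType k) (F : 'X_{1..d} -> V) (p : R) : V :=
  \sum_(m <- msupp p) p@_m *: F m.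

Lemma mon_linE (V : lmodType k) (F : 'X_{1..d} -> V) B p : (msize p <= B)%N ->
  mon_lin F p = \sum_(m : 'X_{1..d < B}) p@_m *: F m.
Proof.
move=> lt_pB; pose J : subFinType _ := 'X_{1..d < B}.
rewrite /mon_lin (big_mksub J) //=; first last.
- by move=> x /msize_mdeg_lt /leq_trans; apply.
- by rewrite msupp_uniq.
by rewrite big_rmcond //= => i; move/memN_msupp_eq0=> ->; rewrite scale0r.
Qed.

Lemma mon_lin_linear (V : lmodType k) (F : 'X_{1..d} -> V) : linear (mon_lin F).
Proof.
move=> c p q; pose B := (msize p + msize q + msize (c *: p + q))%N.
rewrite !(@mon_linE _ F B); try by rewrite /B; lia.
rewrite scaler_sumr -big_split /=; apply: eq_bigr => m _.
by rewrite mcoeffD mcoeffZ scalerDl scalerA.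
Qed.
HB.instance Definition _ (V : lmodType k) (F : 'X_{1..d} -> V) :=
  GRing.isLinear.Build k R V *:%R (mon_lin F) (mon_lin_linear F).

Lemma mon_linZ (V : lmodType k) (F : 'X_{1..d} -> V) c p :
  mon_lin F (c *: p) = c *: mon_lin F p.
Proof. by rewrite -[c *: p]addr0 mon_lin_linear raddf0 addr0. Qed.

Lemma mon_linX (V : lmodType k) (F : 'X_{1..d} -> V) m : mon_lin F 'X_[m] = F m.
Proof. by rewrite /mon_lin msuppX big_seq1 mcoeffX eqxx scale1r. Qed.

Lemma mon_linM (F F1 F2 : 'X_{1..d} -> R) p q :
  (forall a b, p@_a != 0 -> q@_b != 0 -> F (a + b)%MM = F1 a * F2 b) ->
  mon_lin F (p * q) = mon_lin F1 p * mon_lin F2 q.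
Proof.
move=> H; rewrite {1}[p]mpolyE {1}[q]mpolyE mulr_suml raddf_sum mulr_suml.
rewrite !big_seq; apply: eq_bigr => a; rewrite mcoeff_msupp => pa.
rewrite mulr_sumr raddf_sum mulr_sumr !big_seq; apply: eq_bigr => b.
rewrite mcoeff_msupp => qb; rewrite -scalerAl -scalerAr scalerA -mpolyXD.
by rewrite /= mon_linZ mon_linX H // -scalerAl -scalerAr scalerA.
Qed.

Lemma eq_mon_lin (V : lmodType k) (F G : 'X_{1..d} -> V) p :
  (forall m, p@_m != 0 -> F m = G m) -> mon_lin F p = mon_lin G p.
Proof.
by move=> H; rewrite /mon_lin !big_seq; apply: eq_bigr => m; rewrite mcoeff_msupp => /H ->.
Qed.

Definition monoidl I : Prop := forall p m, I p -> p@_m != 0 -> I 'X_[m].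

Lemma ideal_support I p : (forall m, p@_m != 0 -> I 'X_[m]) -> I p.
Proof.
move=> H; rewrite [p]mpolyE big_seq.
apply: (big_ind (fun q => I q)) => [|x y|m]; [exact: ideal0|exact: idealD|].
by rewrite mcoeff_msupp => /H Im; rewrite -mul_mpolyC; apply: idealMl.
Qed.

Lemma supp_mul (p q : R) m : (p * q)@_m != 0 ->
  exists a b, [/\ p@_a != 0, q@_b != 0 & m = (a + b)%MM].
Proof.
rewrite -mcoeff_msupp => /msuppM_le /allpairsP[[a b] [/= pa qb ->]].
by exists a, b; rewrite -!mcoeff_msupp.
Qed.

Lemma monoidl_gen (M : set 'X_{1..d}) : monoidl (gen [set 'X_[k, m] | m in M]).
Proof.
set I := gen _; have iW : is_ideal [set p : R | forall m, p@_m != 0 -> I 'X_[m]].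
  split=> /= [m|p q Hp Hq m|a p Hp m].
  - by rewrite mcoeff0 eqxx.
  - rewrite mcoeffD; have [p0|/Hp//] := eqVneq p@_m 0.
    by rewrite p0 add0r; apply: Hq.
  - by move=> Hm; have [x [y [_ /Hp Iy ->]]] := supp_mul Hm; rewrite mpolyXD; apply: idealMl.
move=> p m Ip; suff H : Ideal iW p by exact: H.
apply: Ip => _ [a Ma <-] b; rewrite mcoeffX; case: (a =P b) => [<- _|_]; last by rewrite mulr0n eqxx.
by apply: sub_gen; exists a.
Qed.

Lemma monomial_monoidl I : is_monomial_ideal I -> monoidl I.
Proof. by move=> [M ->]; apply: monoidl_gen. Qed.

Lemma monoidl_monomial I : monoidl I -> is_monomial_ideal I.
Proof.
move=> mI; exists [set m | I 'X_[m]]; apply: eq_ideal; apply/seteqP; split.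
  by move=> p Ip; apply: ideal_support => m /(mI _ _ Ip) Im; apply: sub_gen; exists m.
by apply: gen_sub => _ [m Im <-].
Qed.

Lemma monoidl_mul I J : monoidl I -> monoidl J -> monoidl (mul_ideal I J).
Proof.
move=> mI mJ.
have -> : mul_ideal I J = gen [set 'X_[k, m] | m in
    [set m | exists a b, [/\ I 'X_[a], J 'X_[b] & m = (a + b)%MM]]].
  apply: eq_ideal; apply/seteqP; split.
    apply: mul_ideal_sub => p q Ip Jq; apply: ideal_support => m Hm.
    have [a [b [pa qb ->]]] := supp_mul Hm.
    apply: sub_gen; exists (a + b)%MM => //; exists a, b; split=> //; [exact: mI pa|exact: mJ qb].
  apply: gen_sub => _ [_ [a [b [Ia Jb ->]]] <-]; rewrite mpolyXD; exact: mul_ideal_mem.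
exact: monoidl_gen.
Qed.

Lemma monoidl_exp I n : monoidl I -> monoidl (exp_ideal I n).
Proof.
move=> mI; elim: n => [p m _ _|n IH]; first exact: gen_setT.
exact: monoidl_mul.
Qed.

Lemma monoidl_gens I : monoidl I -> exists n (w : 'I_n -> 'X_{1..d}),
  (forall i, I 'X_[w i]) /\ I = gen (range (fun i => 'X_[k, w i])).
Proof.
move=> /monoidl_monomial[M IE].
have [n [c [Hc]]] := gen_finite (@noeth_mpoly k d) [set 'X_[k, m] | m in M].
rewrite -IE => Ic; have H i : exists m, 'X_[k, m] = c i by have [m _ <-] := Hc i; exists m.
have [w Hw] := choice H; exists n, w; split=> [i|].
  by rewrite Hw Ic; apply: sub_gen; exists i.
by rewrite Ic; have -> // : c = (fun i => 'X_[k, w i]); apply/funext => i; rewrite Hw.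
Qed.

Lemma monomial_le I a b : (a <= b)%MM -> I 'X_[a] -> I 'X_[b].
Proof. by move=> /submK <-; rewrite mpolyXD; apply: idealMl. Qed.

Lemma monoidl_gens_le n (w : 'I_n -> 'X_{1..d}) m :
  gen (range (fun i => 'X_[k, w i])) 'X_[m] -> exists i, (w i <= m)%MM.
Proof.
move=> /gen_rangeP[a E]; have : ('X_[m] : R)@_m != 0 by rewrite mcoeffX eqxx oner_eq0.
rewrite E raddf_sum /=; have [[i Hi] _|H] := pselect (exists i, (a i * 'X_[w i])@_m != 0).
  have [x [y [_ Hy ->]]] := supp_mul Hi; exists i.
  move: Hy; rewrite mcoeffX; case: (w i =P y) => [<- _|_]; last by rewrite mulr0n eqxx.
  by apply/mnm_lepP => j; rewrite mnmDE leq_addl.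
rewrite big1 ?eqxx // => i _; apply/eqP; apply: contrapT => /negP Hi; apply: H.
by exists i.
Qed.

Definition mres S m : 'X_{1..d} := [multinom (if i \in S then m i else 0%N) | i < d].

Lemma mresE S m i : mres S m i = if i \in S then m i else 0%N.
Proof. exact: mnmE. Qed.
Lemma mresD S a b : mres S (a + b)%MM = (mres S a + mres S b)%MM.
Proof. by apply/mnmP => i; rewrite !(mresE, mnmDE); case: ifP. Qed.
Lemma mres_split S m : m = (mres S m + mres (~: S) m)%MM.
Proof. by apply/mnmP => i; rewrite mnmDE !mresE inE; case: ifP; rewrite ?addn0. Qed.

Definition kill S : R -> R := mmap (@mpolyC d k) (fun i => if i \in S then 0 else 'X_i).
HB.instance Definition _ S := GRing.RMorphism.on (kill S).

Lemma killC S c : kill S c%:MP = c%:MP. Proof. exact: mmapC. Qed.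
Lemma killU S i : kill S 'X_i = if i \in S then 0 else 'X_i.
Proof. by rewrite /kill mmapX mmap1U. Qed.

Lemma killX S m : kill S 'X_[m] = if mres S m == 0%MM then 'X_[m] else 0.
Proof.
rewrite /kill mmapX /mmap1; case: eqP => [m0|m0].
  rewrite [RHS]mpolyXE_id; apply: eq_bigr => i _; case: ifP => // iS.
  by have /mnmP/(_ i) := m0; rewrite mresE iS mnm0E => ->; rewrite !expr0.
have [i [iS mi]] : exists i, i \in S /\ m i != 0%N.
  apply: contrapT => H; apply: m0; apply/mnmP => i; rewrite mresE mnm0E.
  case: ifP => // iS; apply/eqP; apply: contrapT => /negP mi; apply: H.
  by exists i.
by rewrite (bigD1 i) //= iS expr0n (negbTE mi) mul0r.
Qed.

Lemma mpoly_dom (x y : R) : x * y = 0 -> x = 0 \/ y = 0.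
Proof. by move=> /eqP; rewrite mulf_eq0 => /orP[] /eqP; [left|right]. Qed.

Lemma zero_ideal1 : ~ zideal R 1.
Proof. by move/zidealP/eqP; rewrite oner_eq0. Qed.
Lemma zero_idealM (x y : R) : zideal R (x * y) -> zideal R x \/ zideal R y.
Proof. by rewrite !zidealP; apply: mpoly_dom. Qed.
Definition zero_prime : prime_ideal R := PrimeIdeal zero_ideal1 zero_idealM.

(* the prime ideal (X_i, i in S) *)
Definition mprime S : prime_ideal R := pcontr (kill S : {rmorphism R -> R}) zero_prime.

Lemma mprimeP S p : mprime S p <-> kill S p = 0.
Proof. exact: zidealP. Qed.

Lemma mprimeU S i : mprime S 'X_i <-> i \in S.
Proof.
rewrite mprimeP killU; case: ifP => // _; split=> // /(congr1 (mcoeff U_(i)%MM)).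
by rewrite mcoeffX eqxx mcoeff0 => /eqP; rewrite oner_eq0.
Qed.

Lemma kill_sub S (P : ideal R) p : (forall i, i \in S -> P 'X_i) -> P (p - kill S p).
Proof.
move=> HP; elim/mpoly_ring_ind: p => [c|i|p q IHp IHq|p q IHp IHq].
- by rewrite killC subrr; apply: ideal0.
- by rewrite killU; case: ifP => [/HP|]; rewrite ?subr0 // subrr => _; apply: ideal0.
- by rewrite rmorphD opprD addrACA; apply: idealD.
- have -> : p * q - kill S (p * q) = (p - kill S p) * q + kill S p * (q - kill S q).
    by rewrite rmorphM; ring.
  by apply: idealD; [apply: idealMr|apply: idealMl].
Qed.

Lemma mprime_sub S (P : prime_ideal R) : (forall i, i \in S -> P 'X_i) -> mprime S `<=` P.
Proof.
by move=> HP p /mprimeP p0; have := kill_sub p HP; rewrite p0 subr0.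
Qed.

Lemma max_idealU i : max_ideal k d 'X_i.
Proof. by apply: sub_gen; exists i. Qed.

Lemma mprime_max S : mprime S `<=` max_ideal k d.
Proof. by apply: mprime_sub => i _; apply: max_idealU. Qed.

Lemma max_mprime (P : prime_ideal R) : P `<=` max_ideal k d ->
  (forall i, P 'X_i) -> P = max_ideal k d.
Proof.
move=> Pm H; apply: eq_prime => //; apply: gen_sub => _ [i _ <-]; exact: H.
Qed.

Lemma mprime_lt (S S' : {set 'I_d}) : S \proper S' -> mprime S `<` mprime S'.
Proof.
move=> /properP[SS' [i iS' iS]]; split.
  by apply: mprime_sub => j /(fintype.subsetP SS') /mprimeU.
by move=> H; move/negP: iS; apply; apply/mprimeU/H/mprimeU.
Qed.

Lemma mprime_ht S : prime_ht_ge (mprime S) #|S|.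
Proof.
move cS: #|S| => n; elim: n S cS => [|n IH] S cS; first exact: prime_ht_ge0.
have [i iS] : exists i, i \in S by apply/set0Pn; rewrite -cards_eq0 cS.
apply: (@prime_ht_geS _ _ (mprime (S :\ i))); first exact/mprime_lt/properD1.
by apply: IH; have := cardsD1 i S; rewrite iS cS => -[].
Qed.

Lemma max_ht_ge : prime_ht_ge (max_ideal k d) d.
Proof.
rewrite -(@max_mprime (mprime [set: 'I_d]%SET)); [|exact: mprime_max|by move=> i; apply/mprimeU; rewrite finset.in_setT].
by have := mprime_ht [set: 'I_d]%SET; rewrite cardsT card_ord.
Qed.

Lemma ht_le_dim (P : prime_ideal R) n : prime_ht_ge P n -> (n <= d)%N.
Proof.
move=> /ht_indep H; rewrite -[n]addn0; apply: (H [::]).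
by move=> N c s; rewrite inE => /eqP -> c0 /= Pc; apply: (@prime_proper _ P);
  rewrite -[1]/(1%:MP) -(mulVf c0) rmorphM; apply: idealMl.
Qed.

Lemma mprime_height S : S != [set: 'I_d]%SET -> exists h, prime_ht (mprime S) h /\ (h < d)%N.
Proof.
move=> ST; have [i iS] : exists i, i \notin S.
  by apply/existsP; rewrite -[[exists _, _]]negbK negb_exists; apply: contra ST => /forallP H;
    apply/eqP/setP => i; rewrite inE; have := H i; rewrite negbK.
have [|h hd hh] := @prime_htP _ (mprime S) d; first by move/ht_le_dim; rewrite ltnn.
exists h; split=> //; have [hh1 _] := hh.
have : prime_ht_ge (mprime (i |: S)) h.+1.
  apply: prime_ht_geS hh1; apply: mprime_lt; rewrite properE subsetU1 /=.
  by apply/negP => /fintype.subsetP/(_ i); rewrite !inE eqxx (negbTE iS) => /(_ isT).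
by move/ht_le_dim.
Qed.

End MonomialTools.

(** * The fiber of a monomial ideal at a prime *)

Section PowersOfIdeals.
Variable T : comPzRingType.
Implicit Types (I J W : ideal T) (P : prime_ideal T).

Lemma sat_exp P I J e : I `<=` sat P J -> exp_ideal I e `<=` sat P (exp_ideal J e).
Proof.
move=> IJ; elim: e => [|e IH]; last exact: sat_mul.
exact: sub_sat.
Qed.

Lemma exp_gen_words n (z : 'I_n -> T) e W :
  (forall w : seq 'I_n, size w = e -> W (\prod_(j <- w) z j)) ->
  exp_ideal (gen (range z)) e `<=` W.
Proof.
elim: e W => [|e IH] W HW.
  by move=> x _; rewrite -[x]mulr1; apply: idealMl; have := HW [::] erefl; rewrite big_nil.
apply: mul_ideal_sub => x y Hx Hy; suff : gen (range z) `<=` ann W y by apply.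
apply: gen_sub => _ [j _ <-]; suff : ann W (z j) y by rewrite !annE mulrC.
apply: IH Hy => w sw; rewrite annE mulrC.
by have := HW (j :: w); rewrite big_cons /= sw; apply.
Qed.

Lemma prod_mem_exp I (A : eqType) (z : A -> T) (w : seq A) : (forall j, I (z j)) ->
  exp_ideal I (size w) (\prod_(j <- w) z j).
Proof.
move=> Iz; elim: w => [|j w IH]; first exact: gen_setT.
by rewrite big_cons; apply: mul_ideal_mem.
Qed.

End PowersOfIdeals.

Section FiberMonomials.
Variables (k : fieldType) (d : nat).
Local Notation R := {mpoly k[d]}.
Variable I : ideal R.
Hypothesis mI : monoidl I.
Variable S : {set 'I_d}.

Lemma prime_X (P : prime_ideal R) m : P 'X_[m] -> exists i, m i != 0%N /\ P 'X_i.
Proof.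
rewrite mpolyXE_id => H; apply: contrapT => nH.
suff : ~ P (\prod_(i < d) 'X_i ^+ m i) by apply.
apply/prime_sum => i; have [->|mi] := eqVneq (m i) 0%N; first exact: prime_proper.
by move=> /prime_pow Pi; apply: nH; exists i.
Qed.

Lemma mul_ideal_X (J L : ideal R) m : monoidl J -> monoidl L -> mul_ideal J L 'X_[m] ->
  exists a b, [/\ J 'X_[a], L 'X_[b] & m = (a + b)%MM].
Proof.
move=> mJ mL H.
have iW : is_ideal [set p : R | forall m, p@_m != 0 ->
    exists a b, [/\ J 'X_[a], L 'X_[b] & m = (a + b)%MM]].
  split=> /= [a|p q Hp Hq a|a p Hp x Hx].
  - by rewrite mcoeff0 eqxx.
  - rewrite mcoeffD; have [p0|/Hp//] := eqVneq p@_a 0.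
    by rewrite p0 add0r; apply: Hq.
  - have [y [z [_ /Hp [b [c [Jb Lc ->]]] ->]]] := supp_mul Hx.
    exists (y + b)%MM, c; split=> //; last by rewrite addmA.
    by rewrite mpolyXD; apply: idealMl.
have : Ideal iW 'X_[m].
  move: H; apply: mul_ideal_sub => p q Jp Lq a Ha.
  have [y [z [py qz ->]]] := supp_mul Ha.
  by exists y, z; split=> //; [exact: mJ py|exact: mL qz].
by apply; rewrite mcoeffX eqxx oner_eq0.
Qed.

(** The [n j] are the minimal exponents of I after the variables outside S are set to 1, as if they
    were inverted; B is an exponent in these variables that brings all of them back into I. *)
Lemma minimal_exponents : exists mu (n : 'I_mu -> 'X_{1..d}) (B : 'X_{1..d}),
  [/\ forall j, mres S (n j) = n j, forall i j, (n i <= n j)%MM -> i = j,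
      mres S B = 0%MM, forall j, I 'X_[n j + B] &
      forall g, I 'X_[g] -> exists j, (n j <= mres S g)%MM].
Proof.
have [r [g [Ig IE]]] := monoidl_gens mI.
pose N := undup [seq mres S (g i) | i <- enum 'I_r].
pose Nm := [seq x <- N | all (fun y => (y <= x)%MM ==> (y == x)) N].
have uNm : uniq Nm by rewrite filter_uniq ?undup_uniq.
have inN x : x \in N -> exists i, x = mres S (g i).
  by rewrite mem_undup => /mapP[i _ ->]; exists i.
have below x : x \in N -> exists2 y, y \in Nm & (y <= x)%MM.
  move: {2}(mdeg x) (leqnn (mdeg x)) => e; elim: e x => [|e IH] x xe xN.
    exists x; last exact: lepm_refl.
    rewrite mem_filter xN andbT; apply/allP => y yN; apply/implyP => yx.
    move: xe; rewrite leqn0 mdeg_eq0 => /eqP x0; rewrite x0 in yx *.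
    by apply/eqP/mnmP => i; apply/eqP; rewrite mnm0E -leqn0; move/mnm_lepP: yx => /(_ i); rewrite mnm0E.
  case: (boolP (x \in Nm)) => xNm; first by exists x => //; apply: lepm_refl.
  move: xNm; rewrite mem_filter xN andbT => /allPn[y yN]; rewrite negb_imply => /andP[yx nyx].
  have yd : (mdeg y < mdeg x)%N.
    rewrite -(submK yx) mdegD -[X in (X < _)%N]add0n ltn_add2r lt0n mdeg_eq0.
    by apply: contra nyx => /eqP E; rewrite -(submK yx) E add0m.
  have [|z zNm zy] := IH y _ yN; first by rewrite -ltnS; apply: leq_trans xe.
  by exists z => //; apply: lepm_trans yx.
exists (size Nm), (fun j => nth 0%MM Nm j), (\sum_(i < r) mres (~: S) (g i))%MM.
have Nmj (j : 'I_(size Nm)) : nth 0%MM Nm j \in N.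
  by have := mem_nth 0%MM (ltn_ord j); rewrite mem_filter => /andP[].
split.
- move=> j; have [i ->] := inN _ (Nmj j).
  by apply/mnmP => l; rewrite !mresE; case: (l \in S).
- move=> i j ij; have := mem_nth 0%MM (ltn_ord j); rewrite mem_filter => /andP[/allP H _].
  have /implyP/(_ ij) := H _ (Nmj i); rewrite nth_uniq ?ltn_ord // => /eqP E.
  exact: val_inj.
- apply/mnmP => l; rewrite mresE mnm_sumE mnm0E; case: ifP => // lS.
  by rewrite big1 // => i _; rewrite mresE inE lS.
- move=> j; have [i E] := inN _ (Nmj j); apply: monomial_le (Ig i).
  rewrite E {1}(mres_split S (g i)); apply/mnm_lepP => l; rewrite !mnmDE leq_add2l.
  by rewrite mnm_sumE (bigD1 i) //= leq_addr.
- move=> a; rewrite IE => /monoidl_gens_le[i ia].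
  have [|y] := below (mres S (g i)).
    by rewrite mem_undup; apply/mapP; exists i; rewrite ?mem_enum.
  move=> /(nthP 0%MM)[j js <-] yx; exists (Ordinal js); apply: lepm_trans yx _.
  by apply/mnm_lepP => l; rewrite !mresE; case: ifP => // _; move/mnm_lepP: ia.
Qed.

Variables (mu : nat) (n : 'I_mu -> 'X_{1..d}) (B : 'X_{1..d}).
Hypothesis nS : forall j, mres S (n j) = n j.
Hypothesis n_min : forall i j, (n i <= n j)%MM -> i = j.
Hypothesis BS : mres S B = 0%MM.
Hypothesis nI : forall j, I 'X_[n j + B].
Hypothesis n_below : forall g, I 'X_[g] -> exists j, (n j <= mres S g)%MM.

Let z (j : 'I_mu) : R := 'X_[n j + B].
Definition wsum (w : seq 'I_mu) : 'X_{1..d} := (\sum_(j <- w) n j)%MM.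

(** Different monomials of degree e in the z_j have different S-parts, none of which divides
    another; for all e, this says that the fiber ring is a polynomial ring in the z_j. *)
Definition comb (e : nat) : Prop := forall w w', size w = e -> size w' = e ->
  (wsum w <= wsum w')%MM -> perm_eq w w'.

Lemma wsum_perm w w' : perm_eq w w' -> wsum w = wsum w'.
Proof. exact: perm_big. Qed.

(** The value at the monomial g of the multiplicative extension of z_j -> v_j to degree e. It is 0
    when the S-part of g is not a sum of e of the [n j]: if g is in I^e, it then lies in P I^e at P.
    Under [comb] the chosen word is unique up to order. *)
Definition om e (v : 'I_mu -> R) (g : 'X_{1..d}) : R :=
  match pselect (exists w, size w = e /\ mres S g = wsum w) with
  | left H => \prod_(j <- sval (cid H)) v j
  | right _ => 0
  end.

Lemma om_eq e v g w : comb e -> size w = e -> mres S g = wsum w ->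
  om e v g = \prod_(j <- w) v j.
Proof.
move=> He sw gw; rewrite /om; case: pselect => [H|[]]; last by exists w.
case: (cid H) => w' /= [sw' gw']; apply: perm_big; apply: He => //.
by rewrite -gw gw' lepm_refl.
Qed.

Lemma om0 e v g : (forall w, size w = e -> mres S g <> wsum w) -> om e v g = 0.
Proof. by move=> H; rewrite /om; case: pselect => // -[w [sw gw]]; case: (H w). Qed.

Definition psi e v : R -> R :=
  mon_lin (fun g => om e v g * 'X_[mres (~: S) g]).

Lemma psiD e v p q : psi e v (p + q) = psi e v p + psi e v q.
Proof. exact: raddfD. Qed.
Lemma psi0r e v : psi e v 0 = 0.
Proof. exact: raddf0. Qed.
Lemma psiN e v p : psi e v (- p) = - psi e v p.
Proof. exact: raddfN. Qed.

Lemma exp_wsum e g : exp_ideal I e 'X_[g] ->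
  exists2 w, size w = e & (wsum w <= mres S g)%MM.
Proof.
elim: e g => [|e IH] g; first by exists [::] => //; rewrite /wsum big_nil; apply/mnm_lepP => i; rewrite mnm0E.
move=> /(mul_ideal_X mI (@monoidl_exp _ _ I e mI))[a [b [/n_below[j ja] /IH[w sw wb] ->]]].
exists (j :: w); first by rewrite /= sw.
rewrite /wsum big_cons mresD; apply/mnm_lepP => i; rewrite !mnmDE.
by move/mnm_lepP: ja => /(_ i) ja; move/mnm_lepP: wb => /(_ i) wb; apply: leq_add.
Qed.

(** A monomial of I^e lies over a sum of e of the [n j]. By [comb] in degree e1 + e2, the product
    attains such a sum exactly only if both factors do. *)
Lemma psi_mul e1 e2 v p q : comb e1 -> comb e2 -> comb (e1 + e2) ->
  exp_ideal I e1 p -> exp_ideal I e2 q ->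
  psi (e1 + e2) v (p * q) = psi e1 v p * psi e2 v q.
Proof.
move=> H1 H2 H12 Ip Iq; apply: mon_linM => a b pa qb.
have [w1 s1 w1a] := exp_wsum (monoidl_exp mI Ip pa).
have [w2 s2 w2b] := exp_wsum (monoidl_exp mI Iq qb).
have sw : size (w1 ++ w2) = (e1 + e2)%N by rewrite size_cat s1 s2.
have w12 : wsum (w1 ++ w2) = (wsum w1 + wsum w2)%MM by rewrite /wsum big_cat.
rewrite !mresD mpolyXD; suff -> : om (e1 + e2) v (a + b)%MM = om e1 v a * om e2 v b by ring.
case: (eqVneq (mres S a + mres S b)%MM (wsum w1 + wsum w2)%MM) => E.
  have Ea : mres S a = wsum w1.
    apply/mnmP => i; have /mnmP/(_ i) := E; rewrite !mnmDE.
    by move/mnm_lepP: w1a => /(_ i); move/mnm_lepP: w2b => /(_ i); lia.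
  have Eb : mres S b = wsum w2.
    apply/mnmP => i; have /mnmP/(_ i) := E; rewrite !mnmDE.
    by move/mnm_lepP: w1a => /(_ i); move/mnm_lepP: w2b => /(_ i); lia.
  rewrite (om_eq v H1 s1 Ea) (om_eq v H2 s2 Eb) -big_cat.
  by apply: om_eq => //; rewrite mresD w12.
have contra w : size w = (e1 + e2)%N -> mres S (a + b)%MM <> wsum w.
  move=> sw' gw; case/eqP: E; rewrite -mresD gw -w12; apply/esym/wsum_perm.
  apply: H12 => //; rewrite -gw w12 mresD; apply/mnm_lepP => i; rewrite !mnmDE.
  by move/mnm_lepP: w1a => /(_ i) ?; move/mnm_lepP: w2b => /(_ i) ?; apply: leq_add.
rewrite (om0 v contra).
have [Ea|Ea] := eqVneq (mres S a) (wsum w1); last first.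
  rewrite (@om0 e1) ?mul0r // => w sw1 aw; case/eqP: Ea; rewrite aw.
  by apply/esym/wsum_perm/H1; rewrite // -aw.
have [Eb|Eb] := eqVneq (mres S b) (wsum w2); first by case/eqP: E; rewrite Ea Eb.
rewrite (@om0 e2) ?mulr0 // => w sw2 bw; case/eqP: Eb; rewrite bw.
by apply/esym/wsum_perm/H2; rewrite // -bw.
Qed.

Lemma comb0 : comb 0.
Proof. by move=> w w' /size0nil -> /size0nil ->. Qed.

Lemma comb1 : comb 1.
Proof.
move=> [|i [|? ?]] [|j [|? ?]] // _ _; rewrite /wsum !big_seq1 => /n_min ->.
exact: perm_refl.
Qed.

Lemma psi0 v p : psi 0 v p = kill S p.
Proof.
rewrite {2}[p]mpolyE rmorph_sum; apply: eq_bigr => m _.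
rewrite -mul_mpolyC rmorphM /= killC mul_mpolyC killX; congr (_ *: _).
case: eqP => [m0|m0].
  rewrite (@om_eq 0 v m [::] comb0) ?big_nil ?mul1r //; last by rewrite m0 /wsum big_nil.
  by congr 'X_[_]; rewrite [RHS](mres_split S) m0 add0m.
by rewrite om0 ?mul0r // => w /size0nil -> E; apply: m0; rewrite E /wsum big_nil.
Qed.

Lemma psi1z v j : psi 1 v (z j) = v j * 'X_[B].
Proof.
rewrite /psi mon_linX (@om_eq 1 v _ [:: j] comb1) ?big_seq1 //; last first.
  by rewrite mresD nS BS addm0 /wsum big_seq1.
congr (_ * 'X_[_]); apply/mnmP => i; rewrite !mresE mnmDE inE.
have /mnmP/(_ i) := BS; have /mnmP/(_ i) := nS j; rewrite !mresE mnm0E.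
by case: ifP => //= iS <-; rewrite ?addn0 // add0n.
Qed.

Lemma psi1_kill v s p : I p -> psi 1 v (s * p) = kill S s * psi 1 v p.
Proof.
move=> Ip; rewrite -[1%N]add0n (psi_mul v comb0 comb1 comb1 _) ?psi0 //.
  exact: gen_setT.
by rewrite exp_ideal1.
Qed.

Lemma zI j : I (z j). Proof. exact: nI. Qed.

Section AtPrime.
Variable P : prime_ideal R.
Hypothesis PS : forall i, P 'X_i <-> i \in S.

Lemma nPX m : mres S m = 0%MM -> ~ P 'X_[m].
Proof.
move=> m0 /prime_X[i [mi /PS iS]]; have /mnmP/(_ i) := m0.
by rewrite mresE iS mnm0E => E; rewrite E in mi.
Qed.

Lemma ideal_sat_z : I `<=` sat P (gen (range z)).
Proof.
move=> p Ip; apply: ideal_support => g /(mI Ip) Ig.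
have [j jg] := n_below Ig.
exists 'X_[B]; first exact: nPX.
have jg' : (n j <= g)%MM.
  apply/mnm_lepP => i; move/mnm_lepP: jg => /(_ i); rewrite mresE.
  by case: ifP => // _ H; apply: leq_trans H _.
rewrite -(submK jg') -mpolyXD addmC -addmA mpolyXD; apply: idealMl.
by apply: sub_gen; exists j.
Qed.

Lemma kill_mod s : P (s - kill S s).
Proof. by apply: kill_sub => i /PS. Qed.

Lemma kill_notin s : ~ P s -> ~ P (kill S s).
Proof.
move=> Ps Pk; apply: Ps; rewrite -(subrK (kill S s) s); apply: idealD => //.
exact: kill_mod.
Qed.

(* a P-saturated ideal H containing L + P I and maximal among those not containing
   I defines a linear form v on the fiber of I at P which vanishes on L; since the
   fiber ring is a polynomial ring, v extends to a multiplicative functional psi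
   on the powers of I, which vanishes on L I^(e-1) but not on I^e *)
Lemma no_proper_reduction (L : ideal R) N : (forall e, comb e) -> L `<=` I ->
  exp_ideal I N.+1 `<=` sat P (mul_ideal L (exp_ideal I N)) -> I `<=` sat P L.
Proof.
move=> Hc LI Hred; apply: contrapT => nIL.
have [|H [LH HP nIH] max] := @noeth_max _ (@noeth_mpoly k d)
   (fun H : ideal R => [/\ add_ideal L (mul_ideal P I) `<=` H, sat P H `<=` H & ~ I `<=` H]).
  exists (sat P (add_ideal L (mul_ideal P I))); split; [exact: sub_sat|exact: sat_sat|].
  by move=> H; apply: nIL; apply: (nakayama (@noeth_mpoly k d)).
have [j0 Hj0] : exists j, ~ H (z j).
  apply: contrapT => nH; apply: nIH; apply: subset_trans ideal_sat_z _.
  apply: subset_trans (HP); apply: sat_mono; apply: gen_sub => _ [j _ <-].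
  by apply: contrapT => Hj; apply: nH; exists j.
have IH0 : I `<=` sat P (addg H (z j0)).
  apply: contrapT => nI'; apply: Hj0; apply: (max (sat P (addg H (z j0)))).
  - split; [|exact: sat_sat|exact: nI'].
    by apply: subset_trans LH _ => x Hx; apply: sub_sat; apply: sub_addg.
  - by move=> x Hx; apply: sub_sat; apply: sub_addg.
  - by apply: sub_sat; apply: mem_addg.
have [s Ps Hs] := sat_denom (@noeth_mpoly k d) IH0.
(* [v j] is the ratio of z_j to z_j0 in the one-dimensional quotient of the fiber by H, cleared of a
   common denominator s; so [v j0] is s. *)
have Hv j : exists r, H (s * z j - r * z j0) /\ (j = j0 -> r = s).
  have [->|jj0] := eqVneq j j0.
    by exists s; split=> //; rewrite subrr; apply: ideal0.
  have /addgP[r Hr] := Hs _ (zI j); exists r; split=> // E; case/eqP: jj0; exact: E.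
have [v Hv'] := choice Hv.
have psi1L g : I g -> H g -> P (psi 1 v g).
  move=> Ig Hg; have [t Pt /gen_rangeP[c Ec]] := ideal_sat_z Ig.
  have Pcv : P (\sum_j c j * v j).
    apply: contrapT => nP; apply: Hj0; apply: HP; exists (\sum_j c j * v j) => //.
    have -> : (\sum_j c j * v j) * z j0 =
        s * (t * g) - \sum_j c j * (s * z j - v j * z j0).
      rewrite Ec mulr_sumr mulr_suml -sumrB; apply: eq_bigr => j _; ring.
    apply: idealB; first by do 2?apply: idealMl.
    by apply: ideal_sum => j; apply: idealMl; have [] := Hv' j.
  have : P (kill S t * psi 1 v g).
    rewrite -psi1_kill // Ec; have -> : psi 1 v (\sum_i c i * z i) =
        \sum_i kill S (c i) * (v i * 'X_[B]).
      rewrite /psi raddf_sum; apply: eq_bigr => j _ /=.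
      by rewrite -/(psi 1 v _) psi1_kill ?psi1z //; apply: zI.
    have -> : \sum_i kill S (c i) * (v i * 'X_[B]) =
       'X_[B] * (\sum_i c i * v i - \sum_i (c i - kill S (c i)) * v i).
      rewrite -sumrB mulr_sumr; apply: eq_bigr => j _; ring.
    apply: idealMl; apply: idealB => //; apply: ideal_sum => j; apply: idealMr.
    exact: kill_mod.
  by case/prime_mul=> // /(kill_notin Pt).
have iW : is_ideal [set g : R | exp_ideal I N.+1 g /\ P (psi N.+1 v g)].
  split=> /= [|x y [Ix Px] [Iy Py]|a x [Ix Px]].
  - by split; [apply: ideal0|rewrite psi0r; apply: ideal0].
  - by split; [apply: idealD|rewrite psiD; apply: idealD].
  - split; first exact: idealMl.
    rewrite -[N.+1]add0n psi_mul //; first exact: idealMl.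
    exact: gen_setT.
have LW : mul_ideal L (exp_ideal I N) `<=` Ideal iW.
  apply: mul_ideal_sub => l b Ll Ib; split; first by apply: mul_ideal_mem => //; apply: LI.
  rewrite -[N.+1]add1n psi_mul ?exp_ideal1 //; last exact: LI.
  by apply: idealMr; apply: psi1L; [apply: LI|apply: LH; apply: add_idealL].
have z0e : exp_ideal I N.+1 (z j0 ^+ N.+1) by apply: exp_ideal_pow; apply: zI.
have [t Pt /LW[_]] := Hred _ z0e.
have E := @psi_mul 0 N.+1 v t _ (Hc _) (Hc _) (Hc _) (gen_setT _) z0e.
rewrite add0n in E; rewrite E psi0 => /prime_mul[/(kill_notin Pt)//|].
suff -> : psi N.+1 v (z j0 ^+ N.+1) = (v j0 * 'X_[B]) ^+ N.+1.
  move=> /prime_pow/prime_mul[|]; last exact: nPX.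
  by have [_ /(_ erefl) ->] := Hv' j0.
elim: (N.+1) => [|e IHe]; first by rewrite !expr0 psi0 rmorph1.
rewrite !exprS -[e.+1]add1n psi_mul ?exp_ideal1 ?psi1z ?IHe //; first exact: zI.
by apply: exp_ideal_pow; apply: zI.
Qed.

End AtPrime.

End FiberMonomials.

(** * The fiber ring is a polynomial ring *)

Section FiberRing.
Variables (k : fieldType) (d : nat).
Local Notation R := {mpoly k[d]}.
Local Notation m := (max_ideal k d).
Variable I : ideal R.
Hypothesis infk : infinite_set [set: k].
Hypothesis mI : monoidl I.
Hypothesis I_neq0 : exists2 p, I p & p != 0.
Hypothesis HG : satisfies_G d I.
Hypothesis HS : weakly_residually_S2 (d%:Z - 2) (loc_ideal m I).

Lemma exists_pow_neq a b : a != b -> exists t : k, t != 0 /\ t ^+ a != t ^+ b.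
Proof.
move=> ab; have [t Ht] : exists t, ('X * ('X^a - 'X^b) : {poly k}).[t] != 0.
  apply: (cof_ex infk); apply: cof_root; rewrite mulf_neq0 ?polyX_eq0 //.
  apply/negP => /eqP/(congr1 (fun p : {poly k} => p`_a)).
  by rewrite coefB !coefXn eqxx (negbTE ab) subr0 coef0 => /eqP; rewrite oner_eq0.
exists t; move: Ht; rewrite hornerM hornerX hornerD hornerN !hornerXn mulf_eq0 negb_or.
by rewrite subr_eq0 => /andP[].
Qed.

Variable S : {set 'I_d}.
Hypothesis ST : S != [set: 'I_d]%SET.
Variables (mu : nat) (n : 'I_mu -> 'X_{1..d}) (B : 'X_{1..d}).
Hypothesis nS : forall j, mres S (n j) = n j.
Hypothesis n_min : forall i j, (n i <= n j)%MM -> i = j.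
Hypothesis BS : mres S B = 0%MM.
Hypothesis nI : forall j, I 'X_[n j + B].
Hypothesis n_below : forall g, I 'X_[g] -> exists j, (n j <= mres S g)%MM.
Let z (j : 'I_mu) : R := 'X_[n j + B].
Let p := mprime k S.

Let pS i : p 'X_i <-> i \in S. Proof. exact: mprimeU. Qed.

Lemma zprod w : \prod_(j <- w) z j = 'X_[wsum n w + (B *+ size w)%MM].
Proof.
elim: w => [|j w IH]; first by rewrite big_nil /wsum big_nil mulm0n addm0 mpolyX0.
rewrite big_cons IH -mpolyXD /wsum big_cons [size _]/= mulmS; congr 'X_[_].
by apply/mnmP => i; rewrite !mnmDE addnACA.
Qed.

(* otherwise a hyperplane of the fiber of I at p avoiding a zero of the
   relation w - w' would give a proper reduction of I_p *)
Lemma comb_all e : comb n e.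
Proof.
move=> w w' sw sw' ww'; apply: contrapT => nww'.
have [Ip|Ip] := pselect (I `<=` p); last first.
  have [g [Ig g0]] : exists g, I 'X_[g] /\ mres S g = 0%MM.
    apply: contrapT => H; apply: Ip => q Iq; apply: ideal_support => g /(mI Iq) Ig.
    apply/mprimeP; rewrite killX; case: eqP => // g0; case: H; by exists g.
  have [j] := n_below Ig; rewrite g0 => nj.
  have all_j i : i = j.
    symmetry; apply: n_min; apply/mnm_lepP => l; move/mnm_lepP: nj => /(_ l).
    by rewrite mnm0E leqn0 => /eqP ->.
  have wE (v : seq 'I_mu) : v = nseq (size v) j.
    by elim: v => //= i v <-; rewrite (all_j i).
  by apply: nww'; rewrite (wE w) (wE w') sw sw'; apply: perm_refl.
have [j cj] : exists j, count_mem j w != count_mem j w'.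
  apply: contrapT => H; apply: nww'; apply/allP => j _ /=.
  by apply/eqP; apply: contrapT => /eqP cj; apply: H; exists j.
have [t [t0 tab]] := exists_pow_neq cj.
(* A point with nonzero coordinates at which the monomials w and w' take different values. *)
pose v (i : 'I_mu) : k := if i == j then t else 1.
have v0 i : v i != 0 by rewrite /v; case: ifP => // _; rewrite oner_eq0.
have vprod u : \prod_(i <- u) v i = t ^+ count_mem j u.
  elim: u => [|i u IH]; first by rewrite big_nil.
  by rewrite big_cons IH /v /=; case: eqP => _; rewrite ?mul1r // exprS.
have [j0 [w0 Ew]] : exists j0 w0, w = j0 :: w0.
  case: w sw ww' nww' cj tab => [|j0 w0] sw ww' nww' _ _; last by exists j0, w0.
  by case: nww'; move: sw'; rewrite -sw => /size0nil ->.
have e0 : (0 < e)%N by rewrite -sw Ew.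
(* J is the kernel, in the fiber at p, of the functional z_i -> v_i. The multiples of I by the
   variables of S make J and I agree at all primes that do not contain p. *)
pose J0 := [set y : R | (exists i q, [/\ i \in S, I q & y = 'X_i * q]) \/
   exists a b, y = (v b)%:MP * z a - (v a)%:MP * z b].
have [r [c Jc]] := @noeth_mpoly k d (gen J0).
have JI : gen J0 `<=` I.
  apply: gen_sub => _ [[i [q [_ Iq ->]]]|[a [b ->]]]; first exact: idealMl.
  by apply: idealB; apply: idealMl; apply: zI.
set J := gen J0 in Jc JI.
have Jx i q : i \in S -> I q -> J ('X_i * q).
  by move=> iS Iq; apply: sub_gen; left; exists i, q.
have Jz a b : J ((v b)%:MP * z a - (v a)%:MP * z b).
  by apply: sub_gen; right; exists a, b.
have dich (q : prime_ideal R) : mprime k S `<=` q \/ exists2 i, i \in S & ~ q 'X_i.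
  have [[i iS qi]|H] := pselect (exists2 i, i \in S & ~ q 'X_i); first by right; exists i.
  by left; apply: mprime_sub => i iS; apply: contrapT => qi; apply: H; exists i.
have word u : J = J -> mul_ideal J (exp_ideal I (size u).-1)
    (((v j0) ^+ size u)%:MP * \prod_(i <- u) z i -
     (\prod_(i <- u) v i)%:MP * z j0 ^+ size u).
  move=> _; elim: u => [|i u IH].
    by rewrite !big_nil !expr0 !mulr1 subrr; apply: ideal0.
  rewrite !big_cons [size _]/=.
  have -> : (v j0 ^+ (size u).+1)%:MP * (z i * \prod_(l <- u) z l) -
     (v i * \prod_(l <- u) v l)%:MP * z j0 ^+ (size u).+1 =
     (v j0)%:MP * (z i * ((v j0 ^+ size u)%:MP * \prod_(l <- u) z l -
         (\prod_(l <- u) v l)%:MP * z j0 ^+ size u)) +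
     (\prod_(l <- u) v l)%:MP * (((v j0)%:MP * z i - (v i)%:MP * z j0) * z j0 ^+ size u).
    by rewrite !exprS !rmorphM /=; ring.
  apply: idealD; apply: idealMl; last first.
    by apply: mul_ideal_mem; [exact: Jz|apply: exp_ideal_pow; apply: zI].
  case: u IH => [|i' u] IH.
    by rewrite !big_nil !expr0 !mulr1 subrr mulr0; apply: ideal0.
  have : mul_ideal I (mul_ideal J (exp_ideal I (size u))) (z i *
     ((v j0 ^+ size (i' :: u))%:MP * \prod_(l <- i' :: u) z l -
         (\prod_(l <- i' :: u) v l)%:MP * z j0 ^+ size (i' :: u))).
    by apply: mul_ideal_mem; [exact: zI|exact: IH].
  by rewrite mul_idealA (mul_idealC I) -mul_idealA.
pose W := sat p (add_ideal (mul_ideal J (exp_ideal I e.-1)) (mul_ideal p (exp_ideal I e))).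
have wordW u : size u = e -> W ((\prod_(i <- u) v i)%:MP * z j0 ^+ e) <->
    W (\prod_(i <- u) z i).
  move=> su; have := word u erefl; rewrite su => H.
  have {}H : W ((v j0 ^+ e)%:MP * \prod_(i <- u) z i - (\prod_(i <- u) v i)%:MP * z j0 ^+ e).
    by apply: sub_sat; apply: add_idealL.
  split=> Hu; last first.
    rewrite -[X in W X]opprK; apply: idealN.
    rewrite -[X in W X](addKr ((v j0 ^+ e)%:MP * \prod_(i <- u) z i)); apply: idealD => //.
    by apply: idealN; apply: idealMl.
  have -> : \prod_(i <- u) z i = (v j0 ^- e)%:MP * ((v j0 ^+ e)%:MP * \prod_(i <- u) z i).
    by rewrite mulrA -rmorphM /= mulVf ?mul1r // expf_neq0.
  by apply: idealMl; rewrite -(subrK ((\prod_(i <- u) v i)%:MP * z j0 ^+ e)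
    ((v j0 ^+ e)%:MP * _)); apply: idealD.
have prodv0 (u : seq 'I_mu) : \prod_(i <- u) v i != 0.
  by rewrite vprod expf_neq0.
(* Modulo J I^(e-1) each word is a nonzero multiple of z_j0^e, by its value at v up to a common
   factor. If w and w' have the same exponent, these multiples differ; otherwise the word w' lies in
   p I^e. *)
have Wz0 : W (z j0 ^+ e).
  have cancel (a : k) : a != 0 -> W (a%:MP * z j0 ^+ e) -> W (z j0 ^+ e).
    move=> a0 Wa; have -> : z j0 ^+ e = a^-1%:MP * (a%:MP * z j0 ^+ e).
      by rewrite mulrA -rmorphM /= mulVf ?mul1r.
    exact: idealMl.
  have [E|E] := eqVneq (wsum n w) (wsum n w').
    have Ez : \prod_(i <- w) z i = \prod_(i <- w') z i by rewrite !zprod E sw sw'.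
    have H1 := word w erefl; have H2 := word w' erefl; rewrite sw Ez in H1; rewrite sw' in H2.
    apply: (@cancel (\prod_(i <- w') v i - \prod_(i <- w) v i)).
      by rewrite subr_eq0 !vprod eq_sym.
    apply: sub_sat; apply: add_idealL; have := idealB H1 H2.
    by congr (mul_ideal _ _ _); rewrite rmorphB /=; ring.
  apply: (@cancel (\prod_(i <- w') v i)) => //; apply/wordW => //.
  have /submK Ed := ww'; set dl := (wsum n w' - wsum n w)%MM in Ed.
  have [i dli] : exists i, dl i != 0%N.
    apply: contrapT => H; case/eqP: E; rewrite -Ed.
    suff -> : dl = 0%MM by rewrite add0m.
    apply/mnmP => i; rewrite mnm0E; apply/eqP; apply: contrapT => /negP dli.
    by apply: H; exists i.
  have iS : i \in S.
    apply: contraNT dli => iS; rewrite mnmBE; suff -> : wsum n w' i = 0%N by rewrite sub0n.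
    by rewrite /wsum mnm_sumE big1 // => l _; rewrite -(nS l) mresE (negbTE iS).
  have Ew' : \prod_(l <- w') z l = 'X_[dl] * \prod_(l <- w) z l.
    by rewrite !zprod -mpolyXD addmA Ed sw sw'.
  apply: sub_sat; apply: add_idealR; rewrite Ew'; apply: mul_ideal_mem.
    have /submK <- : (U_(i) <= dl)%MM.
      by apply/mnm_lepP => l; rewrite mnm1E; case: eqP => // <-; rewrite lt0n.
    by rewrite mpolyXD; apply: idealMl; apply/pS.
  by rewrite -sw; apply: prod_mem_exp => l; apply: zI.
have Hred : exp_ideal I e `<=` sat p (mul_ideal J (exp_ideal I e.-1)).
  apply: (nakayama (@noeth_mpoly k d)).
  apply: subset_trans (sat_exp (ideal_sat_z mI BS n_below pS)) _.
  apply: sat_sub; apply: exp_gen_words => u su.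
  by apply/wordW => //; apply: idealMl.
have [h [hh hd]] := mprime_height k ST.
have h0 : (0 < h)%N.
  have [_ nh] := hh; rewrite lt0n; apply/eqP => h0; apply: nh; rewrite h0.
  apply: (@prime_ht_geS _ _ (zero_prime k d)); last exact: prime_ht_ge0.
  split=> [x /zidealP ->|]; first exact: ideal0.
  have [x Ix x0] := I_neq0; move=> /(_ x (Ip _ Ix)) /zidealP xE.
  by rewrite xE eqxx in x0.
have IJ : I `<=` sat p J.
  rewrite Jc; apply: (@red_at _ _ _ I_neq0 HG HS infk p h r c e.-1); rewrite -?Jc //.
  - exact: mprime_max.
  - by rewrite h0 ltnW.
  - exact: G_gens.
  - move=> q qm Iq nq; have [pq|[i iS qi]] := dich q.
      by case: nq; apply: prime_ht_ge_sub pq _; case: hh.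
    by move=> x Ix; exists 'X_i => //; apply: Jx.
  - move=> q Jq; have [pq|[i iS qi]] := dich q; first exact: subset_trans Ip pq.
    by move=> x Ix; have /prime_mul[] := Jq _ (Jx _ _ iS Ix).
  - by rewrite prednK.
(* The functional itself, extended by [psi] in degree 1, where [comb] is known, kills J but not
   z_j0. *)
pose V (i : 'I_mu) : R := (v i)%:MP.
have iK : is_ideal [set g : R | I g /\ psi S n 1 V g = 0].
  split=> /= [|x y [Ix Px] [Iy Py]|a x [Ix Px]].
  - by split; [apply: ideal0|rewrite psi0r].
  - by split; [apply: idealD|rewrite psiD Px Py addr0].
  - split; first exact: idealMl.
    by rewrite (psi1_kill mI n_min n_below) // Px mulr0.
have JK : J `<=` Ideal iK.
  apply: gen_sub => _ [[i [q [iS Iq ->]]]|[a [b ->]]]; split.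
  - exact: idealMl.
  - by rewrite (psi1_kill mI n_min n_below) // killU iS mul0r.
  - by apply: idealB; apply: idealMl; apply: zI.
  - rewrite psiD psiN !(psi1_kill mI n_min n_below) ?killC; try exact: zI.
    by rewrite !(psi1z nS n_min BS) /V; ring.
have [s ps /JK[_]] := IJ _ (zI nI j0).
rewrite (psi1_kill mI n_min n_below) ?(psi1z nS n_min BS); last exact: zI.
move=> H; have : p (kill S s * (V j0 * 'X_[B])) by rewrite H; apply: ideal0.
move=> /prime_mul[|/prime_mul[]]; last exact: nPX.
  exact: kill_notin.
move=> pV; apply: (@prime_proper _ p).
have -> : (1 : R) = (v j0)^-1%:MP * V j0 by rewrite /V -rmorphM /= mulVf.
exact: idealMl.
Qed.

End FiberRing.

(** * Pigeonhole for words and Cramer's rule *)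

Section PowerPigeonhole.
Variables (T : comPzRingType) (n : nat) (c : 'I_n -> T).

Lemma prod_count (w : seq 'I_n) i q : (q <= count_mem i w)%N ->
  exists w', size w = (q + size w')%N /\ \prod_(j <- w) c j = c i ^+ q * \prod_(j <- w') c j.
Proof.
elim: w q => [|j w IH] q /=.
  by rewrite leqn0 => /eqP ->; exists [::]; rewrite big_nil mulr1.
rewrite big_cons; case: eqP => [->|_] /=; last first.
  rewrite add0n => /IH[w' [-> ->]]; exists (j :: w'); rewrite big_cons /= addnS.
  by split=> //; ring.
case: q => [|q]; first by exists (i :: w); rewrite big_cons expr0 mul1r.
by rewrite add1n ltnS => /IH[w' [-> ->]]; exists w'; rewrite exprS mulrA.
Qed.

Lemma word_pigeonhole (w : seq 'I_n) q : (n * q.-1 < size w)%N ->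
  exists i, (q <= count_mem i w)%N.
Proof.
move=> H; apply: contrapT => nH; move: H; rewrite ltnNge => /negP; apply.
rewrite -(sum1_size w); have -> : (\sum_(j <- w) 1 = \sum_(i < n) count_mem i w)%N.
  elim: w {nH} => [|j w IH]; first by rewrite big_nil big1.
  rewrite big_cons IH /= big_split /=; congr (_ + _)%N; rewrite (bigD1 j) //= eqxx big1 // => i.
  by rewrite eq_sym => /negbTE ->.
rewrite -[X in (_ <= X * _)%N]card_ord -sum_nat_const; apply: leq_sum => i _.
have : ~ (q <= count_mem i w)%N by move=> H; apply: nH; exists i.
by move/negP; rewrite -ltnNge => Hq; rewrite -ltnS (ltn_predK Hq).
Qed.

Lemma pow_words (W : ideal T) q e : (n * q.-1 < e)%N -> (forall i, W (c i ^+ q)) ->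
  exp_ideal (gen (range c)) e `<=` W.
Proof.
move=> He HW; apply: exp_gen_words => w sw.
have [|i /prod_count[w' [_ ->]]] := @word_pigeonhole w q; first by rewrite sw.
exact: idealMr.
Qed.

Lemma mul_genP (K : ideal T) x : mul_ideal (gen (range c)) K x <->
  exists g : 'I_n -> T, (forall i, K (g i)) /\ x = \sum_i c i * g i.
Proof.
split=> [|[g [Kg ->]]]; last first.
  by apply: ideal_sum => i; apply: mul_ideal_mem => //; apply: sub_gen; exists i.
have iW : is_ideal [set x | exists g : 'I_n -> T,
    (forall i, K (g i)) /\ x = \sum_i c i * g i].
  split=> /= [|y z [g [Kg ->]] [h [Kh ->]]|a y [g [Kg ->]]].
  - exists (fun=> 0); split=> [i|]; first exact: ideal0.
    by rewrite big1 // => i _; rewrite mulr0.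
  - exists (fun i => g i + h i); split=> [i|]; first exact: idealD.
    by rewrite -big_split; apply: eq_bigr => i _; rewrite mulrDr.
  - exists (fun i => a * g i); split=> [i|]; first exact: idealMl.
    by rewrite mulr_sumr; apply: eq_bigr => i _; ring.
suff H : mul_ideal (gen (range c)) K `<=` Ideal iW by move/H.
apply: mul_ideal_sub => y z /gen_rangeP[a ->] Kz; exists (fun i => a i * z).
split=> [i|]; first exact: idealMl.
by rewrite mulr_suml; apply: eq_bigr => i _; ring.
Qed.

Lemma det_mem r (A : 'M[T]_r) (G : 'I_r -> T) (W : ideal T) :
  (forall a, W (\sum_b A a b * G b)) -> forall a, W (\det A * G a).
Proof.
move=> HA a; have /matrixP E := mul_adj_mx A.
have -> : \det A * G a = \sum_b (\adj A *m A) a b * G b.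
  rewrite (bigD1 a) //= big1 ?addr0 => [|b ba]; rewrite E mxE; first by rewrite eqxx.
  by rewrite eq_sym (negbTE ba) mul0r.
have -> : \sum_b (\adj A *m A) a b * G b = \sum_l \adj A a l * \sum_b A l b * G b.
  under eq_bigr => b _ do rewrite mxE mulr_suml.
  rewrite exchange_big /=; apply: eq_bigr => l _; rewrite mulr_sumr.
  by apply: eq_bigr => b _; rewrite mulrA.
by apply: ideal_sum => l; apply: idealMl.
Qed.

End PowerPigeonhole.

Lemma prime_avoiding (T : comPzRingType) (M : T -> Prop) (b : ideal T) : noeth T ->
  M 1 -> (forall x y, M x -> M y -> M (x * y)) -> (forall x, M x -> ~ b x) ->
  exists2 P : prime_ideal T, b `<=` P & forall x, M x -> ~ P x.
Proof.
move=> nT M1 MM Mb.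
have [|H [bH MH] max] := @noeth_max _ nT
    (fun H : ideal T => b `<=` H /\ forall x, M x -> ~ H x); first by exists b; split.
have HM x y : H (x * y) -> H x \/ H y.
  move=> Hxy; apply: contrapT => /not_orP[Hx Hy].
  have big w : ~ H w -> exists2 s, M s & addg H w s.
    move=> Hw; apply: contrapT => nM; apply: Hw; apply: (max (addg H w)).
    - split; first by apply: subset_trans bH _; apply: sub_addg.
      by move=> s Ms Hs; apply: nM; exists s.
    - exact: sub_addg.
    - exact: mem_addg.
  have [s Ms /addgP[r Hr]] := big _ Hx; have [t Mt /addgP[r' Hr']] := big _ Hy.
  apply: (MH (s * t)); first exact: MM.
  have -> : s * t = (s - r * x) * t + r * x * (t - r' * y) + r * r' * (x * y) by ring.
  by apply: idealD; [apply: idealD; [apply: idealMr|apply: idealMl]|apply: idealMl].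
by exists (PrimeIdeal (MH 1 M1) HM).
Qed.

(** * Local reductions and powers of m conducting I into them *)

Section LocalReductions.
Variables (k : fieldType) (d : nat).
Local Notation R := {mpoly k[d]}.
Local Notation m := (max_ideal k d).
Variable I : ideal R.

(** Equations s G_a = sum_i c_i g_ai for generators G_a of I^(N+1) deform into a matrix s + t X
    acting on the G_a. By Cramer's rule its determinant multiplies I^(N+1) into J I^N; it is a unit
    at m unless its constant term, a polynomial in t that is nonzero at 0, vanishes. *)
Lemma red_line n (c : 'I_n -> R) (w : 'I_n -> k) e N : I e ->
  exp_ideal I N.+1 `<=` sat m (mul_ideal (gen (range c)) (exp_ideal I N)) ->
  cof (fun t => exp_ideal I N.+1 `<=` sat m (mul_ideal
    (gen (range (fun i => c i + (t * w i) *: e))) (exp_ideal I N))).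
Proof.
move=> Ie Hred; have [r [G EG]] := @noeth_mpoly k d (exp_ideal I N.+1).
have [s ms Hs] := sat_denom (@noeth_mpoly k d) Hred.
have GI a : exp_ideal I N.+1 (G a) by rewrite EG; apply: sub_gen; exists a.
have Hg a : exists g : 'I_n -> R, (forall i, exp_ideal I N (g i)) /\
    s * G a = \sum_i c i * g i by apply/mul_genP/Hs.
have [g Hg'] := choice Hg.
have HX a : exists x : 'I_r -> R, \sum_i w i *: (e * g a i) = \sum_b x b * G b.
  apply/gen_rangeP; rewrite -EG; apply: ideal_sum => i.
  rewrite -mul_mpolyC; apply: idealMl; apply: mul_ideal_mem => //.
  by have [] := Hg' a.
have [X HX'] := choice HX.
pose q : {poly k} := \det ((s@_0%MM)%:P%:M + 'X *: map_mx (fun p : R => (p@_0%MM)%:P)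
  (\matrix_(a, b) X a b)).
have q0 : q.[0] != 0.
  rewrite -horner_evalE -det_map_mx; set M := map_mx _ _.
  have -> : M = (s@_0%MM)%:M.
    apply/matrixP => a b; rewrite !mxE /= !horner_evalE hornerD hornerM hornerX mul0r addr0.
    by case: (a == b); rewrite ?mulr0n ?mulr1n ?hornerC // horner0.
  by rewrite det_scalar expf_neq0 //; apply/eqP => /vars_idealP.
apply: (@cof_sub _ (fun t => q.[t] != 0)); last first.
  by apply: cof_root; apply: contraNneq q0 => ->; rewrite horner0.
move=> t qt; set J := gen _.
pose A : 'M[R]_r := s%:M + t%:MP *: \matrix_(a, b) X a b.
have HA a : mul_ideal J (exp_ideal I N) (\sum_b A a b * G b).
  have [Ig Eg] := Hg' a.
  have -> : \sum_b A a b * G b = \sum_i (c i + (t * w i) *: e) * g a i.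
    have -> : \sum_i (c i + (t * w i) *: e) * g a i = s * G a + t *: \sum_b X a b * G b.
      rewrite Eg -HX' scaler_sumr -big_split; apply: eq_bigr => i _ /=.
      by rewrite mulrDl -scalerA -!scalerAl.
    rewrite -mul_mpolyC mulr_sumr (bigD1 a) //= [X in _ = _ + X](bigD1 a) //= addrA.
    congr (_ + _); first by rewrite !mxE eqxx mulr1n mulrDl mulrA.
    by apply: eq_bigr => b ba; rewrite !mxE eq_sym (negbTE ba) mulr0n add0r mulrA.
  apply: ideal_sum => i; apply: mul_ideal_mem => //.
  by apply: sub_gen; exists i.
have detA : ~ m (\det A).
  move/vars_idealP => E; move/negP: qt; apply; apply/eqP; rewrite -[RHS]E.
  rewrite -[(\det A)@_0%MM]/((mcoeff 0%MM : {rmorphism R -> k}) (\det A)) -det_map_mx.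
  rewrite -horner_evalE -det_map_mx; congr (\det _); apply/matrixP => a b.
  rewrite !mxE /= horner_evalE hornerD hornerM hornerX hornerC.
  rewrite mcoeffD [in RHS]mcoeffCM; congr (_ + _).
  by case: (a == b); [rewrite !mulr1n hornerC|rewrite !mulr0n horner0 mcoeff0].
rewrite EG; apply: gen_sub => _ [a _ <-]; exists (\det A) => //; exact: det_mem HA a.
Qed.

Hypothesis infk : infinite_set [set: k].
Hypothesis mI : monoidl I.
Hypothesis I_neq0 : exists2 p, I p & p != 0.
Hypothesis HG : satisfies_G d I.
Hypothesis HS : weakly_residually_S2 (d%:Z - 2) (loc_ideal m I).

Lemma reduction_off (P : prime_ideal R) i (L : ideal R) N : ~ P 'X_i -> L `<=` I ->
  exp_ideal I N.+1 `<=` sat P (mul_ideal L (exp_ideal I N)) -> I `<=` sat P L.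
Proof.
move=> Pi LI Hred; pose S : {set 'I_d} := [set i | `[< P 'X_i >]]%SET.
have PS j : P 'X_j <-> j \in S by rewrite inE; split=> /asboolP.
have ST : S != [set: 'I_d]%SET.
  apply/eqP => /setP/(_ i); rewrite [RHS]finset.in_setT => iS; apply: Pi; exact/PS.
have [mu [n [B [nS n_min BS nI n_below]]]] := minimal_exponents mI S.
apply: (no_proper_reduction mI nS n_min BS nI n_below PS _ LI Hred) => e.
exact: (comb_all infk mI I_neq0 HG HS ST nS n_min BS nI n_below).
Qed.

(** If no product s X_i^e with s in D carried I into L, some prime would contain L : I and avoid all
    these products, against [reduction_off]. D is the complement of m in the local application and
    {1} in the global one. *)
Lemma var_pow (D : R -> Prop) i (L : ideal R) N : D 1 ->
  (forall x y, D x -> D y -> D (x * y)) -> L `<=` I ->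
  (forall P : prime_ideal R, (forall x, D x -> ~ P x) ->
    exp_ideal I N.+1 `<=` sat P (mul_ideal L (exp_ideal I N))) ->
  exists s e, D s /\ forall x, I x -> L (s * 'X_i ^+ e * x).
Proof.
move=> D1 DM LI Hred; apply: contrapT => H.
pose M x := exists s e, D s /\ x = s * 'X_i ^+ e.
have [||x [s [e [Ds ->]]] Hx|P LP MP] := @prime_avoiding _ M (colon_ideal L I) (@noeth_mpoly k d).
- by exists 1, 0%N; rewrite mulr1.
- move=> x y [s [e [Ds ->]]] [t [f [Dt ->]]]; exists (s * t), (e + f)%N.
  by split; [exact: DM|rewrite exprD; ring].
- by apply: H; exists s, e.
have Pi : ~ P 'X_i by apply: MP; exists 1, 1%N; rewrite mul1r.
have DP x : D x -> ~ P x by move=> Dx; apply: MP; exists x, 0%N; rewrite mulr1.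
have [s Ps Hs] := sat_denom (@noeth_mpoly k d) (reduction_off Pi LI (Hred P DP)).
exact/Ps/LP.
Qed.

Lemma max_pow_sub (W : ideal R) : (forall i, exists e, forall x, I x -> W ('X_i ^+ e * x)) ->
  exists t, mul_ideal (exp_ideal m t) I `<=` W.
Proof.
move=> H; have [e He] := choice H; pose q := (\max_i e i)%N.
exists (d * q.-1).+1; apply: mul_ideal_sub => x y Hx Iy.
suff : colon_ideal W I x by apply.
move: x Hx; apply: (@pow_words _ _ (fun i : 'I_d => 'X_i) _ q) => // i z Iz.
rewrite -(subnK (leq_bigmax i : (e i <= q)%N)) exprD -mulrA; apply: idealMl; exact: He.
Qed.

Lemma local_reduction_pow (L : ideal R) N : L `<=` I ->
  exp_ideal I N.+1 `<=` sat m (mul_ideal L (exp_ideal I N)) ->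
  exists t, mul_ideal (exp_ideal m t) I `<=` sat m L.
Proof.
move=> LI Hred; apply: max_pow_sub => i.
have [||P HP|s [e [ms He]]] := @var_pow (fun s => ~ m s) i L N _ _ LI _.
- exact: prime_proper.
- exact: prime_mulN.
- apply: subset_trans Hred _; apply: sat_le => x Px; apply: contrapT => mx.
  exact: HP mx Px.
by exists e => x Ix; exists s => //; rewrite mulrA; apply: He.
Qed.

Lemma reduction_pow (L : ideal R) N : L `<=` I ->
  exp_ideal I N.+1 `<=` mul_ideal L (exp_ideal I N) ->
  exists t, mul_ideal (exp_ideal m t) I `<=` L.
Proof.
move=> LI Hred; apply: max_pow_sub => i.
have [|x y -> ->|P HP|s [e [-> He]]] := @var_pow (fun s => s = 1) i L N _ _ LI _ => //.
- by rewrite mulr1.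
- by apply: subset_trans Hred _; apply: sub_sat.
by exists e => x /He; rewrite mul1r.
Qed.

Lemma unit_mod_max (s : R) t : ~ m s -> exists r, exp_ideal m t (1 - r * s).
Proof.
move=> ms; have s0 : s@_0%MM != 0 by apply/eqP => /vars_idealP.
pose y := (s@_0%MM)^-1 *: s.
have my : m (1 - y).
  by apply/vars_idealP; rewrite mcoeffB mcoeff1 eqxx mcoeffZ mulVf // subrr.
exists ((s@_0%MM)^-1 *: (\sum_(i < t) (1 - y) ^+ i)).
have -> : 1 - (s@_0%MM)^-1 *: (\sum_(i < t) (1 - y) ^+ i) * s = (1 - y) ^+ t.
  rewrite -scalerAl scalerAr -/y.
  have := subrX1 (1 - y) t; move: (\sum_(i < t) _) => z H.
  by rewrite -(subrK 1 ((1 - y) ^+ t)) H; ring.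
exact: exp_ideal_pow.
Qed.

End LocalReductions.

(** * Linear algebra over a domain *)

Section LinearAlgebraOverDomain.
Variable A : idomainType.
Local Notation F := {fraction A}.

Lemma frac_numden (x : F) : exists n d : A, d != 0 /\ x * FracField.tofrac d = FracField.tofrac n.
Proof.
elim/generic_quotient.quotW: x => r; exists (frac r).1, (frac r).2; split.
  exact: denom_ratioP.
unlock FracField.tofrac; rewrite -[LHS]FracField.pi_mul; apply/eqmodP.
rewrite /= FracField.equivfE /FracField.mulf !numden_Ratio ?mulf_neq0 ?oner_eq0 ?denom_ratioP //.
by rewrite !mulr1 mulrC.
Qed.

Lemma frac_denom (X : finType) (c : X -> F) : exists (D : A) (c' : X -> A),
  D != 0 /\ forall x, c x * FracField.tofrac D = FracField.tofrac (c' x).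
Proof.
have H x : exists nd : A * A, nd.2 != 0 /\ c x * FracField.tofrac nd.2 = FracField.tofrac nd.1.
  by have [n [d [d0 E]]] := frac_numden (c x); exists (n, d).
have [nd Hnd] := choice H.
exists (\prod_x (nd x).2), (fun x => (nd x).1 * \prod_(y | y != x) (nd y).2); split.
  by apply/prodf_neq0 => x _; have [] := Hnd x.
by move=> x; rewrite (bigD1 x) //= !tofracM mulrA; have [_ ->] := Hnd x.
Qed.

Lemma lin_dep_dom (X Y : finType) (f : X -> Y -> A) : (#|Y| < #|X|)%N ->
  exists2 c : X -> A, (exists x, c x != 0) & forall y, \sum_x c x * f x y = 0.
Proof.
move=> YX; have [c [x0 cx0] Hc] := lin_dep (fun x y => FracField.tofrac (f x y)) YX.
have [D [c' [D0 Hc']]] := frac_denom c; exists c'.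
  exists x0; rewrite -tofrac_eq0 -Hc' mulf_neq0 // tofrac_eq0; exact: D0.
move=> y; apply/eqP; rewrite -tofrac_eq0 rmorph_sum /=.
rewrite (eq_bigr (fun x => FracField.tofrac D * (c x * FracField.tofrac (f x y)))).
  by rewrite -mulr_sumr Hc mulr0.
by move=> x _; rewrite tofracM -Hc'; ring.
Qed.

(** The alternative of linear algebra over the fraction field, cleared of denominators. Each
    certificate survives every specialization that does not annihilate the nonzero element coming
    with it. *)
Lemma row_space_dichotomy (X Y : finType) (M : X -> Y -> A) (y : Y -> A) :
  (exists (D : A) (c : X -> A), D != 0 /\ forall b, D * y b = \sum_a c a * M a b) \/
  (exists v : Y -> A, (forall a, \sum_b M a b * v b = 0) /\ \sum_b y b * v b != 0).
Proof.
pose MM : 'M[F]_(#|X|, #|Y|) := \matrix_(i, j) FracField.tofrac (M (enum_val i) (enum_val j)).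
pose yy : 'rV[F]_#|Y| := \row_j FracField.tofrac (y (enum_val j)).
case: (boolP (yy <= MM)%MS) => [/submxP[C EC]|].
  left; have [D [c [D0 Hc]]] := frac_denom (fun a : X => C 0 (enum_rank a)).
  exists D, c; split=> // b; apply/eqP; rewrite -tofrac_eq tofracM rmorph_sum /=.
  have /matrixP/(_ 0 (enum_rank b)) := EC; rewrite !mxE enum_rankK => ->.
  rewrite mulr_sumr (reindex (@enum_val X predT)) /=; last first.
    by exists enum_rank => x _; rewrite ?enum_valK ?enum_rankK.
  apply/eqP; apply: eq_bigr => i _; rewrite !mxE enum_rankK tofracM -Hc enum_valK; ring.
rewrite submxE => nz; right.
have [j Hj] : exists j, (yy *m cokermx MM) 0 j != 0.
  apply/existsP; apply: contraNT nz => /existsPn H.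
  by apply/eqP/matrixP => i j; rewrite ord1 [RHS]mxE; apply/eqP; have := H j; rewrite negbK.
have [D [v [D0 Hv]]] := frac_denom (fun b : Y => cokermx MM (enum_rank b) j).
exists v; split=> [a|].
  apply/eqP; rewrite -tofrac_eq0 rmorph_sum /=.
  have /matrixP/(_ (enum_rank a) j) := mulmx_coker MM; rewrite mxE [RHS]mxE => E.
  rewrite (reindex (@enum_val Y predT)) /=; last first.
    by exists enum_rank => x _; rewrite ?enum_valK ?enum_rankK.
  rewrite (eq_bigr (fun i => FracField.tofrac D * (MM (enum_rank a) i * cokermx MM i j))).
    by rewrite -mulr_sumr E mulr0.
  by move=> i _; rewrite [MM _ _]mxE enum_rankK tofracM -Hv enum_valK; ring.
rewrite -tofrac_eq0 rmorph_sum /= (reindex (@enum_val Y predT)) /=; last first.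
  by exists enum_rank => x _; rewrite ?enum_valK ?enum_rankK.
rewrite (eq_bigr (fun i => FracField.tofrac D * (yy 0 i * cokermx MM i j))); last first.
  by move=> i _; rewrite [yy _ _]mxE tofracM -Hv enum_valK; ring.
by rewrite -mulr_sumr mulf_neq0 ?tofrac_eq0 //; move: Hj; rewrite mxE.
Qed.

End LinearAlgebraOverDomain.

(** * Kronecker substitution *)

Section Kronecker.

Definition kweight (B n : nat) (m : 'X_{1..n}) : nat := (\sum_(i < n) m i * B ^ i)%N.

Lemma digits_inj B n (f g : nat -> nat) :
  (forall i, (i < n)%N -> (f i < B)%N) -> (forall i, (i < n)%N -> (g i < B)%N) ->
  (\sum_(i < n) f i * B ^ i = \sum_(i < n) g i * B ^ i)%N ->
  forall i, (i < n)%N -> f i = g i.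
Proof.
elim: n f g => [|n IH] f g Hf Hg //; rewrite !big_ord_recl /= expn0 !muln1 => E.
have B0 : (0 < B)%N by apply: leq_ltn_trans (Hf 0%N isT).
have sh (h : nat -> nat) : (\sum_(i < n) h (bump 0 i) * B ^ bump 0 i =
    B * \sum_(i < n) h i.+1 * B ^ i)%N.
  by rewrite big_distrr /=; apply: eq_bigr => i _; rewrite /bump /= add1n expnS mulnCA.
rewrite !sh in E.
have E0 : f 0%N = g 0%N.
  have := congr1 (modn^~ B) E.
  by rewrite ![(B * _)%N]mulnC ![(_ + _ * B)%N]addnC !modnMDl !modn_small ?Hf ?Hg.
move: E; rewrite E0 => /addnI/eqP; rewrite eqn_pmul2l // => /eqP E [_|i] //.
by rewrite ltnS => lin; apply: (IH (fun i => f i.+1) (fun i => g i.+1)) => // j jn;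
  [apply: Hf|apply: Hg].
Qed.

Lemma kweight_inj B n (a b : 'X_{1..n}) : (mdeg a < B)%N -> (mdeg b < B)%N ->
  kweight B a = kweight B b -> a = b.
Proof.
have le (c : 'X_{1..n}) i : (c i <= mdeg c)%N by rewrite mdegE (bigD1 i) //= leq_addr.
move=> aB bB E; pose f (c : 'X_{1..n}) j := if insub j is Some i then c i else 0%N.
have fE (c : 'X_{1..n}) (i : 'I_n) : f c i = c i by rewrite /f valK.
apply/mnmP => i; rewrite -!fE; apply: (@digits_inj B n) => // [j jn|j jn|].
- by rewrite /f insubT //; apply: leq_ltn_trans aB.
- by rewrite /f insubT //; apply: leq_ltn_trans bB.
- by move: E; rewrite /kweight; under eq_bigr do rewrite -fE; under [in RHS]eq_bigr do rewrite -fE.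
Qed.

Variable k : fieldType.
Hypothesis infk : infinite_set [set: k].

Lemma meval_kron n B (p : {mpoly k[n]}) t : p.@[fun i => t ^+ (B ^ i)] =
  (\sum_(m <- msupp p) p@_m *: 'X^(kweight B m)).[t].
Proof.
rewrite horner_sum mevalE; apply: eq_bigr => m _.
rewrite hornerZ hornerXn; congr (_ * _); rewrite /kweight.
rewrite -prodrXr; apply: eq_bigr => i _; by rewrite -exprM mulnC.
Qed.

Lemma mpoly_nonroot n (p : {mpoly k[n]}) : p != 0 -> exists v, p.@[v] != 0.
Proof.
move=> p0; pose q := \sum_(m <- msupp p) p@_m *: ('X^(kweight (msize p) m) : {poly k}).
have q0 : q != 0.
  have [m mp] : exists m, m \in msupp p by exists (mlead p); apply: mlead_supp.
  apply/negP => /eqP/(congr1 (fun q : {poly k} => q`_(kweight (msize p) m))).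
  rewrite coef_sum (bigD1_seq m) ?msupp_uniq //= coefZ coefXn eqxx mulr1 big_seq_cond.
  rewrite big1 ?addr0 ?coef0 => [/eqP|m' /andP[m'p m'm]].
    by rewrite mcoeff_eq0 mp.
  rewrite coefZ coefXn; case: eqP => [E|_]; last by rewrite mulr0.
  by case/eqP: m'm; apply: (kweight_inj (B := msize p)) => //; apply: msize_mdeg_lt.
have [t qt] := cof_ex infk (cof_root q0).
by exists (fun i => t ^+ (msize p ^ i)); rewrite meval_kron.
Qed.

End Kronecker.

(** * Generic integrality by counting *)

Section GenericIntegrality.
Variables (k : fieldType) (d u : nat).
Local Notation R := {mpoly k[d]}.
Local Notation L := {mpoly k[d * u]}.
Hypothesis infk : infinite_set [set: k].

Definition evmx (p : L) (lam : 'M[k]_(d, u)) : k := p.@[mxvec lam 0].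

Lemma evmx0 lam : evmx 0 lam = 0.
Proof. exact: rmorph0. Qed.
Lemma evmxM p q lam : evmx (p * q) lam = evmx p lam * evmx q lam.
Proof. exact: rmorphM. Qed.
Lemma evmxZ c p lam : evmx (c *: p) lam = c * evmx p lam.
Proof. by rewrite /evmx mevalZ. Qed.
Lemma evmx_sum (J : Type) (s : seq J) (P : pred J) (F : J -> L) lam :
  evmx (\sum_(i <- s | P i) F i) lam = \sum_(i <- s | P i) evmx (F i) lam.
Proof. exact: rmorph_sum. Qed.
Lemma evmxX i j lam : evmx 'X_(mxvec_index i j) lam = lam i j.
Proof. by rewrite /evmx mevalXU mxvecE. Qed.

Lemma evmx_nonroot (p : L) : p != 0 -> exists lam, evmx p lam != 0.
Proof.
move=> /(mpoly_nonroot infk)[v pv]; exists (vec_mx (\row_l v l)).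
rewrite /evmx vec_mxK; suff -> : p.@[(\row_l v l) 0] = p.@[v] by [].
by apply: meval_eq => l; rewrite mxE.
Qed.

Variables (g : 'I_u -> R) (G : ideal R).
Hypothesis Gg : forall j, G (g j).

Definition gel (lam : 'M[k]_(d, u)) (i : 'I_d) : R := \sum_(j < u) lam i j *: g j.

(** Forms of degree e in the g_j with coefficients polynomial in the matrix entries, kept as a list
    so that each product of the g_j can be rewritten separately. *)
Definition expands (e : nat) (F : 'M[k]_(d, u) -> R) : Prop :=
  exists s : seq (L * seq 'I_u), (forall x, x \in s -> size x.2 = e) /\
    forall lam, F lam = \sum_(x <- s) evmx x.1 lam *: \prod_(j <- x.2) g j.

Lemma expands1 : expands 0 (fun=> 1).
Proof.
exists [:: (1, [::])]; split=> [x|lam]; first by rewrite inE => /eqP ->.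
by rewrite big_seq1 big_nil /evmx rmorph1 scale1r.
Qed.

Lemma expands_g j e F : expands e F -> expands e.+1 (fun lam => g j * F lam).
Proof.
move=> [s [Hs HF]]; exists [seq (x.1, j :: x.2) | x <- s]; split=> [x|lam].
  by case/mapP=> y /Hs ys ->; rewrite /= ys.
by rewrite HF big_map mulr_sumr; apply: eq_bigr => x _; rewrite big_cons -scalerAr.
Qed.

Lemma expands_gel i e F : expands e F -> expands e.+1 (fun lam => gel lam i * F lam).
Proof.
move=> [s [Hs HF]].
exists [seq ('X_(mxvec_index i j) * x.1, j :: x.2) | x <- s, j <- enum 'I_u].
split=> [x|lam].
  by case/allpairsP=> -[y j] [/Hs ys _ ->]; rewrite /= ys.
rewrite HF big_allpairs_dep mulr_sumr; apply: eq_bigr => x _.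
rewrite big_enum /= mulr_suml; apply: eq_bigr => j _ /=.
by rewrite evmxM evmxX big_cons -scalerAl -scalerAr scalerA.
Qed.

Lemma expands_pow i e a F :
  expands e F -> expands (a + e) (fun lam => gel lam i ^+ a * F lam).
Proof.
move=> HF; elim: a => [|a IH].
  by move: HF; congr expands; apply/funext => lam; rewrite expr0 mul1r.
have := expands_gel i IH; rewrite addSn; congr expands; apply/funext => lam.
by rewrite exprS mulrA.
Qed.

Lemma expands_gpow j e : expands e (fun=> g j ^+ e).
Proof.
elim: e => [|e IH]; first exact: expands1.
by have := expands_g j IH; congr expands; apply/funext => lam; rewrite exprS.
Qed.

Lemma expands_prod (s : seq 'I_d) (al : 'I_d -> nat) e F : expands e F ->
  expands (\sum_(i <- s) al i + e) (fun lam => (\prod_(i <- s) gel lam i ^+ al i) * F lam).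
Proof.
move=> HF; elim: s => [|i s IH].
  rewrite big_nil; move: HF; congr expands; apply/funext => lam.
  by rewrite big_nil mul1r.
have := expands_pow i (al i) IH; rewrite big_cons addnA; congr expands.
by apply/funext => lam; rewrite big_cons mulrA.
Qed.

Section Congruence.
Variable a : 'I_d -> R.
Hypothesis aG : forall i, G (a i).

(** J G^(e-1) for the ideal J of the [a i]; in degree 0 it has to be the zero ideal for congruences
    to multiply. *)
Let Je e : ideal R := if e is e'.+1 then mul_ideal (gen (range a)) (exp_ideal G e')
  else zideal R.

Lemma Je_mul e f x y : Je e x -> exp_ideal G f y -> Je (e + f) (x * y).
Proof.
case: e => [|e] /= Jx Gy; first by move/zidealP: Jx => ->; rewrite mul0r; apply: ideal0.
by rewrite exp_idealD mul_idealA; apply: mul_ideal_mem.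
Qed.

Definition cong e x y := [/\ exp_ideal G e x, exp_ideal G e y & Je e (x - y)].

Lemma cong_mul e f x y x' y' : cong e x y -> cong f x' y' -> cong (e + f) (x * x') (y * y').
Proof.
move=> [Gx Gy Jxy] [Gx' Gy' Jxy']; split.
- by rewrite exp_idealD; apply: mul_ideal_mem.
- by rewrite exp_idealD; apply: mul_ideal_mem.
- have -> : x * x' - y * y' = (x - y) * x' + (x' - y') * y by ring.
  by apply: idealD; [exact: Je_mul|rewrite addnC; exact: Je_mul].
Qed.

Lemma cong0 : cong 0 1 1.
Proof. by split; [exact: gen_setT|exact: gen_setT|rewrite subrr; exact: ideal0]. Qed.

Lemma cong_pow e x y : cong 1 x y -> cong e (x ^+ e) (y ^+ e).
Proof.
move=> H; elim: e => [|e IH]; first exact: cong0.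
by rewrite !exprS -add1n; apply: cong_mul.
Qed.

Lemma cong_prod (s : seq 'I_d) (al : 'I_d -> nat) (x y : 'I_d -> R) :
  (forall i, cong 1 (x i) (y i)) ->
  cong (\sum_(i <- s) al i) (\prod_(i <- s) x i ^+ al i) (\prod_(i <- s) y i ^+ al i).
Proof.
move=> H; elim: s => [|i s IH]; first by rewrite !big_nil; apply: cong0.
by rewrite !big_cons; apply: cong_mul => //; apply: cong_pow.
Qed.

Lemma cong_refl e x : exp_ideal G e x -> cong e x x.
Proof. by move=> Gx; split=> //; rewrite subrr; apply: ideal0. Qed.

Lemma cong_shift i c j : cong 1 (a i + c *: g j) (c *: g j).
Proof.
rewrite /cong exp_ideal1 addrK; split.
- by apply: idealD => //; rewrite -mul_mpolyC; apply: idealMl.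
- by rewrite -mul_mpolyC; apply: idealMl.
- by rewrite /= mul_ideal1; apply: sub_gen; exists i.
Qed.

End Congruence.

(* counting gives a homogeneous relation of degree n over k[Lambda] between the
   generic elements and g_j; translating the j-th column of Lambda makes it monic
   in g_j up to a nonzero factor h *)
Lemma generic_integrality (n q r : nat) (beta : 'I_r -> R) (W : ideal R) :
  n = (d * q)%N -> (0 < n)%N -> (r < q.+1 ^ d)%N ->
  (forall w : seq 'I_u, size w = n ->
    exists c : 'I_r -> k, W (\prod_(j <- w) g j - \sum_b c b *: beta b)) ->
  forall j, exists h : L, h != 0 /\ forall lam, exists y,
    mul_ideal (gen (range (gel lam))) (exp_ideal G n.-1) y /\
    W (evmx h lam *: g j ^+ n - y).
Proof.
move=> En n0 rq Hspan j; pose X := {ffun 'I_d -> 'I_q.+1}.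
pose sm (al : X) := (\sum_(i < d) al i)%N.
have smn al : (sm al <= n)%N.
  have -> : n = (\sum_(i < d) q)%N by rewrite sum_nat_const card_ord.
  by apply: leq_sum => i _; rewrite -ltnS.
(* The exponents al have degree at most n = d q; a power of g_j fills each product up to degree
   n. *)
pose M (al : X) lam := (\prod_(i < d) gel lam i ^+ al i) * g j ^+ (n - sm al).
have HM al : expands n (M al).
  have := expands_prod (index_enum 'I_d) (fun i => al i : nat) (expands_gpow j (n - sm al)).
  by rewrite -/(sm al) subnKC.
have [s Hs] := choice HM.
have HT w : exists c : 'I_r -> k,
    size w = n -> W (\prod_(j <- w) g j - \sum_b c b *: beta b).
  have [sw|sw] := eqVneq (size w) n; last by exists (fun=> 0) => E; rewrite E eqxx in sw.
  by have [c Hc] := Hspan _ sw; exists c.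
have [T HT'] := choice HT.
pose f (al : X) (b : 'I_r) : L := \sum_(x <- s al) T x.2 b *: x.1.
have HMf al lam : W (M al lam - \sum_b evmx (f al b) lam *: beta b).
  have [Hsz ->] := Hs al.
  have -> : \sum_b evmx (f al b) lam *: beta b =
      \sum_(x <- s al) evmx x.1 lam *: \sum_b T x.2 b *: beta b.
    under eq_bigr => b _ do rewrite /f evmx_sum scaler_suml.
    rewrite exchange_big /=; apply: eq_bigr => x _; rewrite scaler_sumr.
    by apply: eq_bigr => b _; rewrite evmxZ scalerA mulrC.
  rewrite -sumrB big_seq; elim/big_ind: _ => [|x y|x xs]; [exact: ideal0|exact: idealD|].
  rewrite -scalerBr -mul_mpolyC; apply: idealMl; apply: HT'; exact: Hsz.
have [|c [al0 cal0] Hc] := @lin_dep_dom L X 'I_r f; first by rewrite card_ord card_ffun !card_ord.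
have Hrel lam : W (\sum_al evmx (c al) lam *: M al lam).
  have -> : \sum_al evmx (c al) lam *: M al lam =
      \sum_al evmx (c al) lam *: (M al lam - \sum_b evmx (f al b) lam *: beta b).
    under [RHS]eq_bigr => al _ do rewrite scalerBr scaler_sumr.
    rewrite sumrB exchange_big /= [X in _ - X]big1 ?subr0 // => b _.
    under eq_bigr => al _ do rewrite scalerA -evmxM.
    by rewrite -scaler_suml -evmx_sum Hc /evmx rmorph0 scale0r.
  elim/big_ind: _ => [|x y|al _]; [exact: ideal0|exact: idealD|].
  by rewrite -mul_mpolyC; apply: idealMl.
have [lam0 Hlam0] := evmx_nonroot cal0.
pose mon (al : X) : 'X_{1..d} := [multinom (al i : nat) | i < d].
pose P : R := \sum_al evmx (c al) lam0 *: 'X_[mon al].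
have P0 : P != 0.
  apply/negP => /eqP/(congr1 (mcoeff (mon al0))).
  rewrite raddf_sum /= (bigD1 al0) //= mcoeffZ mcoeffX eqxx mulr1 mcoeff0 big1 ?addr0.
    by move/eqP; rewrite (negbTE Hlam0).
  move=> al alN; rewrite mcoeffZ mcoeffX; case: eqP => [E|_]; last by rewrite mulr0.
  case/eqP: alN; apply/ffunP => i; apply: val_inj.
  by have /mnmP/(_ i) := E; rewrite !mnmE.
have [v Pv] := mpoly_nonroot infk P0.
(* Translating column j by v turns the i-th generic element a_i into a_i + v_i g_j, which is v_i g_j
   modulo J. The relation becomes h g_j^n, and h takes the nonzero value P(v) at [lam0 - Sh]. *)
pose Sh : 'M[k]_(d, u) := \matrix_(i, l) (if l == j then v i else 0).
pose wt (al : X) := \prod_(i < d) v i ^+ al i.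
pose sub := [tuple 'X_l + (mxvec Sh 0 l)%:MP_[d * u] | l < d * u].
pose h : L := \sum_al wt al *: (c al \mPo sub).
have evsub p lam : evmx (p \mPo sub) lam = evmx p (lam + Sh).
  rewrite /evmx comp_mpoly_meval; apply: meval_eq => l.
  by rewrite tnth_mktuple mevalD mevalXU mevalC linearD mxE.
have hE lam : evmx h lam = \sum_al wt al * evmx (c al) (lam + Sh).
  by rewrite evmx_sum; apply: eq_bigr => al _; rewrite evmxZ evsub.
exists h; split.
  apply: contraNneq Pv => h0; have := hE (lam0 - Sh); rewrite h0 /evmx rmorph0 subrK => E.
  apply/eqP; rewrite [RHS]E /P rmorph_sum /=; apply: eq_bigr => al _.
  rewrite mevalZ mevalX mulrC; congr (_ * _); apply: eq_bigr => i _.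
  by rewrite mnmE.
move=> lam.
have gelS i : gel (lam + Sh) i = gel lam i + v i *: g j.
  rewrite /gel; under eq_bigr => l _ do rewrite mxE scalerDl.
  rewrite big_split /=; congr (_ + _); rewrite (bigD1 j) //= big1 ?addr0 ?mxE ?eqxx // => l lj.
  by rewrite mxE (negbTE lj) scale0r.
have aG i : G (gel lam i).
  by rewrite /gel; apply: ideal_sum => l; rewrite -mul_mpolyC; apply: idealMl.
have HMS al : mul_ideal (gen (range (gel lam))) (exp_ideal G n.-1)
    (M al (lam + Sh) - wt al *: g j ^+ n).
  have := cong_mul (cong_prod (index_enum 'I_d) (fun i => al i : nat)
     (fun i => cong_shift aG i (v i) j))
     (cong_refl (gel lam) (exp_ideal_pow (n - sm al) (Gg j))).
  rewrite -/(sm al) subnKC // => -[_ _]; rewrite -{1}(prednK n0).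
  congr (mul_ideal _ _ _); congr (_ - _).
    by rewrite /M; congr (_ * _); apply: eq_bigr => i _; rewrite gelS.
  rewrite (eq_bigr (fun i => (v i ^+ al i)%:MP * g j ^+ al i)); last first.
    by move=> i _; rewrite exprZn -mul_mpolyC.
  rewrite big_split /= prodrXr -mulrA -exprD subnKC; last exact: smn.
  by rewrite -(mul_mpolyC (wt al)) /wt rmorph_prod.
exists (evmx h lam *: g j ^+ n - \sum_al evmx (c al) (lam + Sh) *: M al (lam + Sh)); split.
  have -> : evmx h lam *: g j ^+ n - \sum_al evmx (c al) (lam + Sh) *: M al (lam + Sh) =
     - \sum_al evmx (c al) (lam + Sh) *: (M al (lam + Sh) - wt al *: g j ^+ n).
    under [in RHS]eq_bigr => al _ do rewrite scalerBr scalerA.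
    rewrite sumrB opprB hE scaler_suml; congr (_ - _).
    by apply: eq_bigr => al _; rewrite mulrC.
  apply: idealN; elim/big_ind: _ => [|x y|al _]; [exact: ideal0|exact: idealD|].
  by rewrite -(mul_mpolyC (evmx _ _)); apply: idealMl.
by rewrite subKr; exact: Hrel.
Qed.

End GenericIntegrality.

(** * Counting monomials under a staircase *)

Section Counting.
Import Order.TTheory.
Variables (k : fieldType) (d' : nat).
Local Notation d := d'.+1.
Local Notation R := {mpoly k[d]}.
Local Notation m := (max_ideal k d).

Definition stair (N : nat) (w0 : 'X_{1..d}) : finType :=
  {g : 'X_{1..d < N.+1} | ~~ (w0 <= (g : 'X_{1..d}))%MM}.

Lemma mnm_le_mdeg n (g : 'X_{1..n}) i : (g i <= mdeg g)%N.
Proof. by rewrite mdegE (bigD1 i) //= leq_addr. Qed.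

(** An exponent not above w0 is smaller than w0 in some coordinate, which takes boundedly many
    values; the other d - 1 coordinates are free. *)
Lemma stair_count N w0 : (#|stair N w0| <= d * (mdeg w0).+1 * N.+1 ^ d')%N.
Proof.
pose ix (g : 'X_{1..d}) : 'I_d := odflt ord0 [pick i | (g i < w0 i)%N].
pose F (g : stair N w0) : 'I_d * 'I_(mdeg w0).+1 * {ffun 'I_d' -> 'I_N.+1} :=
  let e : 'X_{1..d} := val g in
  (ix e, inord (e (ix e)), [ffun l => inord (e (lift (ix e) l))]).
have Finj : injective F.
  move=> g g' [E1 E2 E3]; do 2!apply: val_inj.
  have ixP (h : stair N w0) : ((val h : 'X_{1..d}) (ix (val h)) <= mdeg w0)%N.
    rewrite /ix; case: pickP => [i /ltnW hi|H] /=; first exact: leq_trans hi (mnm_le_mdeg _ _).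
    have /negP[] := valP h; apply/mnm_lepP => i; rewrite leqNgt.
    by have := H i; rewrite /= => ->.
  have hN (h : stair N w0) i : ((val h : 'X_{1..d}) i <= N)%N.
    by apply: leq_trans (mnm_le_mdeg _ _) _; rewrite -ltnS; apply: (valP (val h)).
  apply/mnmP => i; have [->|ii] := eqVneq i (ix (val g)).
    move/(congr1 val): E2; rewrite /= !inordK ?ltnS ?ixP // -?E1 => -> //.
  have [l ->] : exists l, i = lift (ix (val g)) l.
    by case: (unliftP (ix (val g)) i) => [l|] E; [exists l|case/eqP: ii].
  have /ffunP/(_ l) := E3; rewrite !ffunE => /(congr1 val).
  by rewrite /= !inordK ?ltnS ?hN // -E1.
have := leq_card F Finj.
by rewrite !card_prod card_ffun !card_ord.
Qed.

Lemma stair_small D w0 : exists2 q, (0 < q)%N & forall r,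
  (r <= #|stair (d * q * D) w0|)%N -> (r < q.+1 ^ d)%N.
Proof.
(* As d q D + 1 <= (d D + 1) (q + 1), the count is at most q (q + 1)^(d-1), less than (q + 1)^d. *)
pose q := (d * (mdeg w0).+1 * (d * D).+1 ^ d')%N.
have q0 : (0 < q)%N by rewrite !muln_gt0 /= expn_gt0.
exists q => // r rs; apply: leq_ltn_trans rs _.
apply: leq_ltn_trans (stair_count _ _) _.
rewrite (expnS q.+1); apply: leq_ltn_trans (_ : q * q.+1 ^ d' < _)%N; last first.
  by rewrite ltn_mul2r ltnSn expn_gt0.
rewrite /q -[X in (_ <= X)%N]mulnA leq_mul2l; apply/orP; right.
rewrite -expnMn; apply: leq_expn2; rewrite -/q; nia.
Qed.

Lemma msize_prod (J : Type) (w : seq J) (g : J -> R) D : (forall j, (msize (g j) <= D.+1)%N) ->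
  (msize (\prod_(j <- w) g j) <= (size w * D).+1)%N.
Proof.
move=> gD; elim: w => [|j w IH]; first by rewrite big_nil msize1.
by rewrite big_cons mulSn; apply: msizeM_deg.
Qed.

Section Instances.
Hypothesis infk : infinite_set [set: k].
Variables (u : nat) (g : 'I_u -> R).

Lemma gens_degree : exists D, forall j, (msize (g j) <= D.+1)%N.
Proof. by exists (\max_j msize (g j))%N => j; apply: leqW; apply: leq_bigmax. Qed.

(* on each line parallel to an exponent w0 of I there is at most one monomial of
   I^n outside I^(n+1) *)
Lemma integral_mod_power (I : ideal R) w0 : monoidl I -> I 'X_[w0] -> w0 != 0%MM ->
  (forall j, I (g j)) ->
  exists2 n, (0 < n)%N & forall j, exists h : {mpoly k[d * u]}, h != 0 /\
    forall lam, exists y, mul_ideal (gen (range (gel g lam))) (exp_ideal I n.-1) y /\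
      exp_ideal I n.+1 (evmx h lam *: g j ^+ n - y).
Proof.
move=> mI Iw w0n0 Ig; have [D gD] := gens_degree.
have [q q0 Hq] := stair_small D w0; pose n := (d * q)%N.
exists n; first by rewrite muln_gt0.
pose Q (e : 'X_{1..d < (n * D).+1}) : bool :=
  `[< exp_ideal I n 'X_[e] /\ ~ exp_ideal I n.+1 'X_[e] >].
have strip (e : 'X_{1..d}) : exists st : 'X_{1..d} * nat,
    ~~ (w0 <= st.1)%MM /\ e = (st.1 + w0 *+ st.2)%MM.
  move: {2}(mdeg e) (leqnn (mdeg e)) => b; elim: b e => [|b IH] e eb.
    exists (e, 0%N); split; last by rewrite mulm0n addm0.
    apply: contra w0n0 => we; move: eb; rewrite leqn0 mdeg_eq0 => /eqP e0; rewrite e0 in we.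
    by apply/eqP/mnmP => i; move/mnm_lepP: we => /(_ i); rewrite mnm0E leqn0 => /eqP.
  case: (boolP (w0 <= e)%MM) => we; last by exists (e, 0%N); rewrite mulm0n addm0.
  have [|[s t] [/= ws E]] := IH (e - w0)%MM.
    rewrite -ltnS; apply: leq_trans eb; rewrite -{2}(submK we) mdegD.
    by rewrite -[X in (X < _)%N]addn0 ltn_add2l lt0n mdeg_eq0.
  exists (s, t.+1); split=> //=.
  by rewrite -(submK we) E mulmSr addmA.
have [st Hst] := choice strip.
pose F (e : {e | Q e}) : 'X_{1..d} := (st (val (val e) : 'X_{1..d})).1.
have FN (e : {e | Q e}) : (mdeg (F e) < (n * D).+1)%N.
  have [_ E] := Hst (val (val e)); apply: leq_ltn_trans (valP (val e)).
  by rewrite [X in (_ <= mdeg X)%N]E mdegD leq_addr.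
have FS (e : {e | Q e}) : ~~ (w0 <= (BMultinom (FN e) : 'X_{1..d}))%MM.
  by have [] := Hst (val (val e)).
pose F' (e : {e | Q e}) : stair (n * D) w0 := exist _ (BMultinom (FN e)) (FS e).
have lineI (a : 'X_{1..d}) t t' : (t < t')%N -> exp_ideal I n 'X_[a + w0 *+ t] ->
    exp_ideal I n.+1 'X_[a + w0 *+ t'].
  move=> tt Ia; have -> : (a + w0 *+ t' = w0 + (w0 *+ (t' - t).-1 + (a + w0 *+ t)))%MM.
    by apply/mnmP => i; rewrite !(mnmDE, mulmnE); nia.
  rewrite mpolyXD; apply: mul_ideal_mem => //.
  by rewrite mpolyXD; apply: idealMl.
have F'inj : injective F'.
  move=> e1 e2 /(congr1 (fun s => val (val s) : 'X_{1..d})) /= E.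
  have [_ E1] := Hst (val (val e1)); have [_ E2] := Hst (val (val e2)).
  have /asboolP[I1 N1] := valP e1; have /asboolP[I2 N2] := valP e2.
  rewrite /F in E; do 2!apply: val_inj; rewrite E1 E2 E.
  rewrite E1 E in I1 N1; rewrite E2 in I2 N2.
  case: (ltngtP (st (val (val e1))).2 (st (val (val e2))).2) => [lt|lt|-> //].
  - by case: N2; apply: lineI I1.
  - by case: N1; apply: lineI I2.
pose r := #|{: {e | Q e}}|.
pose beta (b : 'I_r) : R := 'X_[val (enum_val b : {e | Q e})].
apply: (@generic_integrality _ _ _ infk g I Ig n q r beta) => //.
- by rewrite muln_gt0.
- by apply: Hq; apply: leq_card F'inj.
move=> w sw; set p := \prod_(j <- w) g j.
have pI : exp_ideal I n p by rewrite -sw; apply: prod_mem_exp.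
have psz : (msize p <= (n * D).+1)%N by rewrite -sw; apply: msize_prod.
exists (fun b => p@_(val (enum_val b : {e | Q e}))).
have -> : \sum_b p@_(val (enum_val b : {e | Q e})) *: beta b =
    \sum_(e : {e | Q e}) p@_(val e) *: 'X_[val e].
  rewrite [RHS](reindex (@enum_val {e | Q e} predT)) //=.
  by exists enum_rank => x _; rewrite ?enum_valK ?enum_rankK.
have -> : \sum_(e : {e | Q e}) p@_(val e) *: 'X_[val e] =
    \sum_(e : 'X_{1..d < (n * D).+1} | Q e) p@_e *: 'X_[e] :> R.
  rewrite [RHS](reindex_omap (val : {e | Q e} -> _) insub) /=; last first.
    by move=> e Qe; rewrite insubT.
  apply: eq_big => [e|//]; by rewrite valK (valP e) eqxx.
rewrite {1}(mpolywE psz) (bigID Q) /= [X in X - _]addrC addrK.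
elim/big_ind: _ => [|x y|e Qe]; [exact: ideal0|exact: idealD|].
have [->|pe] := eqVneq p@_e 0; first by rewrite scale0r; apply: ideal0.
rewrite -mul_mpolyC; apply: idealMl; apply: contrapT => Ie; move/negP: Qe; apply.
by apply/asboolP; split=> //; apply: (monoidl_exp mI) pI pe.
Qed.

(** Division by f, by induction on the leading monomial; the monomial order refines the degree, so
    the degree bound is kept. *)
Lemma mlead_reduce (f : R) N p : f != 0 -> (msize p <= N.+1)%N ->
  exists c : stair N (mlead f) -> k, gen [set f] (p - \sum_e c e *: 'X_[val e]).
Proof.
move=> f0; have [a pa] : exists a, (mlead p <= a)%O by exists (mlead p); rewrite lexx.
elim/(@ltmwf d): a p pa => a IH p pa psz.
have [->|p0] := eqVneq p 0.
  exists (fun=> 0); rewrite big1 ?subr0 => [|e _]; first exact: ideal0.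
  by rewrite scale0r.
have next (p' : R) : (msize p' <= N.+1)%N -> (forall e, (a <= e)%O -> p'@_e = 0) ->
    exists c : stair N (mlead f) -> k, gen [set f] (p' - \sum_e c e *: 'X_[val e]).
  move=> sp' H; have [->|p'0] := eqVneq p' 0.
    exists (fun=> 0); rewrite big1 ?subr0 => [|e _]; first exact: ideal0.
    by rewrite scale0r.
  apply: (IH (mlead p')) => //.
  rewrite ltNge; apply/negP => /H /eqP; rewrite mleadc_eq0; exact/negP.
have above (p' : R) (e : 'X_{1..d}) : (mlead p' <= a)%O -> (a <= e)%O -> e != a -> p'@_e = 0.
  move=> p'a ae ea; apply: mcoeff_gt_mlead; apply: le_lt_trans p'a _.
  by rewrite lt_neqAle eq_sym ea.
have [Ha|Ha] := eqVneq p@_a 0.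
  apply: next => // e ae; have [->//|ea] := eqVneq e a; exact: above ea.
have ma : mlead p = a.
  apply/eqP; rewrite eq_le pa /=; apply: msupp_le_mlead; by rewrite mcoeff_msupp.
have aN : (mdeg a < N.+1)%N by rewrite -ma mlead_deg.
case: (boolP (mlead f <= a)%MM) => [fa|fa].
  pose q : R := (p@_a / mleadc f) *: 'X_[a - mlead f].
  have lf : mlead ('X_[a - mlead f] * f) = a.
    rewrite mleadM_proper ?mleadXm ?submK // mcoeffX eqxx mul1r.
    by rewrite mleadc_eq0.
  have [||c Hc] := next (p - q * f).
  - rewrite /q -scalerAl; apply: leq_trans (msizeD_le _ _) _; rewrite geq_max psz msizeN.
    apply: leq_trans (msizeZ_le _ _) _; rewrite -mlead_deg ?lf //.
    by rewrite mulf_neq0 // -msupp_eq0 msuppX.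
  - move=> e ae; have [->|ea] := eqVneq e a.
      rewrite mcoeffB /q -scalerAl mcoeffZ -{3}(submK fa) mulrC.
      have -> : ('X_[a - mlead f] * f)@_(a - mlead f + mlead f) = mleadc f.
        have := mleadcM ('X_[a - mlead f] : R) f; rewrite mleadXm mcoeffX eqxx mul1r => ->.
        by [].
      by rewrite mulrCA mulfV ?mulr1 ?subrr // mleadc_eq0.
    rewrite mcoeffB /q -scalerAl mcoeffZ (above p e pa ae ea).
    by rewrite (above _ e _ ae ea) ?mulr0 ?subr0 // lf lexx.
  exists c; rewrite -(subrK (q * f) p) addrAC; apply: idealD => //.
  by apply: idealMl; apply: sub_gen.
have [||c Hc] := next (p - p@_a *: 'X_[a]).
- apply: leq_trans (msizeD_le _ _) _; rewrite geq_max psz msizeN.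
  by apply: leq_trans (msizeZ_le _ _) _; rewrite msizeX.
- move=> e ae; rewrite mcoeffB mcoeffZ mcoeffX; have [->|ea] := eqVneq e a.
    by rewrite mulr1 subrr.
  by rewrite mulr0 subr0 above.
pose a' : stair N (mlead f) := exist _ (BMultinom aN) fa.
exists (fun e => c e + (if e == a' then p@_a else 0)).
under eq_bigr => e _ do rewrite scalerDl.
rewrite big_split /= opprD addrA addrAC.
have -> : \sum_e (if e == a' then p@_a else 0) *: 'X_[val e] = p@_a *: 'X_[a] :> R.
  rewrite (bigD1 a') //= eqxx big1 ?addr0 // => e /negbTE ->; by rewrite scale0r.
exact: Hc.
Qed.

Lemma integral_mod_element (f : R) : f != 0 ->
  exists2 n, (0 < n)%N & forall j, exists h : {mpoly k[d * u]}, h != 0 /\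
    forall lam, exists y, gen (range (gel g lam)) y /\
      gen [set f] (evmx h lam *: g j ^+ n - y).
Proof.
move=> f0; have [D gD] := gens_degree; set w0 := mlead f.
have [q q0 Hq] := stair_small D w0; pose n := (d * q)%N.
exists n; first by rewrite muln_gt0.
pose r := #|stair (n * D) w0|.
pose beta (b : 'I_r) : R := 'X_[val (enum_val b : stair (n * D) w0)].
move=> j; have [|||w sw|h [h0 Hh]] := @generic_integrality _ _ _ infk g (gen setT)
  (fun j => gen_setT (g j)) n q r beta (gen [set f]) _ _ _ _ j => //.
- by rewrite muln_gt0.
- exact: Hq.
- have [|c Hc] := @mlead_reduce f (n * D) (\prod_(j <- w) g j) f0.
    by rewrite -sw; apply: msize_prod.
  exists (fun b => c (enum_val b)).
  have -> : \sum_b c (enum_val b) *: beta b = \sum_e c e *: 'X_[val e].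
    rewrite [RHS](reindex (@enum_val (stair (n * D) w0) predT)) //=.
    by exists enum_rank => x _; rewrite ?enum_valK ?enum_rankK.
  exact: Hc.
exists h; split=> // lam; have [y [/mul_ideal_subl Hy Hy']] := Hh lam.
by exists y.
Qed.

End Instances.
End Counting.

(** * Reductions by generic elements *)

Section ReductionCriteria.
Variable T : comPzRingType.
Implicit Types (I J K L W : ideal T) (P : prime_ideal T).

(** Among u n + 1 factors one of the u generators occurs at least n times. *)
Lemma power_mod u (g : 'I_u -> T) I J n : (0 < n)%N -> (forall j, I (g j)) ->
  (forall j, add_ideal (mul_ideal J (exp_ideal I n.-1)) (exp_ideal I n.+1) (g j ^+ n)) ->
  exp_ideal (gen (range g)) (u * n).+1 `<=`
    add_ideal (mul_ideal J (exp_ideal I (u * n))) (exp_ideal I (u * n).+2).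
Proof.
move=> n0 Ig Hg; apply: exp_gen_words => w sw.
have [|i /(prod_count g)[w' [sw' ->]]] := @word_pigeonhole _ w n.
  by rewrite sw ltnS leq_mul2l leq_pred orbT.
have Iw' : exp_ideal I (size w') (\prod_(j <- w') g j) by apply: prod_mem_exp.
have /add_idealP[a [b [Ja Ib ->]]] := Hg i.
rewrite mulrDl; apply: idealD.
  apply: add_idealL; have -> : (u * n = n.-1 + size w')%N by move: sw' n0; rewrite sw; lia.
  by rewrite exp_idealD mul_idealA; apply: mul_ideal_mem.
apply: add_idealR; have -> : ((u * n).+2 = n.+1 + size w')%N by move: sw' n0; rewrite sw; lia.
by rewrite exp_idealD; apply: mul_ideal_mem.
Qed.

Lemma reduction_iter P I L M e : exp_ideal I M.+1 `<=` sat P (mul_ideal L (exp_ideal I M)) ->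
  exp_ideal I (e + M) `<=` sat P (mul_ideal (exp_ideal L e) (exp_ideal I M)).
Proof.
move=> Hred; elim: e => [|e IH].
  by rewrite mul_idealC mul_ideal1; apply: sub_sat.
have -> : exp_ideal I (e.+1 + M) = mul_ideal I (exp_ideal I (e + M)) by [].
apply: subset_trans (sat_mul (@sub_sat _ P I) IH) _; apply: sat_sub.
rewrite mul_idealA (mul_idealC I) -mul_idealA.
have -> : mul_ideal (exp_ideal L e.+1) (exp_ideal I M) =
    mul_ideal (exp_ideal L e) (mul_ideal L (exp_ideal I M)).
  by rewrite /= mul_idealA (mul_idealC L).
by apply: sat_mul => //; apply: sub_sat.
Qed.

Lemma local_global (X b : ideal T) : noeth T -> (forall P, X `<=` sat P b) -> X `<=` b.
Proof.
move=> nT H x Xx; apply: contrapT => bx.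
have [|y z -> ->|y ->|P bP _] := @prime_avoiding T (fun y => y = 1) (ann b x) nT => //.
- by rewrite mulr1.
- by rewrite annE mul1r.
by have [s Ps Hs] := H P x Xx; apply: Ps; apply: bP.
Qed.

Lemma reductionP K I N : K `<=` I -> exp_ideal I N.+1 `<=` mul_ideal K (exp_ideal I N) ->
  is_reduction K I.
Proof.
move=> KI H; split=> //; exists N => e /subnKC <-; apply: eq_ideal; apply/seteqP; split.
  rewrite -addSn exp_idealD; apply: subset_trans (mul_ideal_mono H (@subset_refl _ _)) _.
  by rewrite -mul_idealA -exp_idealD.
by apply: mul_ideal_mono.
Qed.

Lemma reductionE L I : is_reduction L I ->
  L `<=` I /\ exists N, exp_ideal I N.+1 `<=` mul_ideal L (exp_ideal I N).
Proof. by move=> [LI [N HN]]; split=> //; exists N; rewrite HN. Qed.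

End ReductionCriteria.

Section GenericReductions.
Variables (k : fieldType) (d' : nat).
Local Notation d := d'.+1.
Local Notation R := {mpoly k[d]}.
Local Notation m := (max_ideal k d).
Hypothesis infk : infinite_set [set: k].
Variable I : ideal R.
Hypothesis mI : monoidl I.
Hypothesis I_neq0 : exists2 p, I p & p != 0.

Lemma ideal_exponent : exists2 w0, I 'X_[w0] & w0 != 0%MM.
Proof.
have [p Ip p0] := I_neq0; exists (mlead p + U_(ord0))%MM.
  by rewrite mpolyXD; apply: idealMr; apply: (mI Ip); rewrite mleadc_eq0.
by apply/eqP => /mnmP/(_ ord0); rewrite mnmDE mnm1E eqxx mnm0E addn1.
Qed.

Variables (u : nat) (g : 'I_u -> R).
Hypothesis Ig : forall j, I (g j).

Lemma generic_power : exists n (h : {mpoly k[d * u]}), [/\ (0 < n)%N, h != 0 &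
  forall lam, evmx h lam != 0 -> forall j,
    add_ideal (mul_ideal (gen (range (gel g lam))) (exp_ideal I n.-1)) (exp_ideal I n.+1)
      (g j ^+ n)].
Proof.
have [w0 Iw w0n] := ideal_exponent.
have [n n0 Hn] := integral_mod_power infk mI Iw w0n Ig.
have [h Hh] := choice Hn; exists n, (\prod_j h j); split=> //.
  by apply/prodf_neq0 => j _; have [] := Hh j.
move=> lam; rewrite /evmx rmorph_prod => /prodf_neq0 hn j.
have [_ /(_ lam)[y [Hy Hy']]] := Hh j; have {}hn := hn j isT.
have -> : g j ^+ n = (evmx (h j) lam)^-1%:MP * y +
    (evmx (h j) lam)^-1%:MP * (evmx (h j) lam *: g j ^+ n - y).
  by rewrite -mulrDr addrC subrK -mul_mpolyC mulrA -rmorphM /= mulVf // mul1r.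
by apply: idealD; [apply: add_idealL|apply: add_idealR]; apply: idealMl.
Qed.

(** Relations modulo I^(n+1) suffice because I lies in m. The g_j need only generate a local
    reduction of I, since they will also be generators of an arbitrary reduction. *)
Lemma generic_reduction_local M : I `<=` m ->
  exp_ideal I M.+1 `<=` sat m (mul_ideal (gen (range g)) (exp_ideal I M)) ->
  exists2 h : {mpoly k[d * u]}, h != 0 & forall lam, evmx h lam != 0 -> exists N,
    exp_ideal I N.+1 `<=` sat m (mul_ideal (gen (range (gel g lam))) (exp_ideal I N)).
Proof.
move=> Im Hred; have [n [h [n0 h0 Hh]]] := generic_power.
exists h => // lam hlam; exists (u * n + M)%N; apply: (nakayama (@noeth_mpoly k d)).
apply: subset_trans (reduction_iter (e := (u * n).+1) Hred) _; apply: sat_mono.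
apply: subset_trans (mul_ideal_mono (power_mod n0 Ig (Hh lam hlam)) (@subset_refl _ _)) _.
apply: mul_ideal_sub => x y /add_idealP[a [b [Ja Ib ->]]] Iy; rewrite mulrDl; apply: idealD.
  by apply: add_idealL; rewrite exp_idealD mul_idealA; apply: mul_ideal_mem.
apply: add_idealR.
have : exp_ideal I ((u * n).+2 + M) (b * y) by rewrite exp_idealD; apply: mul_ideal_mem.
by rewrite addSn; apply: mul_ideal_mono.
Qed.

Hypothesis IE : I = gen (range g).

(** At primes over I, Nakayama turns the relations modulo I^(n+1) into the reduction property. At
    other primes both I and K become the unit ideal: a prime containing J and f contains the g_j,
    which have powers in J + (f). *)
Lemma generic_reduction_global (f : R) : I f -> f != 0 ->
  exists2 h : {mpoly k[d * u]}, h != 0 & forall lam, evmx h lam != 0 -> exists N,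
    exp_ideal I N.+1 `<=`
      mul_ideal (add_ideal (gen (range (gel g lam))) (gen [set f ^+ d])) (exp_ideal I N).
Proof.
move=> If f0; have [n [h [n0 h0 Hh]]] := generic_power.
have [n2 n20 Hn2] := integral_mod_element infk g f0; have [h2 Hh2] := choice Hn2.
exists (h * \prod_j h2 j).
  by rewrite mulf_neq0 //; apply/prodf_neq0 => j _; have [] := Hh2 j.
move=> lam; rewrite evmxM mulf_eq0 negb_or => /andP[hlam].
rewrite {1}/evmx rmorph_prod => /prodf_neq0 h2lam.
set J := gen (range (gel g lam)); set K := add_ideal J _.
exists (u * n)%N; apply: (local_global (@noeth_mpoly k d)) => P.
have [IP|IP] := pselect (I `<=` P).
  apply: (nakayama (@noeth_mpoly k d)).
  rewrite {1}IE; apply: subset_trans (power_mod n0 Ig (Hh lam hlam)) _.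
  apply: subset_trans (@sub_sat _ P _); apply: add_ideal_sub.
    by apply: subset_trans (@add_idealL _ _ _); apply: mul_ideal_mono => //; apply: add_idealL.
  by apply: subset_trans (@add_idealR _ _ _); apply: mul_ideal_mono.
have KP : ~ K `<=` P.
  move=> KP; apply: IP; rewrite IE; apply: gen_sub => _ [j _ <-].
  have Pf : P f by apply: (@prime_pow _ P f d); apply: KP; apply: add_idealR; apply: sub_gen.
  have [_ /(_ lam)[y [Jy Hy]]] := Hh2 j; have {}h2j := h2lam j isT.
  apply: (@prime_pow _ P _ n2).
  have : P (evmx (h2 j) lam *: g j ^+ n2).
    rewrite -(subrK y (_ *: _)); apply: idealD; last by apply: KP; apply: add_idealL.
    by move: Hy => /gen1P[r ->]; apply: idealMl.
  move=> Ph; have -> : g j ^+ n2 = (evmx (h2 j) lam)^-1%:MP * (evmx (h2 j) lam *: g j ^+ n2).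
    by rewrite -mul_mpolyC mulrA -rmorphM /= mulVf // mul1r.
  exact: idealMl.
have [a [Ka Pa]] : exists a, K a /\ ~ P a.
  by apply: contrapT => H; apply: KP => a Ka; apply: contrapT => Pa; apply: H; exists a.
have [y [Iy Py]] : exists y, I y /\ ~ P y.
  by apply: contrapT => H; apply: IP => y Iy; apply: contrapT => Py; apply: H; exists y.
move=> x _; exists (a * y ^+ (u * n)).
  by apply: prime_mulN => // /prime_pow.
by apply: idealMr; apply: mul_ideal_mem => //; apply: exp_ideal_pow.
Qed.

Lemma is_ideal_degge c : is_ideal [set p : R | forall e, p@_e != 0 -> (c <= mdeg e)%N].
Proof.
split=> /= [e|p q Hp Hq e|a p Hp e He].
- by rewrite mcoeff0 eqxx.
- rewrite mcoeffD; have [p0|/Hp//] := eqVneq p@_e 0.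
  by rewrite p0 add0r; apply: Hq.
- have [x [y [_ /Hp Hy ->]]] := supp_mul He.
  by rewrite mdegD; apply: leq_trans Hy (leq_addl _ _).
Qed.

Lemma homog_coef (p : R) c e : p \is c.-homog -> p@_e != 0 -> mdeg e = c.
Proof. by move=> /dhomogP H; rewrite -mcoeff_msupp => /H. Qed.

Definition degpart (c : nat) : R -> R :=
  mon_lin (fun e : 'X_{1..d} => if mdeg e == c then 'X_[e] else 0).

Lemma degpart_mul c b p q : p \is c.-homog -> degpart (c + b) (p * q) = p * degpart b q.
Proof.
move=> hp; have -> : p * degpart b q = mon_lin (fun e => 'X_[e]) p * degpart b q.
  by congr (_ * _); rewrite {1}[p]mpolyE.
apply: mon_linM => x y px qy; rewrite mdegD (homog_coef hp px) eqn_add2l.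
by case: ifP; rewrite ?mulr0 // mpolyXD.
Qed.

Lemma degpart_homog c p : p \is c.-homog -> degpart c p = p.
Proof.
move=> hp; rewrite [RHS]mpolyE; apply: eq_mon_lin => e pe.
by rewrite (homog_coef hp pe) eqxx.
Qed.

Lemma degpart_mem (J : ideal R) c p : monoidl J -> J p -> J (degpart c p).
Proof.
move=> mJ Jp; rewrite /degpart /mon_lin big_seq.
elim/big_ind: _ => [|x y|e]; [exact: ideal0|exact: idealD|].
rewrite mcoeff_msupp => pe; case: ifP => _; last by rewrite scaler0; apply: ideal0.
by rewrite -mul_mpolyC; apply: idealMl; apply: mJ pe.
Qed.

(** Taking the part of degree n delta removes the error term in I^(n+1), so J is a reduction
    globally without the help of f. *)
Lemma generic_reduction_homog delta : (0 < delta)%N -> (forall j, g j \is delta.-homog) ->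
  exists2 h : {mpoly k[d * u]}, h != 0 & forall lam, evmx h lam != 0 -> exists N,
    exp_ideal I N.+1 `<=` mul_ideal (gen (range (gel g lam))) (exp_ideal I N).
Proof.
move=> d0 hg; have [n [h [n0 h0 Hh]]] := generic_power.
exists h => // lam hlam; set J := gen _; exists (u * n)%N.
have degI : exp_ideal I n.+1 `<=` Ideal (is_ideal_degge (n.+1 * delta)).
  rewrite IE; apply: exp_gen_words => w <- e.
  have : \prod_(j <- w) g j \is (size w * delta).-homog.
    elim: w => [|j w IH]; first by rewrite big_nil; apply: dhomog1.
    by rewrite big_cons mulSn; apply: dhomogM.
  by move=> H /(homog_coef H) ->.
have gJ j : mul_ideal J (exp_ideal I n.-1) (g j ^+ n).
  have hgn : g j ^+ n \is (n * delta).-homog.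
    elim: {n0 Hh degI} n => [|n IH]; first by rewrite expr0; apply: dhomog1.
    by rewrite exprS mulSn; apply: dhomogM.
  have /add_idealP[a [b [Ja Ib E]]] := Hh lam hlam j.
  rewrite -(degpart_homog hgn) E /degpart raddfD /= -!/(degpart _ _).
  have -> : degpart (n * delta) b = 0.
    rewrite /degpart /mon_lin big_seq big1 // => e; rewrite mcoeff_msupp => /(degI _ Ib).
    move=> ge; case: eqP => [E'|_]; last by rewrite scaler0.
    by move: ge; rewrite E' leq_pmul2r // ltnn.
  rewrite addr0; have /mul_genP[c [Ic ->]] := Ja.
  rewrite /degpart raddf_sum; apply: ideal_sum => i /=; rewrite -/(degpart _ _).
  have -> : (n * delta = delta + n.-1 * delta)%N by rewrite -mulSn prednK.
  have ha : gel g lam i \is delta.-homog.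
    by rewrite /gel; apply: rpred_sum => j' _; apply: rpredZ.
  rewrite (degpart_mul _ _ ha); apply: mul_ideal_mem; first by apply: sub_gen; exists i.
  by apply: degpart_mem => //; apply: monoidl_exp.
rewrite {1}IE; apply: exp_gen_words => w sw.
have [|i /(prod_count g)[w' [sw' ->]]] := @word_pigeonhole _ w n.
  by rewrite sw ltnS leq_mul2l leq_pred orbT.
have -> : (u * n = n.-1 + size w')%N by move: sw' n0; rewrite sw; lia.
rewrite exp_idealD mul_idealA; apply: mul_ideal_mem => //.
exact: prod_mem_exp.
Qed.

End GenericReductions.

(** * Deformation of coefficient matrices *)

Section Deformation.
Variables (k : fieldType) (n : nat).
Local Notation d := n.+1.
Local Notation R := {mpoly k[d]}.
Local Notation m := (max_ideal k d).

Lemma gen_recombine (H : 'M[k]_d) (b : 'I_d -> R) : H \in unitmx ->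
  gen (range (fun i => \sum_l H i l *: b l)) = gen (range b).
Proof.
move=> uH.
have sub (V : 'M[k]_d) (c : 'I_d -> R) :
    gen (range (fun i => \sum_l V i l *: c l)) `<=` gen (range c).
  apply: gen_sub => _ [i _ <-]; apply: ideal_sum => l; rewrite -mul_mpolyC.
  by apply: idealMl; apply: sub_gen; exists l.
apply: eq_ideal; apply/seteqP; split; first exact: sub.
have {1}-> : b = fun i => \sum_l invmx H i l *: (\sum_j H l j *: b j).
  apply/funext => i; under eq_bigr => l _ do rewrite scaler_sumr.
  rewrite exchange_big /= (bigD1 i) //= [X in _ + X]big1 ?addr0 => [|j ji].
    have /matrixP/(_ i i) := mulVmx uH; rewrite !mxE eqxx => E.
    by under eq_bigr => l _ do rewrite scalerA; rewrite -scaler_suml E scale1r.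
  have /matrixP/(_ i j) := mulVmx uH; rewrite !mxE eq_sym (negbTE ji) => E.
  by under eq_bigr => l _ do rewrite scalerA; rewrite -scaler_suml E scale0r.
exact: sub.
Qed.

Lemma complete_column (w : 'cV[k]_d) : w != 0 ->
  exists2 V : 'M[k]_d, V \in unitmx & V *m delta_mx ord_max 0 = w.
Proof.
move=> w0; pose r := w^T; have r1 : \rank r = 1%N.
  rewrite rank_rV; suff -> : r != 0 by [].
  by apply: contra w0 => /eqP E; rewrite -(trmxK w) -/r E trmx0.
pose a := col_ebase r 0 0.
have a0 : a != 0.
  have := col_ebase_unit r; rewrite [col_ebase r]mx11_scalar unitmxE det_scalar1.
  by rewrite unitfE.
have rE : r = a *: row ord0 (row_ebase r).
  rewrite -{1}(mulmx_ebase r) r1 {1}[col_ebase r]mx11_scalar mul_scalar_mx -scalemxAl.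
  congr (_ *: _); rewrite rowE; congr (_ *m _); apply/matrixP => i j.
  by rewrite !mxE !ord1 eqxx /= andbT eq_sym.
pose V := a *: (perm_mx (tperm ord0 ord_max) *m row_ebase r).
exists V^T.
  rewrite unitmx_tr /V unitmxZ ?unitfE // unitmx_mul unitmx_perm row_ebase_unit //.
rewrite -[w]trmxK -/r rE -[LHS]trmxK trmx_mul trmxK; congr (_^T).
rewrite /V -scalemxAr; congr (_ *: _); rewrite trmx_delta -rowE.
by rewrite -row_permE; apply/matrixP => i j; rewrite !mxE tpermR.
Qed.

Variables (I : ideal R) (u : nat) (g : 'I_u -> R).
Hypothesis infk : infinite_set [set: k].
Hypothesis mI : monoidl I.
Hypothesis I_neq0 : exists2 p, I p & p != 0.
Hypothesis HG : satisfies_G d I.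
Hypothesis HS : weakly_residually_S2 (d%:Z - 2) (loc_ideal m I).
Hypothesis Ig : forall j, I (g j).

Definition gelR (Th : 'M[R]_(d, u)) (i : 'I_d) : R := \sum_j Th i j * g j.
Definition ev0 (Th : 'M[R]_(d, u)) : 'M[k]_(d, u) := map_mx (mcoeff 0%MM) Th.
Definition local_red (Th : 'M[R]_(d, u)) : Prop := exists N,
  exp_ideal I N.+1 `<=` sat m (mul_ideal (gen (range (gelR Th))) (exp_ideal I N)).
(** The only consequence of Zariski openness that the deformation uses. *)
Definition line_open (G : 'M[k]_(d, u) -> Prop) : Prop := forall A B,
  (exists t : k, G (A + t *: B)) -> cof (fun t => G (A + t *: B)).

Lemma gelR_sub Th : gen (range (gelR Th)) `<=` I.
Proof. by apply: gen_sub => _ [i _ <-]; apply: ideal_sum => j; apply: idealMl. Qed.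

Lemma local_red_off (q : prime_ideal R) Th : local_red Th -> q `<=` m ->
  ~ prime_ht_ge q d -> I `<=` sat q (gen (range (gelR Th))).
Proof.
move=> [N Hred] qm hq.
have [i qi] : exists i, ~ q 'X_i.
  apply: contrapT => H; apply: hq; rewrite (@max_mprime _ _ q) //; first exact: max_ht_ge.
  by move=> i; apply: contrapT => qi; apply: H; exists i.
apply: (reduction_off infk mI I_neq0 HG HS qi (@gelR_sub Th) (N := N)).
by apply: subset_trans Hred _; apply: sat_le.
Qed.

Section Step.
Variables (Th : 'M[R]_(d, u)) (Y : 'M[k]_(d, u)) (j : 'I_u).

Definition put_col (w : 'cV[k]_d) : 'M[k]_(d, u) :=
  \matrix_(i, l) (if l == j then ev0 Th i j + w i 0 else Y i l).

Lemma put_col_line w v t : put_col (w + t *: v) =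
  put_col w + t *: \matrix_(i, l) (if l == j then v i 0 else 0).
Proof.
by apply/matrixP => i l; rewrite !mxE; case: ifP => _; rewrite ?mulr0 ?addr0 ?addrA.
Qed.

Definition coef_col (p : {poly k}) : 'cV[k]_d := \col_i p`_i.

Lemma coef_colD p q : coef_col (p + q) = coef_col p + coef_col q.
Proof. by apply/matrixP => i l; rewrite !mxE coefD. Qed.
Lemma coef_colZ c p : coef_col (c *: p) = c *: coef_col p.
Proof. by apply/matrixP => i l; rewrite !mxE coefZ. Qed.

Lemma node_poly_insert (ts : seq k) t s : node_poly (ts ++ t :: s) =
  node_poly (ts ++ 0 :: s) + t *: - node_poly (ts ++ s).
Proof.
rewrite /node_poly !big_cat !big_cons /= -mul_polyC subr0; ring.
Qed.

End Step.

(* the columns of Th are moved one after the other to generic position, along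
   rank one directions to which swap_at applies *)
Lemma core_local (G : 'M[k]_(d, u) -> Prop) x : line_open G -> (exists Y, G Y) -> I x ->
  (forall Th, G (ev0 Th) -> sat m (gen (range (gelR Th))) x) ->
  forall Th, local_red Th -> sat m (gen (range (gelR Th))) x.
Proof.
move=> Gopen [Y0 GY0] Ix HGx.
(* Y is a point of G whose first b columns agree with the constant terms of Th; c counts the columns
   still to be moved. *)
suff H c b Th Y : (b + c = u)%N -> local_red Th -> G Y ->
    (forall i (l : 'I_u), (l < b)%N -> Y i l = ev0 Th i l) -> sat m (gen (range (gelR Th))) x.
  by move=> Th rTh; apply: (H u 0%N Th Y0).
elim: c b Th Y => [|c IH] b Th Y bc rTh GY EY.
  apply: HGx; suff <- : Y = ev0 Th by [].
  by apply/matrixP => i l; apply: EY; rewrite -[b]addn0 bc.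
have bu : (b < u)%N by rewrite -bc addnS ltnS leq_addr.
pose j := Ordinal bu.
pose w0 : 'cV[k]_d := \col_i (Y i j - ev0 Th i j).
have [w00|w00] := eqVneq w0 0.
  apply: (IH b.+1 Th Y) => // [|i l]; first by rewrite addSnnS.
  rewrite ltnS leq_eqVlt => /orP[/eqP lb|]; last exact: EY.
  have -> : l = j by apply: val_inj.
  by have /matrixP/(_ i 0) := w00; rewrite !mxE => /eqP; rewrite subr_eq0 => /eqP.
have [V uV VE] := complete_column w00.
(* Nodes not yet chosen are set to 0. With no node chosen the polynomial is X^n, whose coefficient
   vector V maps to w0, and the moved column is that of Y; each further node leaves 0 along a line,
   so G persists for almost all its values. *)
pose pad ts := ts ++ nseq (n - size ts) (0 : k).
pose F ts := G (put_col Th Y j (V *m coef_col (node_poly (pad ts)))).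
have F0 : F [::].
  rewrite /F /pad /= subn0.
  have -> : coef_col (node_poly (nseq n 0)) = delta_mx ord_max 0.
    apply/matrixP => i l; rewrite !mxE ord1 eqxx andbT /node_poly big_nseq.
    have -> : iter n ( *%R ('X - 0%:P)) 1 = 'X^n :> {poly k}.
      by elim: (n) => [|e IHe]; rewrite ?expr0 //= IHe subr0 -exprS.
    by rewrite coefXn.
  rewrite VE; suff -> : put_col Th Y j w0 = Y by [].
  apply/matrixP => i l; rewrite !mxE; case: eqP => [->|//].
  by rewrite addrC subrK.
pose C ts t := (size ts < n)%N -> F ts -> F (rcons ts t).
have HC ts : cof (C ts).
  apply: cof_imp => sts; apply: cof_imp => Fts.
  pose A := put_col Th Y j (V *m coef_col (node_poly (pad ts))).
  pose Bm : 'M[k]_(d, u) := \matrix_(i, l) (if l == j then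
    (V *m coef_col (- node_poly (ts ++ nseq (n - (size ts).+1) 0))) i 0 else 0).
  have E t : F (rcons ts t) = G (A + t *: Bm).
    rewrite -put_col_line scalemxAr -mulmxDr -coef_colZ -coef_colD.
    rewrite /F /pad size_rcons -cats1 -catA /= node_poly_insert.
    have -> : (n - size ts = (n - (size ts).+1).+1)%N by rewrite subnSK.
    by rewrite /=.
  apply: (@cof_sub k (fun t => G (A + t *: Bm))) => [t|]; first by rewrite E.
  by apply: Gopen; exists 0; rewrite scale0r addr0.
pose H := invmx V; have uH : H \in unitmx by rewrite unitmx_inv.
pose b' i := \sum_l H i l *: gelR Th l.
have b'E : gen (range b') = gen (range (gelR Th)) by apply: gen_recombine.
have [N Hred] := rTh.
(* In the generators recombined by the inverse of V, the direction w becomes the coefficient vector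
   of the node polynomial. *)
have [|||ts [sts Cts Hts]] := @swap_at k n I b' C N (g j) x infk I_neq0 HG HS _ _ _ HC (Ig j) Ix.
- by rewrite b'E; apply: gelR_sub.
- by move=> q qm _ hq; rewrite b'E; apply: local_red_off.
- by rewrite b'E.
rewrite -b'E; apply: Hts.
have Fts : F ts.
  suff Hi i : (i <= n)%N -> F (take i ts) by rewrite -(take_size ts) sts; apply: Hi.
  elim: i => [|i IHi] lin; first by rewrite take0.
  have := Cts i lin; rewrite /C size_takel; last by rewrite sts ltnW.
  move=> /(_ lin (IHi (ltnW lin))).
  by rewrite -take_nth ?sts.
pose w := V *m coef_col (node_poly ts).
have padts : pad ts = ts by rewrite /pad sts subnn cats0.
pose Tt t : 'M[R]_(d, u) := Th + \matrix_(i, l) (if l == j then (t * w i 0)%:MP else 0).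
have gelT t i : gelR (Tt t) i = gelR Th i + (t * w i 0) *: g j.
  rewrite /gelR; under eq_bigr => l _ do rewrite mxE mulrDl.
  rewrite big_split /=; congr (_ + _); rewrite (bigD1 j) //= big1 ?addr0 => [|l lj].
    by rewrite !mxE eqxx mul_mpolyC.
  by rewrite !mxE (negbTE lj) mul0r.
have genT t : gen (range (fun i => b' i + (t * (node_poly ts)`_i) *: g j)) =
    gen (range (gelR (Tt t))).
  rewrite -(gen_recombine (gelR (Tt t)) uH).
  set f1 := (fun i => b' i + _); set f2 := (fun i => \sum_l _).
  suff -> : f1 = f2 by []; apply/funext => i; rewrite /f1 /f2 /b'.
  under [RHS]eq_bigr => l _ do rewrite gelT scalerDr scalerA.
  rewrite big_split /=; congr (_ + _); rewrite -scaler_suml; congr (_ *: _).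
  have E : coef_col (node_poly ts) = H *m w by rewrite /H /w mulmxA mulVmx // mul1mx.
  have /matrixP/(_ i 0) := E; rewrite !mxE => ->; rewrite mulr_sumr.
  by apply: eq_bigr => l _; rewrite mulrCA.
have cofR : cof (fun t => local_red (Tt t)).
  apply: cof_sub (red_line (fun i => w i 0) (Ig j) Hred) => t Ht; exists N.
  suff -> : gelR (Tt t) = (fun i => gelR Th i + (t * w i 0) *: g j) by [].
  by apply/funext => i; apply: gelT.
have cofG : cof (fun t => G (put_col Th Y j (t *: w))).
  have [|s Hs] := Gopen (put_col Th Y j 0) (\matrix_(i, l) (if l == j then w i 0 else 0)).
    by exists 1; rewrite -put_col_line scale1r add0r; move: Fts; rewrite /F padts.
  by exists s => t /Hs; rewrite -put_col_line add0r.
apply: cof_sub (cofI cofR cofG) => t [Rt Gt]; rewrite genT.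
apply: (IH b.+1 (Tt t) (put_col Th Y j (t *: w))) => // [|i l]; first by rewrite addSnnS.
move=> lb; rewrite /ev0 /Tt mxE [RHS]mxE mxE [in RHS]mxE mcoeffD [in X in _ + X]mxE [in RHS]mxE.
have [->|lj] := eqVneq l j; first by rewrite mcoeffC eqxx mulr1 mxE.
rewrite mcoeff0 addr0 EY ?mxE //.
by move: lb; rewrite ltnS leq_eqVlt => /orP[/eqP lb|//]; case/eqP: lj; apply: val_inj.
Qed.

End Deformation.

(** * Ideal membership as a linear system *)

Section LinearSystem.
Variables (k : fieldType) (d' : nat).
Local Notation d := d'.+1.
Local Notation R := {mpoly k[d]}.
Local Notation m := (max_ideal k d).
Variables (A : idomainType) (phi : {rmorphism A -> k}).
Variables (u : nat) (f : 'I_u -> {mpoly A[d]}).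
Variables (B E : nat) (mask : 'X_{1..d} -> bool).
Local Notation L := {mpoly A[d * u]}.
Local Notation Row := ('X_{1..d < B} * 'I_d)%type.
Local Notation Col := 'X_{1..d < E}.

Definition fk (j : 'I_u) : R := map_mpoly phi (f j).

(** The rows are the products of monomials of degree below B with the generic generators; the
    columns are the coefficients that matter modulo a monomial ideal F, given by [mask].
    Coefficients in a domain A mapped to k let one system serve several fields. *)
Definition sys (a : Row) (e : Col) : L :=
  if mask e then \sum_j ('X_[a.1] * f j)@_e *: 'X_(mxvec_index a.2 j) else 0.
Definition rhs (x : {mpoly A[d]}) (e : Col) : L := if mask e then (x@_e)%:MP else 0.

Lemma exp_max_X t (e : 'X_{1..d}) : (t <= mdeg e)%N -> exp_ideal m t 'X_[e].
Proof.
elim: t e => [|t IH] e te; first exact: gen_setT.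
have [i ei] : exists i, e i != 0%N.
  apply: contrapT => H; move: te; rewrite mdegE big1 // => i _.
  by apply/eqP; apply: contrapT => /negP ei; apply: H; exists i.
have Ue : (U_(i) <= e)%MM by apply/mnm_lepP => l; rewrite mnm1E; case: eqP => // <-; rewrite lt0n.
rewrite -(submK Ue) mpolyXD mulrC; apply: mul_ideal_mem; first exact: max_idealU.
by apply: IH; move: te; rewrite -{1}(submK Ue) mdegD mdeg1 addn1.
Qed.

Variables (I F : ideal R).
Hypothesis fI : forall j, I (fk j).
Hypothesis mI : monoidl I.
Hypothesis mF : monoidl F.
Hypothesis maskF : forall e, mask e <-> ~ F 'X_[e].
Hypothesis bigF : forall e, I 'X_[e] -> (E <= mdeg e)%N -> F 'X_[e].
Hypothesis powF : mul_ideal (exp_ideal m B) I `<=` F.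

Definition msk (p : R) : R := \sum_(e : Col) (if mask e then p@_e else 0) *: 'X_[e].

Lemma mskE p e : (msk p)@_e = if (mdeg e < E)%N && mask e then p@_e else 0.
Proof.
rewrite /msk raddf_sum /=; case: ltnP => eE /=.
  rewrite (bigD1 (BMultinom eE)) //= mcoeffZ mcoeffX eqxx mulr1 big1 ?addr0 // => e' e'e.
  rewrite mcoeffZ mcoeffX; case: eqP => [Ee|_]; last by rewrite mulr0.
  by case/eqP: e'e; apply: val_inj.
rewrite big1 // => e' _; rewrite mcoeffZ mcoeffX; case: eqP => [Ee|_]; last by rewrite mulr0.
by have := valP e'; rewrite /= Ee ltnNge eE.
Qed.

Lemma msk_mod p : I p -> F (p - msk p).
Proof.
move=> Ip; apply: ideal_support => e; rewrite mcoeffB mskE; case: ifP => [_|].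
  by rewrite subrr eqxx.
rewrite subr0 => H pe; have Ie := mI Ip pe; move: H.
case: ltnP => /= eE; last by move=> _; apply: bigF.
by move=> Hm; apply: contrapT => /maskF; rewrite Hm.
Qed.

Lemma fkE a e j : ('X_[a] * fk j)@_e = phi ('X_[a] * f j)@_e.
Proof.
have -> : 'X_[a] * fk j = map_mpoly phi ('X_[a] * f j).
  by rewrite rmorphM /= /fk; congr (_ * _); rewrite map_mpolyX.
by rewrite mcoeff_map_mpoly.
Qed.

Definition evR (Th : 'M[R]_(d, u)) : L -> R :=
  mmap (@mpolyC d k \o phi) (fun l => mxvec Th 0 l).
HB.instance Definition _ Th := GRing.RMorphism.on (evR Th).

Lemma evR_sys Th (a : Row) : \sum_(e : Col) evR Th (sys a e) * 'X_[e] =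
  \sum_j Th a.2 j * msk ('X_[a.1] * fk j).
Proof.
under [RHS]eq_bigr => j _ do rewrite /msk mulr_sumr.
rewrite exchange_big /=; apply: eq_bigr => e _; rewrite /sys; case: ifP => _; last first.
  by rewrite rmorph0 mul0r big1 // => j _; rewrite scale0r mulr0.
rewrite rmorph_sum mulr_suml; apply: eq_bigr => j _ /=.
rewrite /evR mmapZ mmapX mmap1U mxvecE fkE -mul_mpolyC /=.
by rewrite -mulrA mulrCA.
Qed.

Lemma evR_const Th D : (evR Th D)@_0%MM = evmx (map_mpoly phi D) (ev0 Th).
Proof.
rewrite /evmx; elim/mpoly_ring_ind: D => [c|i|p q IHp IHq|p q IHp IHq].
- by rewrite /evR mmapC map_mpolyC mevalC /= mcoeffC eqxx mulr1.
- by case/mxvec_indexP: i => i j; rewrite /evR mmapX mmap1U map_mpolyX mevalXU !mxvecE mxE.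
- by rewrite !rmorphD /= IHp IHq.
- by rewrite !rmorphM /= IHp IHq.
Qed.

Lemma gelR_row Th (a : Row) : F ('X_[a.1] * gelR fk Th a.2 -
  \sum_(e : Col) evR Th (sys a e) * 'X_[e]).
Proof.
rewrite evR_sys /gelR mulr_sumr -sumrB; apply: ideal_sum => j.
rewrite mulrCA -mulrBr; apply: idealMl; apply: msk_mod.
by apply: idealMl.
Qed.

(** Modulo F the rows at Th are multiples of the elements [gelR fk Th i], and D at Th is a unit at
    m, because its constant term is D at the constant terms of Th. *)
Lemma system_cert (x : {mpoly A[d]}) D (c : Row -> L) : I (map_mpoly phi x) ->
  (forall e, D * rhs x e = \sum_a c a * sys a e) ->
  forall Th, evmx (map_mpoly phi D) (ev0 Th) != 0 ->
  sat m (add_ideal (gen (range (gelR fk Th))) F) (map_mpoly phi x).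
Proof.
move=> Ix HD Th DTh; exists (evR Th D).
  by move/vars_idealP; rewrite evR_const => E0; rewrite E0 eqxx in DTh.
set J := gen _; set xk := map_mpoly phi x in Ix *.
have Ey : \sum_(e : Col) evR Th (rhs x e) * 'X_[e] = msk xk.
  apply: eq_bigr => e _; rewrite /rhs; case: ifP => _; last by rewrite rmorph0 mul0r scale0r.
  by rewrite /evR mmapC /= mul_mpolyC mcoeff_map_mpoly.
rewrite -(subrK (msk xk) xk) mulrDr; apply: idealD.
  by apply: add_idealR; apply: idealMl; apply: msk_mod.
rewrite -Ey mulr_sumr.
have -> : \sum_e evR Th D * (evR Th (rhs x e) * 'X_[e]) =
    \sum_(a : Row) evR Th (c a) * \sum_e evR Th (sys a e) * 'X_[e].
  under [RHS]eq_bigr => a _ do rewrite mulr_sumr.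
  rewrite exchange_big /=; apply: eq_bigr => e _.
  rewrite mulrA -rmorphM HD rmorph_sum mulr_suml; apply: eq_bigr => a _.
  by rewrite rmorphM mulrA.
elim/big_ind: _ => [|y z|a _]; [exact: ideal0|exact: idealD|].
apply: idealMl; rewrite -(subKr ('X_[a.1] * gelR fk Th a.2) (\sum_e _)).
apply: idealB; last by apply: add_idealR; apply: gelR_row.
by apply: add_idealL; apply: idealMl; apply: sub_gen; exists a.2.
Qed.

(** Elements outside m are invertible modulo m^B, and m^B I lies in F. *)
Lemma mem_unsat (J : ideal R) x : I x -> sat m (add_ideal J F) x -> add_ideal J F x.
Proof.
move=> Ix [s ms Hs]; have [r Hr] := unit_mod_max B ms.
rewrite -[x]mul1r -(subrK (r * s) 1) mulrDl; apply: idealD.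
  by apply: add_idealR; apply: powF; apply: mul_ideal_mem.
by rewrite -mulrA; apply: idealMl.
Qed.

Lemma mem_coords (lam : 'M[k]_(d, u)) x : I x ->
  add_ideal (gen (range (gel fk lam))) F x ->
  exists c : Row -> k, forall e, mask e -> x@_e = \sum_(a : Row) c a * ('X_[a.1] * gel fk lam a.2)@_e.
Proof.
move=> Ix /add_idealP[y [z [/gen_rangeP[r ->] Fz xE]]].
exists (fun a : Row => (r a.2)@_(a.1)) => e me.
have F0 p : F p -> p@_e = 0.
  move=> Fp; apply/eqP; apply: contrapT => /negP pe; have Fe := mF Fp pe.
  by have /maskF := me; apply.
pose tr i : R := \sum_(g : 'X_{1..d < B}) (r i)@_g *: 'X_[g].
have Ftr i : F (r i * gel fk lam i - tr i * gel fk lam i).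
  rewrite -mulrBl; apply: powF; apply: mul_ideal_mem; last first.
    by apply: ideal_sum => j; rewrite -mul_mpolyC; apply: idealMl.
  apply: ideal_support => g; rewrite mcoeffB /tr raddf_sum /=.
  case: (ltnP (mdeg g) B) => gB; last by move=> _; apply: exp_max_X.
  rewrite (bigD1 (BMultinom gB)) //= mcoeffZ mcoeffX eqxx mulr1 big1 ?addr0 ?subrr ?eqxx //.
  move=> g' g'g; rewrite mcoeffZ mcoeffX; case: eqP => [Ee|_]; last by rewrite mulr0.
  by case/eqP: g'g; apply: val_inj.
have -> : x = \sum_i tr i * gel fk lam i +
    (\sum_i (r i * gel fk lam i - tr i * gel fk lam i) + z).
  by rewrite xE sumrB addrA; congr (_ + _); rewrite addrC subrK.
rewrite mcoeffD (F0 (_ + _)) ?addr0; last by apply: idealD => //; apply: ideal_sum.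
rewrite raddf_sum /=.
rewrite -(pair_bigA _ (fun (g : 'X_{1..d < B}) i => (r i)@_g * ('X_[g] * gel fk lam i)@_e)) /=.
rewrite exchange_big /=; apply: eq_bigr => i _.
rewrite /tr mulr_suml raddf_sum /=; apply: eq_bigr => g _.
by rewrite -scalerAl mcoeffZ.
Qed.

Lemma evmx_sys lam (a : Row) (e : Col) : evmx (map_mpoly phi (sys a e)) lam =
  if mask e then ('X_[a.1] * gel fk lam a.2)@_e else 0.
Proof.
rewrite /sys; case: ifP => _; last by rewrite rmorph0 /evmx rmorph0.
rewrite rmorph_sum evmx_sum /gel mulr_sumr raddf_sum; apply: eq_bigr => j _ /=.
rewrite map_mpolyZ evmxZ map_mpolyX evmxX -scalerAr mcoeffZ fkE mulrC.
by [].
Qed.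

Lemma evmx_rhs lam x (e : Col) : evmx (map_mpoly phi (rhs x e)) lam =
  if mask e then (map_mpoly phi x)@_e else 0.
Proof.
rewrite /rhs; case: ifP => _; last by rewrite rmorph0 /evmx rmorph0.
by rewrite map_mpolyC /evmx mevalC mcoeff_map_mpoly.
Qed.

Lemma system_neg (x : {mpoly A[d]}) (v : Col -> L) : I (map_mpoly phi x) ->
  (forall a, \sum_e sys a e * v e = 0) ->
  forall lam, evmx (map_mpoly phi (\sum_e rhs x e * v e)) lam != 0 ->
  ~ sat m (add_ideal (gen (range (gel fk lam))) F) (map_mpoly phi x).
Proof.
move=> Ix Hv lam + Hx; have [c Hc] := mem_coords Ix (mem_unsat Ix Hx).
rewrite rmorph_sum evmx_sum => /eqP; apply.
under eq_bigr => e _ do rewrite rmorphM evmxM evmx_rhs.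
have -> : \sum_(e : Col) (if mask e then (map_mpoly phi x)@_e else 0) *
    evmx (map_mpoly phi (v e)) lam =
  \sum_(a : Row) c a * evmx (map_mpoly phi (\sum_e sys a e * v e)) lam.
  under [RHS]eq_bigr => a _ do rewrite rmorph_sum evmx_sum mulr_sumr.
  rewrite exchange_big /=; apply: eq_bigr => e _.
  under [RHS]eq_bigr => a _ do rewrite rmorphM evmxM evmx_sys.
  case: ifP => [/Hc ->|_]; last first.
    by rewrite mul0r big1 // => a _; rewrite mulr0.
  by rewrite mulr_suml; apply: eq_bigr => a _; rewrite mulrA.
by rewrite big1 // => a _; rewrite Hv rmorph0 /evmx rmorph0 mulr0.
Qed.

End LinearSystem.

(** * A uniform power of m conducting I into generic J *)

Section UniformConductor.
Variables (k : fieldType) (d' : nat).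
Local Notation d := d'.+1.
Local Notation R := {mpoly k[d]}.
Local Notation m := (max_ideal k d).
Hypothesis infk : infinite_set [set: k].

(** D is a maximal nonvanishing minor at lam0. *)
Lemma rank_generic u p q (MM : 'M[{mpoly k[d * u]}]_(p, q)) (lam0 : 'M[k]_(d, u)) :
  exists2 D : {mpoly k[d * u]}, D != 0 & forall lam, evmx D lam != 0 ->
    (\rank (map_mx (meval (mxvec lam0 0%R)) MM) <= \rank (map_mx (meval (mxvec lam 0%R)) MM))%N.
Proof.
set M0 := map_mx _ MM; pose B0 := (rowsub (maxrankfun M0) M0)^T.
have full : row_full B0.
  by rewrite /row_full mxrank_tr; have := maxrowsub_free M0.
pose Sm (C : comNzRingType) (M : 'M[C]_(p, q)) :=
  rowsub (fullrankfun full) (rowsub (maxrankfun M0) M)^T.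
have evSm lam : evmx (\det (Sm _ MM)) lam = \det (Sm _ (map_mx (meval (mxvec lam 0%R)) MM)).
  rewrite /evmx -det_map_mx; congr (\det _); apply/matrixP => i j.
  by rewrite !mxE.
exists (\det (Sm _ MM)).
  have := fullrowsub_unit full; rewrite unitmxE unitfE => Hd.
  apply: contraNneq Hd => D0; have := evSm lam0; rewrite D0 /evmx rmorph0 => <-.
  by [].
move=> lam; rewrite evSm -unitfE -unitmxE => /mxrank_unit E; rewrite -{1}E.
have sub (p' q' r' : nat) (g : 'I_r' -> 'I_p') (C : 'M[k]_(p', q')) : (\rank (rowsub g C) <= \rank C)%N.
  by apply: mxrankS; apply/row_subP => i; rewrite row_rowsub row_sub.
by apply: leq_trans (sub _ _ _ _ _) _; rewrite mxrank_tr; apply: sub.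
Qed.

Variable I : ideal R.
Hypothesis mI : monoidl I.
Let F (t : nat) : ideal R := mul_ideal (exp_ideal m t) I.

Lemma monoidl_max : monoidl m.
Proof.
move=> p e /vars_idealP p0 pe; apply/vars_idealP; rewrite mcoeffX.
by case: eqP => // E; rewrite E p0 eqxx in pe.
Qed.

Lemma monoidl_F t : monoidl (F t).
Proof. by apply: monoidl_mul => //; apply: monoidl_exp; apply: monoidl_max. Qed.

Lemma F_le s t : (s <= t)%N -> F t `<=` F s.
Proof. by move=> st; apply: mul_ideal_mono => //; apply: exp_ideal_le. Qed.

Lemma F_big : exists D, forall t e, I 'X_[e] -> (D + t <= mdeg e)%N -> F t 'X_[e].
Proof.
have [r [w [Iw IE]]] := monoidl_gens mI; exists (\max_i mdeg (w i))%N => t e.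
rewrite {1}IE => /monoidl_gens_le[i ie] De; rewrite -(submK ie) mpolyXD.
apply: mul_ideal_mem => //; apply: exp_max_X.
have := leq_bigmax (F := fun i => mdeg (w i)) i.
by move: De; rewrite -{1}(submK ie) mdegD; lia.
Qed.

Variables (u : nat) (fs : 'I_u -> R).
Hypothesis fI : forall j, I (fs j).
Let phi : {rmorphism k -> k} := idfun.

Lemma map_mpoly_idfun n (p : {mpoly k[n]}) : map_mpoly phi p = p.
Proof. by apply/mpolyP => e; rewrite mcoeff_map_mpoly. Qed.

Lemma fk_id : fk phi fs = fs.
Proof. by apply/funext => j; apply: map_mpoly_idfun. Qed.

Definition fmask (t : nat) (e : 'X_{1..d}) : bool := `[< ~ F t 'X_[e] >].
Lemma fmaskP t e : fmask t e <-> ~ F t 'X_[e].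
Proof. by split=> /asboolP. Qed.

Lemma rhs_monomial B t (e : 'X_{1..d}) (v : 'X_{1..d < B} -> {mpoly k[d * u]})
    (eB : (mdeg e < B)%N) :
  \sum_e' rhs u (fmask t) 'X_[e] e' * v e' = if fmask t e then v (BMultinom eB) else 0.
Proof.
rewrite (bigD1 (BMultinom eB)) //= big1 ?addr0 => [|e' e'e].
  by rewrite /rhs /=; case: ifP; rewrite ?mul0r // mcoeffX eqxx mul1r.
rewrite /rhs mcoeffX; case: eqP => [E|_]; last by case: ifP; rewrite mul0r.
by case/eqP: e'e; apply: val_inj.
Qed.

(* if no power of m conducted I into the generic J, dim I/(J + m^T I) would be at
   least T for generic J, while it is bounded for the special J given by lam0 *)
Lemma uniform_conductor lam0 t0 : F t0 `<=` sat m (gen (range (gel fs lam0))) ->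
  exists t (D : {mpoly k[d * u]}), D != 0 /\ forall Th, evmx D (ev0 Th) != 0 ->
    F t `<=` sat m (gen (range (gelR fs Th))).
Proof.
move=> Ht0; apply: contrapT => nH; have [D0 HD0] := F_big.
(* C0 bounds the number of monomials of I outside m^t0 I, which have degree below D0 + t0; the
   option type accommodates [insub]. *)
pose C0 := #|{: option 'X_{1..d < D0 + t0}}|; pose T := C0.+1; pose E := (D0 + T)%N.
have bigF t : (t <= T)%N -> forall e, I 'X_[e] -> (E <= mdeg e)%N -> F t 'X_[e].
  by move=> tT e Ie Ee; apply: HD0 => //; apply: leq_trans Ee; rewrite leq_add2l.
have fI' j : I (fk phi fs j) by rewrite fk_id.
(* At each level t some monomial of m^t I is generically outside J + m^(t+1) I, for otherwise
   Nakayama would put m^t I in J_m for generic J. *)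
have level (t : 'I_T) : exists ev : 'X_{1..d} * ('X_{1..d < E} -> {mpoly k[d * u]}),
    [/\ F t 'X_[ev.1], forall a : 'X_{1..d < T} * 'I_d,
        \sum_e sys fs (fmask t.+1) a e * ev.2 e = 0 &
        \sum_e rhs u (fmask t.+1) 'X_[ev.1] e * ev.2 e != 0].
  apply: contrapT => nt; apply: nH; exists t.
  have [r [w [Fw FE]]] := monoidl_gens (@monoidl_F t).
  have cert i : exists Dc : {mpoly k[d * u]} * ('X_{1..d < T} * 'I_d -> {mpoly k[d * u]}),
      Dc.1 != 0 /\ forall e : 'X_{1..d < E}, Dc.1 * rhs u (fmask t.+1) 'X_[w i] e =
        \sum_a Dc.2 a * sys fs (fmask t.+1) a e :> {mpoly k[d * u]}.
    have [[D [c [Dn0 Hc]]]|[v [Hv vn0]]] := row_space_dichotomy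
      (fun (a : 'X_{1..d < T} * 'I_d) (e : 'X_{1..d < E}) => sys fs (fmask t.+1) a e)
      (fun e => rhs u (fmask t.+1) 'X_[w i] e); first by exists (D, c).
    by case: nt; exists (w i, v); split; [exact: Fw|exact: Hv|exact: vn0].
  have [Dc HDc] := choice cert; exists (\prod_i (Dc i).1); split.
    by apply/prodf_neq0 => i _; have [] := HDc i.
  move=> Th; rewrite /evmx rmorph_prod => /prodf_neq0 HTh.
  apply: (nakayama (@noeth_mpoly k d)).
  have -> : mul_ideal m (F t) = F t.+1 by rewrite /F /= mul_idealA.
  rewrite {1}FE; apply: gen_sub => _ [i _ <-].
  have := @system_cert k d' k phi u fs T E (fmask t.+1) I (F t.+1) fI' mI
    (fmaskP t.+1) (bigF _ (ltn_ord t)) 'X_[w i] (Dc i).1 (Dc i).2.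
  rewrite !map_mpoly_idfun fk_id; apply.
  - by have := Fw i; apply: mul_ideal_subr.
  - by have [] := HDc i.
  - exact: HTh.
have [ev Hev] := choice level.
pose e s := (ev s).1; pose v s := (ev s).2.
have Fe (s : 'I_T) : F s 'X_[e s] by have [] := Hev s.
have Ie (s : 'I_T) : I 'X_[e s] by apply: mul_ideal_subr (Fe s).
have sysv (s : 'I_T) : forall a : 'X_{1..d < T} * 'I_d, \sum_e sys fs (fmask s.+1) a e * v s e = 0.
  by have [] := Hev s.
have rhsv (s : 'I_T) : \sum_e' rhs u (fmask s.+1) 'X_[e s] e' * v s e' != 0 by have [] := Hev s.
have mask_e (s : 'I_T) : fmask s.+1 (e s).
  apply: contraNT (rhsv s) => /negbTE ms; rewrite big1 // => e' _; rewrite /rhs mcoeffX.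
  case: (e s =P e') => [<-|_]; first by rewrite ms mul0r.
  by case: ifP; rewrite mul0r.
have eE (s : 'I_T) : (mdeg (e s) < E)%N.
  rewrite ltnNge; apply/negP => Ee; have /fmaskP := mask_e s; apply.
  exact: (bigF s.+1 (ltn_ord s)).
have vn0 (s : 'I_T) : v s (BMultinom (eE s)) != 0.
  by have := rhsv s; rewrite (rhs_monomial s.+1 (v s) (eE s)) mask_e.
have maskS s t e' : (s <= t)%N -> fmask s e' -> fmask t e'.
  by move=> st /fmaskP H; apply/fmaskP => H'; apply: H; apply: F_le H'.
pose Vp (e' : 'X_{1..d < E}) := fmask T e' && `[< I 'X_[e'] >].
pose V : finType := {e' | Vp e'}.
pose col (j : 'I_#|V|) : 'X_{1..d < E} := val (enum_val j).
pose row (i : 'I_#|{: 'X_{1..d < T} * 'I_d}|) : 'X_{1..d < T} * 'I_d := enum_val i.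
pose MM : 'M[{mpoly k[d * u]}]_(_, _) := \matrix_(i, j) sys fs (fmask T) (row i) (col j).
have [Dr Dr0 HDr] := rank_generic MM lam0.
have [lam1 Hlam1] : exists lam1, evmx (Dr * \prod_s v s (BMultinom (eE s))) lam1 != 0.
  apply: (evmx_nonroot infk); rewrite mulf_neq0 //; exact/prodf_neq0.
move: Hlam1; rewrite evmxM mulf_eq0 negb_or => /andP[/HDr rk].
rewrite {1}/evmx rmorph_prod => /prodf_neq0 v1.
set M1 := map_mx (meval (mxvec lam1 0%R)) MM in rk; set M0 := map_mx _ MM in rk.
have colV e' : Vp e' -> exists j, col j = e'.
  by move=> Ve; exists (enum_rank (exist _ e' Ve : V)); rewrite /col enum_rankK.
have Vpe (s : 'I_T) : Vp (BMultinom (eE s)).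
  rewrite /Vp /= (maskS _ _ _ _ (mask_e s)) ?ltn_ord //=; exact/asboolP.
(* The certificates of all levels as columns. They are orthogonal to the rows of the system at lam1,
   and independent, since pairing them with the monomials of the levels gives a triangular matrix
   with nonzero diagonal. *)
pose W : 'M[k]_(#|V|, T) :=
  \matrix_(j, s) (if fmask s.+1 (col j) then evmx (v s (col j)) lam1 else 0).
have M1W : M1 *m W = 0.
  apply/matrixP => i s; rewrite [RHS]mxE mxE.
  have H0 : \sum_e' evmx (sys fs (fmask s.+1) (row i) e' * v s e') lam1 = 0.
    by rewrite -evmx_sum sysv /evmx rmorph0.
  rewrite -[RHS]H0.
  rewrite [RHS](bigID Vp) /= [X in _ + X]big1 ?addr0 => [|e' nV].
    rewrite [RHS](reindex_omap (val : V -> _) insub) /=; last first.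
      by move=> e' Ve; rewrite insubT.
    rewrite [RHS](eq_bigl predT); last by move=> e' /=; rewrite valK (valP e') eqxx.
    rewrite [RHS](reindex (@enum_val V predT)) /=; last first.
      by exists enum_rank => x _; rewrite ?enum_valK ?enum_rankK.
    apply: eq_bigr => j _; rewrite !mxE -/(evmx _ lam1) evmxM /sys -/(col j).
    have /andP[-> _] : Vp (col j) := valP (enum_val j).
    by case: ifP => _ //; rewrite mulr0 evmx0 mul0r.
  rewrite /sys; case: ifP => ms; last by rewrite mul0r evmx0.
  rewrite big1 ?mul0r ?evmx0 // => j _.
  suff -> : ('X_[(row i).1] * fs j)@_e' = 0 by rewrite scale0r.
  apply/eqP; apply: contrapT => /negP c0; move/negP: nV; apply.
  rewrite /Vp (maskS _ _ _ _ ms) ?ltn_ord //=; apply/asboolP; apply: mI c0.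
  by apply: idealMl.
pose Xm : 'M[k]_(T, #|V|) := \matrix_(s, j) ((BMultinom (eE s) == col j)%:R).
have XW (s s' : 'I_T) : (Xm *m W) s s' =
    if fmask s'.+1 (e s) then evmx (v s' (BMultinom (eE s))) lam1 else 0.
  have [j Ej] := colV _ (Vpe s); rewrite mxE (bigD1 j) //= big1 ?addr0 => [|j' j'j].
    by rewrite !mxE Ej eqxx mul1r.
  rewrite !mxE -Ej; case: eqP => [E'|_]; last by rewrite mul0r.
  by case/eqP: j'j; apply: (can_inj (@enum_valK V)); apply: val_inj; rewrite -/(col j') -E'.
have rW : (T <= \rank W)%N.
  have trig : is_trig_mx (Xm *m W)^T.
    apply/is_trig_mxP => s s' ss'; rewrite mxE XW; case: ifP => // /fmaskP[].
    exact: F_le ss' _ (Fe s').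
  have : \det (Xm *m W) != 0.
    rewrite -det_tr det_trig //; apply/prodf_neq0 => s _; rewrite mxE XW mask_e.
    exact: v1.
  rewrite -unitfE -unitmxE => /mxrank_unit E1.
  by have := mxrankM_maxr Xm W; rewrite E1.
have up : (\rank M1 + T <= #|V|)%N.
  by apply: leq_trans (mulmx0_rank_max M1W); rewrite leq_add2l.
(* At lam0 the unit vectors of the monomials in m^t0 I lie in the row space, so the corank is at
   most C0; at lam1 it is at least T = C0 + 1, although the rank there is no smaller. *)
pose Cs := [set j | ~~ `[< F t0 'X_[col j] >]]%SET.
have CsC0 : (#|Cs| <= C0)%N.
  pose h (j : 'I_#|V|) : option 'X_{1..d < D0 + t0} := insub (col j : 'X_{1..d}).
  have hinj : {in Cs &, injective h}.
    have hC j : j \in Cs -> (mdeg (col j) < D0 + t0)%N.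
      rewrite inE ltnNge; apply: contra => De; apply/asboolP; apply: HD0 => //.
      by have /andP[_ /asboolP] : Vp (col j) := valP (enum_val j).
    move=> j j' /hC jC /hC j'C; rewrite /h !insubT => -[Ej].
    apply: (can_inj (@enum_valK V)); apply: val_inj; apply: val_inj; exact: Ej.
  by rewrite -(card_in_imset hinj); apply: max_card.
pose Ud : 'M[k]_#|V| := \matrix_(i, j) ((i == j) && (i \notin Cs))%:R.
pose Ac : 'M[k]_(#|V|, #|Cs|) := \matrix_(i, c) (i == enum_val c)%:R.
have UA : 1%:M = Ud + Ac *m Ac^T.
  apply/matrixP => i j; rewrite !mxE; case: (boolP (i \in Cs)) => iC.
    rewrite andbF add0r (bigD1 (enum_rank_in iC i)) //= !mxE enum_rankK_in // eqxx mul1r.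
    rewrite big1 ?addr0 1?eq_sym // => c ci; rewrite !mxE; case: (i =P _) => [E'|_].
      by case/eqP: ci; apply: enum_val_inj; rewrite enum_rankK_in.
    by rewrite mul0r.
  rewrite andbT big1 ?addr0 // => c _; rewrite !mxE; case: (i =P _) => [E'|_].
    by move: iC; rewrite E' enum_valP.
  by rewrite mul0r.
have UM : (Ud <= M0)%MS.
  apply/row_subP => i; case: (boolP (i \in Cs)) => iC.
    rewrite (_ : matrix.row i Ud = 0) ?sub0mx //.
    by apply/matrixP => a j; rewrite !mxE iC andbF.
  have Fi : F t0 'X_[col i] by move: iC; rewrite inE negbK => /asboolP.
  have Ii : I 'X_[col i] by apply: mul_ideal_subr Fi.
  have Fcol : sat m (add_ideal (gen (range (gel fs lam0))) (F T)) 'X_[col i].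
    by apply: sat_mono (Ht0 _ Fi); apply: add_idealL.
  have FT : F T `<=` F T by [].
  have := mem_unsat FT Ii Fcol; rewrite -{1}fk_id => Hmem.
  have [c Hc] := @mem_coords k d' k phi u fs T (fmask T) I (F T) fI' (@monoidl_F T)
    (fmaskP T) FT lam0 _ Ii Hmem.
  apply/submxP; exists (\row_l c (row l)); apply/matrixP => a j; rewrite !mxE.
  have /andP[mj _] : Vp (col j) := valP (enum_val j).
  have := Hc _ mj; rewrite mcoeffX.
  have -> : (bmnm (col i) == col j :> 'X_{1..d}) = (i == j).
    apply/eqP/eqP => [E'|-> //]; apply: (can_inj (@enum_valK V)); apply: val_inj.
    by apply: val_inj.
  rewrite iC andbT => ->; rewrite [LHS](reindex row) /=; last first.
    by exists enum_rank => x _; rewrite /row ?enum_valK ?enum_rankK.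
  apply: eq_bigr => l _; rewrite !mxE; congr (_ * _).
  have := @evmx_sys k d' k phi u fs T E (fmask T) lam0 (row l) (col j).
  by rewrite map_mpoly_idfun fk_id mj /evmx => ->.
have low : (#|V| <= \rank M0 + C0)%N.
  have := mxrank_add Ud (Ac *m Ac^T); rewrite -UA mxrank1 => H.
  apply: leq_trans H _; apply: leq_add; first exact: mxrankS.
  apply: leq_trans CsC0; apply: leq_trans (mxrankM_maxl _ _) _; exact: rank_leq_col.
by have := leq_trans up low; move: rk; rewrite /T; lia.
Qed.

End UniformConductor.

(** * Nonvanishing along lines and under base change *)

Section LineOpen.
Variables (k : fieldType) (d' u : nat).
Local Notation d := d'.+1.

Lemma line_open_evmx (p : {mpoly k[d * u]}) :
  @line_open k d' u (fun lam => evmx p lam != 0).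
Proof.
move=> A B [t0 Ht0].
pose q : {poly k} := mmap (@polyC k) (fun l => (mxvec A 0 l)%:P + 'X * (mxvec B 0 l)%:P) p.
have qE t : q.[t] = evmx p (A + t *: B).
  rewrite /q /evmx; elim/mpoly_ring_ind: p {Ht0 q} => [c|i|p1 p2 IH1 IH2|p1 p2 IH1 IH2].
  - by rewrite mmapC hornerC mevalC.
  - rewrite mmapX mmap1U hornerD hornerM hornerX !hornerC mevalXU.
    by rewrite linearD linearZ !mxE.
  - by rewrite !rmorphD /= hornerD IH1 IH2.
  - by rewrite !rmorphM /= hornerM IH1 IH2.
apply: (@cof_sub _ (fun t => q.[t] != 0)) => [t|]; first by rewrite qE.
by apply: cof_root; apply: contraNneq Ht0 => q0; rewrite -qE q0 horner0.
Qed.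

End LineOpen.

Lemma map_mpoly_neq0 n (A C : nzRingType) (phi : {rmorphism A -> C}) (q : {mpoly A[n]}) :
  (forall y, phi y = 0 -> y = 0) -> q != 0 -> map_mpoly phi q != 0.
Proof.
move=> phi0 q0; apply/negP => /eqP/mpolyP/(_ (mlead q)).
rewrite mcoeff_map_mpoly mcoeff0 => /phi0/eqP; rewrite mleadc_eq0.
exact/negP.
Qed.

(** * A Briancon-Skoda theorem in positive characteristic *)

Section Frobenius.
Variables (k : fieldType) (d' p : nat).
Local Notation d := d'.+1.
Local Notation R := {mpoly k[d]}.
Local Notation m := (max_ideal k d).
Hypothesis chp : p \in [pchar k].
Hypothesis infk : infinite_set [set: k].

Lemma pchar_mpoly : p \in [pchar R].
Proof.
have /andP[pp /eqP p0] := chp; apply/andP; split=> //.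
by rewrite -(rmorph_nat (@mpolyC d k)) p0 rmorph0.
Qed.

Lemma p_gt1 : (1 < p)%N. Proof. by have /andP[/prime_gt1] := chp. Qed.

Section Power.
Variable a : nat.
Let q := (p ^ a)%N.

Lemma q_gt0 : (0 < q)%N. Proof. by rewrite expn_gt0 ltnW // p_gt1. Qed.

Lemma pnat_q (S : nzSemiRingType) : p \in [pchar S] -> [pchar S].-nat q.
Proof.
move=> pS; rewrite pnatX; apply/orP; left; rewrite pnatE //.
by have /andP[] := chp.
Qed.

Definition frob (c : k) : k := c ^+ q.

Lemma frob_zmod : zmod_morphism frob.
Proof.
have D x y : frob (x + y) = frob x + frob y.
  by rewrite /frob exprDn_pchar // pnat_q.
by move=> x y; rewrite -[in RHS](subrK y x) [in RHS]D addrK.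
Qed.
HB.instance Definition _ := GRing.isZmodMorphism.Build k k frob frob_zmod.
Lemma frob_monoid : monoid_morphism frob.
Proof. by split=> [|x y]; rewrite /frob ?expr1n ?exprMn. Qed.
HB.instance Definition _ := GRing.isMonoidMorphism.Build k k frob frob_monoid.

Definition frob_mor : {rmorphism k -> k} := frob.

Lemma mpoly_expq (P : R) : P ^+ q = \sum_(e <- msupp P) (frob P@_e) *: 'X_[(e *+ q)%MM].
Proof.
have H : {morph (fun x : R => x ^+ q) : x y / x + y} := fun x y =>
  exprDn_pchar x y (pnat_q pchar_mpoly).
rewrite {1}[P]mpolyE (big_morph (fun x : R => x ^+ q) H (id1 := 0)); last first.
  by rewrite expr0n; case: (q) q_gt0.
by apply: eq_bigr => e _; rewrite exprZn mpolyXn.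
Qed.

Definition mdivq (e : 'X_{1..d}) : 'X_{1..d} := [multinom (e i %/ q)%N | i < d].

Variable g0 : 'X_{1..d}.
Hypothesis g0q : forall i, (g0 i < q)%N.

(** The coordinate of X^g0 in R as a free module over k[X_1^q, ..., X_d^q], with exponents divided
    by q. No roots of coefficients are taken, so P^q becomes the Frobenius twist of P and k may be
    imperfect. *)
Definition extract : R -> R := mon_lin (fun e : 'X_{1..d} =>
  if [forall i, (e i %% q == g0 i)%N] then 'X_[mdivq e] else 0).

Lemma extract_mul r P : extract (r * P ^+ q) = extract r * map_mpoly frob_mor P.
Proof.
have supq e : (P ^+ q)@_e != 0 -> exists e', e = (e' *+ q)%MM.
  move=> He; apply: contrapT => nH; move/negP: He; apply.
  rewrite mpoly_expq raddf_sum /= big1 // => e' _; rewrite mcoeffZ mcoeffX.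
  by case: eqP => [E|_]; rewrite ?mulr0 //; case: nH; exists e'.
have -> : map_mpoly frob_mor P = mon_lin (fun e => 'X_[mdivq e]) (P ^+ q).
  rewrite mpoly_expq {1}[P]mpolyE !raddf_sum; apply: eq_bigr => e _ /=.
  rewrite map_mpolyZ map_mpolyX mon_linZ mon_linX; congr (_ *: 'X_[_]).
  by apply/mnmP => i; rewrite mnmE mulmnE mulnK // q_gt0.
apply: mon_linM => x y _ /supq[e ->].
have -> : [forall i, ((x + e *+ q)%MM i %% q == g0 i)%N] = [forall i, (x i %% q == g0 i)%N].
  by apply: eq_forallb => i; rewrite mnmDE mulmnE addnC modnMDl.
case: ifP => _; last by rewrite mul0r.
rewrite -mpolyXD; congr 'X_[_]; apply/mnmP => i; rewrite !(mnmDE, mnmE, mulmnE).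
by rewrite mulnK ?q_gt0 // [X in (X %/ _)%N]addnC divnMDl ?q_gt0 // addnC.
Qed.

Lemma extract_g0 : extract 'X_[g0] = 1.
Proof.
rewrite /extract mon_linX; have -> : [forall i, (g0 i %% q == g0 i)%N].
  by apply/forallP => i; rewrite modn_small.
rewrite -mpolyX0; congr 'X_[_]; apply/mnmP => i.
by rewrite mnmE mnm0E divn_small.
Qed.

Lemma frobenius_descent n (b : 'I_n -> R) P :
  gen (range (fun i => b i ^+ q)) ('X_[g0] * P ^+ q) ->
  gen (range (fun i => map_mpoly frob_mor (b i))) (map_mpoly frob_mor P).
Proof.
move=> /gen_rangeP[r E]; have := congr1 extract E.
rewrite extract_mul extract_g0 mul1r => ->; rewrite /extract raddf_sum.
apply: ideal_sum => i; rewrite /= -/(extract _) extract_mul; apply: idealMl.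
by apply: sub_gen; exists i.
Qed.

End Power.

Lemma map_monoidl (phi : {rmorphism k -> k}) (I : ideal R) P :
  monoidl I -> I P -> I (map_mpoly phi P).
Proof.
move=> mI IP; apply: ideal_support => e; rewrite mcoeff_map_mpoly => H; apply: (mI _ _ IP).
apply/eqP => Pe; move/negP: H; apply; apply/eqP; rewrite Pe; exact: rmorph0.
Qed.

Variable I : ideal R.
Hypothesis mI : monoidl I.
Hypothesis I_neq0 : exists2 P, I P & P != 0.

Lemma iterated_reduction (J : ideal R) N s : (forall y, exp_ideal I N.+1 y ->
    mul_ideal J (exp_ideal I N) (s * y)) ->
  forall e y, exp_ideal I (e + N) y -> mul_ideal (exp_ideal J e) (exp_ideal I N) (s ^+ e * y).
Proof.
move=> Hs; elim=> [|e IH] y Hy.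
  by rewrite mul1r mul_idealC mul_ideal1.
suff H : exp_ideal I (e.+1 + N) `<=`
    ann (mul_ideal (exp_ideal J e.+1) (exp_ideal I N)) (s ^+ e.+1).
  by have := H _ Hy; rewrite annE mulrC.
have st : mul_ideal (exp_ideal J e) (exp_ideal I N.+1) `<=`
    ann (mul_ideal (exp_ideal J e.+1) (exp_ideal I N)) s.
  apply: mul_ideal_sub => v w Jv Iw; rewrite annE.
  have -> : v * w * s = v * (s * w) by ring.
  by rewrite /= (mul_idealC J) -mul_idealA; apply: mul_ideal_mem => //; apply: Hs.
apply: mul_ideal_sub => v w Iv /IH Hw; rewrite annE exprS.
have -> : v * w * (s * s ^+ e) = (v * (s ^+ e * w)) * s by ring.
apply: st; have : mul_ideal I (mul_ideal (exp_ideal J e) (exp_ideal I N)) (v * (s ^+ e * w)).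
  exact: mul_ideal_mem.
by rewrite mul_idealA (mul_idealC I) -mul_idealA.
Qed.

Lemma gelR_const u (f : 'I_u -> R) (lam : 'M[k]_(d, u)) :
  gelR f (map_mx (@mpolyC d k) lam) = gel f lam.
Proof.
by apply/funext => i; apply: eq_bigr => j _; rewrite mxE mul_mpolyC.
Qed.

Lemma ev0_const u (lam : 'M[k]_(d, u)) : ev0 (map_mx (@mpolyC d k) lam) = lam.
Proof. by apply/matrixP => i j; rewrite !mxE mcoeffC eqxx mulr1. Qed.

(* X^g0 (s^d x)^q lies in (b_1^q, ..., b_d^q) by the reduction property, with g0
   independent of q; reading off the exponents congruent to g0 modulo a large q
   shows that the Frobenius twist of s^d x is in that of (b_1, ..., b_d) *)
Lemma briancon_skoda_pchar (b : 'I_d -> R) N t x :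
  (forall i, I (b i)) ->
  exp_ideal I N.+1 `<=` sat m (mul_ideal (gen (range b)) (exp_ideal I N)) ->
  exp_ideal I d x ->
  sat m (add_ideal (gen (range b)) (mul_ideal (exp_ideal m t) I)) x.
Proof.
move=> Ib Hred Ix; have [s ms Hs] := sat_denom (@noeth_mpoly k d) Hred.
have IxI : I x := mul_ideal_subl Ix.
have [P IP P0] := I_neq0.
have Iw : I 'X_[mlead P] by apply: (mI IP); rewrite mleadc_eq0.
pose g0 : 'X_{1..d} := (mlead P *+ N)%MM.
have Ig0 : exp_ideal I N 'X_[g0] by rewrite /g0 -mpolyXn; apply: exp_ideal_pow.
pose a := (mdeg g0).+1; pose q := (p ^ a)%N.
have g0q i : (g0 i < q)%N.
  apply: leq_ltn_trans (mnm_le_mdeg _ _) _; apply: leq_trans (ltn_expl _ p_gt1).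
  by rewrite /a.
have memq : gen (range (fun i => b i ^+ q)) ('X_[g0] * (s ^+ d * x) ^+ q).
  have H1 : exp_ideal I (d * q + N) (x ^+ q * 'X_[g0]).
    by rewrite exp_idealD -exp_idealM; apply: mul_ideal_mem => //; apply: exp_ideal_pow.
  have := mul_ideal_subl (iterated_reduction Hs H1).
  have -> : s ^+ (d * q) * (x ^+ q * 'X_[g0]) = 'X_[g0] * (s ^+ d * x) ^+ q.
    by rewrite [in RHS]exprMn -exprM mulrA [LHS]mulrC.
  (* In a product of d q of the b_i one of them occurs q times: this is where the exponent d comes
     from. *)
  apply: (@pow_words _ _ b _ q) => [|i]; last by apply: sub_gen; exists i.
  by rewrite ltn_mul2l /= prednK // q_gt0.
have desc := frobenius_descent g0q memq.
set phi := frob_mor a in desc.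
set F := mul_ideal (exp_ideal m t) I.
have [D0 HD0] := F_big mI; pose E := (D0 + t)%N.
(* The linear system concerns d generic combinations of the b_i; where this determinant does not
   vanish, they generate the same ideal as the b_i. *)
pose detp : {mpoly k[d * d]} := \det (\matrix_(i < d, j < d) 'X_(mxvec_index i j)).
have detE lam : evmx detp lam = \det lam.
  rewrite /evmx /detp -det_map_mx; congr (\det _); apply/matrixP => i j.
  by rewrite !mxE /= mevalXU mxvecE.
have detp0 : detp != 0.
  apply/negP => /eqP E0; have := detE 1%:M; rewrite E0 evmx0 det1 => /eqP.
  by rewrite eq_sym oner_eq0.
have recomb (c : 'I_d -> R) lam : evmx detp lam != 0 -> gen (range (gel c lam)) = gen (range c).
  by rewrite detE -unitfE -unitmxE; apply: gen_recombine.
have powF : mul_ideal (exp_ideal m t) I `<=` F by [].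
have bigF e : I 'X_[e] -> (E <= mdeg e)%N -> F 'X_[e] by apply: HD0.
have mF : monoidl F := monoidl_F mI (t := t).
(* A certificate of nonmembership of x stays nonzero under the twist phi, where it contradicts
   [desc]: this brings the statement back from the twisted data. *)
have [[D [c [Dn0 Hc]]]|[v [Hv vn0]]] := row_space_dichotomy
  (fun (r : 'X_{1..d < t} * 'I_d) (e : 'X_{1..d < E}) => sys b (fmask I t) r e)
  (fun e => rhs d (fmask I t) x e).
  have [lam] := evmx_nonroot infk (mulf_neq0 Dn0 detp0).
  rewrite evmxM mulf_eq0 negb_or => /andP[Dlam /recomb Elam].
  have := @system_cert k d' k idfun d b t E (fmask I t) I F _ mI (@fmaskP _ _ I t) bigF x D c _ Hc
    (map_mx (@mpolyC d k) lam).
  rewrite fk_id ev0_const gelR_const !map_mpoly_idfun Elam; exact.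
have phi0 (y : k) : phi y = 0 -> y = 0 by move/eqP; rewrite fmorph_eq0 => /eqP.
have qn0 := map_mpoly_neq0 phi0 vn0.
have [lam] := evmx_nonroot infk (mulf_neq0 qn0 detp0).
rewrite evmxM mulf_eq0 negb_or => /andP[qlam /recomb Elam].
have Ifk j : I (fk phi b j) by apply: map_monoidl.
case: (@system_neg k d' k phi d b t E (fmask I t) I F Ifk mF (@fmaskP _ _ I t) powF x v
  (map_monoidl phi mI IxI) Hv lam qlam).
rewrite Elam; apply: (@sat_mono _ m _ _ (@add_idealL _ _ _)).
exists (map_mpoly phi s ^+ d).
  move=> /prime_pow/vars_idealP; rewrite mcoeff_map_mpoly => /phi0 s0.
  by apply: ms; apply/vars_idealP.
by move: desc; rewrite rmorphM rmorphXn.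
Qed.

End Frobenius.

(** * Infinite fields of positive characteristic *)

Section InfiniteField.

Lemma infinite_of_inj (T : choiceType) (f : nat -> T) : injective f -> infinite_set [set: T].
Proof.
move=> finj /finite_seqP[s sE].
have : (size [seq f i | i <- iota 0 (size s).+1] <= size s)%N.
  apply: uniq_leq_size; first by rewrite map_inj_uniq ?iota_uniq.
  by move=> x _; have : [set` s] x by rewrite -sE.
by rewrite size_map size_iota ltnn.
Qed.

Lemma infinite_field_pchar p : prime p -> exists K : fieldType,
  p \in [pchar K] /\ infinite_set [set: K].
Proof.
move=> pp; exists {fraction {poly 'F_p}}; split.
  apply/andP; split=> //; rewrite -(rmorph_nat (@FracField.tofrac {poly 'F_p})) tofrac_eq0.
  rewrite -polyC_natr polyC_eq0; have := pchar_Fp pp; rewrite inE => /andP[_].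
  by [].
apply: (@infinite_of_inj _ (fun n => FracField.tofrac ('X^n : {poly 'F_p}))) => i j /eqP.
rewrite tofrac_eq => /eqP/(congr1 (fun q : {poly _} => size q)).
by rewrite !size_polyXn => -[].
Qed.

Lemma pchar0_int_inj (k : fieldType) : (forall p, p \notin [pchar k]) ->
  forall z : int, (z%:~R : k) = 0 -> z = 0.
Proof.
move=> ch0; have nat0 n : (n%:R : k) = 0 -> n = 0%N.
  case: n => // n /eqP n0; have [p pc] := natf0_pchar (ltn0Sn n) n0.
  by have := ch0 p; rewrite pc.
case=> [n /nat0 ->|n] //.
by rewrite NegzE mulrNz => /eqP; rewrite oppr_eq0 => /eqP /nat0.
Qed.

Lemma pchar_int_neq0 (K : fieldType) p (z : int) : p \in [pchar K] -> z != 0 ->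
  (`|z|%N < p)%N -> (z%:~R : K) != 0.
Proof.
move=> pc z0 zp.
have H : (`|z|%N%:R : K) != 0.
  rewrite -(dvdn_pcharf pc); apply/negP => /dvdn_leq; rewrite absz_gt0 z0 => /(_ isT).
  by rewrite leqNgt zp.
by rewrite {1}[z]intEsign intrM mulf_neq0 //; case: (z < 0)%R; rewrite ?oner_eq0 // oppr_eq0 oner_eq0.
Qed.

End InfiniteField.

(** * Briancon-Skoda for monomials over any infinite field *)

Section MonomialBrianconSkoda.
Variables (d' u : nat) (w : 'I_u -> 'X_{1..d'.+1}).
Local Notation d := d'.+1.
Hypothesis u_gt0 : (0 < u)%N.
Hypothesis w_neq0 : forall j, w j != 0%MM.

(** The ideal with given exponents over a variable field; neither the exponents nor [wmask] depend
    on the field, so that one linear system serves them all. *)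
Definition wideal (K : fieldType) : ideal {mpoly K[d]} := gen (range (fun j => 'X_[K, w j])).
Definition wcond (K : fieldType) (t : nat) : ideal {mpoly K[d]} :=
  mul_ideal (exp_ideal (max_ideal K d) t) (wideal K).
Definition wmask (t : nat) (e : 'X_{1..d}) : bool :=
  ~~ [exists j, (w j <= e)%MM && (t <= mdeg (e - w j))%N].

Section OverField.
Variable K : fieldType.
Local Notation m := (max_ideal K d).
Local Notation I := (wideal K).

Lemma wideal_X e : I 'X_[e] <-> exists j, (w j <= e)%MM.
Proof.
split=> [/monoidl_gens_le //|[j je]]; apply: (monomial_le je).
by apply: sub_gen; exists j.
Qed.

Lemma wideal_gen j : I 'X_[w j]. Proof. by apply: sub_gen; exists j. Qed.

Lemma wideal_monoidl : monoidl I.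
Proof.
have -> : I = gen [set 'X_[K, e] | e in range w].
  rewrite /wideal; apply: eq_ideal; apply/seteqP; split; apply: gen_sub.
    by move=> _ [j _ <-]; apply: sub_gen; exists (w j) => //; exists j.
  by move=> _ [_ [j _ <-] <-]; apply: sub_gen; exists j.
exact: monoidl_gen.
Qed.

Lemma wideal_max : I `<=` m.
Proof.
apply: gen_sub => _ [j _ <-]; apply/vars_idealP; rewrite mcoeffX.
by have /negbTE -> := w_neq0 j.
Qed.

Lemma wideal_neq0 : exists2 p, I p & p != 0.
Proof.
exists 'X_[w (Ordinal u_gt0)]; first exact: wideal_gen.
by rewrite -msupp_eq0 msuppX.
Qed.

Lemma exp_max_deg t e : exp_ideal m t 'X_[e] -> (t <= mdeg e)%N.
Proof.
elim: t e => [//|t IH] e.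
move=> /(mul_ideal_X (@monoidl_max K d') (@monoidl_exp _ _ _ t (@monoidl_max K d'))).
move=> [a [b [/vars_idealP + /IH tb ->]]]; rewrite mcoeffX mdegD -(add1n t) => a0.
apply: leq_add tb; rewrite lt0n mdeg_eq0; apply/eqP => E; move: a0; rewrite E eqxx.
by move/eqP; rewrite oner_eq0.
Qed.

Lemma wmaskP t e : wmask t e <-> ~ wcond K t 'X_[e].
Proof.
suff H : wcond K t 'X_[e] <-> [exists j, (w j <= e)%MM && (t <= mdeg (e - w j))%N].
  by rewrite /wmask; split=> [/negP nH /H //|nH]; apply/negP => /H.
split=> [|/existsP[j /andP[je te]]]; last first.
  rewrite -(submK je) mpolyXD; apply: mul_ideal_mem; last exact: wideal_gen.
  exact: exp_max_X.
move=> /(mul_ideal_X (@monoidl_exp _ _ _ t (@monoidl_max K d')) wideal_monoidl).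
move=> [a [b [/exp_max_deg ta /wideal_X[j jb] ->]]]; apply/existsP; exists j.
rewrite -addmBA // mdegD (leq_trans ta (leq_addr _ _)) andbT.
apply/mnm_lepP => i; rewrite mnmDE; move/mnm_lepP: jb => /(_ i) H.
exact: leq_trans H (leq_addl _ _).
Qed.

Lemma wexp_X n e : exp_ideal I n 'X_[e] <->
  exists2 s : seq 'I_u, size s = n & ((\sum_(j <- s) w j)%MM <= e)%MM.
Proof.
split=> [|[s <- se]].
  elim: n e => [|n IH] e.
    by exists [::] => //; rewrite big_nil; apply/mnm_lepP => i; rewrite mnm0E.
  move=> /(mul_ideal_X wideal_monoidl (@monoidl_exp _ _ _ n wideal_monoidl)).
  move=> [a [b [/wideal_X[j ja] /IH[s sn sb] ->]]]; exists (j :: s); first by rewrite /= sn.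
  rewrite big_cons; apply/mnm_lepP => i; rewrite !mnmDE.
  by move/mnm_lepP: ja => /(_ i) H1; move/mnm_lepP: sb => /(_ i) H2; apply: leq_add.
apply: (monomial_le se); have := @prod_mem_exp _ I _ (fun j => 'X_[w j]) s wideal_gen.
suff -> : 'X_[(\sum_(j <- s) w j)%MM] = \prod_(j <- s) 'X_[K, w j] by [].
by elim: s {se} => [|j s IH]; rewrite ?big_nil ?mpolyX0 // !big_cons mpolyXD IH.
Qed.

Hypothesis infK : infinite_set [set: K].

Lemma wgeneric_red (q : {mpoly K[d * u]}) : q != 0 ->
  exists lam, evmx q lam != 0 /\ exists N, exp_ideal I N.+1 `<=`
    sat m (mul_ideal (gen (range (gel (fun j => 'X_[w j]) lam))) (exp_ideal I N)).
Proof.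
move=> q0; have [|h h0 Hh] := @generic_reduction_local _ _ infK I wideal_monoidl
  wideal_neq0 u (fun j => 'X_[w j]) wideal_gen 0 wideal_max.
  exact: sub_sat.
have [lam] := evmx_nonroot infK (mulf_neq0 q0 h0).
by rewrite evmxM mulf_eq0 negb_or => /andP[ql /Hh H]; exists lam.
Qed.

End OverField.

Let wmax := (\max_j mdeg (w j))%N.

Lemma wbig (K : fieldType) t e : wideal K 'X_[e] -> (wmax + t <= mdeg e)%N -> wcond K t 'X_[e].
Proof.
move=> /wideal_X[j je] te; rewrite -(submK je) mpolyXD.
apply: mul_ideal_mem; last exact: wideal_gen.
apply: exp_max_X; have := leq_bigmax (F := fun j => mdeg (w j)) j; rewrite -/wmax.
by move: te; rewrite -{1}(submK je) mdegD; lia.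
Qed.

Lemma fk_monomial (A : idomainType) (K : fieldType) (phi : {rmorphism A -> K}) :
  fk phi (fun j => 'X_[w j] : {mpoly A[d]}) = (fun j => 'X_[w j]).
Proof. by apply/funext => j; rewrite /fk map_mpolyX. Qed.

(* a certificate that X^e is generically not in J + m^t I is defined over the
   prime ring, and hence survives in some infinite field of positive characteristic *)
Lemma monomial_briancon_skoda (k : fieldType) e t : infinite_set [set: k] ->
  exp_ideal (wideal k) d 'X_[e] -> exists2 D : {mpoly k[d * u]}, D != 0 &
  forall Th, evmx D (ev0 Th) != 0 ->
    sat (max_ideal k d)
      (add_ideal (gen (range (gelR (fun j => 'X_[w j]) Th))) (wcond k t)) 'X_[e].
Proof.
move=> infk /wexp_X He.
(* A will be k itself in positive characteristic and the ring of integers in characteristic 0; psi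
   leads to a field of positive characteristic. *)
have cert (A : idomainType) (phi : {rmorphism A -> k}) : (forall y, phi y = 0 -> y = 0) ->
    (forall q : {mpoly A[d * u]}, q != 0 -> exists (K : fieldType) (psi : {rmorphism A -> K}) p,
      [/\ p \in [pchar K], infinite_set [set: K] & map_mpoly psi q != 0]) ->
    exists2 D : {mpoly k[d * u]}, D != 0 & forall Th, evmx D (ev0 Th) != 0 ->
    sat (max_ideal k d)
      (add_ideal (gen (range (gelR (fun j => 'X_[w j]) Th))) (wcond k t)) 'X_[e].
  move=> phi0 Hneg; pose f (j : 'I_u) : {mpoly A[d]} := 'X_[w j].
  have IkK (K : fieldType) : wideal K 'X_[e].
    by have /wexp_X H := He; apply: mul_ideal_subl (H K).
  have fI (K : fieldType) (psi : {rmorphism A -> K}) j : wideal K (fk psi f j).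
    by rewrite fk_monomial; apply: wideal_gen.
  have [[D [c [Dn0 Hc]]]|[v [Hv vn0]]] := row_space_dichotomy
    (fun (r : 'X_{1..d < t} * 'I_d) (e' : 'X_{1..d < wmax + t}) => sys f (wmask t) r e')
    (fun e' => rhs u (wmask t) 'X_[e] e').
    exists (map_mpoly phi D); first exact: map_mpoly_neq0.
    have := @system_cert k d' A phi u f t (wmax + t) (wmask t) (wideal k) (wcond k t) (fI _ _)
      (@wideal_monoidl k) (@wmaskP k t) (@wbig k t) 'X_[e] D c.
    by rewrite map_mpolyX fk_monomial; apply.
  have [K [psi [p [pK infK qn0]]]] := Hneg _ vn0.
  have [lam [qlam [N Hred]]] := wgeneric_red infK qn0.
  have mW : monoidl (wcond K t).
    by apply: monoidl_mul (@wideal_monoidl K); apply: monoidl_exp; apply: monoidl_max.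
  have := @system_neg K d' A psi u f t (wmax + t) (wmask t) (wideal K) (wcond K t) (fI _ _)
    mW (@wmaskP K t) (@subset_refl _ _) 'X_[e] v.
  rewrite map_mpolyX fk_monomial => /(_ (IkK K) Hv lam qlam); case.
  apply: (briancon_skoda_pchar pK infK (@wideal_monoidl K) (wideal_neq0 K) t _ Hred).
    by move=> i; apply: ideal_sum => j; rewrite -mul_mpolyC; apply: idealMl; apply: wideal_gen.
  exact/wexp_X.
have [[p pk]|ch0] := pselect (exists p, p \in [pchar k]).
  apply: (cert k idfun) => // q q0; exists k, idfun, p; split=> //.
  by rewrite map_mpoly_idfun.
apply: (cert int (intmul 1)).
  by apply: pchar0_int_inj => p; apply/negP => pk; apply: ch0; exists p.
move=> q q0; have [p zp pp] := prime_above `|q@_(mlead q)|%N.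
have [K [pK infK]] := infinite_field_pchar pp; exists K, (intmul 1), p; split=> //.
apply/negP => /eqP/mpolyP/(_ (mlead q)); rewrite mcoeff_map_mpoly mcoeff0 => /eqP.
by apply/negP; apply: (pchar_int_neq0 pK) zp; rewrite mleadc_eq0.
Qed.

End MonomialBrianconSkoda.

(** * Briancon-Skoda for all local reductions *)

Section BrianconSkoda.
Variables (k : fieldType) (d' : nat).
Local Notation d := d'.+1.
Local Notation R := {mpoly k[d]}.
Local Notation m := (max_ideal k d).
Variable I : ideal R.
Hypothesis infk : infinite_set [set: k].
Hypothesis mI : monoidl I.
Hypothesis I_neq0 : exists2 p, I p & p != 0.
Hypothesis HG : satisfies_G d I.
Hypothesis HS : weakly_residually_S2 (d%:Z - 2) (loc_ideal m I).
Hypothesis Im : I `<=` m.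

Lemma generic_membership u (g : 'I_u -> R) : I = gen (range g) ->
  exists t (D : {mpoly k[d * u]}), D != 0 /\ forall Th, evmx D (ev0 Th) != 0 ->
    mul_ideal (exp_ideal m t) I `<=` sat m (gen (range (gelR g Th))).
Proof.
move=> IE; have Ig j : I (g j) by rewrite IE; apply: sub_gen; exists j.
have [|h h0 Hh] := generic_reduction_local (M := 0) infk mI I_neq0 Ig Im.
  by rewrite -IE; apply: sub_sat.
have [lam0 /Hh[N Hred]] := evmx_nonroot infk h0.
have JI : gen (range (gel g lam0)) `<=` I.
  apply: gen_sub => _ [i _ <-]; apply: ideal_sum => j; rewrite -mul_mpolyC.
  exact: idealMl.
have [t0 Ht0] := local_reduction_pow infk mI I_neq0 HG HS JI Hred.
exact: (uniform_conductor infk mI Ig Ht0).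
Qed.

(** For monomial generators and generic J the error term m^t I lies in J_m by the uniform conductor.
    [core_local] passes from generic J to all local reductions, and other elements g are absorbed
    into the matrix, whose entries may lie in R. *)
Lemma briancon_skoda u (g : 'I_u -> R) Th : (forall j, I (g j)) -> local_red I g Th ->
  exp_ideal I d `<=` sat m (gen (range (gelR g Th))).
Proof.
move=> Ig Hred x Ix; apply: ideal_support => e xe.
have Ie : exp_ideal I d 'X_[e] := monoidl_exp mI Ix xe.
have [r [w [Iw IE]]] := monoidl_gens mI.
have w0 j : w j != 0%MM.
  by apply/eqP => E; have /Im/vars_idealP := Iw j; rewrite E mcoeffX eqxx => /eqP; rewrite oner_eq0.
have r0 : (0 < r)%N.
  rewrite lt0n; apply/eqP => r0; have [p + pn0] := I_neq0; rewrite IE => /gen_rangeP[c pE].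
  by move/eqP: pn0; apply; rewrite pE big1 // => -[i ir]; exfalso; move: ir; rewrite r0.
pose g' (j : 'I_r) : R := 'X_[w j].
have [t [D1 [D10 HD1]]] := generic_membership IE.
have IW : I = wideal w k := IE.
have [|D2 D20 HD2] := @monomial_briancon_skoda d' r w r0 w0 k e t infk.
  by rewrite -IW.
have Hcore Th' : local_red I g' Th' -> sat m (gen (range (gelR g' Th'))) 'X_[e].
  apply: (@core_local k d' I r g' infk mI I_neq0 HG HS Iw
     (fun lam => evmx (D1 * D2) lam != 0) 'X_[e]).
  - exact: line_open_evmx.
  - by apply: (evmx_nonroot infk); rewrite mulf_neq0.
  - exact: mul_ideal_subl Ie.
  - move=> Th2; rewrite evmxM mulf_eq0 negb_or => /andP[H1 /HD2 H2].
    apply: (@sat_sub _ m _ _ _ _ H2); apply: add_ideal_sub; first exact: sub_sat.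
    by rewrite /wcond -IW; apply: HD1.
have Hc j : exists c : 'I_r -> R, g j = \sum_l c l * g' l.
  by have := Ig j; rewrite {1}IE => /gen_rangeP.
have [c Ec] := choice Hc.
pose Th' : 'M[R]_(d, r) := Th *m \matrix_(j, l) c j l.
have gE : gelR g' Th' = gelR g Th.
  apply/funext => i; rewrite /gelR.
  under [RHS]eq_bigr => j _ do rewrite Ec mulr_sumr.
  rewrite exchange_big /=; apply: eq_bigr => l _; rewrite !mxE mulr_suml.
  by apply: eq_bigr => j _; rewrite mxE mulrA.
by rewrite -gE; apply: Hcore; case: Hred => N HN; exists N; rewrite gE.
Qed.

End BrianconSkoda.

(** * Torus action and monomiality of the core *)

Section Torus.
Variables (k : fieldType) (d B : nat).
Local Notation R := {mpoly k[d]}.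

(** The one-parameter subgroup X_i -> t^(B^i) X_i, whose weights separate the exponents of degree
    below B. *)
Definition torus (t : k) : R -> R :=
  mon_lin (fun e : 'X_{1..d} => t ^+ kweight B e *: 'X_[e] : R).

Lemma torusD t p q : torus t (p + q) = torus t p + torus t q.
Proof.
by have := mon_lin_linear (fun e : 'X_{1..d} => t ^+ kweight B e *: 'X_[e] : R) 1 p q; rewrite !scale1r.
Qed.

Lemma torusM t p q : torus t (p * q) = torus t p * torus t q.
Proof.
apply: mon_linM => a b _ _; rewrite mpolyXD -scalerAl -scalerAr scalerA -exprD.
rewrite /kweight -big_split /=; congr (_ ^+ _ *: _).
by apply: eq_bigr => i _; rewrite mnmDE mulnDl.
Qed.

Lemma mcoeff_torus t p e : (torus t p)@_e = t ^+ kweight B e * p@_e.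
Proof.
rewrite /torus (mon_linE _ (leqnn _)) raddf_sum /=.
have [ep|ep] := ltnP (mdeg e) (msize p); last first.
  rewrite (memN_msupp_eq0 (msize_mdeg_ge ep)) mulr0 big1 // => e' _.
  rewrite !mcoeffZ mcoeffX; case: eqP => [E|_]; last by rewrite !mulr0.
  by have := valP e'; rewrite /= E ltnNge ep.
rewrite (bigD1 (BMultinom ep)) //= !mcoeffZ mcoeffX eqxx mulr1 mulrC big1 ?addr0 // => e' e'e.
rewrite !mcoeffZ mcoeffX; case: eqP => [E|_]; last by rewrite !mulr0.
by case/eqP: e'e; apply: val_inj.
Qed.

Lemma torusK t s p : t * s = 1 -> torus t (torus s p) = p.
Proof.
by move=> ts; apply/mpolyP => e; rewrite !mcoeff_torus mulrA -exprMn ts expr1n mul1r.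
Qed.

Lemma torus_monoidl (I : ideal R) t p : monoidl I -> I p -> I (torus t p).
Proof.
move=> mI Ip; apply: ideal_support => e; rewrite mcoeff_torus mulf_eq0 negb_or => /andP[_].
exact: mI.
Qed.

Lemma is_ideal_torus t (L : ideal R) : is_ideal [set p | L (torus t p)].
Proof.
split=> [|p q Lp Lq|a p Lp] /=.
- suff -> : torus t 0 = 0 by apply: ideal0.
  by apply/mpolyP => e; rewrite mcoeff_torus mcoeff0 mulr0.
- by rewrite torusD; apply: idealD.
- by rewrite torusM; apply: idealMl.
Qed.

Lemma torus_reduction t (L I : ideal R) : t != 0 -> monoidl I -> is_reduction L I ->
  is_reduction (Ideal (is_ideal_torus t L)) I.
Proof.
move=> t0 mI /reductionE[LI [N HN]]; apply: (@reductionP _ _ _ N) => [p /= /LI Ip|p Ip].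
  by rewrite -(@torusK t^-1 t p) ?mulVf //; apply: torus_monoidl.
rewrite -(@torusK t^-1 t p) ?mulVf //.
have {Ip} := HN _ (torus_monoidl t (monoidl_exp mI) Ip).
set K := mul_ideal (Ideal _) _.
suff H : mul_ideal L (exp_ideal I N) `<=` Ideal (is_ideal_torus t^-1 K) by move/H.
apply: mul_ideal_sub => x y Lx Iy.
change (K (torus t^-1 (x * y))); rewrite torusM; apply: mul_ideal_mem.
  by change (L (torus t (torus t^-1 x))); rewrite torusK ?mulfV.
exact: (torus_monoidl t^-1 (monoidl_exp mI)).
Qed.

End Torus.

(** By Vandermonde the weight components of p are combinations of its torus translates, and B is
    large enough for each component to be a single term. *)
Lemma core_monoidl (k : fieldType) (d : nat) (I : ideal {mpoly k[d]}) :
  infinite_set [set: k] -> monoidl I -> monoidl (core I).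
Proof.
move=> infk mI p e Cp pe.
pose B := msize p; have Bs e' : e' \in msupp p -> (mdeg e' < B)%N by apply: msize_mdeg_lt.
have Ct t : t != 0 -> core I (torus B t p).
  by move=> t0 L /(torus_reduction B t0 mI) HL; apply: (Cp _ HL).
pose n := (\max_(e' <- msupp p) kweight B e').+1.
pose c (j : 'I_n) : {mpoly k[d]} :=
  \sum_(e' <- msupp p | kweight B e' == j) p@_e' *: 'X_[e'].
have cE t : mom (@mpolyC d k) c t = torus B t p.
  rewrite /mom /c /torus /mon_lin.
  under eq_bigr => j _ do rewrite mulr_sumr big_mkcond.
  rewrite exchange_big /=; apply: eq_big_seq => e' e'p.
  have e'n : (kweight B e' < n)%N by rewrite ltnS; apply: leq_bigmax_seq.
  rewrite (bigD1 (Ordinal e'n)) //= eqxx big1 ?addr0 => [|j].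
    by rewrite mul_mpolyC !scalerA mulrC.
  by rewrite -val_eqE /= eq_sym => /negbTE ->.
have [s [us ss Hs]] := cof_list infk n (cof_neq 0).
pose s' (i : 'I_n) := nth 0 s i.
have s'inj : injective s'.
  move=> i j /eqP; rewrite nth_uniq ?ss ?ltn_ord // => /eqP; exact: val_inj.
have Hc := mom_all (iota := @mpolyC d k) (c := c) (W := core I) s'inj.
have ep : e \in msupp p by rewrite mcoeff_msupp.
have en : (kweight B e < n)%N by rewrite ltnS; apply: leq_bigmax_seq.
have := Hc _ (Ordinal en); rewrite /c big_mkcond (bigD1_seq e) //= eqxx big1_seq ?addr0; last first.
  move=> e' /andP[e'e e'p]; case: eqP => // E; case/eqP: e'e.
  by apply: kweight_inj E; apply: Bs.
move=> H; have {H} : core I (p@_e *: 'X_[e]).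
  apply: H => i; rewrite cE; apply: Ct; apply/eqP; apply: Hs.
  by apply: mem_nth; rewrite ss.
move=> /(@idealMl _ (core I) ((p@_e)^-1)%:MP); rewrite mul_mpolyC scalerA mulVf // scale1r.
by [].
Qed.

(** * Membership of monomials in the core *)

Section CoreMembership.
Variables (k : fieldType) (d' : nat).
Local Notation d := d'.+1.
Local Notation R := {mpoly k[d]}.
Local Notation m := (max_ideal k d).
Variable I : ideal R.
Hypothesis infk : infinite_set [set: k].
Hypothesis mI : monoidl I.
Hypothesis I_neq0 : exists2 p, I p & p != 0.
Hypothesis HG : satisfies_G d I.
Hypothesis HS : weakly_residually_S2 (d%:Z - 2) (loc_ideal m I).
Hypothesis Im : I `<=` m.

Section GenericMembership.
Variables (u : nat) (g : 'I_u -> R).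
Hypothesis IE : I = gen (range g).

Lemma gens_in j : I (g j). Proof. by rewrite IE; apply: sub_gen; exists j. Qed.

Lemma generic_all_local (D : {mpoly k[d * u]}) x : D != 0 -> I x ->
  (forall Th, evmx D (ev0 Th) != 0 -> sat m (gen (range (gelR g Th))) x) ->
  forall Th, local_red I g Th -> sat m (gen (range (gelR g Th))) x.
Proof.
move=> D0 Ix HD; apply: (@core_local k d' I u g infk mI I_neq0 HG HS gens_in
  (fun lam => evmx D lam != 0) x _ _ Ix HD); first exact: line_open_evmx.
exact: (evmx_nonroot infk).
Qed.

(** A monomial of degree below E has either a certificate of generic membership, which extends to
    all local reductions, or one of nonmembership, and then D rules out the hypothesis on lam. From
    degree E on, membership is automatic. *)
Lemma generic_monomials : exists2 D : {mpoly k[d * u]}, D != 0 &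
  forall lam e, evmx D lam != 0 -> I 'X_[e] -> sat m (gen (range (gel g lam))) 'X_[e] ->
  forall Th, local_red I g Th -> sat m (gen (range (gelR g Th))) 'X_[e].
Proof.
have [t [D1 [D10 HD1]]] := generic_membership infk mI I_neq0 HG HS Im IE.
have [D0 HD0] := F_big mI; pose E := (D0 + t)%N; pose F := mul_ideal (exp_ideal m t) I.
have bigF e : I 'X_[e] -> (E <= mdeg e)%N -> F 'X_[e] by apply: HD0.
have mF : monoidl F := monoidl_F mI (t := t).
have idg j : I (fk idfun g j) by rewrite fk_id; apply: gens_in.
have powF : mul_ideal (exp_ideal m t) I `<=` F by [].
have Hx (e : 'X_{1..d < E}) : exists D : {mpoly k[d * u]}, D != 0 /\
    forall lam, evmx D lam != 0 -> I 'X_[e] -> sat m (gen (range (gel g lam))) 'X_[e] ->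
    forall Th, local_red I g Th -> sat m (gen (range (gelR g Th))) 'X_[e].
  have [Ie|nIe] := pselect (I 'X_[e]); last by exists 1; split=> //; rewrite oner_neq0.
  have Ie' : I (map_mpoly idfun 'X_[e]) by rewrite map_mpoly_idfun.
  have [[D [c [Dn0 Hc]]]|[v [Hv vn0]]] := row_space_dichotomy
    (fun (r : 'X_{1..d < t} * 'I_d) (e : 'X_{1..d < E}) => sys g (fmask I t) r e)
    (fun e' => rhs u (fmask I t) 'X_[e] e').
    exists D; split=> // lam _ _ _; apply: (generic_all_local (mulf_neq0 D10 Dn0) Ie) => Th.
    rewrite evmxM mulf_eq0 negb_or => /andP[/HD1 HF DTh].
    have := @system_cert k d' k idfun u g t E (fmask I t) I F idg mI (@fmaskP _ _ I t) bigF
      'X_[e] D c Ie' Hc Th.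
    rewrite fk_id !map_mpoly_idfun => /(_ DTh); apply: (@sat_sub _ m).
    by apply: add_ideal_sub HF; apply: sub_sat.
  exists (\sum_e' rhs u (fmask I t) 'X_[e] e' * v e'); split=> // lam qlam _ Hs.
  have := @system_neg k d' k idfun u g t E (fmask I t) I F idg mF (@fmaskP _ _ I t) powF
    'X_[e] v Ie' Hv lam.
  rewrite fk_id !map_mpoly_idfun => /(_ qlam) []; apply: (@sat_mono _ m _ _ _ _ Hs).
  exact: add_idealL.
have [De HDe] := choice Hx.
exists (\prod_e De e); first by apply/prodf_neq0 => e _; have [] := HDe e.
move=> lam e; rewrite /evmx rmorph_prod => /prodf_neq0 Dlam Ie He Th.
have [eE|eE] := ltnP (mdeg e) E.
  by have [_ /(_ lam)] := HDe (BMultinom eE); apply=> //; exact: Dlam.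
apply: (generic_all_local D10 Ie) => Th' /HD1; apply; exact: bigF.
Qed.

(** General elements of L, d in number, generate a local reduction of I inside L, with a coefficient
    matrix over R with respect to g. To pass from L_m to L, a denominator is inverted modulo m^t,
    where m^t I lies in L. *)
Lemma local_core x : I x ->
  (forall Th, local_red I g Th -> sat m (gen (range (gelR g Th))) x) -> core I x.
Proof.
move=> Ix Hx L /reductionE[LI [N HN]].
have [v [l LE]] := @noeth_mpoly k d L.
have Il j : I (l j) by apply: LI; rewrite LE; apply: sub_gen; exists j.
have [|h h0 Hh] := generic_reduction_local (M := N) infk mI I_neq0 Il Im.
  by rewrite -LE; apply: subset_trans HN _; apply: sub_sat.
have [lam /Hh[M HM]] := evmx_nonroot infk h0.
have Hc j : exists c : 'I_u -> R, l j = \sum_i c i * g i.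
  by have := Il j; rewrite {1}IE => /gen_rangeP.
have [c Ec] := choice Hc.
pose Th : 'M[R]_(d, u) := map_mx (@mpolyC d k) lam *m \matrix_(j, i) c j i.
have gE : gelR g Th = gel l lam.
  apply/funext => i; rewrite /gelR /gel.
  under [RHS]eq_bigr => j _ do rewrite Ec -mul_mpolyC mulr_sumr.
  rewrite exchange_big /=; apply: eq_bigr => j _; rewrite !mxE mulr_suml.
  by apply: eq_bigr => i' _; rewrite !mxE mulrA.
have : sat m L x.
  have : local_red I g Th by exists M; rewrite gE.
  move/Hx; rewrite gE; apply: sat_mono; rewrite LE; apply: gen_sub => _ [i _ <-].
  apply: ideal_sum => j; rewrite -mul_mpolyC; apply: idealMl.
  by apply: sub_gen; exists j.
move=> [s ms Ls]; have [t Ht] := reduction_pow infk mI I_neq0 HG HS LI HN.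
have [r Hr] := unit_mod_max t ms.
rewrite -[x]mul1r -(subrK (r * s) 1) mulrDl; apply: idealD.
  by apply: Ht; apply: mul_ideal_mem.
by rewrite -mulrA; apply: idealMl.
Qed.

Lemma core_eq_mono_general f : I f ->
  (exists2 h : {mpoly k[d * u]}, h != 0 & forall lam, evmx h lam != 0 ->
    is_reduction (add_ideal (gen (range (gel g lam))) (gen [set f ^+ d])) I) ->
  exists2 h : {mpoly k[d * u]}, h != 0 & forall lam, evmx h lam != 0 ->
    let K := add_ideal (gen (range (gel g lam))) (gen [set f ^+ d]) in
    is_reduction K I /\ core I = mono K.
Proof.
move=> If [h h0 Hh].
have [|h' h'0 Hh'] := generic_reduction_local (M := 0) infk mI I_neq0 gens_in Im.
  by rewrite -IE; apply: sub_sat.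
have [D D0 HD] := generic_monomials.
exists (h * h' * D); first by rewrite !mulf_neq0.
move=> lam; rewrite !evmxM !mulf_eq0 !negb_or => /andP[/andP[/Hh redK /Hh' [N HN]] Dlam] K.
split=> //; apply: eq_ideal; apply/seteqP; split.
  apply: mono_max; last by move=> x; apply.
  by apply: monoidl_monomial; apply: core_monoidl.
have [KI _] := redK.
have mM : monoidl (mono K) by apply: monomial_monoidl; apply: mono_monomial.
move=> x Kx; apply: ideal_support => e xe.
have Ke : K 'X_[e] by apply: mono_sub; apply: mM Kx xe.
have Ie := KI _ Ke; apply: (local_core Ie); apply: (HD lam) => //.
have red : local_red I g (map_mx (@mpolyC d k) lam) by exists N; rewrite gelR_const.
have Hf : sat m (gen (range (gel g lam))) (f ^+ d).
  have := briancon_skoda infk mI I_neq0 HG HS Im gens_in red (exp_ideal_pow d If).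
  by rewrite gelR_const.
suff KJ : K `<=` sat m (gen (range (gel g lam))) by apply: KJ.
by apply: add_ideal_sub; [exact: sub_sat|apply: gen_sub => _ ->].
Qed.

End GenericMembership.
End CoreMembership.

(** * General matrices, the unit ideal, and the theorem *)

Section GeneralMatrices.
Variables (k : fieldType) (d u : nat).
Hypothesis infk : infinite_set [set: k].

Lemma nonvanishing_open (h : {mpoly k[d * u]}) : zariski_open [set lam | evmx h lam != 0].
Proof.
exists [set h]; apply/seteqP; split=> lam /=; first by exists h.
by move=> [_ ->].
Qed.

Lemma nonvanishing_dense (h : {mpoly k[d * u]}) : h != 0 ->
  zariski_dense [set lam : 'M[k]_(d, u) | evmx h lam != 0].
Proof.
move=> h0 _ [S ->] [lam0 [p Sp p0]].
have pn0 : p != 0 by apply: contraNneq p0 => ->; rewrite rmorph0.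
have [lam] := evmx_nonroot infk (mulf_neq0 h0 pn0).
by rewrite evmxM mulf_eq0 negb_or => /andP[hl pl]; exists lam; split=> //; exists p.
Qed.

End GeneralMatrices.

Lemma mono_neq0_unit (k : fieldType) (d : nat) (I : ideal {mpoly k[d]}) :
  monoidl I -> (exists2 p, I p & p@_0%MM != 0) -> I 1.
Proof. by move=> mI [p Ip p0]; rewrite -mpolyX0; apply: mI p0. Qed.

Lemma unit_core_eq_mono (k : fieldType) (d : nat) (I K : ideal {mpoly k[d]}) :
  monoidl I -> I 1 -> K 1 -> is_reduction K I /\ core I = mono K.
Proof.
move=> mI I1 K1.
have all (L : ideal {mpoly k[d]}) x : L 1 -> L x by move=> L1; rewrite -[x]mulr1; apply: idealMl.
split.
  apply: (@reductionP _ _ _ 0) => [x _|x _]; first exact: all.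
  by rewrite [exp_ideal I 0]/= mul_ideal1; apply: all.
apply: eq_ideal; apply/seteqP; split=> x _.
  apply: (@mono_max _ _ K I); [exact: monoidl_monomial|by move=> y _; apply: all|exact: all].
move=> L /reductionE[_ [N HN]]; apply: mul_ideal_subl.
by apply: HN; apply: all; rewrite -(expr1n _ N.+1); apply: exp_ideal_pow.
Qed.

Lemma homog0_const (k : fieldType) (n : nat) (p : {mpoly k[n.+1]}) :
  p \is 0.-homog -> p = (p@_0%MM)%:MP.
Proof.
move=> hp; apply/mpolyP => e; rewrite mcoeffC; case: eqP => [<-|e0]; first by rewrite mulr1.
rewrite mulr0; apply/eqP; apply: contrapT => /negP pe; apply: e0.
by have /eqP := homog_coef hp pe; rewrite mdeg_eq0 => /eqP.
Qed.

(** In degree 0 the generators are constants, and the first generic combination is a nonzero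
    constant for general [lam]. *)
Lemma const_general_ideal (k : fieldType) (n u : nat) (fs : 'I_u -> {mpoly k[n.+1]}) :
  (forall j, fs j \is 0.-homog) -> gen (range fs) 1 ->
  exists2 h : {mpoly k[n.+1 * u]}, h != 0 &
    forall lam, evmx h lam != 0 -> gen (range (gel fs lam)) 1.
Proof.
move=> hf /gen_rangeP[a aE]; pose c j := (fs j)@_0%MM.
have fE j : fs j = (c j)%:MP by apply: homog0_const.
have [j cj] : exists j, c j != 0.
  apply: contrapT => H; have /eqP := aE; rewrite big1 ?oner_eq0 // => j _.
  rewrite fE; suff -> : c j = 0 by rewrite mpolyC0 mulr0.
  by apply/eqP; apply: contrapT => /negP cj; apply: H; exists j.
pose h : {mpoly k[n.+1 * u]} := \sum_j c j *: 'X_(mxvec_index ord0 j).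
have hE lam : evmx h lam = \sum_j c j * lam ord0 j.
  by rewrite evmx_sum; apply: eq_bigr => l _; rewrite evmxZ evmxX.
exists h.
  apply/eqP => h0; have := hE (delta_mx ord0 j); rewrite h0 evmx0 (bigD1 j) //= big1 => [|l lj].
    by rewrite mxE !eqxx mulr1 addr0 => /esym/eqP; apply/negP.
  by rewrite mxE eqxx (negbTE lj) mulr0.
move=> lam hl; have gE : gel fs lam ord0 = (evmx h lam)%:MP.
  rewrite hE raddf_sum; apply: eq_bigr => l _ /=.
  by rewrite fE -mul_mpolyC -mpolyCM mulrC.
have : gen (range (gel fs lam)) (gel fs lam ord0) by apply: sub_gen; exists ord0.
by rewrite gE => /(@idealMl _ _ ((evmx h lam)^-1)%:MP); rewrite -mpolyCM mulVf.
Qed.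

Theorem theorem4p7 (k : fieldType) (d : nat) (I : ideal {mpoly k[d]})
    (u : nat) (fs : 'I_u -> {mpoly k[d]}) (f : {mpoly k[d]}) :
  infinite_set [set: k] ->
  is_monomial_ideal I ->
  (exists2 p : {mpoly k[d]}, I p & p != 0) ->
  satisfies_G d I ->
  weakly_residually_S2 (d%:Z - 2) (loc_ideal (max_ideal k d) I) ->
  I = gen (range fs) ->
  (forall delta : nat, generated_in_degree I delta ->
     f = 0 /\ forall j, fs j \is delta.-homog) ->
  (~ (exists delta : nat, generated_in_degree I delta) -> I f /\ f != 0) ->
  exists U : set 'M[k]_(d, u),
    [/\ zariski_open U, zariski_dense U &
      forall lam : 'M[k]_(d, u), U lam ->
        let K := add_ideal (general_ideal fs lam) (gen [set f ^+ d]) in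
        is_reduction K I /\ core I = mono K].
Proof.
move=> infk /monomial_monoidl mI I_neq0 HG HS IE Hhom Hnon.
suff [h h0 Hh] : exists2 h : {mpoly k[d * u]}, h != 0 & forall lam, evmx h lam != 0 ->
    let K := add_ideal (gen (range (gel fs lam))) (gen [set f ^+ d]) in
    is_reduction K I /\ core I = mono K.
  exists [set lam | evmx h lam != 0]; split=> [||lam /Hh //].
    exact: nonvanishing_open.
  exact: nonvanishing_dense.
case: d I fs f mI I_neq0 HG HS IE Hhom Hnon => [|n] I fs f mI I_neq0 HG HS IE Hhom Hnon.
  (* For d = 0 the ring is k, and the zeroth power of f makes K the unit ideal. *)
  exists 1; first exact: oner_neq0.
  move=> lam _ /=; apply: unit_core_eq_mono => //.
    apply: mono_neq0_unit => //; have [p Ip p0] := I_neq0; exists p => //.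
    have -> : 0%MM = mlead p by apply/mnmP => -[].
    by rewrite mleadc_eq0.
  by apply: add_idealR; rewrite expr0; apply: sub_gen.
(* The unit ideal is generated in degree 0, so f = 0 and the fixed generators are constants. *)
have [I1|nI1] := pselect (I 1).
  have g0 : generated_in_degree I 0.
    exists [set 1] => [_ ->|]; first exact: dhomog1.
    apply: eq_ideal; apply/seteqP; split=> x _; last by rewrite -[x]mulr1; apply: idealMl.
    by rewrite -[x]mulr1; apply: idealMl; apply: sub_gen.
  have [f0 hom0] := Hhom _ g0.
  have [|h h0 Hh] := const_general_ideal hom0; first by rewrite -IE.
  exists h => // lam /Hh K1 /=; apply: unit_core_eq_mono => //.
  by apply: add_idealL; apply: K1.
have Im : I `<=` max_ideal k n.+1.
  move=> p Ip; apply/vars_idealP/eqP; apply: contrapT => /negP p0; apply: nI1.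
  by apply: mono_neq0_unit => //; exists p.
have Ifs j : I (fs j) by rewrite IE; apply: sub_gen; exists j.
have JI lam : gen (range (gel fs lam)) `<=` I.
  apply: gen_sub => _ [i _ <-]; apply: ideal_sum => j; rewrite -mul_mpolyC; exact: idealMl.
have [[delta Hd]|Hd] := pselect (exists delta, generated_in_degree I delta).
  have [f0 homd] := Hhom _ Hd; rewrite f0.
  have d0 : (0 < delta)%N.
    rewrite lt0n; apply/eqP => de0; rewrite de0 in homd.
    have [p + /eqP] := I_neq0; rewrite IE => /gen_rangeP[a ->]; apply.
    rewrite big1 // => j _; rewrite (homog0_const (homd j)).
    by have /vars_idealP -> := Im _ (Ifs j); rewrite mpolyC0 mulr0.
  apply: (core_eq_mono_general infk mI I_neq0 HG HS Im IE (ideal0 I)).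
  have [h h0 Hh] := generic_reduction_homog infk mI I_neq0 Ifs IE d0 homd.
  exists h => // lam /Hh[N HN]; apply: (@reductionP _ _ _ N).
    by apply: add_ideal_sub => //; apply: gen_sub => _ ->; rewrite exprS mul0r; apply: ideal0.
  by apply: subset_trans HN _; apply: mul_ideal_mono => //; apply: add_idealL.
have [If f0] := Hnon Hd.
apply: (core_eq_mono_general infk mI I_neq0 HG HS Im IE If).
have [h h0 Hh] := generic_reduction_global infk mI I_neq0 Ifs IE If f0.
exists h => // lam /Hh[N HN]; apply: (@reductionP _ _ _ N) => //.
by apply: add_ideal_sub => //; apply: gen_sub => _ ->; rewrite exprS; apply: idealMr.
Qed.
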